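(* For every complex number $s$ with $\Re s>0$, $$\int_0^1x^{2s-1}K'(x)^2\,dx=\frac{\pi^3}{8}\,\Gamma(s)^4\;L\!\left(s,\,s,\,\tfrac12,\,\tfrac12;\;1;\;s+\tfrac12,\,s+\tfrac12\right).$$
   Context: $K(k)=\int_0^{\pi/2}\frac{d\theta}{\sqrt{1-k^2\sin^2\theta}}$ is the complete elliptic integral of the first kind and $K'(x):=K(\sqrt{1-x^2})$ (the prime denotes the complementary modulus, not a derivative). ${}_4F_3(a_1,\dots,a_4;b_1,b_2,b_3;1)=\sum_{n\ge0}\frac{(a_1)_n\cdots(a_4)_n}{(b_1)_n(b_2)_n(b_3)_n\,n!}$ with $(a)_0=1$, $(a)_n=a(a+1)\cdots(a+n-1)$. Mishev's completed function $L(a,b,c,d;e;f,g)$ is defined on the Saalschützian hyperplane $e+f+g-a-b-c-d=1$ in $\mathbb C^7$; for generic parameters, $$L(a,b,c,d;e;f,g)=\frac{{}_4F_3(a,b,c,d;\,e,f,g;\,1)}{\sin(\pi e)\Gamma(e)\Gamma(f)\Gamma(g)\prod_{\xi\in\{a,b,c,d\}}\Gamma(1+\xi-e)}-\frac{{}_4F_3(1+a-e,1+b-e,1+c-e,1+d-e;\,1+f-e,1+g-e,2-e;\,1)}{\sin(\pi e)\Gamma(a)\Gamma(b)\Gamma(c)\Gamma(d)\Gamma(1+f-e)\Gamma(1+g-e)\Gamma(2-e)},$$ and at parameter values where the individual terms are singular (for instance $e=1$), $L$ denotes the meromorphic continuation of this expression along the hyperplane. *)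

(* Defs.v *)
(* Stdlib reals, with Coquelicot's complex numbers, integrals and derivatives. *)
From Stdlib Require Import Reals Factorial List.
From Coquelicot Require Import Coquelicot.
Import ListNotations.

Open Scope R_scope.

(** Complete elliptic integral of the first kind, of modulus [k], and its value
    at the complementary modulus. *)
Definition ellK (k : R) : R :=
  RInt (fun theta => / sqrt (1 - k ^ 2 * sin theta ^ 2)) 0 (PI / 2).

Definition ellK' (x : R) : R := ellK (sqrt (1 - x ^ 2)).

Open Scope C_scope.

(** The complex number satisfying [P], when it exists and is unique (cf. [iota_correct]). *)
Definition Ciota (P : C -> Prop) : C := iota (T := C_CompleteNormedModule) P.

Definition Cexp (z : C) : C :=
  RtoC (exp (Re z)) * (cos (Im z), sin (Im z)).

Definition Csin (z : C) : C :=
  (Cexp (Ci * z) - Cexp (- (Ci * z))) / (2 * Ci).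

(** [x ^ z] for real [x > 0], with the real logarithm. *)
Definition Rcpow (x : R) (z : C) : C := Cexp (z * RtoC (ln x)).

Fixpoint pochhammer (a : C) (n : nat) : C :=
  match n with
  | O => 1
  | S m => pochhammer a m * (a + RtoC (INR m))
  end.

(** Gauss's limit [n! n^z / (z (z+1) ... (z+n))], which is the Gamma function on
    all of [C] minus the nonpositive integers. *)
Definition is_Gamma (z v : C) : Prop :=
  filterlim
    (fun n : nat =>
       RtoC (INR (fact n)) * Rcpow (INR n) z / pochhammer z (S n))
    eventually (locally (v : C_NormedModule)).

Definition CGamma (z : C) : C := Ciota (is_Gamma z).

Definition CSeries (u : nat -> C) : C := Ciota (is_series (V := C_NormedModule) u).

(** [4F3(a1,a2,a3,a4; b1,b2,b3; 1)]. *)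
Definition hyp4F3 (a1 a2 a3 a4 b1 b2 b3 : C) : C :=
  CSeries (fun n : nat =>
    pochhammer a1 n * pochhammer a2 n * pochhammer a3 n * pochhammer a4 n
    / (pochhammer b1 n * pochhammer b2 n * pochhammer b3 n
       * RtoC (INR (fact n)))).

Definition mishev_expr (a b c d e f g : C) : C :=
  hyp4F3 a b c d e f g
  / (Csin (RtoC PI * e) * CGamma e * CGamma f * CGamma g
     * (CGamma (1 + a - e) * CGamma (1 + b - e)
        * CGamma (1 + c - e) * CGamma (1 + d - e)))
  - hyp4F3 (1 + a - e) (1 + b - e) (1 + c - e) (1 + d - e)
           (1 + f - e) (1 + g - e) (2 - e)
    / (Csin (RtoC PI * e) * CGamma a * CGamma b * CGamma c * CGamma d
       * CGamma (1 + f - e) * CGamma (1 + g - e) * CGamma (2 - e)).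

Definition nonpos_int (z : C) : Prop := exists n : nat, z = RtoC (- INR n).

(** Parameters at which every constituent of [mishev_expr] is defined: no zero
    of [Csin (PI e)], no pole of a Gamma factor, no vanishing denominator in
    the two series (the conditions on [e] and [2 - e] follow from the first). *)
Definition mishev_generic (a b c d e f g : C) : Prop :=
  (forall n : Z, e <> RtoC (IZR n)) /\
  List.Forall (fun z => ~ nonpos_int z)
    [a; b; c; d; 1 + a - e; 1 + b - e; 1 + c - e; 1 + d - e;
     f; g; 1 + f - e; 1 + g - e].

(** Product normed space over the complex field: [ex_filterdiff] on it is
    complex differentiability in six variables. *)
Definition C6 : NormedModule C_AbsRing :=
  let P := prod_NormedModule C_AbsRing in
  let V := C_NormedModule in
  P (P (P (P (P V V) V) V) V) V.

(** [v] is the value at [(a,b,c,d;e;f,g)] of the meromorphic continuation of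
    [mishev_expr] along the hyperplane [e + f + g - a - b - c - d = 1], the
    continuation being holomorphic at that point.  The hyperplane is charted by
    [(a,b,c,d,e,f)].  Its generic points are dense in every open set, so the
    germ of the continuation is the only holomorphic germ [F] that agrees with
    [mishev_expr] at the generic points near the given one. *)
Definition is_mishevL (a b c d e f g v : C) : Prop :=
  e + f + g - a - b - c - d = 1 /\
  exists F : C6 -> C_NormedModule,
    locally ((a, b, c, d, e, f) : C6)
      (fun q : C6 => ex_filterdiff F (locally q)) /\
    locally ((a, b, c, d, e, f) : C6)
      (fun q : C6 =>
         let '(a', b', c', d', e', f') := q in
         let g' := 1 + a' + b' + c' + d' - e' - f' in
         mishev_generic a' b' c' d' e' f' g' ->
         F q = mishev_expr a' b' c' d' e' f' g') /\
    F (a, b, c, d, e, f) = v.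

Definition mishevL (a b c d e f g : C) : C := Ciota (is_mishevL a b c d e f g).

(* Main.v *)
(** Put [w u = ellw u = K' (sqrt u)]; the integral is half the Mellin transform at [s] of [w ^ 2].

    The differential equation [(u (1 - u) w')' = w / 4] gives the recurrence
    [z^2 * mG z = (z + 1/2)^2 * mG (z + 1)] for the Mellin transform [mG] of [w] over the unit
    interval, and Gauss's product turns it into
    [mG z = PI / 2 * (Gamma z / Gamma (z + 1/2)) ^ 2].  The expansion
    [w u = sum_n (ka n - kb n * ln u) u^n], where [PI^2 * kb n = mG (n + 1/2)] and
    [PI^2 * ka n = - mG1 (n + 1/2)] with [mG1 = mG'], is identified through the Wronskian of its two sides,
    and integrating it termwise against [u^(s-1) w] yields
    [sum_n (ka n * mG (s + n) - kb n * mG1 (s + n))].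

    On the other side, both hypergeometric series are locally uniform limits of holomorphic
    functions of the six parameters, and at [e = 1] the numerator of Mishev's expression
    vanishes; it is therefore divisible by [e - 1], like [sin (PI e)], and the continuation at
    [e = 1] is [- 1 / PI] times the derivative of the numerator in any direction with
    [e]-component [1].  In the direction [(1/2, 1/2, 1/2, 1/2, 1, 1/2)] the two series are
    exchanged by [t |-> - t], and their terms are [mG (s + n + t / 2) / Gamma(1 + t + n)]
    times Gamma factors in [1/2 + n + t / 2] and [1 + n], so that their derivatives at [0] are
    the terms of the sum above. *)

(* The continuation asks for differentiability in six variables on a whole neighbourhood, while the
   hypergeometric series and the Gamma function are given only as pointwise limits. Holomorphy is
   therefore encoded by a uniform second-order remainder, and Cauchy's estimates, proved by
   differentiating circle integrals with respect to the radius, bound that remainder by the supremum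
   alone, so that it passes to limits. The supremum is under control because on the Saalschützian
   hyperplane the powers of [n] in a term of the series collapse to [1/n], leaving bounded Gauss
   products over [n (n + 1)].

   The two constants in the expansion of [w] are fixed at opposite ends. A nonzero Wronskian would
   make the quotient of the two solutions diverge like [ln (1 - u)] at [1], where both are bounded
   and [w] stays away from [0]; the remaining factor is read off the coefficient [- 1/2] of [ln u]
   at [0]. The normalisation by [PI^2] reflects Gamma(1/2)^2 = PI, which itself comes out of the
   product formula and the elementary value [mG 1 = 2]. *)
Require Import Defs.
From Stdlib Require Import Reals.
From Coquelicot Require Import Coquelicot.
From Stdlib Require Import Lra Lia Factorial List ClassicalEpsilon.
From Corelib Require Import ssreflect.

Open Scope C_scope.

(** * Limits and derivatives of complex-valued functions *)

Lemma Cmod_plus_le (x y : C) (a b : R) :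
  (Cmod x <= a -> Cmod y <= b -> Cmod (x + y) <= a + b)%R.
Proof. move=> ha hb. have := Cmod_triangle x y. lra. Qed.

Lemma Cmod_mult_le (x y : C) (a b : R) :
  (Cmod x <= a -> Cmod y <= b -> Cmod (x * y) <= a * b)%R.
Proof.
  move=> ha hb. rewrite Cmod_mult.
  apply: Rmult_le_compat => //; exact: Cmod_ge_0.
Qed.

Lemma Cmod_minus_sym (x y : C) : Cmod (x - y) = Cmod (y - x).
Proof. rewrite -Cmod_opp. congr Cmod. ring. Qed.

Lemma Cmod_minus_triangle (x y z : C) :
  (Cmod (x - z) <= Cmod (x - y) + Cmod (y - z))%R.
Proof. have -> : x - z = (x - y) + (y - z) by ring. exact: Cmod_triangle. Qed.

Lemma Cmod_minus_le (x y : C) : (Cmod (x - y) <= Cmod x + Cmod y)%R.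
Proof. have := Cmod_triangle x (- y). by rewrite Cmod_opp. Qed.

Lemma Cmod_ge_minus (x y : C) : (Cmod x - Cmod y <= Cmod (x - y))%R.
Proof. have := Cmod_triangle (x - y) y. have -> : x - y + y = x by ring. lra. Qed.

Lemma im_le_Cmod (z : C) : (Rabs (Im z) <= Cmod z)%R.
Proof. have := Rmax_Cmod z. have := Rmax_r (Rabs (fst z)) (Rabs (snd z)).
  rewrite /Im. lra. Qed.

Lemma C_R_norm (z : C) : @norm R_AbsRing C_R_NormedModule z = Cmod z.
Proof.
  rewrite /Cmod /norm /= /prod_norm /norm /= /abs /=. 
  by rewrite !Rmult_1_r -!Rabs_mult !(Rabs_pos_eq (_ * _)) //; apply: Rle_0_sqr.
Qed.

Lemma C_R_scal (r : R) (z : C) : @scal R_AbsRing C_R_NormedModule r z = RtoC r * z.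
Proof.
  case: z => x y. rewrite /scal /= /prod_scal /scal /= /mult /= /Cmult /=.
  f_equal; ring.
Qed.

(** The balls of the product structure on [C] are squares. Halving the radius absorbs the factor
    [sqrt 2] between the sup norm and the modulus, and later limits can be taken with [Cmod]. *)
Lemma locally_C (z : C) (P : C -> Prop) :
  @locally C_UniformSpace z P <->
  exists d : R, (0 < d)%R /\ forall y : C, (Cmod (y - z) < d)%R -> P y.
Proof.
  split.
  - case=> [[d dpos]] H. exists d. split => // y hy. apply: H.
    exact: C_NormedModule_mixin_compat1.
  - case=> d [dpos H].
    have h : (0 < d / 2)%R by lra.
    exists (mkposreal _ h) => y hy. apply: H.
    have := C_NormedModule_mixin_compat2 _ _ _ hy.
    rewrite /= => h2. apply: Rlt_le_trans h2 _.
    have : (sqrt 2 < 2)%R.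
      rewrite -{2}(sqrt_square 2); last lra. apply: sqrt_lt_1; lra.
    have := sqrt_pos 2. nra.
Qed.

Lemma filterlim_C {T : Type} (F : (T -> Prop) -> Prop) {FF : Filter F} (f : T -> C) (l : C) :
  filterlim f F (@locally C_UniformSpace l) <->
  forall eps : R, (0 < eps)%R -> F (fun t => (Cmod (f t - l) < eps)%R).
Proof.
  split.
  - move=> H eps he. apply: (H (fun y => (Cmod (y - l) < eps)%R)).
    apply/locally_C. by exists eps.
  - move=> H P /locally_C [d [hd hP]]. rewrite /filtermap.
    move: (H d hd). apply: filter_imp => t. exact: hP.
Qed.

Lemma filterlim_Cmult {T : Type} (F : (T -> Prop) -> Prop) {FF : Filter F} (f g : T -> C) (l m : C) :
  filterlim f F (@locally C_UniformSpace l) -> filterlim g F (@locally C_UniformSpace m) ->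
  filterlim (fun t => f t * g t) F (@locally C_UniformSpace (l * m)).
Proof.
  move=> /filterlim_C Hf /filterlim_C Hg. apply/filterlim_C => eps he.
  have hl := Cmod_ge_0 l. have hm := Cmod_ge_0 m.
  set D := (Cmod l + Cmod m + 2)%R. have hD : (0 < D)%R by rewrite /D; lra.
  have hd : (0 < Rmin 1 (eps / D))%R by apply: Rmin_pos; [lra | apply: Rdiv_lt_0_compat].
  apply: filter_imp (filter_and _ _ (Hf _ hd) (Hg _ hd)) => t [h1 h2].
  set d := Rmin 1 (eps / D) in hd h1 h2.
  have d1 : (d <= 1)%R by exact: Rmin_l.
  have d2 : (d * D <= eps)%R by apply/Rle_div_r => //; exact: Rmin_r.
  have -> : f t * g t - l * m = (f t - l) * (g t - m) + (f t - l) * m + l * (g t - m) by ring.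
  have h1' := Rlt_le _ _ h1. have h2' := Rlt_le _ _ h2.
  apply: Rle_lt_trans (Cmod_plus_le _ _ _ _ (Cmod_plus_le _ _ _ _
    (Cmod_mult_le _ _ _ _ h1' h2') (Cmod_mult_le _ _ _ _ h1' (Rle_refl _)))
    (Cmod_mult_le _ _ _ _ (Rle_refl _) h2')) _.
  rewrite /D in d2. nra.
Qed.

(** Stated with the uniform structure alone, which the real and the complex normed modules on [C]
    share; it is thus convertible with the filter limits inside [is_Gamma] and, for partial sums,
    [is_series]. *)
Definition Cseq_lim (u : nat -> C) (l : C) : Prop :=
  filterlim u eventually (@locally C_UniformSpace l).

Lemma Cseq_limE (u : nat -> C) (l : C) :
  Cseq_lim u l <->
  forall eps : R, (0 < eps)%R -> exists N, forall n, (N <= n)%nat -> (Cmod (u n - l) < eps)%R.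
Proof. by apply: filterlim_C. Qed.

Lemma Cseq_lim_unique (u : nat -> C) (l l' : C) :
  Cseq_lim u l -> Cseq_lim u l' -> l = l'.
Proof.
  move=> H H'. exact: (@filterlim_locally_unique _ C_AbsRing C_NormedModule eventually _ u).
Qed.

Lemma Cseq_lim_plus (u v : nat -> C) (l m : C) :
  Cseq_lim u l -> Cseq_lim v m -> Cseq_lim (fun n => u n + v n) (l + m).
Proof.
  move=> H H'. apply: (filterlim_comp_2 _ _ Cplus H H').
  exact: (@filterlim_plus C_AbsRing C_NormedModule).
Qed.

Lemma Cseq_lim_mult (u v : nat -> C) (l m : C) :
  Cseq_lim u l -> Cseq_lim v m -> Cseq_lim (fun n => u n * v n) (l * m).
Proof.
  move=> H H'. exact: filterlim_Cmult.
Qed.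

Lemma Cseq_lim_const (l : C) : Cseq_lim (fun _ => l) l.
Proof. exact: filterlim_const. Qed.

Lemma Cseq_lim_ext (u v : nat -> C) (l : C) :
  (forall n, u n = v n) -> Cseq_lim u l -> Cseq_lim v l.
Proof. move=> H. exact: filterlim_ext. Qed.

Lemma Cseq_lim_opp (u : nat -> C) (l : C) :
  Cseq_lim u l -> Cseq_lim (fun n => - u n) (- l).
Proof.
  move=> H. have := Cseq_lim_mult _ _ _ _ (Cseq_lim_const (-(1))) H.
  have -> : -(1) * l = - l by ring.
  apply: Cseq_lim_ext => n. ring.
Qed.

Lemma Cseq_lim_minus (u v : nat -> C) (l m : C) :
  Cseq_lim u l -> Cseq_lim v m -> Cseq_lim (fun n => u n - v n) (l - m).
Proof. move=> H /Cseq_lim_opp H'. exact: Cseq_lim_plus. Qed.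

Lemma Cseq_lim_S (u : nat -> C) (l : C) :
  Cseq_lim (fun n => u (S n)) l <-> Cseq_lim u l.
Proof.
  rewrite !Cseq_limE; split => H eps he; case: (H eps he) => N hN.
  - exists (S N) => n hn. case: n hn => [|n] hn; first lia. apply: hN. lia.
  - exists N => n hn. apply: hN. lia.
Qed.

Lemma Cseq_lim_inv (u : nat -> C) (l : C) :
  l <> 0 -> Cseq_lim u l -> Cseq_lim (fun n => / u n) (/ l).
Proof.
  move=> hl H. apply/Cseq_limE => eps he.
  have hl0 : (0 < Cmod l)%R by apply/Cmod_gt_0.
  have /Cseq_limE H' := H.
  have hd : (0 < Rmin (Cmod l / 2) (eps * (Cmod l * Cmod l) / 2))%R.
    apply: Rmin_pos; first lra. have := Rmult_lt_0_compat _ _ hl0 hl0. nra.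
  case: (H' _ hd) => N hN. exists N => n /hN {}hN.
  have h1 : (Cmod (u n - l) < Cmod l / 2)%R by apply: Rlt_le_trans hN (Rmin_l _ _).
  have h2 : (Cmod (u n - l) < eps * (Cmod l * Cmod l) / 2)%R by apply: Rlt_le_trans hN (Rmin_r _ _).
  have h3 : (Cmod l / 2 < Cmod (u n))%R.
    have := Cmod_ge_minus l (u n). rewrite (Cmod_minus_sym l). lra.
  have hu : u n <> 0 by apply/Cmod_gt_0; lra.
  have -> : / u n - / l = (l - u n) / (u n * l) by field.
  rewrite Cmod_div; last by apply: Cmult_neq_0.
  rewrite Cmod_mult Cmod_minus_sym.
  apply/Rlt_div_l; first nra.
  have := Rmult_lt_compat_r _ _ _ hl0 h3. nra.
Qed.

Lemma Cseq_lim_Cmod_le (u : nat -> C) (l : C) (M : R) :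
  (forall n, Cmod (u n) <= M)%R -> Cseq_lim u l -> (Cmod l <= M)%R.
Proof.
  move=> hM /Cseq_limE H. apply: Rnot_lt_le => hlt.
  have h : (0 < Cmod l - M)%R by lra.
  case: (H _ h) => N hN. move: (hN N (le_n N)).
  have := Cmod_ge_minus l (u N). rewrite (Cmod_minus_sym l). have := hM N. lra.
Qed.

Lemma Cseq_lim_Cmod_ge (u : nat -> C) (l : C) (M : R) :
  (forall n, M <= Cmod (u n))%R -> Cseq_lim u l -> (M <= Cmod l)%R.
Proof.
  move=> hM /Cseq_limE H. apply: Rnot_lt_le => hlt.
  have h : (0 < M - Cmod l)%R by lra.
  case: (H _ h) => N hN. move: (hN N (le_n N)).
  have := Cmod_ge_minus (u N) l. have := hM N. lra.
Qed.

Lemma Cseq_lim_bound (u : nat -> C) (l : C) (b : nat -> R) :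
  (forall n, Cmod (u n - l) <= b n)%R -> is_lim_seq b 0 -> Cseq_lim u l.
Proof.
  move=> hb /is_lim_seq_spec H. apply/Cseq_limE => eps he.
  case: (H (mkposreal _ he)) => N hN. exists N => n /hN /=.
  have := hb n. rewrite Rminus_0_r => h1 /Rabs_def2. lra.
Qed.

Lemma Cseq_cauchy (u : nat -> C) :
  (forall eps : R, (0 < eps)%R ->
     exists N, forall n m, (N <= n)%nat -> (N <= m)%nat -> (Cmod (u n - u m) < eps)%R) ->
  exists l, Cseq_lim u l.
Proof.
  move=> H.
  apply (@filterlim_locally_cauchy nat C_R_CompleteNormedModule eventually _ u) => eps.
  case: (H eps (cond_pos eps)) => N hN.
  exists (fun n => (N <= n)%nat). split; first by exists N.
  move=> a b ha hb. apply: C_NormedModule_mixin_compat1. exact: hN.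
Qed.

Lemma Cseq_summable (u : nat -> C) (b : nat -> R) :
  (forall n, Cmod (u (S n) - u n) <= b n)%R -> ex_series b -> exists l, Cseq_lim u l.
Proof.
  move=> hb hs. apply: Cseq_cauchy => eps he.
  have [N hN] := Cauchy_ex_series b hs (mkposreal _ he).
  have key : forall n k, (N <= n)%nat -> (Cmod (u (n + k)%nat - u n) < eps)%R.
    move=> n [|k] hn.
      rewrite Nat.add_0_r. have -> : u n - u n = 0 by ring. by rewrite Cmod_0.
    apply: Rle_lt_trans (_ : Rabs (sum_n_m b n (n + k)) < eps)%R; last first.
      apply: hN; lia.
    apply: Rle_trans _ (Rle_abs _).
    elim: k => [|k IH].
      rewrite Nat.add_0_r sum_n_n Nat.add_1_r. exact: hb.
    rewrite !Nat.add_succ_r sum_n_Sm; last lia.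
    rewrite /plus /=.
    apply: Rle_trans (Cmod_minus_triangle _ (u (n + S k)%nat) _) _.
    rewrite Rplus_comm. apply: Rplus_le_compat => //.
    have := hb (n + S k)%nat. by rewrite !Nat.add_succ_r.
  exists N => n m hn hm.
  case: (Nat.le_ge_cases n m) => h.
  - rewrite Cmod_minus_sym. have -> : m = (n + (m - n))%nat by lia. exact: key.
  - have -> : n = (m + (n - m))%nat by lia. exact: key.
Qed.

(** Covers real variables ([i = RtoC]) and complex ones ([i = idC]). *)
Definition cdiff {T : Type} (i : T -> C) (f : T -> C) (x : T) (l : C) : Prop :=
  forall eps : R, (0 < eps)%R -> exists d : R, (0 < d)%R /\
    forall y, (Cmod (i y - i x) < d)%R ->
      (Cmod (f y - f x - l * (i y - i x)) <= eps * Cmod (i y - i x))%R.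

Definition idC (z : C) : C := z.

Section Cdiff.
Context {T : Type} (i : T -> C).
Implicit Types (f g : T -> C) (x : T).

Lemma cdiff_quad f x l (M d : R) : (0 < d)%R ->
  (forall y, (Cmod (i y - i x) < d)%R ->
     Cmod (f y - f x - l * (i y - i x)) <= M * Cmod (i y - i x) ^ 2)%R ->
  cdiff i f x l.
Proof.
  move=> hd H eps he.
  (* [M] may have either sign; [Rabs M + 1] is a positive denominator in all cases. *)
  exists (Rmin d (eps / (Rabs M + 1))). have hM := Rabs_pos M. split.
    apply: Rmin_pos => //. apply: Rdiv_lt_0_compat; lra.
  move=> y hy.
  have h1 : (Cmod (i y - i x) < d)%R by apply: Rlt_le_trans hy (Rmin_l _ _).
  have h2 : (Cmod (i y - i x) < eps / (Rabs M + 1))%R by apply: Rlt_le_trans hy (Rmin_r _ _).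
  apply: Rle_trans (H _ h1) _.
  have h3 := Cmod_ge_0 (i y - i x).
  have {h2} : ((Rabs M + 1) * Cmod (i y - i x) < eps)%R.
    rewrite Rmult_comm. apply/Rlt_div_r => //. lra.
  have := Rle_abs M. nra.
Qed.

Lemma cdiff_lip f x l : cdiff i f x l ->
  exists d : R, (0 < d)%R /\ forall y, (Cmod (i y - i x) < d)%R ->
    (Cmod (f y - f x) <= (Cmod l + 1) * Cmod (i y - i x))%R.
Proof.
  move=> H. case: (H 1%R Rlt_0_1) => d [hd Hd]. exists d. split => // y hy.
  have -> : f y - f x = (f y - f x - l * (i y - i x)) + l * (i y - i x) by ring.
  apply: Rle_trans (Cmod_triangle _ _) _. rewrite Cmod_mult.
  have := Hd y hy. lra.
Qed.

Lemma cdiff_const x (c : C) : cdiff i (fun _ => c) x 0.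
Proof.
  apply: (cdiff_quad _ _ _ 0 1); first lra. move=> y _.
  have -> : c - c - 0 * (i y - i x) = 0 by ring. rewrite Cmod_0. lra.
Qed.

Lemma cdiff_id x : cdiff i i x 1.
Proof.
  apply: (cdiff_quad _ _ _ 0 1); first lra. move=> y _.
  have -> : i y - i x - 1 * (i y - i x) = 0 by ring. rewrite Cmod_0. lra.
Qed.

Lemma cdiff_ext f g x l : (forall y, f y = g y) -> cdiff i f x l -> cdiff i g x l.
Proof.
  move=> e H eps he. case: (H eps he) => d [hd Hd]. exists d; split => // y.
  rewrite -!e. exact: Hd.
Qed.

Lemma cdiff_ext_loc f g x l (d : R) : (0 < d)%R ->
  (forall y, (Cmod (i y - i x) < d)%R -> f y = g y) -> cdiff i f x l -> cdiff i g x l.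
Proof.
  move=> h0 e H eps he. case: (H eps he) => d' [hd Hd]. exists (Rmin d d').
  split; first exact: Rmin_pos.
  move=> y hy. rewrite -!e.
  - apply: Hd. apply: Rlt_le_trans hy (Rmin_r _ _).
  - have -> : i x - i x = 0 by ring. by rewrite Cmod_0.
  - apply: Rlt_le_trans hy (Rmin_l _ _).
Qed.

Lemma cdiff_plus f g x l m :
  cdiff i f x l -> cdiff i g x m -> cdiff i (fun y => f y + g y) x (l + m).
Proof.
  move=> Hf Hg eps he. have he2 : (0 < eps / 2)%R by lra.
  case: (Hf _ he2) => d [hd Hd]. case: (Hg _ he2) => d' [hd' Hd'].
  exists (Rmin d d'). split; first exact: Rmin_pos.
  move=> y hy.
  have {}Hd := Hd y (Rlt_le_trans _ _ _ hy (Rmin_l _ _)).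
  have {}Hd' := Hd' y (Rlt_le_trans _ _ _ hy (Rmin_r _ _)).
  have -> : f y + g y - (f x + g x) - (l + m) * (i y - i x) =
    (f y - f x - l * (i y - i x)) + (g y - g x - m * (i y - i x)) by ring.
  apply: Rle_trans (Cmod_triangle _ _) _. lra.
Qed.

Lemma cdiff_mult f g x l m :
  cdiff i f x l -> cdiff i g x m ->
  cdiff i (fun y => f y * g y) x (l * g x + f x * m).
Proof.
  move=> Hf Hg eps he.
  set Q := ((Cmod l + 1) * (Cmod m + 1))%R.
  set S := (Cmod (g x) + Cmod (f x) + 1)%R.
  have hS : (0 < S)%R by have := Cmod_ge_0 (g x); have := Cmod_ge_0 (f x); rewrite /S; lra.
  have hQ : (0 < Q)%R.
    have := Cmod_ge_0 l; have := Cmod_ge_0 m => ? ?. apply: Rmult_lt_0_compat; lra.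
  have he2 : (0 < eps / (2 * S))%R by apply: Rdiv_lt_0_compat; lra.
  have he3 : (0 < eps / (2 * Q))%R by apply: Rdiv_lt_0_compat; lra.
  case: (Hf _ he2) => d1 [hd1 H1]. case: (Hg _ he2) => d2 [hd2 H2].
  case: (cdiff_lip _ _ _ Hf) => d3 [hd3 H3]. case: (cdiff_lip _ _ _ Hg) => d4 [hd4 H4].
  exists (Rmin (Rmin (Rmin d1 d2) (Rmin d3 d4)) (eps / (2 * Q))).
  split; first by repeat apply: Rmin_pos.
  move=> y hy.
  have hy5 := Rlt_le_trans _ _ _ hy (Rmin_r _ _).
  have {}hy := Rlt_le_trans _ _ _ hy (Rmin_l _ _).
  have hy12 := Rlt_le_trans _ _ _ hy (Rmin_l _ _).
  have hy34 := Rlt_le_trans _ _ _ hy (Rmin_r _ _).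
  have {}H1 := H1 y (Rlt_le_trans _ _ _ hy12 (Rmin_l _ _)).
  have {}H2 := H2 y (Rlt_le_trans _ _ _ hy12 (Rmin_r _ _)).
  have {}H3 := H3 y (Rlt_le_trans _ _ _ hy34 (Rmin_l _ _)).
  have {}H4 := H4 y (Rlt_le_trans _ _ _ hy34 (Rmin_r _ _)).
  set e := i y - i x in H1 H2 H3 H4 hy5 *.
  (* The last summand is a product of two increments, hence of second order: [Q] is its Lipschitz
     constant, and the radius [eps / (2 * Q)] makes [Q * Cmod e] at most [eps / 2]. *)
  have -> : f y * g y - f x * g x - (l * g x + f x * m) * e =
    (f y - f x - l * e) * g x + f x * (g y - g x - m * e) + (f y - f x) * (g y - g x) by ring.
  apply: Rle_trans (Cmod_plus_le _ _ _ _
    (Cmod_plus_le _ _ _ _ (Cmod_mult_le _ _ _ _ H1 (Rle_refl _))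
       (Cmod_mult_le _ _ _ _ (Rle_refl _) H2)) (Cmod_mult_le _ _ _ _ H3 H4)) _.
  have he0 := Cmod_ge_0 e.
  have a1 : (eps / (2 * S) * S = eps / 2)%R by field; lra.
  have a2 : (Q * Cmod e <= eps / 2)%R.
    have -> : (eps / 2 = Q * (eps / (2 * Q)))%R by field; lra.
    apply: Rmult_le_compat_l; lra.
  have -> : ((Cmod l + 1) * Cmod e * ((Cmod m + 1) * Cmod e) = (Q * Cmod e) * Cmod e)%R.
    rewrite /Q; ring.
  have b1 : (Q * Cmod e * Cmod e <= eps / 2 * Cmod e)%R by apply: Rmult_le_compat_r.
  have b2 : (eps / (2 * S) * Cmod e * Cmod (g x) + Cmod (f x) * (eps / (2 * S) * Cmod e)
     <= eps / (2 * S) * S * Cmod e)%R.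
    have := Rmult_le_pos _ _ (Rlt_le _ _ he2) he0. rewrite /S. lra.
  rewrite a1 in b2. lra.
Qed.

Lemma cdiff_comp (f : T -> C) (h : C -> C) x l m :
  cdiff i f x l -> cdiff idC h (f x) m -> cdiff i (fun y => h (f y)) x (m * l).
Proof.
  move=> Hf Hh eps he.
  have hl := Cmod_ge_0 l. have hm := Cmod_ge_0 m.
  have he1 : (0 < eps / (2 * (Cmod l + 1)))%R by apply: Rdiv_lt_0_compat; lra.
  have he2 : (0 < eps / (2 * (Cmod m + 1)))%R by apply: Rdiv_lt_0_compat; lra.
  case: (Hh _ he1) => d1 [hd1 H1]. case: (Hf _ he2) => d2 [hd2 H2].
  case: (cdiff_lip _ _ _ Hf) => d3 [hd3 H3].
  have hd4 : (0 < d1 / (Cmod l + 1))%R by apply: Rdiv_lt_0_compat; lra.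
  exists (Rmin (Rmin d2 d3) (d1 / (Cmod l + 1))). split; first by repeat apply: Rmin_pos.
  move=> y hy.
  have hy1 := Rlt_le_trans _ _ _ hy (Rmin_r _ _).
  have {}hy := Rlt_le_trans _ _ _ hy (Rmin_l _ _).
  have {}H2 := H2 y (Rlt_le_trans _ _ _ hy (Rmin_l _ _)).
  have {}H3 := H3 y (Rlt_le_trans _ _ _ hy (Rmin_r _ _)).
  have h4 : (Cmod (f y - f x) < d1)%R.
    apply: Rle_lt_trans H3 _. rewrite Rmult_comm. apply/Rlt_div_r => //. lra.
  have {}H1 := H1 (f y) h4. rewrite /idC in H1.
  set e := i y - i x in H2 H3 hy1 *.
  have -> : h (f y) - h (f x) - m * l * e =
    (h (f y) - h (f x) - m * (f y - f x)) + m * (f y - f x - l * e) by ring.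
  apply: Rle_trans (Cmod_plus_le _ _ _ _ H1 (Cmod_mult_le _ _ _ _ (Rle_refl _) H2)) _.
  have he0 := Cmod_ge_0 e.
  have a1 : (eps / (2 * (Cmod l + 1)) * Cmod (f y - f x) <= eps / 2 * Cmod e)%R.
    have -> : (eps / 2 = eps / (2 * (Cmod l + 1)) * (Cmod l + 1))%R by field; lra.
    rewrite Rmult_assoc. apply: Rmult_le_compat_l; lra.
  have a2 : (Cmod m * (eps / (2 * (Cmod m + 1)) * Cmod e) <= eps / 2 * Cmod e)%R.
    rewrite -Rmult_assoc. apply: Rmult_le_compat_r => //.
    have -> : (eps / 2 = (Cmod m + 1) * (eps / (2 * (Cmod m + 1))))%R by field; lra.
    apply: Rmult_le_compat_r; lra.
  lra.
Qed.

Lemma cdiff_opp f x l : cdiff i f x l -> cdiff i (fun y => - f y) x (- l).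
Proof.
  move=> H. have := cdiff_mult _ _ _ _ _ (cdiff_const x (-(1))) H.
  have -> : 0 * f x + -(1) * l = - l by ring.
  apply: cdiff_ext => y. ring.
Qed.

Lemma cdiff_minus f g x l m :
  cdiff i f x l -> cdiff i g x m -> cdiff i (fun y => f y - g y) x (l - m).
Proof. move=> H /cdiff_opp H'. exact: cdiff_plus. Qed.

Lemma cdiff_scal (c : C) f x l : cdiff i f x l -> cdiff i (fun y => c * f y) x (c * l).
Proof.
  move=> H. have := cdiff_mult _ _ _ _ _ (cdiff_const x c) H.
  by have -> : 0 * f x + c * l = c * l by ring.
Qed.

End Cdiff.

Lemma cdiff_unique (f : C -> C) (x l m : C) : cdiff idC f x l -> cdiff idC f x m -> l = m.
Proof.
  move=> H H'.
  have : Cmod (l - m) = 0%R; last first.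
    move/Cmod_eq_0 => h. have -> : l = (l - m) + m by ring. rewrite h. ring.
  apply: Rle_antisym; last exact: Cmod_ge_0.
  apply: le_epsilon => eps he. have he2 : (0 < eps / 2)%R by lra.
  case: (H _ he2) => d [hd Hd]. case: (H' _ he2) => d' [hd' Hd'].
  have hm := Rmin_pos _ _ hd hd'.
  set t := (Rmin d d' / 2)%R. have ht : (0 < t)%R by rewrite /t; lra.
  have ht' : (t < Rmin d d')%R by rewrite /t; lra.
  have e : idC (x + RtoC t) - idC x = RtoC t by rewrite /idC; ring.
  have ab : Cmod (RtoC t) = t by rewrite Cmod_R Rabs_pos_eq; lra.
  have := Hd (x + RtoC t). have := Hd' (x + RtoC t). rewrite e ab => h1 h2.
  have {}h1 := h1 (Rlt_le_trans _ _ _ ht' (Rmin_r _ _)).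
  have {}h2 := h2 (Rlt_le_trans _ _ _ ht' (Rmin_l _ _)).
  have : (Cmod (l - m) * t <= eps * t)%R; last by move/(Rmult_le_reg_r _ _ _ ht); lra.
  rewrite -{1}ab -Cmod_mult.
  have -> : (l - m) * RtoC t = (f (x + RtoC t) - f x - m * RtoC t) - (f (x + RtoC t) - f x - l * RtoC t) by ring.
  apply: Rle_trans (Cmod_minus_le _ _) _. lra.
Qed.

(** The integral theorems apply to [C] as a real normed module. This equivalence lets derivatives of
    curves be computed with complex products and then handed to those theorems. *)
Lemma cdiff_R_is_derive (f : R -> C) (x : R) (l : C) :
  cdiff RtoC f x l <-> is_derive (V := C_R_NormedModule) f x l.
Proof.
  split.
  - move=> H. split; first exact: is_linear_scal_l.
    move=> x' /is_filter_lim_locally_unique <- eps.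
    case: (H eps (cond_pos eps)) => d [hd Hd].
    exists (mkposreal _ hd) => y hy.
    rewrite C_R_norm C_R_scal.
    change (Cmod (f y - f x - RtoC (y - x) * l) <= eps * Rabs (y - x))%R.
    have := Hd y. rewrite -RtoC_minus Cmod_R (Cmult_comm _ l). apply. exact: hy.
  - case=> _ H eps he.
    case: (H x (fun P hP => hP) (mkposreal _ he)) => d hd.
    exists d. split; first exact: cond_pos.
    move=> y hy. rewrite -RtoC_minus Cmod_R in hy *.
    have := hd y hy. rewrite C_R_norm C_R_scal /=.
    change (Cmod (f y - f x - RtoC (y - x) * l) <= eps * Rabs (y - x) ->
      Cmod (f y - f x - l * RtoC (y - x)) <= eps * Rabs (y - x))%R.
    by rewrite (Cmult_comm l).
Qed.

Lemma cdiff_RtoC (f : R -> R) (x l : R) :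
  is_derive f x l -> cdiff RtoC (fun y => RtoC (f y)) x (RtoC l).
Proof.
  case=> _ H eps he. case: (H x (fun P hP => hP) (mkposreal _ he)) => d hd.
  exists d. split; first exact: cond_pos.
  move=> y hy. rewrite -RtoC_minus Cmod_R in hy *.
  rewrite -RtoC_minus -RtoC_mult -RtoC_minus Cmod_R.
  have := hd y hy. 
  change (Rabs (f y - f x - (y - x) * l) <= eps * Rabs (y - x) ->
      Rabs (f y - f x - l * (y - x)) <= eps * Rabs (y - x))%R.
  by rewrite (Rmult_comm l).
Qed.

Lemma cdiff_continuous (f : R -> C) (x : R) (l : C) :
  cdiff RtoC f x l -> continuous (U := C_R_NormedModule) f x.
Proof.
  move=> /cdiff_R_is_derive H.
  apply: (@ex_derive_continuous R_AbsRing C_R_NormedModule). by exists l.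
Qed.

Lemma continuous_C (f : R -> C) (x : R) :
  (forall eps : R, (0 < eps)%R -> exists d : R, (0 < d)%R /\
     forall y, (Rabs (y - x) < d)%R -> (Cmod (f y - f x) < eps)%R) ->
  continuous (U := C_R_NormedModule) f x.
Proof.
  move=> H. apply/filterlim_C => eps he. case: (H eps he) => d [hd Hd].
  by exists (mkposreal _ hd) => y /Hd.
Qed.

Lemma continuous_C_E (f : R -> C) (x : R) :
  continuous (U := C_R_NormedModule) f x ->
  (forall eps : R, (0 < eps)%R -> exists d : R, (0 < d)%R /\
     forall y, (Rabs (y - x) < d)%R -> (Cmod (f y - f x) < eps)%R).
Proof.
  move=> /filterlim_C H eps he. case: (H eps he) => d Hd.
  exists d. split; first exact: cond_pos. move=> y hy. exact: Hd.
Qed.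

Lemma continuous_Cmult (f g : R -> C) (x : R) :
  continuous (U := C_R_NormedModule) f x -> continuous (U := C_R_NormedModule) g x ->
  continuous (U := C_R_NormedModule) (fun y => f y * g y) x.
Proof.
  move=> H H'. exact: filterlim_Cmult.
Qed.

Lemma continuous_RtoC (f : R -> R) (x : R) :
  continuous f x -> continuous (U := C_R_NormedModule) (fun y => RtoC (f y)) x.
Proof.
  move=> H. apply: continuous_C => eps he.
  case: (H (ball (f x) (mkposreal _ he)) (locally_ball _ _)) => d hd.
  exists d. split; first exact: cond_pos. move=> y hy. rewrite -RtoC_minus Cmod_R.
  exact: (hd y hy).
Qed.

Lemma is_RInt_C_le (f : R -> C) (g : R -> R) (a b : R) (lf : C) (lg : R) :
  (a <= b)%R -> (forall x, (a <= x <= b)%R -> (Cmod (f x) <= g x)%R) ->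
  is_RInt (V := C_R_NormedModule) f a b lf -> is_RInt g a b lg -> (Cmod lf <= lg)%R.
Proof.
  move=> hab H hf hg. rewrite -C_R_norm. apply: (norm_RInt_le _ _ _ _ _ _ hab _ hf hg).
  move=> x hx. rewrite C_R_norm. exact: H.
Qed.

(** * Cauchy estimates *)

Definition eit (t : R) : C := (cos t, sin t).

Lemma Cmod_eit (t : R) : Cmod (eit t) = 1%R.
Proof.
  rewrite /Cmod /eit /= !Rmult_1_r. have := sin2_cos2 t. rewrite /Rsqr Rplus_comm => ->.
  exact: sqrt_1.
Qed.

Lemma eit_opp (t : R) : eit t * eit (- t) = 1.
Proof.
  rewrite /eit /Cmult /RtoC /= cos_neg sin_neg. f_equal; last ring.
  have := sin2_cos2 t. rewrite /Rsqr. lra.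
Qed.

Lemma is_derive_pair_C (f g : R -> R) (x a b : R) :
  is_derive f x a -> is_derive g x b -> cdiff RtoC (fun t => (f t, g t) : C) x ((a, b) : C).
Proof.
  move=> /cdiff_RtoC Hf /cdiff_RtoC Hg.
  have h (u v : R) : ((u, v) : C) = RtoC u + Ci * RtoC v.
    rewrite /RtoC /Ci /Cplus /Cmult /=. f_equal; ring.
  rewrite h. apply: cdiff_ext (_ : cdiff RtoC (fun y => RtoC (f y) + Ci * RtoC (g y)) _ _).
    by move=> y; rewrite h.
  apply: cdiff_plus => //. exact: cdiff_scal.
Qed.

Lemma cdiff_eit (t : R) : cdiff RtoC eit t (Ci * eit t).
Proof.
  have -> : Ci * eit t = ((- sin t)%R, cos t) by rewrite /Ci /eit /Cmult /=; f_equal; ring.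
  apply: is_derive_pair_C; auto_derive => //; ring.
Qed.

Lemma cdiff_eit_opp (t : R) : cdiff RtoC (fun t => eit (- t)) t (- Ci * eit (- t)).
Proof.
  have -> : - Ci * eit (- t) = ((- sin t)%R, (- cos t)%R).
    rewrite /Ci /eit /Cmult /Copp /= cos_neg sin_neg. f_equal; ring.
  apply: is_derive_pair_C.
  - apply: (is_derive_ext cos) => [y|]; first by rewrite cos_neg. auto_derive => //; ring.
  - apply: (is_derive_ext (fun t => - sin t)%R) => [y|]; first by rewrite sin_neg. auto_derive => //; ring.
Qed.

Lemma continuous_eit_opp (t : R) : continuous (U := C_R_NormedModule) (fun t => eit (- t)) t.
Proof. exact: cdiff_continuous (cdiff_eit_opp t). Qed.

Lemma is_RInt_FTC_C (f df : R -> C) (a b : R) :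
  (forall x, Rmin a b <= x <= Rmax a b -> cdiff RtoC f x (df x))%R ->
  (forall x, (Rmin a b <= x <= Rmax a b)%R -> continuous (U := C_R_NormedModule) df x) ->
  is_RInt (V := C_R_NormedModule) df a b (f b - f a).
Proof.
  move=> H H'. apply: (@is_RInt_derive C_R_CompleteNormedModule) => // x hx.
  apply/cdiff_R_is_derive. exact: H.
Qed.

(** Holomorphy in the form that [holD] takes on a complex line. With a remainder uniform on the
    disc, differentiating a circle integral under the integral sign is a plain estimate. *)
Definition quad_disc (f f' : C -> C) (r K : R) : Prop :=
  forall x y : C, (Cmod x < r)%R -> (Cmod y < r)%R ->
    (Cmod (f y - f x - f' x * (y - x)) <= K * Cmod (y - x) ^ 2)%R.

Section Circle.
Variables (f f' : C -> C) (r K : R).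
Hypothesis Hf : quad_disc f f' r K.

Lemma quad_disc_cdiff (x : C) : (Cmod x < r)%R -> cdiff idC f x (f' x).
Proof.
  move=> hx. apply: (cdiff_quad _ _ _ _ K (r - Cmod x)); first lra.
  rewrite /idC => y hy. apply: Hf => //.
  have := Cmod_triangle (y - x) x. have -> : y - x + x = y by ring. lra.
Qed.

(** Uses the three equally spaced points [x], [y] and [z = 2 y - x]. The expansions from [x] to [z],
    from [y] to [z] and from [x] to [y] combine to [(f' y - f' x) (y - x)] with an error of
    [4 + 1 + 1] times [K |y - x|^2], whence the [6]. Half the distance to the boundary keeps [z] in
    the disc. *)
Lemma quad_disc_cont (x : C) : (Cmod x < r)%R ->
  exists d : R, (0 < d)%R /\ forall y, (Cmod (y - x) < d)%R ->
    (Cmod (f' y - f' x) <= 6 * K * Cmod (y - x))%R.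
Proof.
  move=> hx. exists ((r - Cmod x) / 2)%R. split; first lra.
  move=> y hy.
  case: (Req_dec (Cmod (y - x)) 0) => h0.
    have e : y = x. have -> : y = (y - x) + x by ring. rewrite (Cmod_eq_0 _ h0). ring.
    rewrite e. have -> : f' x - f' x = 0 by ring. have -> : x - x = 0 by ring. rewrite Cmod_0. lra.
  have hp : (0 < Cmod (y - x))%R by have := Cmod_ge_0 (y - x); lra.
  have hy1 : (Cmod y < r)%R.
    have := Cmod_triangle (y - x) x. have -> : y - x + x = y by ring. lra.
  set z := y + (y - x).
  have hz : (Cmod z < r)%R.
    have := Cmod_triangle ((y - x) + (y - x)) x. have := Cmod_triangle (y - x) (y - x).
    have -> : y - x + (y - x) + x = z by rewrite /z; ring. lra.
  have a1 := Hf y z hy1 hz. have a2 := Hf x z hx hz. have a3 := Hf x y hx hy1.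
  have e1 : z - y = y - x by rewrite /z; ring.
  have e2 : z - x = RtoC 2 * (y - x) by rewrite /z; ring.
  rewrite e1 in a1. rewrite e2 Cmod_mult Cmod_R Rabs_pos_eq in a2; last lra.
  apply: (Rmult_le_reg_r (Cmod (y - x))) => //. rewrite -Cmod_mult.
  have -> : (f' y - f' x) * (y - x) =
    (f z - f x - f' x * (RtoC 2 * (y - x))) - (f z - f y - f' y * (y - x))
    - (f y - f x - f' x * (y - x)) by ring.
  apply: Rle_trans (Cmod_minus_le _ _) _.
  have := Cmod_minus_le (f z - f x - f' x * (RtoC 2 * (y - x))) (f z - f y - f' y * (y - x)).
  nra.
Qed.

Lemma circle_lt (rho t : R) : (0 <= rho < r)%R -> (Cmod (RtoC rho * eit t) < r)%R.
Proof. move=> h. rewrite Cmod_mult Cmod_eit Cmod_R Rabs_pos_eq; lra. Qed.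

Lemma cdiff_circle (rho t : R) : (0 <= rho < r)%R ->
  cdiff RtoC (fun t => f (RtoC rho * eit t)) t
    (f' (RtoC rho * eit t) * (RtoC rho * (Ci * eit t))).
Proof.
  move=> h. apply: (cdiff_comp _ (fun t => RtoC rho * eit t)).
  - apply: cdiff_scal. exact: cdiff_eit.
  - apply: quad_disc_cdiff. exact: circle_lt.
Qed.

Lemma continuous_circle' (rho t : R) : (0 <= rho < r)%R ->
  continuous (U := C_R_NormedModule) (fun t => f' (RtoC rho * eit t)) t.
Proof.
  move=> h.
  case: (quad_disc_cont _ (circle_lt rho t h)) => d [hd Hd].
  have := cdiff_continuous _ _ _ (cdiff_scal _ (RtoC rho) _ _ _ (cdiff_eit t)).
  move/continuous_C_E => Hc. apply: continuous_C => eps he.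
  have hK : (0 < 6 * Rabs K + 1)%R by have := Rabs_pos K; lra.
  have hm : (0 < Rmin d (eps / (6 * Rabs K + 1)))%R.
    apply: Rmin_pos => //. exact: Rdiv_lt_0_compat.
  case: (Hc _ hm) => d' [hd' Hd']. exists d'; split => // y hy.
  have {}Hd' := Hd' y hy.
  apply: Rle_lt_trans (Hd _ (Rlt_le_trans _ _ _ Hd' (Rmin_l _ _))) _.
  have := Rlt_le_trans _ _ _ Hd' (Rmin_r _ _).
  move/(Rlt_div_r _ _ _ hK). have := Rle_abs K.
  have := Cmod_ge_0 (RtoC rho * eit y - RtoC rho * eit t). nra.
Qed.

(** The integrand is the derivative of the periodic function [- Ci * f (rho e^(it)) * e^(-it)]: this
    is integration by parts over a period. *)
Lemma circle_RInt (rho : R) : (0 <= rho < r)%R ->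
  is_RInt (V := C_R_NormedModule)
    (fun t => RtoC rho * f' (RtoC rho * eit t) - f (RtoC rho * eit t) * eit (- t)) 0 (2 * PI) (RtoC 0).
Proof.
  move=> h.
  pose F := fun t => - Ci * (f (RtoC rho * eit t) * eit (- t)).
  have -> : RtoC 0 = F (2 * PI)%R - F 0%R.
    rewrite /F /eit !sin_neg !cos_neg sin_2PI cos_2PI sin_0 cos_0. ring.
  apply: is_RInt_FTC_C => t _.
  - have E := eit_opp t.
    have -> : RtoC rho * f' (RtoC rho * eit t) - f (RtoC rho * eit t) * eit (- t) =
      - Ci * (f' (RtoC rho * eit t) * (RtoC rho * (Ci * eit t)) * eit (- t)
        + f (RtoC rho * eit t) * (- Ci * eit (- t))).
      have C2 : Ci * Ci = -(1) by rewrite /Ci /Cmult /Copp /RtoC /=; f_equal; ring.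
      have -> : - Ci * (f' (RtoC rho * eit t) * (RtoC rho * (Ci * eit t)) * eit (- t)
        + f (RtoC rho * eit t) * (- Ci * eit (- t))) =
        - (Ci * Ci) * (f' (RtoC rho * eit t) * RtoC rho * (eit t * eit (- t)))
        + (Ci * Ci) * (f (RtoC rho * eit t) * eit (- t)) by ring.
      rewrite C2 E. ring.
    apply: cdiff_scal. apply: cdiff_mult; first exact: cdiff_circle.
    exact: cdiff_eit_opp.
  - apply: (@continuous_minus _ _ C_R_NormedModule).
    + apply: continuous_Cmult; first exact: continuous_const. exact: continuous_circle'.
    + apply: continuous_Cmult; last exact: continuous_eit_opp.
      exact: cdiff_continuous (cdiff_circle _ _ h).
Qed.

Lemma circle_ex (rho : R) : (0 <= rho < r)%R ->
  ex_RInt (V := C_R_NormedModule) (fun t => f (RtoC rho * eit t) * eit (- t)) 0 (2 * PI).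
Proof.
  move=> h. apply: (@ex_RInt_continuous C_R_CompleteNormedModule) => t _.
  apply: continuous_Cmult; last exact: continuous_eit_opp.
  exact: cdiff_continuous (cdiff_circle _ _ h).
Qed.

(** Up to the factor [2 PI], the first Fourier coefficient of [f] on the circle of radius [rho]
    about the origin. *)
Let c (rho : R) : C := RInt (V := C_R_CompleteNormedModule)
  (fun t => f (RtoC rho * eit t) * eit (- t)) 0 (2 * PI).

Lemma circle_correct (rho : R) : (0 <= rho < r)%R ->
  is_RInt (V := C_R_NormedModule) (fun t => f (RtoC rho * eit t) * eit (- t)) 0 (2 * PI) (c rho).
Proof. move=> h. apply: (@RInt_correct C_R_CompleteNormedModule). exact: circle_ex. Qed.

Lemma circle_RInt' (rho : R) : (0 <= rho < r)%R ->
  is_RInt (V := C_R_NormedModule) (fun t => RtoC rho * f' (RtoC rho * eit t)) 0 (2 * PI) (c rho).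
Proof.
  move=> h. have := is_RInt_plus _ _ _ _ _ _ (circle_RInt _ h) (circle_correct _ h).
  have -> : plus (RtoC 0 : C_R_NormedModule) (c rho) = c rho.
    change (0 + c rho = c rho). ring.
  apply: is_RInt_ext => t _. rewrite /plus /=. 
  change (RtoC rho * f' (RtoC rho * eit t) - f (RtoC rho * eit t) * eit (- t) +
    f (RtoC rho * eit t) * eit (- t) = RtoC rho * f' (RtoC rho * eit t)). ring.
Qed.

Lemma is_RInt_Cscal (g : R -> C) (a b : R) (z l : C) :
  is_RInt (V := C_R_NormedModule) g a b l ->
  is_RInt (V := C_R_NormedModule) (fun t => z * g t) a b (z * l).
Proof.
  case: z l => x y [l1 l2] H.
  have H1 := is_RInt_fct_extend_fst _ _ _ _ H.
  have H2 := is_RInt_fct_extend_snd _ _ _ _ H.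
  apply: is_RInt_fct_extend_pair => /=.
  - apply: (@is_RInt_minus R_NormedModule); exact: (@is_RInt_scal R_NormedModule).
  - apply: (@is_RInt_plus R_NormedModule); exact: (@is_RInt_scal R_NormedModule).
Qed.

Lemma is_RInt_C_const (z : C) (a b : R) :
  is_RInt (V := C_R_NormedModule) (fun _ => z) a b (RtoC (b - a) * z).
Proof. rewrite -C_R_scal. exact: is_RInt_const. Qed.

(** Says that [c] has derivative [c rho / rho]: differentiation under the integral gives the
    integral of [f'] over the circle, which [circle_RInt'] identifies with [c rho / rho]. *)
Lemma circle_diff (rho rho' : R) : (0 < rho < r)%R -> (0 <= rho' < r)%R ->
  (Cmod (c rho' - c rho - (c rho / RtoC rho) * RtoC (rho' - rho))
     <= 2 * PI * K * (rho' - rho) ^ 2)%R.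
Proof.
  move=> h h'.
  have hr : RtoC rho <> 0 by move/RtoC_inj; lra.
  have h2 : (0 <= rho < r)%R by lra.
  have I1 := is_RInt_minus _ _ _ _ _ _ (circle_correct _ h') (circle_correct _ h2).
  have I2 := is_RInt_minus _ _ _ _ _ _ I1
     (is_RInt_Cscal _ _ _ (RtoC (rho' - rho) / RtoC rho) _ (circle_RInt' _ h2)).
  have -> : c rho' - c rho - c rho / RtoC rho * RtoC (rho' - rho) =
    c rho' - c rho - RtoC (rho' - rho) / RtoC rho * c rho by field.
  have -> : (2 * PI * K * (rho' - rho) ^ 2 = (2 * PI - 0) * (K * (rho' - rho) ^ 2))%R by ring.
  have := PI_RGT_0 => hpi.
  have C0 := is_RInt_const (V := R_NormedModule) 0 (2 * PI) (K * (rho' - rho) ^ 2)%R.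
  apply: (is_RInt_C_le _ _ _ _ _ _ _ _ I2 C0); first lra.
  move=> t _. 
  change (Cmod (f (RtoC rho' * eit t) * eit (- t) - f (RtoC rho * eit t) * eit (- t) -
    RtoC (rho' - rho) / RtoC rho * (RtoC rho * f' (RtoC rho * eit t))) <= K * (rho' - rho) ^ 2)%R.
  have -> : f (RtoC rho' * eit t) * eit (- t) - f (RtoC rho * eit t) * eit (- t) -
    RtoC (rho' - rho) / RtoC rho * (RtoC rho * f' (RtoC rho * eit t)) =
    (f (RtoC rho' * eit t) - f (RtoC rho * eit t) -
     f' (RtoC rho * eit t) * (RtoC rho' * eit t - RtoC rho * eit t)) * eit (- t).
    have E := eit_opp t.
    have -> : RtoC (rho' - rho) / RtoC rho * (RtoC rho * f' (RtoC rho * eit t)) =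
      f' (RtoC rho * eit t) * (RtoC rho' - RtoC rho) * (eit t * eit (- t)).
      rewrite E RtoC_minus. by field.
    ring.
  rewrite Cmod_mult Cmod_eit Rmult_1_r.
  apply: Rle_trans (Hf _ _ (circle_lt _ _ h2) (circle_lt _ _ h')) _.
  have -> : RtoC rho' * eit t - RtoC rho * eit t = RtoC (rho' - rho) * eit t.
    rewrite RtoC_minus. ring.
  rewrite Cmod_mult Cmod_eit Rmult_1_r Cmod_R RPow_abs Rabs_pos_eq; last exact: pow2_ge_0.
  lra.
Qed.

(** Expands [f] at the centre. The constant [f 0] drops out because [eit (- t)] has mean zero, and
    the linear term gives the limit of [c rho / rho]. *)
Lemma circle_small (rho : R) : (0 < rho < r)%R ->
  (Cmod (c rho - RtoC (2 * PI * rho) * f' 0) <= 2 * PI * K * rho ^ 2)%R.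
Proof.
  move=> h. have hpi := PI_RGT_0.
  have h2 : (0 <= rho < r)%R by lra.
  have I0 : is_RInt (V := C_R_NormedModule) (fun t => eit (- t)) 0 (2 * PI) (RtoC 0).
    have -> : RtoC 0 = Ci * eit (- (2 * PI)) - Ci * eit (- 0).
      rewrite /eit !sin_neg !cos_neg sin_2PI cos_2PI sin_0 cos_0. ring.
    apply: is_RInt_ext (_ : is_RInt (V := C_R_NormedModule) (fun t => Ci * (- Ci * eit (- t))) _ _ _).
      move=> t _. rewrite /Ci /eit /Cmult /Copp /=. f_equal; ring.
    apply: (is_RInt_FTC_C (fun t => Ci * eit (- t))) => t _.
      apply: cdiff_scal. exact: cdiff_eit_opp.
    apply: continuous_Cmult; first exact: continuous_const.
    apply: continuous_Cmult; first exact: continuous_const. exact: continuous_eit_opp.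
  have I1 := is_RInt_minus _ _ _ _ _ _ (circle_correct _ h2)
     (is_RInt_C_const (RtoC rho * f' 0) 0 (2 * PI)).
  have I2 := is_RInt_minus _ _ _ _ _ _ I1 (is_RInt_Cscal _ _ _ (f 0) _ I0).
  have -> : c rho - RtoC (2 * PI * rho) * f' 0 =
    c rho - RtoC (2 * PI - 0) * (RtoC rho * f' 0) - f 0 * 0.
    rewrite RtoC_mult RtoC_minus. ring.
  have -> : (2 * PI * K * rho ^ 2 = (2 * PI - 0) * (K * rho ^ 2))%R by ring.
  have C0 := is_RInt_const (V := R_NormedModule) 0 (2 * PI) (K * rho ^ 2)%R.
  apply: (is_RInt_C_le _ _ _ _ _ _ _ _ I2 C0); first lra.
  move=> t _.
  change (Cmod (f (RtoC rho * eit t) * eit (- t) - RtoC rho * f' 0 - f 0 * eit (- t)) <= K * rho ^ 2)%R.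
  have E := eit_opp t.
  have -> : RtoC rho * f' 0 = f' 0 * RtoC rho * (eit t * eit (- t)) by rewrite E; ring.
  have -> : f (RtoC rho * eit t) * eit (- t) - f' 0 * RtoC rho * (eit t * eit (- t)) - f 0 * eit (- t)
    = (f (RtoC rho * eit t) - f 0 - f' 0 * (RtoC rho * eit t - 0)) * eit (- t) by ring.
  rewrite Cmod_mult Cmod_eit Rmult_1_r.
  have hr0 : (Cmod 0 < r)%R by rewrite Cmod_0; lra.
  apply: Rle_trans (Hf _ _ hr0 (circle_lt _ _ h2)) _.
  have -> : RtoC rho * eit t - 0 = RtoC rho * eit t by ring.
  rewrite Cmod_mult Cmod_eit Rmult_1_r Cmod_R RPow_abs Rabs_pos_eq; last exact: pow2_ge_0.
  lra.
Qed.

(** [c rho / rho] has derivative [0], and tends to [2 PI f' 0] at [0]. *)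
Lemma circle_formula (rho : R) : (0 < rho < r)%R -> c rho = RtoC (2 * PI * rho) * f' 0.
Proof.
  move=> h.
  have nz s : (0 < s)%R -> RtoC s <> 0 by move=> hs /RtoC_inj; lra.
  have D (s : R) : (0 < s < r)%R -> cdiff RtoC (fun s => c s * / RtoC s) s 0.
    move=> hs. have hs0 := nz s (proj1 hs).
    have Dinv : cdiff RtoC (fun s => / RtoC s) s (- / (RtoC s * RtoC s)).
      have hh : is_derive (fun s => / s)%R s (- / (s * s))%R.
        auto_derive; first lra. field. lra.
      have := cdiff_RtoC _ _ _ hh.
      rewrite RtoC_opp RtoC_inv; last nra.
      rewrite RtoC_mult => H0.
      apply: (cdiff_ext_loc _ _ _ _ _ s _ _ H0); first lra.
      move=> y. rewrite -RtoC_minus Cmod_R => /Rabs_def2 hy. rewrite RtoC_inv //; lra.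
    have -> : RtoC 0 = c s / RtoC s * / RtoC s + c s * (- / (RtoC s * RtoC s)) by field.
    apply: cdiff_mult => //.
    apply: (cdiff_quad _ _ _ _ (2 * PI * K) (Rmin s (r - s))); first by apply: Rmin_pos; lra.
    move=> y. rewrite -RtoC_minus Cmod_R => hy. rewrite RPow_abs Rabs_pos_eq; last exact: pow2_ge_0.
    have := Rlt_le_trans _ _ _ hy (Rmin_l _ _). have := Rlt_le_trans _ _ _ hy (Rmin_r _ _).
    move=> /Rabs_def2 ? /Rabs_def2 ?. apply: circle_diff; lra.
  have cst (s : R) : (0 < s < rho)%R -> c s * / RtoC s = c rho * / RtoC rho.
    move=> hs. apply: (@eq_is_derive C_R_NormedModule (fun s => c s * / RtoC s)); last lra.
    move=> t ht. apply/cdiff_R_is_derive. apply: D. lra.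
  have hr0 := nz rho (proj1 h).
  suff e : c rho * / RtoC rho = RtoC (2 * PI) * f' 0.
    have -> : c rho = c rho * / RtoC rho * RtoC rho by field.
    rewrite e !RtoC_mult. ring.
  have hpi := PI_RGT_0.
  have z0 : Cmod (c rho * / RtoC rho - RtoC (2 * PI) * f' 0) = 0%R; last first.
    move/Cmod_eq_0: z0 => z0.
    have -> : c rho * / RtoC rho = c rho * / RtoC rho - RtoC (2 * PI) * f' 0 + RtoC (2 * PI) * f' 0 by ring.
    rewrite z0. ring.
  apply: Rle_antisym; last exact: Cmod_ge_0.
  apply: le_epsilon => eps he.
  have hK : (0 < 2 * PI * Rabs K + 1)%R by have := Rabs_pos K; nra.
  set s := (Rmin rho (eps / (2 * PI * Rabs K + 1)) / 2)%R.
  have hm : (0 < Rmin rho (eps / (2 * PI * Rabs K + 1)))%R.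
    apply: Rmin_pos; first lra. exact: Rdiv_lt_0_compat.
  have m1 := Rmin_l rho (eps / (2 * PI * Rabs K + 1)).
  have m2 := Rmin_r rho (eps / (2 * PI * Rabs K + 1)).
  have hs : (0 < s < rho)%R by rewrite /s; lra.
  have hs2 : (s * (2 * PI * Rabs K + 1) <= eps)%R.
    apply/Rle_div_r => //. rewrite /s. lra.
  rewrite -(cst s hs).
  have hs0 := nz s (proj1 hs).
  have -> : c s * / RtoC s - RtoC (2 * PI) * f' 0 = (c s - RtoC (2 * PI * s) * f' 0) * / RtoC s.
    rewrite (RtoC_mult (2 * PI) s). by field.
  rewrite Cmod_mult Cmod_inv // Cmod_R Rabs_pos_eq; last lra.
  apply/Rle_div_l; first lra.
  have hs1 : (0 < s < r)%R by lra.
  apply: Rle_trans (circle_small _ hs1) _.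
  have a1 : (2 * PI * K <= 2 * PI * Rabs K)%R by apply: Rmult_le_compat_l (Rle_abs K); lra.
  have a2 : (s * (2 * PI * K) <= eps)%R.
    apply: Rle_trans hs2. apply: Rmult_le_compat_l; lra.
  have := Rmult_le_compat_r s _ _ (Rlt_le _ _ (proj1 hs)) a2. lra.
Qed.

Lemma circle_formula' (rho : R) : (0 < rho < r)%R ->
  is_RInt (V := C_R_NormedModule) (fun t => f (RtoC rho * eit t) * eit (- t)) 0 (2 * PI)
    (RtoC (2 * PI * rho) * f' 0).
Proof. move=> h. rewrite -circle_formula //. apply: circle_correct. lra. Qed.

End Circle.

Lemma quad_disc_shift (f f' : C -> C) (r K : R) (z : C) :
  quad_disc f f' r K -> quad_disc (fun x => f (z + x)) (fun x => f' (z + x)) (r - Cmod z) K.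
Proof.
  move=> H x y hx hy.
  have := H (z + x) (z + y). have -> : z + y - (z + x) = y - x by ring.
  apply; [have := Cmod_triangle z x | have := Cmod_triangle z y]; lra.
Qed.

Lemma cauchy_bound (f f' : C -> C) (r K M : R) (z : C) (rho : R) :
  quad_disc f f' r K ->
  (forall t, (Cmod (f (z + RtoC rho * eit t)%C) <= M)%R) ->
  (0 < rho)%R -> (Cmod z + rho < r)%R -> (Cmod (f' z) <= M / rho)%R.
Proof.
  move=> H hM h0 h1. have hpi := PI_RGT_0.
  have h2 : (0 < rho < r - Cmod z)%R by lra.
  have := circle_formula' _ _ _ _ (quad_disc_shift _ _ _ _ z H) rho h2.
  have -> : z + 0 = z by ring. move=> I.
  have C0 := is_RInt_const (V := R_NormedModule) 0 (2 * PI) M.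
  have := is_RInt_C_le _ _ _ _ _ _ _ _ I C0.
  rewrite Cmod_mult Cmod_R Rabs_pos_eq; last nra.
  move=> X. apply/Rle_div_r => //. apply: (Rmult_le_reg_l (2 * PI)); first lra.
  have -> : (2 * PI * (Cmod (f' z) * rho) = 2 * PI * rho * Cmod (f' z))%R by ring.
  have -> : (2 * PI * M = (2 * PI - 0) * M)%R by ring.
  apply: X; first lra.
  move=> t _. rewrite Cmod_mult Cmod_eit Rmult_1_r. exact: hM.
Qed.

(** The mean value theorem fails for complex values, so it is applied to the real part of [f]
    multiplied by the conjugate of the total increment; that real part increases by exactly the
    squared modulus of the increment. *)
Lemma mean_value_C (f : R -> C) (df : R -> C) (M : R) :
  (forall t, (0 <= t <= 1)%R -> cdiff RtoC f t (df t)) ->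
  (forall t, (0 <= t <= 1)%R -> (Cmod (df t) <= M)%R) ->
  (Cmod (f 1%R - f 0%R) <= M)%R.
Proof.
  move=> D B.
  case: (Req_dec (Cmod (f 1%R - f 0%R)) 0) => h0.
    rewrite h0. apply: Rle_trans (Cmod_ge_0 _) (B 0%R _). lra.
  have hp : (0 < Cmod (f 1%R - f 0%R))%R by have := Cmod_ge_0 (f 1%R - f 0%R); lra.
  set w := Cconj (f 1%R - f 0%R).
  have [t [e ht]] : exists t, (Re (w * f 1%R) - Re (w * f 0%R) = Re (w * df t) * (1 - 0))%R /\ (0 <= t <= 1)%R.
    case: (MVT_gen (fun t => Re (w * f t)) 0 1 (fun t => Re (w * df t))).
    - move=> x hx. rewrite Rmin_left ?Rmax_right in hx; try lra.
      have hx' : (0 <= x <= 1)%R by lra.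
      have /cdiff_R_is_derive H := cdiff_scal _ w _ _ _ (D x hx').
      have := filterdiff_comp (fun t => w * f t) (fun z : C_R_NormedModule => fst z) _ _ H
        (filterdiff_linear _ is_linear_fst).
      exact.
    - move=> x hx. rewrite Rmin_left ?Rmax_right in hx; try lra.
      apply/continuity_pt_filterlim.
      have /cdiff_continuous := cdiff_scal _ w _ _ _ (D x hx).
      move=> H. apply: filterlim_comp H _. exact: (@continuous_fst R_UniformSpace R_UniformSpace).
    - move=> t [ht e]. exists t. split => //. rewrite Rmin_left ?Rmax_right in ht; lra.
  have e2 : (Cmod (f 1%R - f 0%R) ^ 2 = Re (w * df t))%R.
    rewrite Rminus_0_r Rmult_1_r in e. rewrite -e.
    have := Cmod2_conj (f 1%R - f 0%R). rewrite -/w => X.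
    have : Re (RtoC (Cmod (f 1%R - f 0%R) ^ 2)) = Re ((f 1%R - f 0%R) * w).
      by rewrite -X.
    rewrite /Re /RtoC /Cminus /Cplus /Copp /Cmult /=. lra.
  apply: (Rmult_le_reg_l _ _ _ hp).
  have : (Cmod (f 1%R - f 0%R) ^ 2 <= Cmod w * M)%R.
    rewrite e2. apply: Rle_trans (Rle_abs _) _. apply: Rle_trans (re_le_Cmod _) _.
    rewrite Cmod_mult. apply: Rmult_le_compat_l (Cmod_ge_0 _) (B _ ht).
  rewrite /w Cmod_conj. nra.
Qed.

(** As [K] does not occur in the bound, the estimate survives pointwise limits. *)
Lemma cauchy_taylor (f f' : C -> C) (r K M : R) :
  quad_disc f f' r K -> (2 < r)%R -> (forall z, (Cmod z < r)%R -> (Cmod (f z) <= M)%R) ->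
  (Cmod (f 1 - f 0 - f' 0) <= 16 * M / r ^ 2)%R.
Proof.
  move=> H hr hM. have hpi := PI_RGT_0.
  have hM0 : (0 <= M)%R.
    apply: Rle_trans (Cmod_ge_0 (f 0)) (hM _ _). rewrite Cmod_0. lra.
  have B1 z : (Cmod z < 3 * r / 4)%R -> (Cmod (f' z) <= 4 * M / r)%R.
    move=> hz. have -> : (4 * M / r = M / (r / 4))%R by field; lra.
    apply: (cauchy_bound _ _ _ _ _ _ _ H); try lra.
    move=> t. apply: hM. have := Cmod_triangle z (RtoC (r / 4) * eit t).
    rewrite Cmod_mult Cmod_eit Cmod_R Rabs_pos_eq; lra.
  have B2 (t : R) : (0 <= t <= 1)%R -> (Cmod (f' (RtoC t) - f' 0) <= 16 * M / r ^ 2)%R.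
    move=> ht.
    have ct : Cmod (RtoC t) = t by rewrite Cmod_R Rabs_pos_eq; lra.
    (* A Lipschitz bound for [f'] without second derivatives: the increment [g] is at most [4 M / r]
       on the circle of radius [r / 4], by the mean value inequality and [B1], and Cauchy's bound
       for [g'] divides once more by [r / 4]. The condition [2 < r] keeps [1 + r / 4] below
       [3 r / 4]. *)
    pose g z := f (RtoC t + z) - f z. pose g' z := f' (RtoC t + z) - f' z.
    have Hg : quad_disc g g' (r - t) (K + K).
      move=> x y hx hy.
      have := quad_disc_shift _ _ _ _ (RtoC t) H x y. rewrite ct => /(_ hx hy) h1.
      have hx' : (Cmod x < r)%R by lra. have hy' : (Cmod y < r)%R by lra.
      have h2 := H x y hx' hy'.
      have -> : g y - g x - g' x * (y - x) =
        (f (RtoC t + y) - f (RtoC t + x) - f' (RtoC t + x) * (y - x)) - (f y - f x - f' x * (y - x)).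
        rewrite /g /g'. ring.
      apply: Rle_trans (Cmod_minus_le _ _) _. lra.
    have -> : f' (RtoC t) - f' 0 = g' 0 by rewrite /g'; have -> : RtoC t + 0 = RtoC t by ring.
    have -> : (16 * M / r ^ 2 = 4 * M / r / (r / 4))%R by field; lra.
    apply: (cauchy_bound _ _ _ _ _ _ _ Hg); rewrite ?Cmod_0; try lra.
    move=> th. have -> : 0 + RtoC (r / 4) * eit th = RtoC (r / 4) * eit th by ring.
    set z := RtoC (r / 4) * eit th.
    have cz : Cmod z = (r / 4)%R by rewrite /z Cmod_mult Cmod_eit Cmod_R Rabs_pos_eq; lra.
    have hin (s : R) : (0 <= s <= 1)%R -> (Cmod (RtoC (s * t) + z)%C < 3 * r / 4)%R.
      move=> hs. have := Cmod_triangle (RtoC (s * t)) z. rewrite cz Cmod_R Rabs_pos_eq; nra.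
    have -> : g z = f (RtoC (1 * t) + z) - f (RtoC (0 * t) + z).
      rewrite /g Rmult_1_l Rmult_0_l Cplus_0_l. done.
    apply: (mean_value_C (fun s => f (RtoC (s * t) + z)) (fun s => f' (RtoC (s * t) + z) * RtoC t)).
    - move=> s hs. apply: (cdiff_comp _ (fun s => RtoC (s * t) + z)).
      + have -> : RtoC t = RtoC t + 0 by ring.
        apply: cdiff_plus; last exact: cdiff_const.
        apply: cdiff_RtoC. auto_derive => //; ring.
      + apply: (quad_disc_cdiff _ _ _ _ H). have := hin s hs. lra.
    - move=> s hs. rewrite Cmod_mult ct.
      have := B1 _ (hin s hs). have := Cmod_ge_0 (f' (RtoC (s * t) + z)%C). nra.
  have -> : f 1 - f 0 - f' 0 = (f (RtoC 1) - RtoC 1 * f' 0) - (f (RtoC 0) - RtoC 0 * f' 0) by ring.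
  apply: (mean_value_C (fun s => f (RtoC s) - RtoC s * f' 0) (fun s => f' (RtoC s) * 1 - (1 * f' 0 + RtoC s * 0))).
  - move=> s hs. apply: cdiff_minus.
    + apply: (cdiff_comp _ RtoC); first exact: cdiff_id.
      apply: (quad_disc_cdiff _ _ _ _ H). rewrite Cmod_R Rabs_pos_eq; lra.
    + apply: cdiff_mult; [exact: cdiff_id | exact: cdiff_const].
  - move=> s hs.
    have -> : f' (RtoC s) * 1 - (1 * f' 0 + RtoC s * 0) = f' (RtoC s) - f' 0 by ring.
    exact: B2.
Qed.

(** * Holomorphic functions on balls of a complex normed space *)

Lemma Ciota_eq (P : C -> Prop) (l : C) :
  (forall x y, P x -> P y -> x = y) -> P l -> Ciota P = l.
Proof. move=> U H. apply: (@iota_unique _ C_CompleteNormedModule) => // y hy. exact: U. Qed.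

Lemma Ciota_lim (u : nat -> C) (l : C) : Cseq_lim u l -> Ciota (Cseq_lim u) = l.
Proof. apply: Ciota_eq => x y. exact: Cseq_lim_unique. Qed.

(** Counts terms, unlike [sum_n], whose upper index is included; the empty sum is the base case of
    the telescoping arguments. *)
Fixpoint Csum (u : nat -> C) (n : nat) : C :=
  match n with O => 0 | S m => Csum u m + u m end.

Lemma Csum_bound (u : nat -> C) (M : R) (n : nat) :
  (forall k, (k < n)%nat -> (Cmod (u k) <= M)%R) -> (Cmod (Csum u n) <= INR n * M)%R.
Proof.
  elim: n => [|n IH] H.
    rewrite /= Cmod_0. lra.
  rewrite S_INR Rmult_plus_distr_r Rmult_1_l. apply: Cmod_plus_le.
  - apply: IH => k hk. apply: H. lia.
  - apply: H. lia.
Qed.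

Lemma sum_n_Csum (u : nat -> C) (n : nat) :
  sum_n (G := C_AbelianMonoid) u n = Csum u (S n).
Proof.
  elim: n => [|n IH].
    rewrite sum_O /=. ring.
  by rewrite sum_Sn IH.
Qed.

Section Hol.
Context {E : NormedModule C_AbsRing}.
Implicit Types (x y v : E) (f g : E -> C) (D : E -> E -> C).

Lemma plus_minus_E x y : plus x (minus y x) = y.
Proof. by rewrite /minus (plus_comm y) plus_assoc plus_opp_r plus_zero_l. Qed.

Lemma minus_plus_E x v : minus (plus x v) x = v.
Proof. by rewrite /minus (plus_comm x) -plus_assoc plus_opp_r plus_zero_r. Qed.

Lemma minus_plus2_E x u v : minus (plus x u) (plus x v) = minus u v.
Proof.
  by rewrite /minus opp_plus (plus_comm x u) -plus_assoc (plus_assoc x) plus_opp_r plus_zero_l.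
Qed.

Lemma minus_plus3_E u v x : minus (plus u x) (plus v x) = minus u v.
Proof. by rewrite (plus_comm u) (plus_comm v) minus_plus2_E. Qed.

Lemma minus_scal_E (a b : C) v : minus (scal a v) (scal b v) = scal (a - b : C_AbsRing) v.
Proof. rewrite /minus -scal_opp_l -scal_distr_r. done. Qed.

Lemma minus_self x : minus x x = zero.
Proof. exact: plus_opp_r. Qed.

Lemma norm_scal_E (a : C) v : (norm (scal a v) <= Cmod a * norm v)%R.
Proof. exact: norm_scal. Qed.

Lemma norm_minus_triangle x y z : (norm (minus x z) <= norm (minus x y) + norm (minus y z))%R.
Proof. rewrite (minus_trans y). exact: norm_triangle. Qed.

Lemma norm_minus_sym x y : norm (minus x y) = norm (minus y x).
Proof. by rewrite -norm_opp opp_minus. Qed.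

(** Norm balls rather than balls of the uniform structure, so that the triangle inequality is
    lossless; the passage to [locally] is made only when the value of Mishev's function is
    identified. *)
Definition inB x0 (r : R) x : Prop := (norm (minus x x0) < r)%R.

Lemma inB_center x0 (r : R) : (0 < r)%R -> inB x0 r x0.
Proof. move=> h. by rewrite /inB minus_self norm_zero. Qed.

Lemma inB_le x0 (r r' : R) x : (r' <= r)%R -> inB x0 r' x -> inB x0 r x.
Proof. rewrite /inB. lra. Qed.

Lemma inB_line x0 (r : R) x (t : C) v :
  (norm (minus x x0) + Cmod t * norm v < r)%R -> inB x0 r (plus x (scal (t : C_AbsRing) v)).
Proof.
  move=> h. apply: Rle_lt_trans (norm_minus_triangle _ x x0) _. rewrite minus_plus_E.
  apply: Rle_lt_trans h. rewrite Rplus_comm. apply: Rplus_le_compat_l. exact: norm_scal_E.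
Qed.

Lemma inB_dist x0 (r : R) x y : inB x0 r x -> inB x0 r y -> (norm (minus y x) < 2 * r)%R.
Proof.
  rewrite /inB => h h'. have := norm_minus_triangle y x0 x.
  rewrite (norm_minus_sym x0). lra.
Qed.

(** One constant bounds the function, its differential and the second-order remainder over the whole
    ball. Sums and products then stay in the class on the same ball, and complex linearity of [D x]
    is what makes the class holomorphic rather than merely smooth. *)
Record holD x0 (r : R) f D (M : R) : Prop := {
  holD_le : forall x, inB x0 r x -> (Cmod (f x) <= M)%R;
  holD_dle : forall x v, inB x0 r x -> (Cmod (D x v) <= M * norm v)%R;
  holD_plus : forall x u v, inB x0 r x -> D x (plus u v) = D x u + D x v;
  holD_scal : forall x (a : C) v, inB x0 r x -> D x (scal a v) = a * D x v;
  holD_quad : forall x y, inB x0 r x -> inB x0 r y ->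
    (Cmod (f y - f x - D x (minus y x)) <= M * norm (minus y x) ^ 2)%R }.

Definition Hol x0 (r : R) f : Prop := exists D M, holD x0 r f D M.

Lemma holD_restr x0 x0' (r r' : R) f D (M : R) :
  (forall x, inB x0' r' x -> inB x0 r x) -> holD x0 r f D M -> holD x0' r' f D M.
Proof.
  move=> h [a b c d e]. split.
  - move=> x /h. exact: a.
  - move=> x v /h. exact: b.
  - move=> x u v /h. exact: c.
  - move=> x k v /h. exact: d.
  - move=> x y /h hx /h hy. exact: e.
Qed.

Lemma Hol_restr x0 (r r' : R) f : (r' <= r)%R -> Hol x0 r f -> Hol x0 r' f.
Proof.
  move=> h [D [M H]]. exists D, M. apply: holD_restr H => x. exact: inB_le.
Qed.

Lemma holD_pos x0 (r : R) f D (M : R) : (0 < r)%R -> holD x0 r f D M -> (0 <= M)%R.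
Proof.
  move=> hr H. apply: Rle_trans (Cmod_ge_0 (f x0)) (holD_le _ _ _ _ _ H _ _). exact: inB_center.
Qed.

Lemma holD_lip x0 (r : R) f D (M : R) x y : holD x0 r f D M -> inB x0 r x -> inB x0 r y ->
  (Cmod (f y - f x) <= M * (1 + 2 * r) * norm (minus y x))%R.
Proof.
  move=> H hx hy.
  have hM : (0 <= M)%R.
    apply: Rle_trans (Cmod_ge_0 (f x)) (holD_le _ _ _ _ _ H _ hx).
  have -> : f y - f x = (f y - f x - D x (minus y x)) + D x (minus y x) by ring.
  apply: Rle_trans (Cmod_plus_le _ _ _ _ (holD_quad _ _ _ _ _ H _ _ hx hy)
    (holD_dle _ _ _ _ _ H _ _ hx)) _.
  have h0 := norm_ge_0 (minus y x).
  have := inB_dist _ _ _ _ hx hy => h1.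
  have : (M * norm (minus y x) * norm (minus y x) <= M * norm (minus y x) * (2 * r))%R.
    apply: Rmult_le_compat_l; [exact: Rmult_le_pos | lra].
  lra.
Qed.

Lemma Hol_lip x0 (r : R) f : Hol x0 r f -> exists L, forall x y, inB x0 r x -> inB x0 r y ->
  (Cmod (f y - f x) <= L * norm (minus y x))%R.
Proof. case=> D [M H]. exists (M * (1 + 2 * r))%R => x y hx hy. exact: (holD_lip _ _ _ _ _ _ _ H hx hy). Qed.

Lemma Hol_ext x0 (r : R) f g : (forall x, inB x0 r x -> f x = g x) -> Hol x0 r f -> Hol x0 r g.
Proof.
  move=> e [D [M [a b c d q]]]. exists D, M. split => //.
  - move=> x hx. rewrite -e //. exact: a.
  - move=> x y hx hy. rewrite -!e //. exact: q.
Qed.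

Lemma Hol_const x0 (r : R) (c : C) : Hol x0 r (fun _ => c).
Proof.
  exists (fun _ _ => 0), (Cmod c). have hc := Cmod_ge_0 c. split.
  - move=> x _. lra.
  - move=> x v _. rewrite Cmod_0. have := norm_ge_0 v. nra.
  - move=> *. ring.
  - move=> *. ring.
  - move=> x y _ _. have -> : c - c - 0 = 0 by ring. rewrite Cmod_0.
    apply: Rmult_le_pos => //. exact: pow2_ge_0.
Qed.

Lemma Hol_plus x0 (r : R) f g : Hol x0 r f -> Hol x0 r g -> Hol x0 r (fun x => f x + g x).
Proof.
  case=> D [M [a b c d e]] [D' [M' [a' b' c' d' e']]].
  exists (fun x v => D x v + D' x v), (M + M')%R. split.
  - move=> x hx. apply: Cmod_plus_le; auto.
  - move=> x v hx. rewrite Rmult_plus_distr_r. apply: Cmod_plus_le; auto.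
  - move=> x u v hx. rewrite c // c' //. ring.
  - move=> x k v hx. rewrite d // d' //. ring.
  - move=> x y hx hy. 
    have -> : f y + g y - (f x + g x) - (D x (minus y x) + D' x (minus y x)) =
      (f y - f x - D x (minus y x)) + (g y - g x - D' x (minus y x)) by ring.
    rewrite Rmult_plus_distr_r. apply: Cmod_plus_le; auto.
Qed.

Lemma Hol_mult x0 (r : R) f g : Hol x0 r f -> Hol x0 r g -> Hol x0 r (fun x => f x * g x).
Proof.
  case=> D [M H] [D' [M' H']].
  set L := (M * (1 + 2 * r))%R. set L' := (M' * (1 + 2 * r))%R.
  (* The term in [M * M'] covers the two first-order remainders, the term in [L * L'] the product of
     the increments. The absolute values cover an empty ball, where the signs of [M] and [M'] are
     unknown. *)
  exists (fun x v => D x v * g x + f x * D' x v), (2 * Rabs (M * M') + Rabs (L * L'))%R.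
  have hL := Rabs_pos (L * L').
  have base x : inB x0 r x -> (0 <= M /\ 0 <= M' /\ Rabs (M * M') = M * M')%R.
    move=> hx.
    have h1 := Rle_trans _ _ _ (Cmod_ge_0 (f x)) (holD_le _ _ _ _ _ H _ hx).
    have h2 := Rle_trans _ _ _ (Cmod_ge_0 (g x)) (holD_le _ _ _ _ _ H' _ hx).
    split => //; split => //. rewrite Rabs_pos_eq //. exact: Rmult_le_pos.
  case: (H) => a b c d e. case: (H') => a' b' c' d' e'.
  split.
  - move=> x hx. case: (base _ hx) => h1 [h2 ->].
    apply: Rle_trans (Cmod_mult_le _ _ _ _ (a _ hx) (a' _ hx)) _. nra.
  - move=> x v hx. case: (base _ hx) => h1 [h2 ->].
    apply: Rle_trans (Cmod_plus_le _ _ _ _ (Cmod_mult_le _ _ _ _ (b x v hx) (a' _ hx))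
      (Cmod_mult_le _ _ _ _ (a _ hx) (b' x v hx))) _.
    have := norm_ge_0 v. nra.
  - move=> x u v hx. rewrite c // c' //. ring.
  - move=> x k v hx. rewrite d // d' //. ring.
  - move=> x y hx hy. case: (base _ hx) => h1 [h2 ->].
    have l1 := holD_lip _ _ _ _ _ _ _ H hx hy. have l2 := holD_lip _ _ _ _ _ _ _ H' hx hy.
    have -> : f y * g y - f x * g x - (D x (minus y x) * g x + f x * D' x (minus y x)) =
      (f y - f x - D x (minus y x)) * g x + f x * (g y - g x - D' x (minus y x))
      + (f y - f x) * (g y - g x) by ring.
    apply: Rle_trans (Cmod_plus_le _ _ _ _ (Cmod_plus_le _ _ _ _
      (Cmod_mult_le _ _ _ _ (e x y hx hy) (a' _ hx)) (Cmod_mult_le _ _ _ _ (a _ hx) (e' x y hx hy)))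
      (Cmod_mult_le _ _ _ _ l1 l2)) _.
    rewrite -/L -/L'.
    have := Rle_abs (L * L'). have := pow2_ge_0 (norm (minus y x)). nra.
Qed.

Lemma Hol_opp x0 (r : R) f : Hol x0 r f -> Hol x0 r (fun x => - f x).
Proof.
  move=> H. apply: Hol_ext (Hol_mult _ _ _ _ (Hol_const x0 r (-(1))) H) => x _. ring.
Qed.

Lemma Hol_minus x0 (r : R) f g : Hol x0 r f -> Hol x0 r g -> Hol x0 r (fun x => f x - g x).
Proof. move=> H /Hol_opp H'. exact: Hol_plus. Qed.

Lemma Hol_Csum x0 (r : R) (u : nat -> E -> C) (n : nat) :
  (forall k, Hol x0 r (u k)) -> Hol x0 r (fun x => Csum (fun k => u k x) n).
Proof.
  move=> H. elim: n => [|n IH] /=; first exact: Hol_const. exact: Hol_plus.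
Qed.

Lemma Hol_linear x0 (r : R) (l : E -> C) (L : R) :
  (forall u v, l (plus u v) = l u + l v) -> (forall (a : C) v, l (scal a v) = a * l v) ->
  (forall v, Cmod (l v) <= L * norm v)%R -> Hol x0 r l.
Proof.
  move=> hp hs hb. exists (fun _ => l), (Rabs L * (1 + norm x0 + Rabs r))%R.
  have n0 := norm_ge_0 x0. have r0 := Rabs_pos r. have l0 := Rabs_pos L.
  have hb' v : (Cmod (l v) <= Rabs L * norm v)%R.
    apply: Rle_trans (hb v) _. apply: Rmult_le_compat_r (norm_ge_0 v) (Rle_abs L).
  split => //.
  - move=> x hx. apply: Rle_trans (hb' x) _. apply: Rmult_le_compat_l => //.
    have := norm_triangle (minus x x0) x0. rewrite plus_comm plus_minus_E.
    rewrite /inB in hx. have := Rle_abs r. lra.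
  - move=> x v _. apply: Rle_trans (hb' v) _. rewrite Rmult_assoc.
    apply: Rmult_le_compat_l => //. have := norm_ge_0 v. nra.
  - move=> x y _ _.
    have -> : l y - l x - l (minus y x) = 0.
      rewrite -{1}(plus_minus_E x y) hp. ring.
    rewrite Cmod_0. apply: Rmult_le_pos; last exact: pow2_ge_0. nra.
Qed.

Lemma holD_line x0 (r : R) f D (M : R) x v : holD x0 r f D M -> inB x0 r x ->
  cdiff idC (fun t => f (plus x (scal (t : C_AbsRing) v))) 0 (D x v).
Proof.
  move=> H hx. rewrite /inB in hx.
  have nv := norm_ge_0 v.
  have hM : (0 <= M)%R.
    apply: Rle_trans (Cmod_ge_0 (f x)) (holD_le _ _ _ _ _ H _ hx).
  have e0 : plus x (scal (RtoC 0 : C_AbsRing) v) = x.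
    have -> : (RtoC 0 : C_AbsRing) = zero by []. by rewrite scal_zero_l plus_zero_r.
  apply: (cdiff_quad _ _ _ _ (M * norm v ^ 2) ((r - norm (minus x x0)) / (norm v + 1))).
    apply: Rdiv_lt_0_compat; lra.
  move=> t. rewrite e0 /idC. have -> : t - 0 = t by ring.
  move=> /Rlt_div_r h. have {}h := h ltac:(lra).
  have ht := Cmod_ge_0 t.
  have hy : inB x0 r (plus x (scal (t : C_AbsRing) v)) by apply: inB_line; lra.
  have := holD_quad _ _ _ _ _ H _ _ hx hy. rewrite minus_plus_E.
  rewrite (holD_scal _ _ _ _ _ H) // (Cmult_comm t) => h2.
  apply: Rle_trans h2 _. rewrite Rmult_assoc. apply: Rmult_le_compat_l => //.
  rewrite Rmult_comm -Rpow_mult_distr. apply: pow_incr. split; first exact: norm_ge_0. exact: norm_scal_E.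
Qed.

(** Restriction to the complex line through [x] in the direction [v], by which the one-variable
    Cauchy estimates reach the general normed space. *)
Lemma holD_quad_disc x0 (r : R) f D (M : R) x v (s : R) : holD x0 r f D M -> (0 <= M)%R ->
  (norm (minus x x0) + s * norm v <= r)%R -> (0 < norm v)%R ->
  quad_disc (fun t => f (plus x (scal (t : C_AbsRing) v)))
            (fun t => D (plus x (scal (t : C_AbsRing) v)) v) s (M * norm v ^ 2).
Proof.
  move=> H hM hs hv.
  have hin (t : C) : (Cmod t < s)%R -> inB x0 r (plus x (scal (t : C_AbsRing) v)).
    move=> ht. apply: inB_line. nra.
  move=> a b /hin ha /hin hb.
  have := holD_quad _ _ _ _ _ H _ _ ha hb. rewrite minus_plus2_E minus_scal_E.
  rewrite (holD_scal _ _ _ _ _ H) // (Cmult_comm _ (D _ _)) => h2.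
  apply: Rle_trans h2 _. rewrite Rmult_assoc. apply: Rmult_le_compat_l => //.
  rewrite Rmult_comm -Rpow_mult_distr. apply: pow_incr. split; first exact: norm_ge_0.
  exact: norm_scal_E.
Qed.

(** Both bounds involve the supremum [M0] but not [M], so they hold uniformly along a bounded
    sequence. On the line in the direction [v], a disc of radius [s = 7 r / (8 |v|)] stays in the
    ball; Cauchy's bound on the circle of radius [s / 2] gives [16/7], rounded up to [3], and
    [cauchy_taylor] gives [1024/49], rounded up to [21]. *)
Lemma holD_cauchy x0 (r : R) f D (M M0 : R) : (0 < r)%R -> holD x0 r f D M ->
  (forall x, inB x0 r x -> (Cmod (f x) <= M0)%R) ->
  (forall x v, inB x0 (r / 8) x -> (Cmod (D x v) <= 3 * M0 / r * norm v)%R) /\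
  (forall x y, inB x0 (r / 8) x -> inB x0 (r / 8) y ->
    (Cmod (f y - f x - D x (minus y x)) <= 21 * M0 / r ^ 2 * norm (minus y x) ^ 2)%R).
Proof.
  move=> hr H hM0. have hM := holD_pos _ _ _ _ _ hr H.
  have h00 : (0 <= M0)%R.
    apply: Rle_trans (Cmod_ge_0 (f x0)) (hM0 _ _). exact: inB_center.
  have hin x v (t : C) (s : R) : inB x0 (r / 8) x -> (s * norm v <= 7 * r / 8)%R -> (Cmod t < s)%R ->
      (0 < norm v)%R -> inB x0 r (plus x (scal (t : C_AbsRing) v)).
    rewrite /inB => hx hs ht hv. apply: inB_line. nra.
  have e0 x v : plus x (scal (RtoC 0 : C_AbsRing) v) = x.
    have -> : (RtoC 0 : C_AbsRing) = zero by []. by rewrite scal_zero_l plus_zero_r.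
  have e1 x v : plus x (scal (RtoC 1 : C_AbsRing) v) = plus x v.
    have -> : (RtoC 1 : C_AbsRing) = one by []. by rewrite scal_one.
  split.
  - move=> x v hx.
    case: (Rle_lt_or_eq_dec _ _ (norm_ge_0 v)) => hv; last first.
      have hx' : inB x0 r x by apply: inB_le hx; lra.
      have := holD_dle _ _ _ _ _ H x v hx'. rewrite -hv. lra.
    set s := (7 * r / 8 / norm v)%R.
    have hs : (s * norm v = 7 * r / 8)%R by rewrite /s; field; lra.
    have s0 : (0 < s)%R by apply: Rdiv_lt_0_compat; lra.
    have Q := holD_quad_disc _ _ _ _ _ x v s H hM.
    have := cauchy_bound _ _ _ _ M0 0 (s / 2) (Q _ hv).
    rewrite e0 Cmod_0 => X. apply: Rle_trans (X _ _ _ _) _; try lra.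
    + rewrite /inB in hx. lra.
    + move=> t. apply: hM0. apply: (hin _ _ _ s) => //; first lra.
      have -> : 0 + RtoC (s / 2) * eit t = RtoC (s / 2) * eit t by ring.
      rewrite Cmod_mult Cmod_eit Cmod_R Rabs_pos_eq; lra.
    + apply/Rle_div_l; first lra.
      have -> : (3 * M0 / r * norm v * (s / 2) = 3 * M0 / r * ((s * norm v) / 2))%R by field; lra.
      rewrite hs. have -> : (3 * M0 / r * (7 * r / 8 / 2) = 21 / 16 * M0)%R by field; lra. lra.
  - move=> x y hx hy. set v := minus y x.
    have hv2 : (norm v < r / 4)%R by have := inB_dist _ _ _ _ hx hy; rewrite /v; lra.
    have hx' : inB x0 r x by apply: inB_le hx; lra.
    have hy' : inB x0 r y by apply: inB_le hy; lra.
    case: (Rle_lt_or_eq_dec _ _ (norm_ge_0 v)) => hv; last first.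
      have := holD_quad _ _ _ _ _ H x y hx' hy'. rewrite -/v -hv. lra.
    set s := (7 * r / 8 / norm v)%R.
    have hs : (s * norm v = 7 * r / 8)%R by rewrite /s; field; lra.
    have s2 : (2 < s)%R by apply/Rlt_div_r; lra.
    have Q := holD_quad_disc _ _ _ _ _ x v s H hM.
    have := cauchy_taylor _ _ _ _ M0 (Q _ hv) s2.
    rewrite e0 e1 plus_minus_E => X. apply: Rle_trans (X _ _) _.
    + rewrite /inB in hx. lra.
    + move=> z hz. apply: hM0. apply: (hin _ _ _ s) => //. lra.
    + have -> : (norm v = 7 * r / 8 / s)%R by rewrite /s; field; lra.
      have -> : (21 * M0 / r ^ 2 * (7 * r / 8 / s) ^ 2 = 1029 / 64 * M0 / s ^ 2)%R by field; lra.
      apply: Rmult_le_compat_r; last lra.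
      apply: Rlt_le. apply: Rinv_0_lt_compat. nra.
Qed.
End Hol.

(** * Composition, limits and division of holomorphic functions *)

Section Comp.
Context {E : NormedModule C_AbsRing}.

Lemma Hol_affine {E' : NormedModule C_AbsRing} (x0 : E) (x0' : E') (r r' L : R) (f : E -> C)
    (A l : E' -> E) : (0 <= L)%R ->
  (forall x y, minus (A y) (A x) = l (minus y x)) ->
  (forall u v, l (plus u v) = plus (l u) (l v)) ->
  (forall (a : C_AbsRing) v, l (scal a v) = scal a (l v)) ->
  (forall v, norm (l v) <= L * norm v)%R ->
  (forall x, inB x0' r' x -> inB x0 r (A x)) ->
  Hol x0 r f -> Hol x0' r' (fun x => f (A x)).
Proof.
  move=> hL hA hp hs hb hin [D [M [a b c d e]]].
  exists (fun x v => D (A x) (l v)), (Rabs M * (1 + L + L ^ 2))%R.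
  have hM := Rabs_pos M. have hM' := Rle_abs M. have hL2 := pow2_ge_0 L.
  split.
  - move=> x /hin hx. apply: Rle_trans (a _ hx) _. nra.
  - move=> x v /hin hx. apply: Rle_trans (b _ _ hx) _.
    have h1 := norm_ge_0 (l v). have h2 := norm_ge_0 v.
    apply: Rle_trans (_ : Rabs M * (L * norm v) <= _)%R.
      apply: Rmult_le_compat => //; first exact: Rle_trans (Cmod_ge_0 (f (A x))) (a _ hx).
    have -> : (Rabs M * (L * norm v) = Rabs M * L * norm v)%R by ring.
    apply: Rmult_le_compat_r => //. nra.
  - move=> x u v /hin hx. by rewrite hp c.
  - move=> x k v /hin hx. by rewrite hs d.
  - move=> x y /hin hx /hin hy. rewrite -hA. apply: Rle_trans (e _ _ hx hy) _.
    rewrite hA. have h1 := norm_ge_0 (l (minus y x)).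
    have h3 : (norm (l (minus y x)) ^ 2 <= L ^ 2 * norm (minus y x) ^ 2)%R.
      rewrite -Rpow_mult_distr. by apply: pow_incr.
    apply: Rle_trans (_ : Rabs M * (L ^ 2 * norm (minus y x) ^ 2) <= _)%R.
      apply: Rmult_le_compat => //; first exact: Rle_trans (Cmod_ge_0 (f (A x))) (a _ hx).
      exact: pow2_ge_0.
    have -> : (Rabs M * (L ^ 2 * norm (minus y x) ^ 2) = Rabs M * L ^ 2 * norm (minus y x) ^ 2)%R by ring.
    apply: Rmult_le_compat_r; first exact: pow2_ge_0. nra.
Qed.

Lemma Hol_comp (x0 : E) (r rho : R) (f : E -> C) (z0 : C) (g : C -> C) :
  (forall x, inB x0 r x -> (Cmod (f x - z0) < rho)%R) ->
  Hol (E := C_NormedModule) z0 rho g -> Hol x0 r f -> Hol x0 r (fun x => g (f x)).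
Proof.
  move=> hin [D' [M' H']] [D [M H]].
  set L := (M * (1 + 2 * r))%R.
  have hinB x : inB x0 r x -> inB (E := C_NormedModule) z0 rho (f x) by exact: hin.
  exists (fun x v => D' (f x) (D x v)), (Rabs M' * (1 + Rabs M + L ^ 2))%R.
  have m0 := Rabs_pos M'. have m1 := Rle_abs M'. have m2 := Rabs_pos M. have m3 := Rle_abs M.
  have l0 := pow2_ge_0 L.
  case: (H) => a b c d e. case: (H') => a' b' c' d' e'.
  split.
  - move=> x /hinB hx. apply: Rle_trans (a' _ hx) _. nra.
  - move=> x v hx. apply: Rle_trans (b' _ _ (hinB _ hx)) _.
    change (M' * Cmod (D x v) <= Rabs M' * (1 + Rabs M + L ^ 2) * norm v)%R.
    have h1 := b x v hx. have h2 := Cmod_ge_0 (D x v). have h3 := norm_ge_0 v.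
    apply: Rle_trans (_ : Rabs M' * (Rabs M * norm v) <= _)%R.
      apply: Rmult_le_compat => //; first exact: Rle_trans (Cmod_ge_0 (g (f x))) (a' _ (hinB _ hx)).
      apply: Rle_trans h1 _. exact: Rmult_le_compat_r.
    have -> : (Rabs M' * (Rabs M * norm v) = Rabs M' * Rabs M * norm v)%R by ring.
    apply: Rmult_le_compat_r => //. nra.
  - move=> x u v hx. rewrite c //. exact: (c' _ (D x u) (D x v) (hinB _ hx)).
  - move=> x k v hx. rewrite d //. exact: (d' _ k (D x v) (hinB _ hx)).
  - move=> x y hx hy.
    have l1 := holD_lip _ _ _ _ _ _ _ H hx hy. rewrite -/L in l1.
    have q := e' _ _ (hinB _ hx) (hinB _ hy).
    change (Cmod (g (f y) - g (f x) - D' (f x) (f y - f x)%C) <= M' * Cmod (f y - f x) ^ 2)%R in q.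
    set h := minus y x in l1 *.
    have lin : D' (f x) (f y - f x - D x h) = D' (f x) (f y - f x) - D' (f x) (D x h).
      have -> : f y - f x - D x h = plus (f y - f x : C_NormedModule) (scal (-(1) : C_AbsRing) (D x h : C_NormedModule)).
        change (f y - f x - D x h = f y - f x + (-(1)) * D x h). ring.
      rewrite (c' _ _ _ (hinB _ hx)) (d' _ _ _ (hinB _ hx)). ring.
    have -> : g (f y) - g (f x) - D' (f x) (D x h) =
       (g (f y) - g (f x) - D' (f x) (f y - f x)) + D' (f x) (f y - f x - D x h) by rewrite lin; ring.
    have q2 := b' _ (f y - f x - D x h) (hinB _ hx).
    change (Cmod (D' (f x) (f y - f x - D x h)%C) <= M' * Cmod (f y - f x - D x h))%R in q2.
    apply: Rle_trans (Cmod_plus_le _ _ _ _ q q2) _.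
    have q3 := e x y hx hy. rewrite -/h in q3.
    have h0 := Rle_trans _ _ _ (Cmod_ge_0 (g (f x))) (a' _ (hinB _ hx)).
    have h1 : (Cmod (f y - f x) ^ 2 <= L ^ 2 * norm h ^ 2)%R.
      rewrite -Rpow_mult_distr. apply: pow_incr. split => //. exact: Cmod_ge_0.
    have n2 := pow2_ge_0 (norm h).
    have -> : (Rabs M' = M')%R by rewrite Rabs_pos_eq.
    have r1 := Rmult_le_compat_l _ _ _ h0 h1. have r2 := Rmult_le_compat_l _ _ _ h0 q3.
    have r3 : (M' * (M * norm h ^ 2) <= M' * (Rabs M * norm h ^ 2))%R.
      apply: Rmult_le_compat_l => //. exact: Rmult_le_compat_r.
    have r4 := Rmult_le_pos _ _ h0 n2. lra.
Qed.

Lemma Hol_inv (x0 : E) (r m : R) (f : E -> C) : (0 < m)%R ->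
  (forall x, inB x0 r x -> (m <= Cmod (f x))%R) -> Hol x0 r f -> Hol x0 r (fun x => / f x).
Proof.
  move=> hm hf [D [M H]].
  set L := (M * (1 + 2 * r))%R.
  have nz x : inB x0 r x -> f x <> 0 by move=> /hf h; apply/Cmod_gt_0; lra.
  have iv x : inB x0 r x -> (Cmod (/ f x) <= / m)%R.
    move=> hx. rewrite Cmod_inv; last exact: nz. apply: Rinv_le_contravar => //. exact: hf.
  have im : (0 < / m)%R by apply: Rinv_0_lt_compat.
  set k := (/ m)%R in iv im.
  exists (fun x v => - (D x v * (/ f x * / f x))), (k + Rabs M * (k * k) + L ^ 2 * (k * k * k))%R.
  have m2 := Rabs_pos M. have m3 := Rle_abs M. have l0 := pow2_ge_0 L.
  have kk : (0 < k * k)%R by nra. have kkk : (0 < k * k * k)%R by nra.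
  case: (H) => a b c d e. split.
  - move=> x hx. apply: Rle_trans (iv _ hx) _. nra.
  - move=> x v hx. rewrite Cmod_opp.
    apply: Rle_trans (Cmod_mult_le _ _ _ _ (b x v hx) (Cmod_mult_le _ _ _ _ (iv _ hx) (iv _ hx))) _.
    have h3 := norm_ge_0 v.
    have -> : (M * norm v * (k * k) = M * (k * k) * norm v)%R by ring.
    apply: Rmult_le_compat_r => //. nra.
  - move=> x u v hx. rewrite c //. ring.
  - move=> x t v hx. rewrite d //. ring.
  - move=> x y hx hy.
    have l1 := holD_lip _ _ _ _ _ _ _ H hx hy. rewrite -/L in l1.
    set h := minus y x in l1 *.
    have fx := nz _ hx. have fy := nz _ hy.
    have -> : / f y - / f x - - (D x h * (/ f x * / f x)) =
      - ((f y - f x - D x h) * (/ f x * / f x)) + (f y - f x) * (f y - f x) * (/ f x * / f x * / f y).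
      by field.
    have ix := iv _ hx. have iy := iv _ hy.
    have q3 := e x y hx hy. rewrite -/h in q3.
    have t1 := Cmod_mult_le _ _ _ _ q3 (Cmod_mult_le _ _ _ _ ix ix).
    rewrite -(Cmod_opp (_ * (_ * _))) in t1.
    have t2 := Cmod_mult_le _ _ _ _ (Cmod_mult_le _ _ _ _ l1 l1)
      (Cmod_mult_le _ _ _ _ (Cmod_mult_le _ _ _ _ ix ix) iy).
    apply: Rle_trans (Cmod_plus_le _ _ _ _ t1 t2) _.
    have n2 := pow2_ge_0 (norm h).
    have r3 : (M * norm h ^ 2 * (k * k) <= Rabs M * norm h ^ 2 * (k * k))%R.
      apply: Rmult_le_compat_r; first lra. exact: Rmult_le_compat_r.
    have r4 := Rmult_le_pos _ _ (Rlt_le _ _ im) n2. lra.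
Qed.

(** Vitali-Montel: Cauchy's estimates bound the second-order remainders uniformly. *)
Lemma Hol_limit (x0 : E) (r M0 : R) (f : nat -> E -> C) (D : nat -> E -> E -> C) (g : E -> C) :
  (0 < r)%R -> (forall n, exists M, holD x0 r (f n) (D n) M) ->
  (forall n x, inB x0 r x -> (Cmod (f n x) <= M0)%R) ->
  (forall x, inB x0 r x -> Cseq_lim (fun n => f n x) (g x)) ->
  exists D' M', holD x0 (r / 8) g D' M' /\
    forall x v, inB x0 (r / 8) x -> Cseq_lim (fun n => D n x v) (D' x v).
Proof.
  move=> hr H hb hl.
  have incl x : inB x0 (r / 8) x -> inB x0 r x by apply: inB_le; lra.
  set A := (3 * M0 / r)%R. set B := (21 * M0 / r ^ 2)%R.
  have h00 : (0 <= M0)%R.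
    apply: Rle_trans (Cmod_ge_0 (f O x0)) (hb O _ _). exact: inB_center.
  have hA : (0 <= A)%R by apply: Rdiv_le_0_compat; lra.
  have hB : (0 <= B)%R by apply: Rdiv_le_0_compat; [lra | apply: pow_lt].
  have cb n : (forall x v, inB x0 (r / 8) x -> (Cmod (D n x v) <= A * norm v)%R) /\
    (forall x y, inB x0 (r / 8) x -> inB x0 (r / 8) y ->
      (Cmod (f n y - f n x - D n x (minus y x)) <= B * norm (minus y x) ^ 2)%R).
    case: (H n) => M HM. exact: (holD_cauchy _ _ _ _ _ _ hr HM (hb n)).
  (* The difference quotients with a fixed step [t] converge in [n], and they differ from [D n x v]
     by at most [B t |v|^2] uniformly in [n]; a small [t] followed by a large [n] gives the Cauchy
     property. *)
  have conv x v : inB x0 (r / 8) x -> exists l, Cseq_lim (fun n => D n x v) l.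
    move=> hx. apply: Cseq_cauchy => eps he.
    have nv := norm_ge_0 v.
    have hx' := hx. rewrite /inB in hx'.
    set t := Rmin ((r / 8 - norm (minus x x0)) / (2 * (norm v + 1))) (eps / (4 * (B * norm v ^ 2 + 1))).
    have n2 := pow2_ge_0 (norm v).
    have bn : (0 <= B * norm v ^ 2)%R by exact: Rmult_le_pos.
    have ht : (0 < t)%R.
      apply: Rmin_pos; apply: Rdiv_lt_0_compat; lra.
    have t1 : (t * (2 * (norm v + 1)) <= r / 8 - norm (minus x x0))%R.
      apply/Rle_div_r; first lra. exact: Rmin_l.
    have t2 : (t * (4 * (B * norm v ^ 2 + 1)) <= eps)%R.
      apply/Rle_div_r; first lra. exact: Rmin_r.
    have ct : Cmod (RtoC t) = t by rewrite Cmod_R Rabs_pos_eq; lra.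
    set y := plus x (scal (RtoC t : C_AbsRing) v).
    have hy : inB x0 (r / 8) y by apply: inB_line; rewrite ct; nra.
    have key n : (Cmod (f n y - f n x - RtoC t * D n x v) <= B * (t * norm v) ^ 2)%R.
      have := proj2 (cb n) x y hx hy. rewrite /y minus_plus_E.
      case: (H n) => M HM. rewrite (holD_scal _ _ _ _ _ HM); last exact: incl.
      move=> h. apply: Rle_trans h _. apply: Rmult_le_compat_l => //.
      apply: pow_incr. split; first exact: norm_ge_0.
      rewrite -{2}ct. exact: norm_scal_E.
    have hd : (0 < eps * t / 8)%R by apply: Rdiv_lt_0_compat; [nra | lra].
    have /Cseq_limE /(_ _ hd) [N1 h1] := hl x (incl _ hx).
    have /Cseq_limE /(_ _ hd) [N2 h2] := hl y (incl _ hy).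
    exists (N1 + N2)%nat => n m hn hm.
    have a1 := h1 n ltac:(lia). have a2 := h1 m ltac:(lia).
    have b1 := h2 n ltac:(lia). have b2 := h2 m ltac:(lia).
    have k1 := key n. have k2 := key m.
    apply: (Rmult_lt_reg_r t) => //. rewrite -{1}ct -Cmod_mult.
    have -> : (D n x v - D m x v) * RtoC t =
      ((f n y - g y) - (f m y - g y) - ((f n x - g x) - (f m x - g x)))
      - ((f n y - f n x - RtoC t * D n x v) - (f m y - f m x - RtoC t * D m x v)) by ring.
    apply: Rle_lt_trans (Cmod_minus_le _ _) _.
    have c1 := Cmod_minus_le (f n y - g y) (f m y - g y).
    have c2 := Cmod_minus_le (f n x - g x) (f m x - g x).
    have c3 := Cmod_minus_le ((f n y - g y) - (f m y - g y)) ((f n x - g x) - (f m x - g x)).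
    have c4 := Cmod_minus_le (f n y - f n x - RtoC t * D n x v) (f m y - f m x - RtoC t * D m x v).
    have e1 : (B * (t * norm v) ^ 2 = t * (t * (B * norm v ^ 2)))%R by ring.
    have e2 : (t * (B * norm v ^ 2) <= eps / 4)%R by lra.
    have e3 := Rmult_le_compat_l _ _ _ (Rlt_le _ _ ht) e2. lra.
  pose D' x v := Ciota (Cseq_lim (fun n => D n x v)).
  have hD x v : inB x0 (r / 8) x -> Cseq_lim (fun n => D n x v) (D' x v).
    move=> hx. case: (conv x v hx) => l h. by rewrite /D' (Ciota_lim _ _ h).
  exists D', (M0 + A + B)%R. split => //. split.
  - move=> x hx. have := Cseq_lim_Cmod_le _ _ M0 (fun n => hb n x (incl _ hx)) (hl x (incl _ hx)). lra.
  - move=> x v hx. have := Cseq_lim_Cmod_le _ _ _ (fun n => proj1 (cb n) x v hx) (hD x v hx).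
    have := norm_ge_0 v. nra.
  - move=> x u v hx. apply: (Cseq_lim_unique (fun n => D n x (plus u v))); first exact: hD.
    apply: Cseq_lim_ext (Cseq_lim_plus _ _ _ _ (hD x u hx) (hD x v hx)) => n.
    case: (H n) => M HM. rewrite (holD_plus _ _ _ _ _ HM) //. exact: incl.
  - move=> x a v hx. apply: (Cseq_lim_unique (fun n => D n x (scal a v))); first exact: hD.
    apply: Cseq_lim_ext (Cseq_lim_mult _ _ _ _ (Cseq_lim_const a) (hD x v hx)) => n.
    case: (H n) => M HM. rewrite (holD_scal _ _ _ _ _ HM) //. exact: incl.
  - move=> x y hx hy.
    have := Cseq_lim_Cmod_le _ _ _ (fun n => proj2 (cb n) x y hx hy)
      (Cseq_lim_minus _ _ _ _ (Cseq_lim_minus _ _ _ _ (hl _ (incl _ hy)) (hl _ (incl _ hx)))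
         (hD x (minus y x) hx)).
    have := pow2_ge_0 (norm (minus y x)). nra.
Qed.

Lemma Hol_limit' (x0 : E) (r M0 : R) (f : nat -> E -> C) (g : E -> C) :
  (0 < r)%R -> (forall n, Hol x0 r (f n)) ->
  (forall n x, inB x0 r x -> (Cmod (f n x) <= M0)%R) ->
  (forall x, inB x0 r x -> Cseq_lim (fun n => f n x) (g x)) -> Hol x0 (r / 8) g.
Proof.
  move=> hr H hb hl.
  case: (choice _ H) => D HD.
  case: (Hol_limit _ _ _ _ _ _ hr HD hb hl) => D' [M' [h _]]. by exists D', M'.
Qed.

(** A directional derivative is a limit of difference quotients, which are differences of translates
    of [f] and hence holomorphic; the quadratic remainder bounds them uniformly. The radius is
    halved for the translates and divided by [8] by the limit theorem. *)
Lemma Hol_directional (x0 : E) (r : R) (f : E -> C) (D : E -> E -> C) (M : R) (v : E) :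
  (0 < r)%R -> holD x0 r f D M -> Hol x0 (r / 16) (fun x => D x v).
Proof.
  move=> hr H. have hM := holD_pos _ _ _ _ _ hr H. have nv := norm_ge_0 v.
  pose t := (r / (2 * (norm v + 1)))%R.
  have ht : (0 < t)%R by apply: Rdiv_lt_0_compat; lra.
  have htv : (t * norm v <= r / 2)%R.
    have : (t * (2 * (norm v + 1)) = r)%R by rewrite /t; field; lra. lra.
  pose tau (n : nat) := (t * / (INR n + 1))%R.
  have htau n : (0 < tau n <= t)%R.
    have h := pos_INR n. rewrite /tau. split.
      apply: Rmult_lt_0_compat => //. apply: Rinv_0_lt_compat. lra.
    apply/Rle_div_l; nra.
  have ctau n : Cmod (RtoC (tau n)) = tau n by rewrite Cmod_R Rabs_pos_eq; have := htau n; lra.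
  have nz n : RtoC (tau n) <> 0 by move/RtoC_inj; have := htau n; lra.
  have hin n x : inB x0 (r / 2) x -> inB x0 r (plus x (scal (RtoC (tau n) : C_AbsRing) v)).
    move=> hx. apply: inB_line. rewrite ctau. rewrite /inB in hx. have := htau n. nra.
  have incl x : inB x0 (r / 2) x -> inB x0 r x by apply: inB_le; lra.
  pose f' n x := (f (plus x (scal (RtoC (tau n) : C_AbsRing) v)) - f x) * / RtoC (tau n).
  have est n x : inB x0 (r / 2) x -> (Cmod (f' n x - D x v) <= M * norm v ^ 2 * tau n)%R.
    move=> hx.
    have := holD_quad _ _ _ _ _ H _ _ (incl _ hx) (hin n _ hx). rewrite minus_plus_E.
    rewrite (holD_scal _ _ _ _ _ H); last exact: incl.
    move=> q.
    have -> : f' n x - D x v = (f (plus x (scal (RtoC (tau n) : C_AbsRing) v)) - f x - RtoC (tau n) * D x v) * / RtoC (tau n).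
      rewrite /f'. move: (f (plus x _)) (nz n) => a. move: (RtoC (tau n)) => b hb. by field.
    rewrite Cmod_mult Cmod_inv // ctau. apply/Rle_div_l; first exact: (proj1 (htau n)).
    apply: Rle_trans q _.
    have -> : (M * norm v ^ 2 * tau n * tau n = M * (tau n * norm v) ^ 2)%R by ring.
    apply: Rmult_le_compat_l => //. apply: pow_incr. split; first exact: norm_ge_0.
    rewrite -{2}ctau. exact: norm_scal_E.
  have -> : (r / 16 = r / 2 / 8)%R by field.
  apply: (Hol_limit' _ _ (M * norm v + M * norm v ^ 2 * t) f'); first lra.
  - move=> n. apply: Hol_mult; last exact: Hol_const.
    have Hf : Hol x0 r f by exists D, M.
    apply: Hol_minus; last by apply: Hol_restr Hf; lra.
    apply: (Hol_affine x0 _ r _ 1 f (fun x => plus x (scal (RtoC (tau n) : C_AbsRing) v)) (fun x => x)) => //; first lra.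
    + move=> x y. exact: minus_plus3_E.
    + move=> u. lra.
    + exact: hin.
  - move=> n x hx.
    have -> : f' n x = (f' n x - D x v) + D x v by ring.
    have h := est n x hx. have h' := holD_dle _ _ _ _ _ H _ v (incl _ hx).
    apply: Rle_trans (Cmod_plus_le _ _ _ _ h h') _.
    have n2 := pow2_ge_0 (norm v).
    have := Rmult_le_compat_l _ _ _ (Rmult_le_pos _ _ hM n2) (proj2 (htau n)). lra.
  - move=> x hx. apply: (Cseq_lim_bound _ _ _ (fun n => est n x hx)).
    have -> : Finite 0 = Rbar_mult (M * norm v ^ 2 * t)%R 0 by rewrite /= Rmult_0_r.
    apply: is_lim_seq_ext (_ : is_lim_seq (fun n => (M * norm v ^ 2 * t) * / (INR n + 1))%R _).
      by move=> n; rewrite /tau; ring.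
    apply: is_lim_seq_scal_l.
    have := is_lim_seq_INR.
    move/(is_lim_seq_incr_1 INR) => h.
    apply: is_lim_seq_ext (is_lim_seq_inv _ _ h _) => // n. by rewrite S_INR.
Qed.

(** The quotient at [x] is the mean of [D _ v] over the segment from [x - l (x - x0) v] to [x], a limit of Riemann sums. *)
Lemma Hol_divide (x0 : E) (r : R) (f : E -> C) (D : E -> E -> C) (M : R) (l : E -> C) (L : R) (v : E) :
  (0 < r)%R -> holD x0 r f D M -> (0 <= L)%R ->
  (forall u w, l (plus u w) = l u + l w) -> (forall (a : C) w, l (scal (a : C_AbsRing) w) = a * l w) ->
  (forall w, Cmod (l w) <= L * norm w)%R -> l v = 1 ->
  (forall x, inB x0 r x -> l (minus x x0) = 0 -> f x = 0) ->
  exists r' g, (0 < r')%R /\ Hol x0 r' g /\ g x0 = D x0 v /\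
    forall x, inB x0 r' x -> l (minus x x0) <> 0 -> g x = f x / l (minus x x0).
Proof.
  move=> hr H hL lp ls lb lv hf.
  have hM := holD_pos _ _ _ _ _ hr H. have nv := norm_ge_0 v.
  have lnv : (0 <= L * norm v)%R by exact: Rmult_le_pos.
  set r1 := (r / 16)%R. set r2 := (r1 / (1 + L * norm v))%R.
  have hr1 : (0 < r1)%R by rewrite /r1; lra.
  have hr2 : (0 < r2)%R by apply: Rdiv_lt_0_compat; lra.
  have hr2e : (r2 * (1 + L * norm v) = r1)%R by rewrite /r2; field; lra.
  have hr21 : (r2 <= r1)%R by nra.
  have lo w : l (opp w) = - l w.
    have -> : opp w = scal (-(1) : C_AbsRing) w by rewrite -(scal_opp_one w).
    rewrite ls. ring.
  have l0 : l zero = 0.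
    have -> : (zero : E) = scal (zero : C_AbsRing) zero by rewrite scal_zero_l.
    rewrite ls. change (0 * l zero = 0). ring.
  (* [A 1] is the identity and [A 0] projects along [v] onto the hyperplane where [l (x - x0)]
     vanishes, since [l v = 1]; there [f] is [0]. The radius [r2] is chosen so that the whole
     segment stays in the ball of radius [r1]. *)
  pose A (tau : R) (x : E) := plus x (scal (RtoC (tau - 1) * l (minus x x0) : C_AbsRing) v).
  have hA tau x : (0 <= tau <= 1)%R -> inB x0 r2 x -> inB x0 r1 (A tau x).
    move=> ht hx. apply: inB_line. rewrite Cmod_mult Cmod_R.
    have : (Rabs (tau - 1) <= 1)%R by apply: Rabs_le; lra.
    have := lb (minus x x0). rewrite /inB in hx.
    have h0 := Cmod_ge_0 (l (minus x x0)). have h1 := norm_ge_0 (minus x x0).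
    have h2 := Rabs_pos (tau - 1) => h3 h4.
    have h5 : (Rabs (tau - 1) * Cmod (l (minus x x0)) <= L * norm (minus x x0))%R by nra.
    have h6 := Rmult_le_compat_r _ _ _ nv h5.
    have : (norm (minus x x0) * (1 + L * norm v) < r2 * (1 + L * norm v))%R by apply: Rmult_lt_compat_r; lra.
    lra.
  have inclr x : inB x0 r1 x -> inB x0 r x by apply: inB_le; rewrite /r1; lra.
  have incl2 x : inB x0 r2 x -> inB x0 r x by move=> h; apply: inclr; apply: inB_le h.
  have HD : Hol x0 r1 (fun x => D x v) by exact: Hol_directional H.
  pose G (m : nat) (x : E) := RtoC (/ INR (S m)) *
     Csum (fun j => D (A (INR j / INR (S m))%R x) v) (S m).
  have jm m j : (j <= S m)%nat -> (0 <= INR j / INR (S m) <= 1)%R.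
    move=> h. have hp : (0 < INR (S m))%R by apply: lt_0_INR; lia.
    split; first by apply: Rdiv_le_0_compat => //; exact: pos_INR.
    apply/Rle_div_l => //. rewrite Rmult_1_l. exact: le_INR.
  have HG m : Hol x0 r2 (G m).
    apply: Hol_mult; first exact: Hol_const.
    move: (S m) (jm m) => k. 
    have : forall n, (n <= k)%nat -> (forall j, (j <= k)%nat -> (0 <= INR j / INR k <= 1)%R) ->
       Hol x0 r2 (fun x => Csum (fun j => D (A (INR j / INR k)%R x) v) n).
      elim => [|n IH] hn hj /=; first exact: Hol_const.
      apply: Hol_plus; first by apply: IH => //; lia.
      have hjn := hj n ltac:(lia).
      set tau := (INR n / INR k)%R in hjn *.
      apply: (Hol_affine x0 x0 r1 r2 (1 + L * norm v) (fun x => D x v) (A tau)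
         (fun w => plus w (scal (RtoC (tau - 1) * l w : C_AbsRing) v))) => //.
      + lra.
      + move=> x y. rewrite /A.
        have -> : l (minus y x) = l (minus y x0) - l (minus x x0).
          rewrite (minus_trans x0 y x) lp -(opp_minus x x0) lo. ring.
        have -> : RtoC (tau - 1) * (l (minus y x0) - l (minus x x0)) =
          RtoC (tau - 1) * l (minus y x0) - RtoC (tau - 1) * l (minus x x0) by ring.
        rewrite -minus_scal_E /minus opp_plus.
        rewrite -!plus_assoc. congr plus. rewrite !plus_assoc. congr plus. exact: plus_comm.
      + move=> u w. rewrite lp.
        have -> : RtoC (tau - 1) * (l u + l w) = RtoC (tau - 1) * l u + RtoC (tau - 1) * l w by ring.
        have -> : scal (RtoC (tau - 1) * l u + RtoC (tau - 1) * l w : C_AbsRing) v =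
          plus (scal (RtoC (tau - 1) * l u : C_AbsRing) v) (scal (RtoC (tau - 1) * l w : C_AbsRing) v).
          by rewrite -scal_distr_r.
        rewrite -!plus_assoc. congr plus. rewrite !plus_assoc. congr plus. exact: plus_comm.
      + move=> a w. rewrite ls scal_distr_l scal_assoc. congr plus. congr scal.
        change (RtoC (tau - 1) * (a * l w) = a * (RtoC (tau - 1) * l w)). ring.
      + move=> w. apply: Rle_trans (norm_triangle _ _) _.
        rewrite Rmult_plus_distr_r Rmult_1_l. apply: Rplus_le_compat_l.
        apply: Rle_trans (norm_scal_E _ _) _. rewrite Cmod_mult Cmod_R.
        have : (Rabs (tau - 1) <= 1)%R by apply: Rabs_le; lra.
        have := lb w. have h0 := Cmod_ge_0 (l w). have h1 := norm_ge_0 w. have h2 := Rabs_pos (tau - 1).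
        move=> h3 h4. have h5 : (Rabs (tau - 1) * Cmod (l w) <= L * norm w)%R by nra.
        have := Rmult_le_compat_r _ _ _ nv h5. lra.
      + move=> x. exact: hA.
    move=> X hj. apply: X => //.
  have GB m x : inB x0 r2 x -> (Cmod (G m x) <= M * norm v)%R.
    move=> hx. have hp : (0 < INR (S m))%R by apply: lt_0_INR; lia.
    rewrite /G Cmod_mult Cmod_R Rabs_pos_eq; last by apply: Rlt_le; exact: Rinv_0_lt_compat.
    rewrite Rmult_comm. apply/Rle_div_l => //. rewrite Rmult_comm. apply: Csum_bound => k hk.
    apply: (holD_dle _ _ _ _ _ H). apply: inclr. apply: hA => //. apply: jm. lia.
  have Gl0 x m : l (minus x x0) = 0 -> G m x = D x v.
    move=> e. rewrite /G.
    have hA0 tau : A tau x = x.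
      rewrite /A e. have -> : RtoC (tau - 1) * 0 = 0 by ring.
      have -> : (RtoC 0 : C_AbsRing) = zero by []. by rewrite scal_zero_l plus_zero_r.
    have hp : INR (S m) <> 0%R by apply: not_0_INR.
    have -> : Csum (fun j => D (A (INR j / INR (S m))%R x) v) (S m) = RtoC (INR (S m)) * D x v.
      move: {hp}(S m) => k. have : forall n, Csum (fun j => D (A (INR j / INR k)%R x) v) n = RtoC (INR n) * D x v.
        elim => [|n IH]; first by rewrite /=; ring.
        rewrite S_INR RtoC_plus. simpl Csum. rewrite IH hA0. ring.
      exact.
    rewrite Cmult_assoc -RtoC_mult Rinv_l //. ring.
  have Glim x : inB x0 r2 x -> (l (minus x x0) <> 0) -> Cseq_lim (fun m => G m x) (f x / l (minus x x0)).
    move=> hx hl. set c := l (minus x x0) in hl *.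
    have c0 : (0 < Cmod c)%R by apply/Cmod_gt_0.
    set K := (M * (Cmod c * norm v) ^ 2 / Cmod c)%R.
    apply: (Cseq_lim_bound _ _ (fun m => K * / INR (S m))%R); last first.
      have -> : Finite 0 = Rbar_mult K 0 by rewrite /= Rmult_0_r.
      apply: is_lim_seq_scal_l. have := is_lim_seq_INR.
      move/(is_lim_seq_incr_1 INR) => h. exact: (is_lim_seq_inv _ _ h).
    move=> m. have hp : (0 < INR (S m))%R by apply: lt_0_INR; lia.
    have hpn : RtoC (INR (S m)) <> 0 by move/RtoC_inj; lra.
    pose y j := A (INR j / INR (S m))%R x.
    have yin j : (j <= S m)%nat -> inB x0 r (y j).
      move=> h. apply: inclr. apply: hA => //. exact: jm.
    (* The increments of [f] along the nodes telescope to [f x - 0]. Each step of length of order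
       [1/m] errs by the quadratic remainder, of order [1/m^2], so the total error of the Riemann
       sum is of order [1/m]. *)
    have tel : forall n, (n <= S m)%nat ->
      (Cmod (f (y n) - f (y 0%nat) - c * RtoC (/ INR (S m)) * Csum (fun j => D (y j) v) n)
        <= INR n * (M * (Cmod c * norm v / INR (S m)) ^ 2))%R.
      elim => [|n IH] hn.
        have -> : f (y 0%nat) - f (y 0%nat) - c * RtoC (/ INR (S m)) * Csum (fun j => D (y j) v) 0 = 0.
          rewrite /=. ring.
        rewrite Cmod_0 /=. lra.
      have -> : f (y (S n)) - f (y 0%nat) - c * RtoC (/ INR (S m)) * Csum (fun j => D (y j) v) (S n) =
        (f (y n) - f (y 0%nat) - c * RtoC (/ INR (S m)) * Csum (fun j => D (y j) v) n)
        + (f (y (S n)) - f (y n) - c * RtoC (/ INR (S m)) * D (y n) v).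
        simpl Csum. ring.
      rewrite (S_INR n) Rmult_plus_distr_r Rmult_1_l. apply: Cmod_plus_le.
        apply: IH. lia.
      have hyn := yin n ltac:(lia). have hyn' := yin (S n) hn.
      have q := holD_quad _ _ _ _ _ H _ _ hyn hyn'.
      have e : minus (y (S n)) (y n) = scal (c * RtoC (/ INR (S m)) : C_AbsRing) v.
        rewrite /y /A minus_plus2_E minus_scal_E -/c. congr scal.
        have -> : (INR (S n) / INR (S m) = INR n / INR (S m) + / INR (S m))%R.
          rewrite (S_INR n). field. lra.
        change (RtoC (INR n / INR (S m) + / INR (S m) - 1) * c - RtoC (INR n / INR (S m) - 1) * c = c * RtoC (/ INR (S m))).
        rewrite !RtoC_minus RtoC_plus. ring.
      rewrite e (holD_scal _ _ _ _ _ H) // in q.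
      apply: Rle_trans q _. apply: Rmult_le_compat_l => //. apply: pow_incr.
      split; first exact: norm_ge_0. apply: Rle_trans (norm_scal_E _ _) _.
      rewrite Cmod_mult Cmod_R Rabs_pos_eq; last by apply: Rlt_le; exact: Rinv_0_lt_compat.
      right. field. lra.
    have := tel (S m) (le_n _).
    have -> : y (S m) = x.
      rewrite /y /A Rdiv_diag; last lra. rewrite Rminus_diag.
      have -> : RtoC 0 * l (minus x x0) = 0 by ring.
      have -> : (RtoC 0 : C_AbsRing) = zero by []. by rewrite scal_zero_l plus_zero_r.
    have -> : f (y 0%nat) = 0.
      apply: hf; first exact: yin (Nat.le_0_l _).
      rewrite /y /A /=. have -> : (0 / INR (S m) - 1 = -1)%R by rewrite /Rdiv; ring.
      have -> : minus (plus x (scal (RtoC (-1) * l (minus x x0) : C_AbsRing) v)) x0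
        = plus (minus x x0) (scal (RtoC (-1) * l (minus x x0) : C_AbsRing) v).
        rewrite /minus -!plus_assoc. congr plus. exact: plus_comm.
      rewrite lp ls lv -/c. ring.
    rewrite -/(y _) => q.
    have -> : G m x - f x / c = - ((f x - 0 - c * RtoC (/ INR (S m)) * Csum (fun j => D (y j) v) (S m)) / c).
      change (RtoC (/ INR (S m)) * Csum (fun j => D (y j) v) (S m) - f x / c =
        - ((f x - 0 - c * RtoC (/ INR (S m)) * Csum (fun j => D (y j) v) (S m)) / c)).
      move: (Csum _ _) (RtoC (/ _)) => a b. by field.
    rewrite Cmod_opp Cmod_div //. apply/Rle_div_l => //. apply: Rle_trans q _.
    right. rewrite /K. field. split; lra.
  pose g x := Ciota (Cseq_lim (fun m => G m x)).
  have hg x : inB x0 r2 x -> Cseq_lim (fun m => G m x) (g x).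
    move=> hx. case: (classic (l (minus x x0) = 0)) => h.
    - have X : Cseq_lim (fun m => G m x) (D x v).
        apply: Cseq_lim_ext (Cseq_lim_const _) => m. by rewrite Gl0.
      by rewrite /g (Ciota_lim _ _ X).
    - have X := Glim x hx h. by rewrite /g (Ciota_lim _ _ X).
  exists (r2 / 8)%R, g. split; first lra.
  have i8 x : inB x0 (r2 / 8) x -> inB x0 r2 x by apply: inB_le; lra.
  split; last split.
  - exact: (Hol_limit' _ _ _ _ _ hr2 HG GB hg).
  - apply: Cseq_lim_unique (hg _ (inB_center _ _ hr2)) _.
    apply: Cseq_lim_ext (Cseq_lim_const _) => m. rewrite Gl0 // minus_self. exact: l0.
  - move=> x /i8 hx h. apply: Cseq_lim_unique (hg _ hx) _. exact: Glim.
Qed.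

End Comp.

(** * The complex exponential *)

Lemma Re_plus (z w : C) : Re (z + w) = (Re z + Re w)%R.
Proof. done. Qed.

Lemma Re_RtoC (x : R) : Re (RtoC x) = x.
Proof. done. Qed.

Lemma Re_le_Cmod (z : C) : (Re z <= Cmod z)%R.
Proof. exact: Rle_trans (Rle_abs _) (re_le_Cmod z). Qed.

Lemma Cexp_eit (z : C) : Cexp z = RtoC (exp (Re z)) * eit (Im z).
Proof. done. Qed.

Lemma Cmod_Cexp (z : C) : Cmod (Cexp z) = exp (Re z).
Proof.
  rewrite Cexp_eit Cmod_mult Cmod_eit Cmod_R Rmult_1_r Rabs_pos_eq //. exact: Rlt_le (exp_pos _).
Qed.

Lemma Cexp_plus (z w : C) : Cexp (z + w) = Cexp z * Cexp w.
Proof.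
  case: z w => a b [c d]. rewrite /Cexp /Re /Im /Cplus /Cmult /RtoC /=.
  rewrite exp_plus cos_plus sin_plus. f_equal; ring.
Qed.

Lemma Cexp_0 : Cexp 0 = 1.
Proof. rewrite /Cexp /= exp_0 cos_0 sin_0 /RtoC /Cmult /=. f_equal; ring. Qed.

Lemma Cexp_neq_0 (z : C) : Cexp z <> 0.
Proof. apply/Cmod_gt_0. rewrite Cmod_Cexp. exact: exp_pos. Qed.

Lemma Cexp_opp (z : C) : Cexp (- z) = / Cexp z.
Proof.
  have h := Cexp_neq_0 z.
  have : Cexp z * Cexp (- z) = 1.
    rewrite -Cexp_plus. have -> : z + - z = 0 by ring. exact: Cexp_0.
  move=> e. have -> : Cexp (- z) = / Cexp z * (Cexp z * Cexp (- z)) by field. rewrite e. ring.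
Qed.

Lemma Cexp_RtoC (x : R) : Cexp (RtoC x) = RtoC (exp x).
Proof. rewrite /Cexp /= cos_0 sin_0 /RtoC /Cmult /=. f_equal; ring. Qed.

Lemma cdiff_Cexp_line (z : C) (t : R) :
  cdiff RtoC (fun t => Cexp (RtoC t * z)) t (z * Cexp (RtoC t * z)).
Proof.
  case: z => a b.
  have E s : Cexp (RtoC s * ((a, b) : C)) = RtoC (exp (s * a)) * ((cos (s * b), sin (s * b)) : C).
    rewrite /Cexp /RtoC /Cmult /Re /Im /=.
    have -> : (s * a - 0 * b = s * a)%R by ring. by have -> : (s * b + 0 * a = s * b)%R by ring.
  apply: cdiff_ext (fun s => eq_sym (E s)) _.
  have -> : ((a, b) : C) * Cexp (RtoC t * ((a, b) : C)) =
    RtoC (a * exp (t * a)) * ((cos (t * b), sin (t * b)) : C) +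
    RtoC (exp (t * a)) * (((- b * sin (t * b))%R, (b * cos (t * b))%R) : C).
    rewrite E /RtoC /Cmult /Cplus /=. f_equal; ring.
  apply: cdiff_mult.
  - apply: cdiff_RtoC. auto_derive => //. ring.
  - apply: is_derive_pair_C; auto_derive => //; ring.
Qed.

#[local] Opaque Cexp.

Lemma exp_le (x y : R) : (x <= y)%R -> (exp x <= exp y)%R.
Proof. case => [/exp_increasing /Rlt_le // | ->]. lra. Qed.

Lemma Cmod_Cexp_m1 (z : C) (t : R) : (0 <= t <= 1)%R ->
  (Cmod (Cexp (RtoC t * z) - 1) <= Cmod z * exp (Cmod z))%R.
Proof.
  move=> ht.
  have -> : Cexp (RtoC t * z) - 1 = Cexp (RtoC (1 * t) * z) - Cexp (RtoC (0 * t) * z).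
    rewrite Rmult_1_l Rmult_0_l. have -> : RtoC 0 * z = 0 by ring. by rewrite Cexp_0.
  apply: (mean_value_C (fun s => Cexp (RtoC (s * t) * z)) (fun s => RtoC t * z * Cexp (RtoC s * (RtoC t * z)))).
  - move=> s _. apply: cdiff_ext (_ : cdiff RtoC (fun s => Cexp (RtoC s * (RtoC t * z))) s _); last exact: cdiff_Cexp_line.
    move=> y. congr Cexp. rewrite RtoC_mult. ring.
  - move=> s hs. have hz := Cmod_ge_0 z.
    rewrite (Cmod_mult (RtoC t * z)) Cmod_Cexp (Cmod_mult (RtoC t)) Cmod_R Rabs_pos_eq; last lra.
    apply: Rmult_le_compat => //; try nra; first exact: Rlt_le (exp_pos _).
    apply: exp_le. apply: Rle_trans (Re_le_Cmod _) _.
    rewrite !Cmod_mult !Cmod_R !Rabs_pos_eq; try lra. have hst : (0 <= s * t <= 1)%R by nra. rewrite -Rmult_assoc. nra.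
Qed.

(** Mean value inequality for [exp (t z) - t z] on [[0, 1]], whose derivative is
    [z (exp (t z) - 1)]. *)
Lemma Cexp_taylor (z : C) : (Cmod (Cexp z - 1 - z) <= Cmod z ^ 2 * exp (Cmod z))%R.
Proof.
  have -> : Cexp z - 1 - z = (Cexp (RtoC 1 * z) - RtoC 1 * z) - (Cexp (RtoC 0 * z) - RtoC 0 * z).
    have -> : RtoC 1 * z = z by ring. have -> : RtoC 0 * z = 0 by ring. rewrite Cexp_0. ring.
  apply: (mean_value_C (fun s => Cexp (RtoC s * z) - RtoC s * z)
    (fun s => z * Cexp (RtoC s * z) - (1 * z + RtoC s * 0))).
  - move=> s _. apply: cdiff_minus; first exact: cdiff_Cexp_line.
    apply: cdiff_mult; [exact: cdiff_id | exact: cdiff_const].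
  - move=> s hs. have -> : z * Cexp (RtoC s * z) - (1 * z + RtoC s * 0) = z * (Cexp (RtoC s * z) - 1) by ring.
    rewrite Cmod_mult /= Rmult_1_r Rmult_assoc. apply: Rmult_le_compat_l (Cmod_ge_0 _) _.
    exact: Cmod_Cexp_m1.
Qed.

(** The addition formula reduces the remainder at [x] to the Taylor bound at [y - x], of modulus at
    most [2 r]; together with [|exp x| <= exp r] this makes the constant [exp (3 r)]. *)
Lemma Hol_Cexp (r : R) : Hol (E := C_NormedModule) (RtoC 0) r Cexp.
Proof.
  have hin (x : C) : inB (E := C_NormedModule) (RtoC 0) r x -> (Cmod x < r)%R.
    rewrite /inB. change (Cmod (x - 0) < r -> Cmod x < r)%R. by have -> : x - 0 = x by ring.
  have hx x : inB (E := C_NormedModule) (RtoC 0) r x -> (Cmod (Cexp x) <= exp r)%R.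
    move=> /hin h. rewrite Cmod_Cexp. apply: exp_le. have := Re_le_Cmod x. lra.
  have h1 x : inB (E := C_NormedModule) (RtoC 0) r x -> (exp r <= exp (3 * r))%R.
    move=> /hin h. apply: exp_le. have := Cmod_ge_0 x. lra.
  have q (x y : C) : (Cmod x < r)%R -> (Cmod y < r)%R ->
    (Cmod (Cexp y - Cexp x - Cexp x * (y - x)) <= exp (3 * r) * Cmod (y - x) ^ 2)%R.
    move=> h h'.
    have {1}-> : y = x + (y - x) by ring.
    have hd : (Cmod (y - x) <= 2 * r)%R by have := Cmod_minus_le y x; lra.
    set d := y - x in hd *.
    have -> : Cexp (x + d) - Cexp x - Cexp x * d = Cexp x * (Cexp d - 1 - d).
      rewrite Cexp_plus. ring.
    rewrite Cmod_mult Cmod_Cexp.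
    have h1' : (exp (Re x) <= exp r)%R by apply: exp_le; have := Re_le_Cmod x; lra.
    apply: Rle_trans (Rmult_le_compat _ _ _ _ (Rlt_le _ _ (exp_pos _)) (Cmod_ge_0 _) h1' (Cexp_taylor d)) _.
    have -> : (exp (3 * r) = exp r * exp (2 * r))%R by rewrite -exp_plus; f_equal; ring.
    have := exp_le _ _ hd. have := exp_pos r. have := pow2_ge_0 (Cmod d) => a b c.
    have -> : (exp r * (Cmod d ^ 2 * exp (Cmod d)) = exp r * exp (Cmod d) * Cmod d ^ 2)%R by ring.
    apply: Rmult_le_compat_r => //. apply: Rmult_le_compat_l; lra.
  have sw (a b c : C) : a * (b * c) = b * (a * c) by ring.
  exists (fun x v => Cexp x * v), (exp (3 * r)). split.
  - move=> x h. apply: Rle_trans (hx _ h) (h1 _ h).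
  - move=> x v h. apply: Rle_trans (Cmod_mult_le _ _ _ _ (hx _ h) (Rle_refl _)) _.
    apply: Rmult_le_compat_r; [exact: Cmod_ge_0 | exact: h1 h].
  - move=> x u v _. exact: Cmult_plus_distr_l.
  - move=> x a v _. exact: sw.
  - move=> x y /hin h /hin h'. exact: (q x y h h').
Qed.

Lemma Hol_exp_comp {E : NormedModule C_AbsRing} (x0 : E) (r : R) (f : E -> C) :
  Hol x0 r f -> Hol x0 r (fun x => Cexp (f x)).
Proof.
  move=> H. case: (H) => D [M HM].
  apply: (Hol_comp _ _ (M + 1) _ (RtoC 0)) => //; last exact: Hol_Cexp.
  move=> x hx. have -> : f x - 0 = f x by ring.
  have := holD_le _ _ _ _ _ HM x hx. lra.
Qed.

Lemma cdiff_Cexp (z : C) : cdiff idC Cexp z (Cexp z).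
Proof.
  case: (Hol_Cexp (Cmod z + 1)) => D [M H].
  have hz0 : inB (E := C_NormedModule) (RtoC 0) (Cmod z + 1) z.
    rewrite /inB. change (Cmod (z - 0) < Cmod z + 1)%R. have -> : z - 0 = z by ring. lra.
  apply: (cdiff_quad _ _ _ _ (exp (Cmod z) * exp 1) 1); first lra.
  rewrite /idC => y hy.
  have {1}-> : y = z + (y - z) by ring. set d := y - z in hy *.
  have -> : Cexp (z + d) - Cexp z - Cexp z * d = Cexp z * (Cexp d - 1 - d).
    rewrite Cexp_plus. ring.
  rewrite Cmod_mult Cmod_Cexp.
  have h1 := exp_le _ _ (Re_le_Cmod z).
  have h2 := Cexp_taylor d. have h3 := exp_le _ _ (Rlt_le _ _ hy).
  have h4 := pow2_ge_0 (Cmod d).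
  rewrite Rmult_assoc. apply: Rmult_le_compat => //.
  - exact: Rlt_le (exp_pos _).
  - exact: Cmod_ge_0.
  - apply: Rle_trans h2 _. rewrite Rmult_comm. exact: Rmult_le_compat_r.
Qed.

Lemma Rcpow_plus (x : R) (z w : C) : Rcpow x (z + w) = Rcpow x z * Rcpow x w.
Proof. rewrite /Rcpow -Cexp_plus. f_equal. ring. Qed.

Lemma Rcpow_opp (x : R) (z : C) : Rcpow x (- z) = / Rcpow x z.
Proof. rewrite /Rcpow -Cexp_opp. f_equal. ring. Qed.

Lemma Rcpow_neq_0 (x : R) (z : C) : Rcpow x z <> 0.
Proof. exact: Cexp_neq_0. Qed.

Lemma Cmod_Rcpow (x : R) (z : C) : Cmod (Rcpow x z) = Rpower x (Re z).
Proof. rewrite /Rcpow Cmod_Cexp /Rpower. f_equal. rewrite /Cmult /Re /RtoC /=. ring. Qed.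

Lemma Rcpow_0 (x : R) : Rcpow x 0 = 1.
Proof. rewrite /Rcpow. have -> : 0 * RtoC (ln x) = 0 by ring. exact: Cexp_0. Qed.

Lemma Rcpow_RtoC (x a : R) : Rcpow x (RtoC a) = RtoC (Rpower x a).
Proof. by rewrite /Rcpow -RtoC_mult Cexp_RtoC. Qed.

Lemma Rcpow_1 (x : R) : (0 < x)%R -> Rcpow x 1 = RtoC x.
Proof. move=> h. by rewrite Rcpow_RtoC Rpower_1. Qed.

Lemma Rcpow_INR (x : R) (n : nat) : (0 < x)%R -> Rcpow x (RtoC (INR n)) = RtoC (x ^ n).
Proof. move=> h. by rewrite Rcpow_RtoC Rpower_pow. Qed.

Lemma Rcpow_1_l (z : C) : Rcpow 1 z = 1.
Proof. rewrite /Rcpow ln_1. have -> : z * 0 = 0 by ring. exact: Cexp_0. Qed.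

(** * Gauss's product for the Gamma function *)

(** The sequence of [is_Gamma]. At [n = 0] it involves the default value of [ln 0], so the estimates
    below start at index [1]. *)
Definition gauss (n : nat) (z : C) : C :=
  RtoC (INR (fact n)) * Rcpow (INR n) z / pochhammer z (S n).

Lemma pochhammer_neq_0 (z : C) (n : nat) : (0 < Re z)%R -> pochhammer z n <> 0.
Proof.
  move=> hz. elim: n => [|n IH] /=.
    by move/RtoC_inj; lra.
  apply: Cmult_neq_0 => // e.
  have : Re (z + RtoC (INR n)) = 0%R by rewrite e.
  have := pos_INR n. rewrite /Re /Cplus /RtoC /= in hz *. lra.
Qed.

Lemma ex_series_inv_sq : ex_series (fun n => / INR (S n) ^ 2)%R.
Proof.
  apply: (ex_series_le _ (fun n => 2 * (/ INR (S n) - / INR (S (S n))))%R).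
  - move=> n. rewrite /norm /= /abs /= !Rmult_1_r.
    have h : (0 < INR (S n))%R by apply: lt_0_INR; lia.
    have h1 : (1 <= INR (S n))%R by rewrite S_INR; have := pos_INR n; lra.
    change (match n with O => 1 | S _ => INR n + 1 end)%R with (INR (S n)).
    change (INR (S n) + 1)%R with (INR (S (S n))).
    rewrite (S_INR (S n)). move: (INR (S n)) h h1 => x h h1.
    rewrite Rabs_pos_eq; last by apply: Rlt_le; apply: Rinv_0_lt_compat; nra.
    have -> : (2 * (/ x - / (x + 1)) = 2 / (x * (x + 1)))%R by field; lra.
    have -> : (/ (x * x) = 1 / (x * x))%R by rewrite /Rdiv Rmult_1_l.
    apply/Rle_div_l; first nra.
    have -> : (2 / (x * (x + 1)) * (x * x) = 2 * x / (x + 1))%R by field; lra.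
    apply/Rle_div_r; nra.
  - exists (2 * (1 - 0))%R. apply: is_series_scal_l.
    apply: filterlim_ext (_ : filterlim (fun n => 1 - / INR (S (S n)))%R _ _).
      elim => [|n IH]; first by rewrite sum_O /=; field.
      rewrite sum_Sn -IH /plus /=. change (match n with O => 1 | S _ => INR n + 1 end)%R with (INR (S n)).
      ring.
    apply: is_lim_seq_minus'; first exact: is_lim_seq_const.
    have := is_lim_seq_INR.
    move/(is_lim_seq_incr_1 INR)/(is_lim_seq_incr_1 (fun n => INR (S n))) => h.
    exact: (is_lim_seq_inv _ _ h).
Qed.

(** Each factor is at most [exp (A / (n + 1)^2)], and [1 / m^2 <= 2 / (m (m + 1))] telescopes: the
    induction carries the partial sum [2 A (1 - 1 / (n + 1))] in the exponent. The increments of the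
    bounded products are then summable. *)
Lemma product_bound (p q : nat -> C) (A : R) : (0 <= A)%R ->
  (forall n, p (S n) = p n * q n) -> (forall n, Cmod (q n - 1) <= A * / INR (S n) ^ 2)%R ->
  (forall n, Cmod (p n) <= Cmod (p O) * exp (2 * A))%R /\ (exists l, Cseq_lim p l).
Proof.
  move=> hA hp hq.
  have B n : (Cmod (p n) <= Cmod (p O) * exp (2 * A * (1 - / INR (S n))))%R.
    elim: n => [|n IH].
      rewrite /= Rinv_1 Rminus_diag Rmult_0_r exp_0. lra.
    rewrite hp Cmod_mult.
    have hx : (1 <= INR (S n))%R by rewrite S_INR; have := pos_INR n; lra.
    have h1 : (Cmod (q n) <= exp (A * / INR (S n) ^ 2))%R.
      have -> : q n = 1 + (q n - 1) by ring.
      apply: Rle_trans (Cmod_triangle _ _) _. rewrite Cmod_1.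
      apply: Rle_trans (_ : 1 + A * / INR (S n) ^ 2 <= _)%R; first by have := hq n; lra.
      exact: exp_ineq1_le.
    apply: Rle_trans (Rmult_le_compat _ _ _ _ (Cmod_ge_0 _) (Cmod_ge_0 _) IH h1) _.
    rewrite Rmult_assoc -exp_plus. apply: Rmult_le_compat_l (Cmod_ge_0 _) _.
    apply: exp_le. rewrite (S_INR (S n)). move: (INR (S n)) hx => x hx.
    have e : (1 - / (x + 1) - (1 - / x) = / (x * (x + 1)))%R by field; lra.
    have : (/ x ^ 2 <= 2 * / (x * (x + 1)))%R.
      have -> : (2 * / (x * (x + 1)) = / (x * (x + 1) / 2))%R by field; lra.
      apply: Rinv_le_contravar; nra.
    move=> h. have := Rmult_le_compat_l _ _ _ hA h. nra.
  have B' n : (Cmod (p n) <= Cmod (p O) * exp (2 * A))%R.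
    apply: Rle_trans (B n) _. apply: Rmult_le_compat_l (Cmod_ge_0 _) _. apply: exp_le.
    have h : (0 < / INR (S n))%R by apply: Rinv_0_lt_compat; apply: lt_0_INR; lia.
    have := Rmult_le_pos _ _ hA (Rlt_le _ _ h). lra.
  split => //.
  apply: (Cseq_summable _ (fun n => (Cmod (p O) * exp (2 * A) * A) * / INR (S n) ^ 2)%R).
  - move=> n. have -> : p (S n) - p n = p n * (q n - 1) by rewrite hp; ring.
    rewrite (Rmult_assoc (_ * _)). exact: Cmod_mult_le.
  - apply: (ex_series_scal_l (V := R_NormedModule)). exact: ex_series_inv_sq.
Qed.

(** The ratio of consecutive Gauss products, that is, the factor [(1 + 1/m)^z / (1 + z / (m + 1))]
    with [m = n + 1]. *)
Definition gstep (n : nat) (z : C) : C :=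
  Rcpow (INR (S (S n)) / INR (S n)) z / (1 + z / RtoC (INR (S (S n)))).

Lemma one_plus_bound (z : C) (x : R) : (0 <= Re z)%R -> (0 < x)%R ->
  (1 <= Cmod (1 + z / RtoC x))%R.
Proof.
  move=> hz hx. apply: Rle_trans (Re_le_Cmod _).
  rewrite /Cdiv -RtoC_inv; last lra. rewrite /Re /Cplus /Cmult /RtoC /= in hz *.
  have := Rinv_0_lt_compat _ hx. nra.
Qed.

Lemma gauss_S (n : nat) (z : C) : (0 < Re z)%R ->
  gauss (S (S n)) z = gauss (S n) z * gstep n z.
Proof.
  move=> hz. rewrite /gauss /gstep.
  have hn1 : (0 < INR (S n))%R by apply: lt_0_INR; lia.
  have hn2 : (0 < INR (S (S n)))%R by apply: lt_0_INR; lia.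
  have nz2 : RtoC (INR (S (S n))) <> 0 by move/RtoC_inj; lra.
  have -> : Rcpow (INR (S (S n))) z = Rcpow (INR (S n)) z * Rcpow (INR (S (S n)) / INR (S n)) z.
    rewrite /Rcpow -Cexp_plus. f_equal.
    have -> : ln (INR (S (S n))) = (ln (INR (S n)) + ln (INR (S (S n)) / INR (S n)))%R.
      rewrite -ln_mult //; last exact: Rdiv_lt_0_compat. f_equal. field. lra.
    rewrite RtoC_plus. ring.
  have -> : pochhammer z (S (S (S n))) = pochhammer z (S (S n)) * (z + RtoC (INR (S (S n)))) by [].
  have hp := pochhammer_neq_0 z (S (S n)) hz.
  have -> : fact (S (S n)) = (S (S n) * fact (S n))%nat by [].
  rewrite mult_INR RtoC_mult.
  have b := one_plus_bound z _ (Rlt_le _ _ hz) hn2.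
  have b0 : 1 + z / RtoC (INR (S (S n))) <> 0 by apply/Cmod_gt_0; lra.
  have b1 : z + RtoC (INR (S (S n))) <> 0.
    move=> e. apply: b0. have -> : 1 + z / RtoC (INR (S (S n))) = (z + RtoC (INR (S (S n)))) / RtoC (INR (S (S n))) by field.
    rewrite e. by field.
  move: (pochhammer _ _) hp (INR (S (S n))) nz2 b0 b1 => p hp x h0 h1 h2.
  field. repeat split => //. by rewrite Cplus_comm.
Qed.

Lemma ln_ratio (n : nat) :
  (/ INR (S (S n)) <= ln (INR (S (S n)) / INR (S n)) <= / INR (S n))%R.
Proof.
  rewrite (S_INR (S n)).
  have : (0 < INR (S n))%R by apply: lt_0_INR; lia.
  move: (INR (S n)) => x hx.
  have key y : (0 < y)%R -> (ln y <= y - 1)%R.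
    move=> hy. have := exp_ineq1_le (ln y). rewrite exp_ln //. lra.
  split.
  - have p1 : (0 < x / (x + 1))%R by apply: Rdiv_lt_0_compat; lra.
    have := key _ p1.
    have -> : (x / (x + 1) = / ((x + 1) / x))%R by field; lra.
    rewrite ln_Rinv; last by apply: Rdiv_lt_0_compat; lra.
    have -> : (/ ((x + 1) / x) = 1 - / (x + 1))%R by field; lra. lra.
  - have p1 : (0 < (x + 1) / x)%R by apply: Rdiv_lt_0_compat; lra.
    have := key _ p1.
    have -> : ((x + 1) / x - 1 = / x)%R by field; lra. done.
Qed.

(** With [m = n + 1], the first-order terms [z ln (1 + 1/m)] and [z / (m + 1)] agree up to
    [|z| / m^2], and the rest of the exponential is quadratic in [1/m]. The denominator has modulus
    at least [1] in the right half-plane. *)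
Lemma gstep_bound (n : nat) (z : C) (Z : R) : (0 <= Re z)%R -> (Cmod z <= Z)%R ->
  (Cmod (gstep n z - 1) <= (Z ^ 2 * exp Z + Z) * / INR (S n) ^ 2)%R.
Proof.
  move=> hz hZ. have z0 := Cmod_ge_0 z.
  have hx : (1 <= INR (S n))%R by rewrite S_INR; have := pos_INR n; lra.
  have hy : INR (S (S n)) = (INR (S n) + 1)%R by rewrite (S_INR (S n)).
  have := ln_ratio n. rewrite /gstep /Rcpow hy. set l := ln _. move: (INR (S n)) hx l => x hx l hl.
  have ix : (0 < / x <= 1)%R by split; [apply: Rinv_0_lt_compat; lra | rewrite -Rinv_1; apply: Rinv_le_contravar; lra].
  have iy : (0 < / (x + 1))%R by apply: Rinv_0_lt_compat; lra.
  have b := one_plus_bound z (x + 1) hz ltac:(lra).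
  have b0 : 1 + z / RtoC (x + 1) <> 0 by apply/Cmod_gt_0; lra.
  set w := 1 + z / RtoC (x + 1) in b b0 *.
  have -> : Cexp (z * RtoC l) / w - 1 = (Cexp (z * RtoC l) - w) / w by field.
  rewrite Cmod_div //. apply/Rle_div_l; first lra.
  set e := z * RtoC l.
  have he : (Cmod e <= Z * / x)%R.
    rewrite Cmod_mult Cmod_R Rabs_pos_eq; last lra. apply: Rmult_le_compat; lra.
  have e0 := Cmod_ge_0 e.
  have he2 : (Cmod e <= Z)%R by nra.
  have nzx : RtoC (x + 1) <> 0 by move/RtoC_inj; lra.
  have -> : Cexp e - w = (Cexp e - 1 - e) + z * RtoC (l - / (x + 1)).
    rewrite /w /e RtoC_minus RtoC_inv; last lra. rewrite /Cdiv. ring.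
  have T := Cexp_taylor e.
  apply: Rle_trans (Cmod_plus_le _ _ _ _ T (Rle_refl _)) _.
  rewrite Cmod_mult Cmod_R Rabs_pos_eq; last lra.
  have h1 : (Cmod e ^ 2 * exp (Cmod e) <= Z ^ 2 * exp Z * / x ^ 2)%R.
    have -> : (Z ^ 2 * exp Z * / x ^ 2 = (Z * / x) ^ 2 * exp Z)%R by field; lra.
    apply: Rmult_le_compat; [exact: pow2_ge_0 | exact: Rlt_le (exp_pos _) | | exact: exp_le].
    apply: pow_incr; lra.
  have h2 : (Cmod z * (l - / (x + 1)) <= Z * / x ^ 2)%R.
    apply: Rmult_le_compat => //; first lra.
    apply: Rle_trans (_ : / x - / (x + 1) <= _)%R; first lra.
    have -> : (/ x - / (x + 1) = / (x * (x + 1)))%R by field; lra.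
    apply: Rinv_le_contravar; nra.
  have h3 : (0 <= (Z ^ 2 * exp Z + Z) * / x ^ 2)%R.
    have := exp_pos Z. have := pow2_ge_0 Z. have : (0 < / x ^ 2)%R by apply: Rinv_0_lt_compat; nra.
    move=> p1 p2 p3. apply: Rmult_le_pos; nra.
  have := Rmult_le_compat_l _ _ _ h3 b. lra.
Qed.

(** The inverse factors satisfy the same kind of bound at the price of [|1 / gstep| <= 1 + Z], where
    the power with exponent [- z] has modulus at most [1] because [Re z >= 0]. *)
Lemma gstep_inv_bound (n : nat) (z : C) (Z : R) : (0 <= Re z)%R -> (Cmod z <= Z)%R ->
  gstep n z <> 0 /\
  (Cmod (/ gstep n z - 1) <= (1 + Z) * (Z ^ 2 * exp Z + Z) * / INR (S n) ^ 2)%R.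
Proof.
  move=> hz hZ. have z0 := Cmod_ge_0 z.
  have hy : (1 <= INR (S (S n)))%R by rewrite (S_INR (S n)); have := pos_INR (S n); lra.
  have b := one_plus_bound z _ hz (Rlt_le_trans _ _ _ Rlt_0_1 hy).
  have b0 : 1 + z / RtoC (INR (S (S n))) <> 0 by apply/Cmod_gt_0; lra.
  have g0 : gstep n z <> 0.
    rewrite /gstep. apply: Cmult_neq_0; first exact: Rcpow_neq_0.
    apply/Cmod_gt_0. rewrite Cmod_inv //. apply: Rinv_0_lt_compat. lra.
  split => //.
  have -> : / gstep n z - 1 = - (gstep n z - 1) * / gstep n z by field.
  rewrite Cmod_mult Cmod_opp Rmult_comm Rmult_assoc.
  apply: Rmult_le_compat; try exact: Cmod_ge_0; last exact: gstep_bound.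
  have -> : / gstep n z = (1 + z / RtoC (INR (S (S n)))) * Rcpow (INR (S (S n)) / INR (S n)) (- z).
    rewrite /gstep Rcpow_opp. have := Rcpow_neq_0 (INR (S (S n)) / INR (S n)) z => h.
    have nzx : RtoC (INR (S (S n))) <> 0 by move/RtoC_inj; lra.
    move: b0; set w := 1 + _ => b0. by field.
  have -> : (1 + Z = (1 + Z) * 1)%R by ring.
  apply: Cmod_mult_le.
  - apply: Rle_trans (Cmod_triangle _ _) _. rewrite Cmod_1. apply: Rplus_le_compat_l.
    rewrite Cmod_div; last by move/RtoC_inj; lra.
    rewrite Cmod_R Rabs_pos_eq; last lra. apply/Rle_div_l; first lra. nra.
  - rewrite Cmod_Rcpow /Rpower -exp_0. apply: exp_le.
    have -> : Re (- z) = (- Re z)%R by case: z {hz hZ z0 b b0 g0}.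
    have [h1 _] := ln_ratio n.
    have : (0 < / INR (S (S n)))%R by apply: Rinv_0_lt_compat; lra. nra.
Qed.

Lemma gauss_neq_0 (n : nat) (z : C) : (0 < Re z)%R -> gauss n z <> 0.
Proof.
  move=> hz. rewrite /gauss. apply: Cmult_neq_0; last first.
    apply/Cmod_gt_0. have := pochhammer_neq_0 z (S n) hz => h. rewrite Cmod_inv //.
    apply: Rinv_0_lt_compat. by apply/Cmod_gt_0.
  apply: Cmult_neq_0; last exact: Rcpow_neq_0.
  move/RtoC_inj. exact: INR_fact_neq_0.
Qed.

Lemma gauss_1 (z : C) : (0 < Re z)%R -> gauss 1 z = / (z * (z + 1)).
Proof.
  move=> hz. rewrite /gauss /= Rcpow_1_l.
  have h : z <> 0 by move=> e; rewrite e /= in hz; lra.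
  have h1 : z + 1 <> 0.
    move=> e. have : Re (z + 1) = 0%R by rewrite e. rewrite /Re /Cplus /RtoC /= in hz *. lra.
  have e0 : z + 0 = z by ring.
  rewrite e0. field. by split.
Qed.

(** Uniform over a region, and two-sided: the bound on inverses keeps the limit away from [0], and
    both bounds feed the limit theorem, for the Gamma function and for its reciprocal. *)
Lemma gauss_bounds (eps Z : R) : (0 < eps)%R -> exists B, (0 < B)%R /\
  forall z, (eps <= Re z)%R -> (Cmod z <= Z)%R -> forall n,
    (Cmod (gauss (S n) z) <= B)%R /\ (Cmod (/ gauss (S n) z) <= B)%R.
Proof.
  move=> he.
  set A := (Rabs Z ^ 2 * exp (Rabs Z) + Rabs Z)%R.
  set A' := ((1 + Rabs Z) * (Rabs Z ^ 2 * exp (Rabs Z) + Rabs Z))%R.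
  have hZ0 := Rabs_pos Z.
  have hA : (0 <= A)%R.
    have := exp_pos (Rabs Z). have := pow2_ge_0 (Rabs Z). rewrite /A. nra.
  have hA' : (0 <= A')%R by apply: Rmult_le_pos => //; lra.
  set B1 := (/ eps * exp (2 * A))%R. set B2 := (Rabs Z * (Rabs Z + 1) * exp (2 * A'))%R.
  have hB1 : (0 < B1)%R by apply: Rmult_lt_0_compat (exp_pos _); exact: Rinv_0_lt_compat.
  have hB2 : (0 <= B2)%R by apply: Rmult_le_pos (Rlt_le _ _ (exp_pos _)); nra.
  exists (B1 + B2)%R. split; first lra.
  move=> z hz hZ n.
  have hzp : (0 < Re z)%R by lra.
  have hZ' : (Cmod z <= Rabs Z)%R by have := Rle_abs Z; lra.
  have z0 : z <> 0 by move=> e; rewrite e /= in hzp; lra.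
  have cz : (eps <= Cmod z)%R by have := Re_le_Cmod z; lra.
  have cz1 : (1 <= Cmod (z + 1))%R.
    apply: Rle_trans (Re_le_Cmod _). rewrite /Re /Cplus /RtoC /= in hzp *. lra.
  have z1 : z + 1 <> 0 by apply/Cmod_gt_0; lra.
  have G1 := gauss_1 z hzp.
  have [P1 _] := product_bound (fun n => gauss (S n) z) (fun n => gstep n z) A hA
    (fun n => gauss_S n z hzp) (fun n => gstep_bound n z _ (Rlt_le _ _ hzp) hZ').
  have GI k : / gauss (S (S k)) z = / gauss (S k) z * / gstep k z.
    rewrite gauss_S //. have h1 := gauss_neq_0 (S k) z hzp.
    have h2 := proj1 (gstep_inv_bound k z _ (Rlt_le _ _ hzp) hZ').
    move: (gauss _ _) (gstep _ _) h1 h2 => a b h1 h2. field. by split.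
  have [P2 _] := product_bound (fun n => / gauss (S n) z) (fun n => / gstep n z) A' hA'
    GI
    (fun n => proj2 (gstep_inv_bound n z _ (Rlt_le _ _ hzp) hZ')).
  have h1 := P1 n. have h2 := P2 n.
  split.
  - apply: Rle_trans h1 _. apply: Rle_trans (_ : B1 <= _)%R; last lra.
    apply: Rmult_le_compat_r (Rlt_le _ _ (exp_pos _)) _.
    rewrite G1 Cmod_inv; last exact: Cmult_neq_0. rewrite Cmod_mult.
    apply: Rinv_le_contravar => //. nra.
  - apply: Rle_trans h2 _. apply: Rle_trans (_ : B2 <= _)%R; last lra.
    apply: Rmult_le_compat_r (Rlt_le _ _ (exp_pos _)) _.
    rewrite G1. have -> : / / (z * (z + 1)) = z * (z + 1) by field.
    apply: Cmod_mult_le => //. apply: Rle_trans (Cmod_triangle _ _) _. rewrite Cmod_1. lra.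
Qed.

Lemma CGamma_lim (z : C) : (0 < Re z)%R -> Cseq_lim (fun n => gauss n z) (CGamma z).
Proof.
  move=> hz.
  have hA : (0 <= Cmod z ^ 2 * exp (Cmod z) + Cmod z)%R.
    have := exp_pos (Cmod z). have := pow2_ge_0 (Cmod z). have := Cmod_ge_0 z. nra.
  have [_ [l hl]] := product_bound (fun n => gauss (S n) z) (fun n => gstep n z) _ hA
    (fun n => gauss_S n z hz) (fun n => gstep_bound n z _ (Rlt_le _ _ hz) (Rle_refl _)).
  have {}hl := proj1 (Cseq_lim_S (fun n => gauss n z) l) hl.
  have -> : CGamma z = l => //.
  apply: Ciota_eq; last by []. move=> x y. exact: Cseq_lim_unique.
Qed.

Lemma CGamma_neq_0 (z : C) : (0 < Re z)%R -> CGamma z <> 0.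
Proof.
  move=> hz. have [B [hB H]] := gauss_bounds (Re z) (Cmod z) hz.
  have h := proj2 (Cseq_lim_S _ _) (CGamma_lim z hz).
  have := Cseq_lim_Cmod_ge _ _ (/ B) _ h => X.
  apply/Cmod_gt_0. apply: Rlt_le_trans (X _); first exact: Rinv_0_lt_compat.
  move=> n. have [_ b] := H z (Rle_refl _) (Rle_refl _) n.
  have g0 := gauss_neq_0 (S n) z hz.
  rewrite Cmod_inv // in b. rewrite -(Rinv_inv (Cmod (gauss (S n) z))).
  apply: Rinv_le_contravar => //. apply: Rinv_0_lt_compat. by apply/Cmod_gt_0.
Qed.

Lemma CGamma_inv_lim (z : C) : (0 < Re z)%R -> Cseq_lim (fun n => / gauss n z) (/ CGamma z).
Proof. move=> hz. apply: Cseq_lim_inv; [exact: CGamma_neq_0 | exact: CGamma_lim]. Qed.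

Lemma CGamma_1 : CGamma 1 = 1.
Proof.
  have h1 : (0 < Re 1)%R by rewrite /=; lra.
  apply: Cseq_lim_unique (CGamma_lim 1 h1) _. apply/(Cseq_lim_S (fun n => gauss n 1)).
  have P n : pochhammer 1 n = RtoC (INR (fact n)).
    elim: n => [|n IH] //. simpl pochhammer. rewrite IH.
    have -> : fact (S n) = (S n * fact n)%nat by []. rewrite mult_INR RtoC_mult S_INR RtoC_plus. ring.
  apply: (Cseq_lim_bound _ _ (fun n => / INR (S (S n)))%R).
    move=> n. rewrite /gauss P Rcpow_1; last by apply: lt_0_INR; lia.
    have -> : fact (S (S n)) = (S (S n) * fact (S n))%nat by []. rewrite mult_INR.
    have hf : RtoC (INR (fact (S n))) <> 0 by move/RtoC_inj; exact: INR_fact_neq_0.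
    have hx : (0 < INR (S (S n)))%R by apply: lt_0_INR; lia.
    have hxn : RtoC (INR (S (S n))) <> 0 by move/RtoC_inj; lra.
    have -> : RtoC (INR (fact (S n))) * RtoC (INR (S n)) / RtoC (INR (S (S n)) * INR (fact (S n))) - 1 =
      - / RtoC (INR (S (S n))).
      have -> : RtoC (INR (S n)) = RtoC (INR (S (S n))) - 1 by rewrite (S_INR (S n)) RtoC_plus; ring.
      rewrite RtoC_mult. move: (RtoC (INR (fact _))) (RtoC (INR (S (S n)))) hf hxn => a b ha hb. field. by split.
    rewrite Cmod_opp Cmod_inv // Cmod_R Rabs_pos_eq; lra.
  have := is_lim_seq_INR.
  move/(is_lim_seq_incr_1 INR)/(is_lim_seq_incr_1 (fun n => INR (S n))) => h.
  exact: (is_lim_seq_inv _ _ h).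
Qed.

Lemma pochhammer_S (z : C) (n : nat) : pochhammer z (S n) = z * pochhammer (z + 1) n.
Proof.
  elim: n => [|n IH]; first by rewrite /=; ring.
  have -> : pochhammer z (S (S n)) = pochhammer z (S n) * (z + RtoC (INR (S n))) by [].
  rewrite IH S_INR RtoC_plus /=. ring.
Qed.

Lemma CGamma_S (z : C) : (0 < Re z)%R -> CGamma (z + 1) = z * CGamma z.
Proof.
  move=> hz. have hz1 : (0 < Re (z + 1))%R by rewrite /Re /Cplus /= in hz *; lra.
  apply: Cseq_lim_unique (CGamma_lim _ hz1) _.
  (* Comes from [gauss n (z + 1) = n / (z + 1 + n) * z * gauss n z], with the first factor written
     as [1 - (z + 1) / (z + 1 + n)]. *)
  have L : Cseq_lim (fun n => (1 - (z + 1) / (z + 1 + RtoC (INR n))) * (z * gauss n z)) ((1 - 0) * (z * CGamma z)).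
    apply: Cseq_lim_mult; last first.
      apply: Cseq_lim_mult; [exact: Cseq_lim_const | exact: CGamma_lim].
    apply: Cseq_lim_minus; first exact: Cseq_lim_const.
    apply/(Cseq_lim_S (fun n => (z + 1) / (z + 1 + RtoC (INR n)))).
    apply: (Cseq_lim_bound _ _ (fun n => Cmod (z + 1) * / INR (S n))%R); last first.
      have -> : Finite 0 = Rbar_mult (Cmod (z + 1)) 0 by rewrite /= Rmult_0_r.
      apply: is_lim_seq_scal_l. have := is_lim_seq_INR.
      move/(is_lim_seq_incr_1 INR) => h. exact: (is_lim_seq_inv _ _ h).
    move=> n. have -> : (z + 1) / (z + 1 + RtoC (INR (S n))) - 0 = (z + 1) / (z + 1 + RtoC (INR (S n))) by ring.
    have hx : (0 < INR (S n))%R by apply: lt_0_INR; lia.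
    have hc : (INR (S n) <= Cmod (z + 1 + RtoC (INR (S n))))%R.
      apply: Rle_trans (Re_le_Cmod _). rewrite /Re /Cplus /RtoC /= in hz *. lra.
    have hn : z + 1 + RtoC (INR (S n)) <> 0 by apply/Cmod_gt_0; lra.
    rewrite Cmod_div //. apply: Rmult_le_compat_l (Cmod_ge_0 _) _. exact: Rinv_le_contravar.
  have -> : z * CGamma z = (1 - 0) * (z * CGamma z) by ring.
  apply/(Cseq_lim_S (fun n => gauss n (z + 1))). move: (proj2 (Cseq_lim_S _ _) L). apply: Cseq_lim_ext => n.
  rewrite /gauss.
  have hx : (0 < INR (S n))%R by apply: lt_0_INR; lia.
  have zn : z <> 0 by move=> e; rewrite e /= in hz; lra.
  rewrite Rcpow_plus Rcpow_1 // (pochhammer_S z).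
  have hp := pochhammer_neq_0 (z + 1) (S n) hz1.
  have -> : pochhammer (z + 1) (S (S n)) = pochhammer (z + 1) (S n) * (z + 1 + RtoC (INR (S n))) by [].
  have hn : z + 1 + RtoC (INR (S n)) <> 0.
    move=> e. have : Re (z + 1 + RtoC (INR (S n))) = 0%R by rewrite e.
    rewrite !Re_plus !Re_RtoC. lra.
  move: (pochhammer _ _) (RtoC (INR (S n))) hp hn => p x hp hn. field. by repeat split.
Qed.

Lemma Re_plus_INR (z : C) (n : nat) : Re (z + RtoC (INR n)) = (Re z + INR n)%R.
Proof. by case: z. Qed.

Lemma pochhammer_CGamma (z : C) (n : nat) : (0 < Re z)%R ->
  pochhammer z n = CGamma (z + RtoC (INR n)) / CGamma z.
Proof.
  move=> hz. have g0 := CGamma_neq_0 z hz.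
  elim: n => [|n IH].
    have -> : z + RtoC (INR 0) = z by rewrite /=; ring. rewrite /=. by field.
  simpl pochhammer. rewrite IH S_INR RtoC_plus Cplus_assoc CGamma_S; first by field.
  rewrite Re_plus_INR. have := pos_INR n. lra.
Qed.

Lemma Hol_pochhammer {E : NormedModule C_AbsRing} (x0 : E) (r : R) (f : E -> C) (n : nat) :
  Hol x0 r f -> Hol x0 r (fun x => pochhammer (f x) n).
Proof.
  move=> H. elim: n => [|n IH] /=; first exact: Hol_const.
  apply: Hol_mult => //. apply: Hol_plus => //. exact: Hol_const.
Qed.

Lemma Cmod_pochhammer_ge (z : C) (n : nat) (eps : R) : (0 < eps)%R -> (eps <= Re z)%R ->
  (eps ^ n <= Cmod (pochhammer z n))%R.
Proof.
  move=> he hz. elim: n => [|n IH] /=.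
    rewrite Cmod_1. lra.
  rewrite Cmod_mult Rmult_comm. apply: Rmult_le_compat => //; try lra.
    exact: pow_le (Rlt_le _ _ he).
  apply: Rle_trans (Re_le_Cmod _). rewrite Re_plus_INR. have := pos_INR n. lra.
Qed.

Lemma Hol_pochhammer_inv {E : NormedModule C_AbsRing} (x0 : E) (r eps : R) (f : E -> C) (n : nat) :
  (0 < eps)%R -> (forall x, inB x0 r x -> (eps <= Re (f x))%R) ->
  Hol x0 r f -> Hol x0 r (fun x => / pochhammer (f x) n).
Proof.
  move=> he hf H. apply: (Hol_inv _ _ (eps ^ n)); first exact: pow_lt.
  - move=> x hx. apply: Cmod_pochhammer_ge => //. exact: hf.
  - exact: Hol_pochhammer.
Qed.

(** The Gauss products and their inverses are uniformly bounded on the values of [f], hence [Hol_limit] applies. *)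
Lemma Hol_CGamma {E : NormedModule C_AbsRing} (x0 : E) (r eps : R) (f : E -> C) :
  (0 < r)%R -> (0 < eps)%R -> (forall x, inB x0 r x -> (eps <= Re (f x))%R) ->
  Hol x0 r f -> Hol x0 (r / 8) (fun x => / CGamma (f x)) /\ Hol x0 (r / 8) (fun x => CGamma (f x)).
Proof.
  move=> hr he hf H. case: (H) => D [M HM].
  have [B [hB HB]] := gauss_bounds eps M he.
  have hb x : inB x0 r x -> forall n, (Cmod (gauss (S n) (f x)) <= B)%R /\ (Cmod (/ gauss (S n) (f x)) <= B)%R.
    move=> hx. apply: HB; [exact: hf | exact: (holD_le _ _ _ _ _ HM)].
  have hp x : inB x0 r x -> (0 < Re (f x))%R by move=> /hf; lra.
  have Hpow n : Hol x0 r (fun x => Rcpow (INR n) (f x)).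
    apply: Hol_exp_comp. apply: Hol_mult => //. exact: Hol_const.
  split.
  - apply: (Hol_limit' _ _ B (fun n x => / gauss (S n) (f x))) => //.
    + move=> n.
      apply: (Hol_ext _ _ (fun x => / RtoC (INR (fact (S n))) * Rcpow (INR (S n)) (- f x) * pochhammer (f x) (S (S n)))).
        move=> x hx. rewrite Rcpow_opp /gauss.
        have h1 := pochhammer_neq_0 (f x) (S (S n)) (hp _ hx).
        have h2 := Rcpow_neq_0 (INR (S n)) (f x).
        have h3 : RtoC (INR (fact (S n))) <> 0 by move/RtoC_inj; exact: INR_fact_neq_0.
        move: (pochhammer _ _) (Rcpow _ _) (RtoC (INR (fact (S n)))) h1 h2 h3 => a b c h1 h2 h3.
        field. by repeat split.
      apply: Hol_mult; last exact: Hol_pochhammer.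
      apply: Hol_mult; first exact: Hol_const.
      apply: Hol_exp_comp. apply: Hol_mult; last exact: Hol_const. exact: Hol_opp.
    + move=> n x hx. exact: (proj2 (hb x hx n)).
    + move=> x hx. apply/(Cseq_lim_S (fun n => / gauss n (f x))). apply: CGamma_inv_lim. exact: hp.
  - apply: (Hol_limit' _ _ B (fun n x => gauss (S n) (f x))) => //.
    + move=> n. apply: Hol_mult; last exact: (Hol_pochhammer_inv _ _ eps).
      apply: Hol_mult; first exact: Hol_const. exact: Hpow.
    + move=> n x hx. exact: (proj1 (hb x hx n)).
    + move=> x hx. apply/(Cseq_lim_S (fun n => gauss n (f x))). apply: CGamma_lim. exact: hp.
Qed.

#[local] Transparent Cexp.

Open Scope R_scope.

(** * The differential equation of K' *)

(** The radicand at squared modulus [1 - u], so that [u] is the square of the argument of [ellK'].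
    It is positive for all [u > 0], which leaves room on both sides of [u = 1]. *)
Definition ellD (u t : R) : R := 1 - (1 - u) * sin t ^ 2.
Definition ellw (u : R) : R := RInt (fun t => / sqrt (ellD u t)) 0 (PI / 2).
(** The complete elliptic integral of the second kind at the same complementary modulus; it
    expresses the derivative of [ellw]. *)
Definition ellE (u : R) : R := RInt (fun t => sqrt (ellD u t)) 0 (PI / 2).
Definition ellw1 (u : R) : R :=
  RInt (fun t => sin t ^ 2 * (- / (2 * ellD u t * sqrt (ellD u t)))) 0 (PI / 2).
Definition ellE1 (u : R) : R := RInt (fun t => sin t ^ 2 * / (2 * sqrt (ellD u t))) 0 (PI / 2).

Lemma ellK'_ellw (x : R) : 0 <= x <= 1 -> ellK' x = ellw (x ^ 2).
Proof.
  move=> hx. rewrite /ellK' /ellK /ellw /ellD. apply: RInt_ext => t _.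
  by rewrite pow2_sqrt //; nra.
Qed.

Lemma sin_sq_bound (t : R) : 0 <= sin t ^ 2 <= 1.
Proof. have := SIN_bound t. nra. Qed.

Lemma ellD_E (u t : R) : ellD u t = cos t ^ 2 + u * sin t ^ 2.
Proof. have := sin2_cos2 t. rewrite /ellD /Rsqr. nra. Qed.

Lemma ellD_pos (u t : R) : 0 < u -> 0 < ellD u t.
Proof. move=> hu. have := sin_sq_bound t. rewrite /ellD. case: (Rle_dec u 1) => h; nra. Qed.

Lemma ellD_ge (u t : R) : u <= 1 -> u <= ellD u t.
Proof. have := sin_sq_bound t. rewrite /ellD. nra. Qed.

Lemma ellD_le (u t : R) : u <= 1 -> ellD u t <= 1.
Proof. have := sin_sq_bound t. rewrite /ellD. nra. Qed.

Lemma continuous_ellD (u t : R) : continuous (ellD u) t.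
Proof.
  apply: (@ex_derive_continuous R_AbsRing R_NormedModule). rewrite /ellD. by auto_derive.
Qed.

Lemma ex_RInt_ell (g : R -> R) (u : R) : 0 < u -> (forall y, 0 < y -> continuous g y) ->
  ex_RInt (fun t => g (ellD u t)) 0 (PI / 2).
Proof.
  move=> hu hg. apply: (@ex_RInt_continuous R_CompleteNormedModule) => t _.
  apply: (continuous_comp (ellD u) g); first exact: continuous_ellD. apply: hg. exact: ellD_pos.
Qed.

(** Stated for a general [g] so that one differentiation under the integral sign serves both kinds
    of integral. *)
Lemma is_derive_ell (g g' : R -> R) (u : R) : 0 < u ->
  (forall y, 0 < y -> is_derive g y (g' y)) -> (forall y, 0 < y -> continuous g' y) ->
  is_derive (fun u => RInt (fun t => g (ellD u t)) 0 (PI / 2)) u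
    (RInt (fun t => sin t ^ 2 * g' (ellD u t)) 0 (PI / 2)).
Proof.
  move=> hu hg hg'.
  have D z t : 0 < z -> is_derive (fun z => g (ellD z t)) z (sin t ^ 2 * g' (ellD z t)).
    move=> hz. apply: (is_derive_comp g (fun z => ellD z t)); first exact: hg (ellD_pos _ _ hz).
    rewrite /ellD. auto_derive => //. ring.
  have near : locally u (fun z => 0 < z).
    exists (mkposreal _ hu) => z. rewrite /ball /= /AbsRing_ball /abs /minus /plus /opp /=.
    move=> /Rabs_def2. lra.
  have -> : RInt (fun t => sin t ^ 2 * g' (ellD u t)) 0 (PI / 2) =
    RInt (fun t => Derive (fun z => g (ellD z t)) u) 0 (PI / 2).
    apply: RInt_ext => t _. symmetry. apply: is_derive_unique. exact: D.
  apply: (is_derive_RInt_param (fun z t => g (ellD z t))).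
  - apply: filter_imp near => z hz t _. eexists. exact: D.
  - move=> t _.
    apply: (continuity_2d_pt_ext_loc (fun z t => sin t ^ 2 * g' (ellD z t))).
      exists (mkposreal _ hu) => z s hz _. symmetry. apply: is_derive_unique. apply: D.
      move: hz => /= /Rabs_def2. lra.
    have S2 : continuity_2d_pt (fun _ t => sin t ^ 2) u t.
      apply: (continuity_1d_2d_pt_comp (fun t => sin t ^ 2) (fun _ t => t)); last exact: continuity_2d_pt_id2.
      apply/continuity_pt_filterlim.
      apply: (@ex_derive_continuous R_AbsRing R_NormedModule (fun t => sin t ^ 2)). by auto_derive.
    apply: continuity_2d_pt_mult => //.
    apply: continuity_1d_2d_pt_comp.
      apply/continuity_pt_filterlim. apply: hg'. exact: ellD_pos.
    rewrite /ellD. apply: continuity_2d_pt_minus; first exact: continuity_2d_pt_const.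
    apply: continuity_2d_pt_mult => //.
    apply: continuity_2d_pt_minus; [exact: continuity_2d_pt_const | exact: continuity_2d_pt_id1].
  - apply: filter_imp near => z hz. apply: ex_RInt_ell => // y hy.
    apply: (@ex_derive_continuous R_AbsRing R_NormedModule). eexists. exact: hg.
Qed.

Lemma is_derive_inv_sqrt (y : R) : 0 < y -> is_derive (fun y => / sqrt y) y (- / (2 * y * sqrt y)).
Proof.
  move=> hy. have hs := sqrt_lt_R0 _ hy. auto_derive; first by split => //; split => //; lra.
  have e : sqrt y * sqrt y = y by apply: sqrt_sqrt; lra.
  have -> : 2 * y * sqrt y = 2 * (sqrt y * sqrt y) * sqrt y by rewrite e. field. lra.
Qed.

Lemma is_derive_sqrt_pos (y : R) : 0 < y -> is_derive sqrt y (/ (2 * sqrt y)).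
Proof.
  move=> hy. have hs := sqrt_lt_R0 _ hy. auto_derive => //. field. lra.
Qed.

Lemma continuous_of_derive (f : R -> R) (x l : R) : is_derive f x l -> continuous f x.
Proof.
  move=> h. apply: (@ex_derive_continuous R_AbsRing R_NormedModule). by exists l.
Qed.

Lemma continuous_inv_sqrt (y : R) : 0 < y -> continuous (fun y => / sqrt y) y.
Proof. move=> /is_derive_inv_sqrt. exact: continuous_of_derive. Qed.

Lemma continuous_inv_cube (c y : R) : 0 < c -> 0 < y -> continuous (fun y => / (c * y * sqrt y)) y.
Proof.
  move=> hc hy. have hs := sqrt_lt_R0 _ hy.
  apply: (@ex_derive_continuous R_AbsRing R_NormedModule). auto_derive. split => //. split => //.
  have : 0 < c * y * sqrt y by repeat apply: Rmult_lt_0_compat; lra. lra.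
Qed.

Lemma continuous_inv_2sqrt (y : R) : 0 < y -> continuous (fun y => / (2 * sqrt y)) y.
Proof.
  move=> hy. have hs := sqrt_lt_R0 _ hy.
  apply: (@ex_derive_continuous R_AbsRing R_NormedModule). auto_derive. split => //. split => //. lra.
Qed.

Lemma is_derive_ellw (u : R) : 0 < u -> is_derive ellw u (ellw1 u).
Proof.
  move=> hu. apply: (is_derive_ell (fun y => / sqrt y) (fun y => - / (2 * y * sqrt y))) => //.
  - exact: is_derive_inv_sqrt.
  - move=> y hy. apply: (@continuous_opp _ _ R_NormedModule). apply: continuous_inv_cube => //. lra.
Qed.

Lemma is_derive_ellE (u : R) : 0 < u -> is_derive ellE u (ellE1 u).
Proof.
  move=> hu. apply: (is_derive_ell sqrt (fun y => / (2 * sqrt y))) => //.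
  - exact: is_derive_sqrt_pos.
  - exact: continuous_inv_2sqrt.
Qed.

Lemma continuous_ellw (u : R) : 0 < u -> continuous ellw u.
Proof. move=> /is_derive_ellw. exact: continuous_of_derive. Qed.

Section EllInt.
Variables (u : R) (hu : 0 < u).

Let Dp (t : R) : 0 < ellD u t := ellD_pos u t hu.
Let Sp (t : R) : 0 < sqrt (ellD u t) := sqrt_lt_R0 _ (Dp t).
Let SS (t : R) : sqrt (ellD u t) * sqrt (ellD u t) = ellD u t.
Proof. apply: sqrt_sqrt. exact: Rlt_le. Qed.

Lemma continuous_ell_mult (f g : R -> R) (t : R) : ex_derive f t ->
  (forall y, 0 < y -> continuous g y) -> continuous (fun t => f t * g (ellD u t)) t.
Proof.
  move=> hf hg. apply: (@continuous_mult _ R_AbsRing).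
  - exact: (@ex_derive_continuous R_AbsRing R_NormedModule).
  - apply: (continuous_comp (ellD u) g); first exact: continuous_ellD. exact: hg.
Qed.

Lemma is_RInt_ellw : is_RInt (fun t => / sqrt (ellD u t)) 0 (PI / 2) (ellw u).
Proof.
  apply: (@RInt_correct R_CompleteNormedModule).
  exact: (ex_RInt_ell (fun y => / sqrt y) u hu continuous_inv_sqrt).
Qed.

Lemma is_RInt_ellE : is_RInt (fun t => sqrt (ellD u t)) 0 (PI / 2) (ellE u).
Proof.
  apply: (@RInt_correct R_CompleteNormedModule). apply: (ex_RInt_ell sqrt u hu) => y hy.
  exact: continuous_of_derive (is_derive_sqrt_pos y hy).
Qed.

Lemma is_RInt_ellw1 :
  is_RInt (fun t => sin t ^ 2 * (- / (2 * ellD u t * sqrt (ellD u t)))) 0 (PI / 2) (ellw1 u).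
Proof.
  apply: (@RInt_correct R_CompleteNormedModule).
  apply: (@ex_RInt_continuous R_CompleteNormedModule) => t _.
  apply: (continuous_ell_mult (fun t => sin t ^ 2) (fun y => - / (2 * y * sqrt y))); first by auto_derive.
  move=> y hy. apply: (@continuous_opp _ _ R_NormedModule). apply: continuous_inv_cube => //. lra.
Qed.

Lemma is_RInt_ellE1 : is_RInt (fun t => sin t ^ 2 * / (2 * sqrt (ellD u t))) 0 (PI / 2) (ellE1 u).
Proof.
  apply: (@RInt_correct R_CompleteNormedModule).
  apply: (@ex_RInt_continuous R_CompleteNormedModule) => t _.
  apply: (continuous_ell_mult (fun t => sin t ^ 2) (fun y => / (2 * sqrt y))); first by auto_derive.
  exact: continuous_inv_2sqrt.
Qed.

(** The integrand is the derivative of [sin t cos t / sqrt (ellD u t)], which vanishes at both ends.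
    This single exact form accounts for both relations below. *)
Lemma is_RInt_ell_exact : is_RInt (fun t =>
  (1 - 2 * sin t ^ 2 + (1 - u) * (sin t ^ 2) ^ 2) / (ellD u t * sqrt (ellD u t))) 0 (PI / 2) 0.
Proof.
  pose F t := sin t * cos t / sqrt (ellD u t).
  have e0 : minus (F (PI / 2)) (F 0) = 0.
    rewrite /F cos_PI2 sin_0 /minus /plus /opp /=. rewrite /Rdiv. ring.
  rewrite -[X in is_RInt _ _ _ X]e0.
  apply: (@is_RInt_derive R_CompleteNormedModule) => t _.
  - have h' := Sp t. have e := SS t.
    have D1 : is_derive (fun t => sin t * cos t) t (cos t ^ 2 - sin t ^ 2) by auto_derive => //; ring.
    have D2 : is_derive (ellD u) t (- (2 * (1 - u) * (sin t * cos t))).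
      rewrite /ellD. auto_derive => //. ring.
    have D3 := is_derive_comp _ _ _ _ _ (is_derive_inv_sqrt _ (Dp t)) D2.
    have := is_derive_mult _ _ _ _ _ D1 D3 Rmult_comm.
    rewrite /plus /scal /mult /= /mult /=.
    suff -> : (1 - 2 * (sin t * (sin t * 1)) + (1 - u) * (sin t * (sin t * 1) * (sin t * (sin t * 1) * 1))) /
       (ellD u t * sqrt (ellD u t)) =
      (cos t * (cos t * 1) - sin t * (sin t * 1)) * / sqrt (ellD u t) +
      sin t * cos t * (- (2 * (1 - u) * (sin t * cos t)) * - / (2 * ellD u t * sqrt (ellD u t))) by [].
    have e2 : cos t ^ 2 = 1 - sin t ^ 2 by have := sin2_cos2 t; rewrite /Rsqr; nra.
    set s := sqrt (ellD u t) in h' e *. rewrite -e.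
    have hs2 : s ^ 2 = 1 - (1 - u) * sin t ^ 2 by rewrite -/(ellD u t) -e; ring.
    field_simplify_eq; last lra.
    rewrite ?e2 ?hs2. ring.
  - apply: (continuous_ell_mult (fun t => 1 - 2 * sin t ^ 2 + (1 - u) * (sin t ^ 2) ^ 2) (fun y => / (y * sqrt y))).
      by auto_derive.
    move=> y hy. have := continuous_inv_cube 1 y Rlt_0_1 hy.
    apply: continuous_ext => z. by rewrite Rmult_1_l.
Qed.

(** Twice the two sides have integrands that differ by [1 - u] times the exact form. The right side
    involves no derivative, so [u (1 - u) w'] can be differentiated again. *)
Lemma ell_relation : u * (1 - u) * ellw1 u = (u * ellw u - ellE u) / 2.
Proof.
  have I1 := is_RInt_scal _ _ _ (2 * u * (1 - u)) _ is_RInt_ellw1.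
  have I2 := is_RInt_scal _ _ _ u _ is_RInt_ellw.
  have I3 := is_RInt_scal _ _ _ (1 - u) _ is_RInt_ell_exact.
  have J := is_RInt_minus _ _ _ _ _ _ I1 (is_RInt_minus _ _ _ _ _ _ (is_RInt_minus _ _ _ _ _ _ I2 is_RInt_ellE) (is_RInt_opp _ _ _ _ I3)).
  have Z : is_RInt (fun _ : R => 0) 0 (PI / 2) 0.
    have := is_RInt_const (V := R_NormedModule) 0 (PI / 2) 0.
    by rewrite scal_zero_r.
  have E := is_RInt_unique _ _ _ _ (is_RInt_ext _ _ _ _ _ _ J).
  have := E (fun _ => 0). rewrite (is_RInt_unique _ _ _ _ Z) => {}E.
  have X : forall x : R, Rmin 0 (PI / 2) < x < Rmax 0 (PI / 2) ->
    2 * u * (1 - u) * (sin x ^ 2 * (- / (2 * ellD u x * sqrt (ellD u x)))) -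
    (u * / sqrt (ellD u x) - sqrt (ellD u x) - - ((1 - u) * ((1 - 2 * sin x ^ 2 + (1 - u) * (sin x ^ 2) ^ 2) / (ellD u x * sqrt (ellD u x))))) = 0.
    move=> t _. have h := Sp t. have e := SS t.
    set s := sqrt (ellD u t) in h e *. rewrite -e.
    have hs2 : s ^ 2 = 1 - (1 - u) * sin t ^ 2 by rewrite -/(ellD u t) -e; ring.
    field_simplify_eq; last lra.
    have -> : s ^ 4 = (s ^ 2) ^ 2 by ring. rewrite hs2. ring.
  have := E X. rewrite /minus /plus /opp /scal /= /mult /=. lra.
Qed.

(** The left side is the derivative of [(u w - E) / 2], so with [ell_relation] this is the
    differential equation. Twice the two sides have integrands that differ by the exact form. *)
Lemma ell_relation1 : (ellw u + u * ellw1 u - ellE1 u) / 2 = ellw u / 4.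
Proof.
  have I1 := is_RInt_scal _ _ _ (2 * u) _ is_RInt_ellw1.
  have I2 := is_RInt_scal _ _ _ 2 _ is_RInt_ellE1.
  have J := is_RInt_minus _ _ _ _ _ _ (is_RInt_minus _ _ _ _ _ _ (is_RInt_plus _ _ _ _ _ _ is_RInt_ellw I1) I2) is_RInt_ell_exact.
  have Z : is_RInt (fun _ : R => 0) 0 (PI / 2) 0.
    have := is_RInt_const (V := R_NormedModule) 0 (PI / 2) 0.
    by rewrite scal_zero_r.
  have E := is_RInt_unique _ _ _ _ (is_RInt_ext _ _ _ _ _ _ J).
  have := E (fun _ => 0). rewrite (is_RInt_unique _ _ _ _ Z) => {}E.
  have X : forall x : R, Rmin 0 (PI / 2) < x < Rmax 0 (PI / 2) ->
    / sqrt (ellD u x) + 2 * u * (sin x ^ 2 * (- / (2 * ellD u x * sqrt (ellD u x))))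
     - 2 * (sin x ^ 2 * / (2 * sqrt (ellD u x)))
     - (1 - 2 * sin x ^ 2 + (1 - u) * (sin x ^ 2) ^ 2) / (ellD u x * sqrt (ellD u x)) = 0.
    move=> t _. have h := Sp t. have e := SS t.
    set s := sqrt (ellD u t) in h e *. rewrite -e.
    have hs2 : s ^ 2 = 1 - (1 - u) * sin t ^ 2 by rewrite -/(ellD u t) -e; ring.
    field_simplify_eq; last lra. rewrite ?hs2. ring.
  have := E X. rewrite /minus /plus /opp /scal /= /mult /=. lra.
Qed.

Lemma is_RInt_pi2_const (c : R) : is_RInt (fun _ => c) 0 (PI / 2) (c * (PI / 2)).
Proof.
  have := is_RInt_const (V := R_NormedModule) 0 (PI / 2) c.
  rewrite /scal /= /mult /=. by have -> : (PI / 2 - 0) * c = c * (PI / 2) by ring.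
Qed.

Hypothesis hu1 : u <= 1.
Let pi0 : 0 <= PI / 2. Proof. have := PI_RGT_0. lra. Qed.
Let isu (t : R) : / sqrt (ellD u t) <= / sqrt u.
Proof.
  apply: Rinv_le_contravar; first exact: sqrt_lt_R0. apply: sqrt_le_1_alt. exact: ellD_ge.
Qed.
Let s1 (t : R) : sqrt (ellD u t) <= 1.
Proof. rewrite -sqrt_1. apply: sqrt_le_1_alt. exact: ellD_le. Qed.

Lemma ellw_ge : PI / 2 <= ellw u.
Proof.
  rewrite -(Rmult_1_l (PI / 2)).
  apply: (is_RInt_le _ _ _ _ _ _ _ (is_RInt_pi2_const 1) is_RInt_ellw) => // t _.
  rewrite -Rinv_1. apply: Rinv_le_contravar; [exact: Sp | exact: s1].
Qed.

Lemma ellw_le : ellw u <= / sqrt u * (PI / 2).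
Proof.
  by apply: (is_RInt_le _ _ _ _ _ _ _ is_RInt_ellw (is_RInt_pi2_const _)) => // t _.
Qed.

(** Since the radicand [D] is at most [1], one has [1 - sqrt D <= 1 - D <= 1 - u]. The behaviour at
    [u = 1] governs the Mellin transform at infinity. *)
Lemma ellw_near_1 : ellw u - PI / 2 <= (1 - u) * / sqrt u * (PI / 2).
Proof.
  have I := is_RInt_minus _ _ _ _ _ _ is_RInt_ellw (is_RInt_pi2_const 1).
  rewrite Rmult_1_l in I.
  apply: (is_RInt_le _ _ _ _ _ _ pi0 I (is_RInt_pi2_const _)) => t _.
  rewrite /minus /plus /opp /=. have h := Sp t. have e := SS t. have l := s1 t.
  apply: Rle_trans (_ : (1 - u) * / sqrt (ellD u t) <= _); last by apply: Rmult_le_compat_l; [lra | exact: isu].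
  have -> : / sqrt (ellD u t) + -1 = (1 - sqrt (ellD u t)) * / sqrt (ellD u t) by field; lra.
  apply: Rmult_le_compat_r; first by apply: Rlt_le; exact: Rinv_0_lt_compat.
  have := sin_sq_bound t. move: e. rewrite {3}/ellD. nra.
Qed.

(** The square root of [cos^2 + u sin^2] lies between [cos] and [cos + sqrt u] on the interval, and
    [cos] integrates to [1]. *)
Lemma ellE_near_0 : Rabs (ellE u - 1) <= sqrt u * (PI / 2).
Proof.
  have Ic : is_RInt cos 0 (PI / 2) 1.
    have -> : 1 = minus (sin (PI / 2)) (sin 0).
      rewrite sin_PI2 sin_0 /minus /plus /opp /=. ring.
    apply: (@is_RInt_derive R_CompleteNormedModule) => t _; first by auto_derive => //; ring.
    apply: (@ex_derive_continuous R_AbsRing R_NormedModule). by auto_derive.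
  have I := is_RInt_minus _ _ _ _ _ _ is_RInt_ellE Ic.
  apply: (norm_RInt_le (V := R_NormedModule) _ _ _ _ _ _ pi0 _ I (is_RInt_pi2_const _)) => t ht.
  rewrite /norm /= /abs /minus /plus /opp /=.
  have c0 : 0 <= cos t by apply: cos_ge_0; lra.
  have h := Sp t. have e := SS t. have hs := sqrt_lt_R0 _ hu.
  have e2 : sqrt u * sqrt u = u by apply: sqrt_sqrt; lra.
  have sb := sin_sq_bound t.
  rewrite ellD_E in h e *. set s := sqrt _ in h e *.
  have a1 : cos t <= s by apply: Rnot_lt_le => k; nra.
  rewrite Rabs_pos_eq; last lra.
  apply: Rnot_lt_le => k. nra.
Qed.

Lemma ellE_bounds : 0 <= ellE u <= PI / 2.
Proof.
  split.
  - have := is_RInt_le _ _ _ _ _ _ pi0 (is_RInt_pi2_const 0) is_RInt_ellE.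
    rewrite Rmult_0_l. apply => t _. exact: Rlt_le (Sp t).
  - rewrite -(Rmult_1_l (PI / 2)).
    apply: (is_RInt_le _ _ _ _ _ _ pi0 is_RInt_ellE (is_RInt_pi2_const 1)) => t _. exact: s1.
Qed.

End EllInt.

(** The quasi-derivative of the self-adjoint equation. It is bounded on the interval although [ellw]
    is not: it tends to [- 1/2] at [0], which is the logarithmic singularity of [ellw], and to [0]
    at [1]. *)
Definition ellq (u : R) : R := u * (1 - u) * ellw1 u.

Lemma is_derive_ellq (u : R) : 0 < u -> is_derive ellq u (ellw u / 4).
Proof.
  move=> hu. rewrite -ell_relation1 //.
  apply: (is_derive_ext_loc (fun u => (u * ellw u - ellE u) / 2)).
    exists (mkposreal _ hu) => z. rewrite /ball /= /AbsRing_ball /abs /minus /plus /opp /=.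
    move=> /Rabs_def2 hz. rewrite /ellq ell_relation //. lra.
  have h1 := is_derive_ellw _ hu. have h2 := is_derive_ellE _ hu.
  auto_derive.
    split; first by exists (ellw1 u). split => //. by exists (ellE1 u).
  rewrite (is_derive_unique _ _ _ h1) (is_derive_unique _ _ _ h2). field.
Qed.

Lemma ellq_1 : ellq 1 = 0.
Proof. rewrite /ellq. ring. Qed.

Lemma sqrt_le_self (u : R) : 0 < u <= 1 -> u * / sqrt u = sqrt u.
Proof.
  move=> h. have hs : 0 < sqrt u by apply: sqrt_lt_R0; lra.
  have e2 : sqrt u * sqrt u = u by apply: sqrt_sqrt; lra.
  have {1}-> : u = sqrt u * sqrt u by []. field. lra.
Qed.

Lemma ellq_near_0 (u : R) : 0 < u <= 1 -> Rabs (ellq u + 1 / 2) <= sqrt u * (PI / 2).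
Proof.
  move=> [h0 h1]. rewrite /ellq ell_relation //.
  have a := ellE_near_0 _ h0. have b := ellw_le _ h0 h1. have c := ellw_ge _ h0 h1.
  have pi0 := PI_RGT_0.
  have d : 0 <= u * ellw u <= sqrt u * (PI / 2).
    split; first nra.
    rewrite -(sqrt_le_self u) // Rmult_assoc. apply: Rmult_le_compat_l; lra.
  move: a => /Rabs_le_between a. apply/Rabs_le_between. lra.
Qed.

Lemma ellq_bound (u : R) : 0 < u <= 1 -> Rabs (ellq u) <= PI.
Proof.
  move=> [h0 h1]. rewrite /ellq ell_relation //.
  have a := ellE_bounds _ h0 h1. have b := ellw_le _ h0 h1. have c := ellw_ge _ h0 h1.
  have pi0 := PI_RGT_0.
  have d : 0 <= u * ellw u <= sqrt u * (PI / 2).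
    split; first nra.
    rewrite -(sqrt_le_self u) // Rmult_assoc. apply: Rmult_le_compat_l; lra.
  have e : sqrt u <= 1 by rewrite -sqrt_1; apply: sqrt_le_1_alt.
  have f := sqrt_pos u. apply/Rabs_le_between. nra.
Qed.

(** Both [w + ln u / 2] and its opposite become nondecreasing when [10 sqrt u] is added. *)
Lemma ellw_log : exists A, 0 < A /\ forall u, 0 < u <= 1 -> Rabs (ellw u + ln u / 2) <= A.
Proof.
  have pi0 := PI_RGT_0. have pi4 := PI_4.
  have key (s : R) : s = 1 \/ s = -1 -> forall u, 0 < u < / 2 ->
    s * (ellw (/ 2) + ln (/ 2) / 2) + 10 * sqrt (/ 2) >= s * (ellw u + ln u / 2) + 10 * sqrt u.
    move=> hs u hu.
    case: (MVT_gen (fun u => s * (ellw u + ln u / 2) + 10 * sqrt u) u (/ 2)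
      (fun u => s * (ellw1 u + / u / 2) + 10 * / (2 * sqrt u))).
    - rewrite Rmin_left ?Rmax_right; try lra. move=> x hx. have hx0 : 0 < x by lra.
      have h := is_derive_ellw _ hx0. have hsx := sqrt_lt_R0 _ hx0.
      auto_derive; first by split; [exists (ellw1 x) | split].
      rewrite (is_derive_unique _ _ _ h). field. split; lra.
    - rewrite Rmin_left ?Rmax_right; try lra. move=> x hx. have hx0 : 0 < x by lra.
      apply/continuity_pt_filterlim.
      apply: (@ex_derive_continuous R_AbsRing R_NormedModule).
      have h := is_derive_ellw _ hx0. auto_derive. split; [by exists (ellw1 x) | by split].
    - rewrite Rmin_left ?Rmax_right; try lra. move=> x [hx e].
      suff : 0 <= s * (ellw1 x + / x / 2) + 10 * / (2 * sqrt x) by nra.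
      have hx0 : 0 < x <= 1 by lra.
      have hsx := sqrt_lt_R0 _ (proj1 hx0). have e2 : sqrt x * sqrt x = x by apply: sqrt_sqrt; lra.
      have q := ellq_near_0 x hx0. have hq : ellq x = x * (1 - x) * ellw1 x by [].
      have s1 : sqrt x <= 1 by rewrite -sqrt_1; apply: sqrt_le_1_alt; lra.
      have e3 : ellw1 x + / x / 2 = (ellq x + 1 / 2 - x / 2) / (x * (1 - x)) by rewrite hq; field; lra.
      have b : Rabs (ellq x + 1 / 2 - x / 2) <= 5 / 2 * sqrt x.
        move/Rabs_le_between: q => q. apply/Rabs_le_between. nra.
      (* [5 / sqrt x] is the derivative of [10 sqrt x], which is where the [10] comes from; [5 / 2]
         is [2] from [PI <= 4] plus [1 / 2] from the term [x / 2], and [1 - x >= 1 / 2] doubles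
         it. *)
      have b2 : Rabs (ellw1 x + / x / 2) <= 5 * / sqrt x.
        rewrite e3 Rabs_div; last nra. rewrite (Rabs_pos_eq (x * (1 - x))); last nra.
        apply/Rle_div_l; first nra. apply: Rle_trans b _.
        have -> : 5 * / sqrt x * (x * (1 - x)) = 5 * (1 - x) * (x * / sqrt x) by ring.
        rewrite sqrt_le_self //. nra.
      have -> : 10 * / (2 * sqrt x) = 5 * / sqrt x by field; lra.
      move/Rabs_le_between: b2. case: hs => ->; lra.
  set K := Rabs (ellw (/ 2) + ln (/ 2) / 2) + 10 * sqrt (/ 2).
  have hK : 0 <= K by have := Rabs_pos (ellw (/ 2) + ln (/ 2) / 2); have := sqrt_pos (/ 2); rewrite /K; lra.
  exists (K + 2 * PI + 1). split; first lra.
  move=> u [h0 h1].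
  case: (Rlt_le_dec u (/ 2)) => h.
  - have k1 := key 1 (or_introl eq_refl) u (conj h0 h).
    have k2 := key (-1) (or_intror eq_refl) u (conj h0 h).
    have := sqrt_pos u. move: (Rle_abs (ellw (/ 2) + ln (/ 2) / 2)) (Rle_abs (- (ellw (/ 2) + ln (/ 2) / 2))).
    rewrite Rabs_Ropp /K => a b c. apply/Rabs_le_between. lra.
  - have l1 : ln u <= 0 by rewrite -ln_1; apply: ln_le.
    have l2 : -1 <= ln u.
      have := exp_ineq1_le (ln (/ u)). rewrite exp_ln; last exact: Rinv_0_lt_compat.
      rewrite ln_Rinv //. have : / u <= 2 by rewrite -(Rinv_inv 2); apply: Rinv_le_contravar; lra. lra.
    have a := ellw_ge _ h0 h1. have b := ellw_le _ h0 h1.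
    have c : / sqrt u <= 2.
      rewrite -(Rinv_inv 2). apply: Rinv_le_contravar; first lra.
      apply: Rle_trans h _. have e : sqrt u * sqrt u = u by apply: sqrt_sqrt; lra.
      have := sqrt_pos u. have : sqrt u <= 1 by rewrite -sqrt_1; apply: sqrt_le_1_alt; lra. nra.
    apply/Rabs_le_between. nra.
Qed.

Open Scope C_scope.

(** * Mellin transforms over the unit interval *)

Definition CRInt (f : R -> C) (a b : R) : C := RInt (V := C_R_CompleteNormedModule) f a b.

Definition cont01 (f : R -> C) : Prop :=
  forall u, (0 < u <= 1)%R -> continuous (U := C_R_NormedModule) f u.

(** Improper at [0] only, the integrands being regular at [1]. Continuity is part of the notion, so
    that the integrals over [[a, 1]] exist; at [1] it is two-sided, which suits [ellw], smooth on
    all [u > 0]. *)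
Definition is_int01 (f : R -> C) (v : C) : Prop :=
  cont01 f /\
  forall eps : R, (0 < eps)%R -> exists d : R, (0 < d)%R /\
    forall a, (0 < a < d)%R -> (a <= 1)%R -> (Cmod (CRInt f a 1 - v) < eps)%R.

Lemma CRInt_correct (f : R -> C) (a b : R) : cont01 f -> (0 < a <= b)%R -> (b <= 1)%R ->
  is_RInt (V := C_R_NormedModule) f a b (CRInt f a b).
Proof.
  move=> hf ha hb. apply: (@RInt_correct C_R_CompleteNormedModule).
  apply: (@ex_RInt_continuous C_R_CompleteNormedModule) => t.
  rewrite Rmin_left ?Rmax_right; try lra. move=> ht. apply: hf. lra.
Qed.

Lemma CRInt_eq (f : R -> C) (a b : R) (l : C) :
  is_RInt (V := C_R_NormedModule) f a b l -> CRInt f a b = l.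
Proof. exact: (@is_RInt_unique C_R_CompleteNormedModule). Qed.

Lemma is_int01_unique (f : R -> C) (v w : C) : is_int01 f v -> is_int01 f w -> v = w.
Proof.
  move=> [_ H] [_ H'].
  have : Cmod (v - w) = 0%R; last first.
    move/Cmod_eq_0 => h. have -> : v = (v - w) + w by ring. rewrite h. ring.
  apply: Rle_antisym; last exact: Cmod_ge_0. apply: le_epsilon => eps he.
  have he2 : (0 < eps / 2)%R by lra.
  case: (H _ he2) => d [hd Hd]. case: (H' _ he2) => d' [hd' Hd'].
  set a := (Rmin (Rmin d d') 1 / 2)%R.
  have h1 := Rmin_l (Rmin d d') 1. have h2 := Rmin_r (Rmin d d') 1.
  have h3 := Rmin_l d d'. have h4 := Rmin_r d d'.
  have h5 : (0 < Rmin (Rmin d d') 1)%R by repeat apply: Rmin_pos => //; lra.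
  have a1 : (0 < a < d)%R by rewrite /a; lra. have a2 : (0 < a < d')%R by rewrite /a; lra.
  have a3 : (a <= 1)%R by rewrite /a; lra.
  have := Hd a a1 a3. have := Hd' a a2 a3.
  have -> : v - w = (CRInt f a 1 - w) - (CRInt f a 1 - v) by ring.
  have := Cmod_minus_le (CRInt f a 1 - w) (CRInt f a 1 - v). lra.
Qed.

Lemma is_int01_ext (f g : R -> C) (v : C) :
  (forall u, (0 < u)%R -> f u = g u) -> is_int01 f v -> is_int01 g v.
Proof.
  move=> e [hc H]. split.
  - move=> u hu. apply: continuous_ext_loc (hc u hu).
    have hu0 : (0 < u)%R by lra.
    exists (mkposreal _ hu0) => z. rewrite /ball /= /AbsRing_ball /abs /minus /plus /opp /=.
    move=> /Rabs_def2 hz. apply: e. lra.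
  - move=> eps he. case: (H eps he) => d [hd Hd]. exists d. split => // a ha ha1.
    have -> : CRInt g a 1 = CRInt f a 1; last exact: Hd.
    rewrite /CRInt; apply: (@RInt_ext C_R_CompleteNormedModule) => t. rewrite Rmin_left // => ht. rewrite e //. lra.
Qed.

Lemma is_int01_plus (f g : R -> C) (v w : C) :
  is_int01 f v -> is_int01 g w -> is_int01 (fun u => f u + g u) (v + w).
Proof.
  move=> [hc H] [hc' H']. split.
  - move=> u hu. apply: (@continuous_plus _ _ C_R_NormedModule); [exact: hc | exact: hc'].
  - move=> eps he. have he2 : (0 < eps / 2)%R by lra.
    case: (H _ he2) => d [hd Hd]. case: (H' _ he2) => d' [hd' Hd'].
    exists (Rmin d d'). split; first exact: Rmin_pos. move=> a ha ha1.
    have h3 := Rmin_l d d'. have h4 := Rmin_r d d'.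
    have -> : CRInt (fun u => f u + g u) a 1 = CRInt f a 1 + CRInt g a 1.
      apply: CRInt_eq. apply: (is_RInt_plus (V := C_R_NormedModule)); apply: CRInt_correct => //; lra.
    have -> : CRInt f a 1 + CRInt g a 1 - (v + w) = (CRInt f a 1 - v) + (CRInt g a 1 - w) by ring.
    apply: Rle_lt_trans (Cmod_triangle _ _) _.
    have := Hd a ltac:(lra) ha1. have := Hd' a ltac:(lra) ha1. lra.
Qed.

Lemma is_int01_scal (c : C) (f : R -> C) (v : C) :
  is_int01 f v -> is_int01 (fun u => c * f u) (c * v).
Proof.
  move=> [hc H]. split.
  - move=> u hu. apply: continuous_Cmult; [exact: continuous_const | exact: hc].
  - move=> eps he. have hc0 := Cmod_ge_0 c.
    have he2 : (0 < eps / (Cmod c + 1))%R by apply: Rdiv_lt_0_compat; lra.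
    case: (H _ he2) => d [hd Hd]. exists d. split => // a ha ha1.
    have -> : CRInt (fun u => c * f u) a 1 = c * CRInt f a 1.
      apply: CRInt_eq. apply: is_RInt_Cscal. apply: CRInt_correct => //; lra.
    have -> : c * CRInt f a 1 - c * v = c * (CRInt f a 1 - v) by ring.
    rewrite Cmod_mult. have := Hd a ha ha1.
    move/Rlt_div_r => h. have {}h := h ltac:(lra). have := Cmod_ge_0 (CRInt f a 1 - v). nra.
Qed.

Lemma is_int01_minus (f g : R -> C) (v w : C) :
  is_int01 f v -> is_int01 g w -> is_int01 (fun u => f u - g u) (v - w).
Proof.
  move=> H H'. have := is_int01_plus _ _ _ _ H (is_int01_scal (-(1)) _ _ H').
  have -> : v + -(1) * w = v - w by ring. apply: is_int01_ext => u _. ring.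
Qed.

Lemma is_int01_Csum (f : nat -> R -> C) (v : nat -> C) (n : nat) :
  (forall k, is_int01 (f k) (v k)) -> is_int01 (fun u => Csum (fun k => f k u) n) (Csum v n).
Proof.
  move=> H. elim: n => [|n IH] /=; last exact: is_int01_plus.
  split; first by move=> u _; exact: continuous_const.
  move=> eps he. exists 1%R. split; first lra. move=> a ha ha1.
  have -> : CRInt (fun _ => RtoC 0) a 1 = RtoC (1 - a) * 0 by apply: CRInt_eq; exact: is_RInt_C_const.
  have -> : RtoC (1 - a) * 0 - 0 = 0 by ring. by rewrite Cmod_0.
Qed.

Section Dominated.
Variables (f : R -> C) (g P : R -> R).
Hypothesis fc : cont01 f.
Hypothesis gc : forall u, (0 < u <= 1)%R -> continuous g u.
Hypothesis gP : forall u, (0 < u <= 1)%R -> is_derive P u (g u).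
Hypothesis fg : forall u, (0 < u <= 1)%R -> (Cmod (f u) <= g u)%R.

Lemma CRInt_dominated (a b : R) : (0 < a <= b)%R -> (b <= 1)%R -> (Cmod (CRInt f a b) <= P b - P a)%R.
Proof.
  move=> ha hb.
  have I : is_RInt g a b (P b - P a)%R.
    apply: (@is_RInt_derive R_CompleteNormedModule) => t; rewrite Rmin_left ?Rmax_right; try lra; move=> ht.
      apply: gP; lra.
    apply: gc; lra.
  apply: (is_RInt_C_le _ _ _ _ _ _ (proj2 ha) _ (CRInt_correct _ _ _ fc ha hb) I).
  move=> x hx. apply: fg. lra.
Qed.

Hypothesis P0 : forall u, (0 < u <= 1)%R -> (0 <= P u)%R.

Lemma is_int01_bound (v : C) : is_int01 f v -> (Cmod v <= P 1%R)%R.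
Proof.
  move=> [_ H]. apply: le_epsilon => eps he. case: (H eps he) => d [hd Hd].
  set a := (Rmin d 1 / 2)%R. have h1 := Rmin_l d 1. have h2 := Rmin_r d 1.
  have h3 : (0 < Rmin d 1)%R by apply: Rmin_pos; lra.
  have a1 : (0 < a < d)%R by rewrite /a; lra. have a2 : (a <= 1)%R by rewrite /a; lra.
  have := Hd a a1 a2.
  have := CRInt_dominated a 1 (conj (proj1 a1) a2) (Rle_refl _).
  have := P0 a (conj (proj1 a1) a2).
  have := Cmod_minus_le (CRInt f a 1) (CRInt f a 1 - v).
  have -> : CRInt f a 1 - (CRInt f a 1 - v) = v by ring.
  lra.
Qed.

Hypothesis Plim : forall eps : R, (0 < eps)%R -> exists d : R, (0 < d)%R /\
  forall a, (0 < a < d)%R -> (a <= 1)%R -> (P a < eps)%R.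

(** Cauchy's criterion at [0]: over [[a, b]] the integral is at most [P b - P a <= P b], which is
    small. An explicit primitive [P] stands for the integrability of the majorant. *)
Lemma is_int01_ex : exists v, is_int01 f v.
Proof.
  have key eps : (0 < eps)%R -> exists d : R, (0 < d)%R /\ forall a b, (0 < a < d)%R -> (0 < b < d)%R ->
     (a <= 1)%R -> (b <= 1)%R -> (Cmod (CRInt f a 1 - CRInt f b 1) < eps)%R.
    move=> he. case: (Plim eps he) => d [hd Hd]. exists d. split => // a b.
    have C1 x y : (0 < x < d)%R -> (0 < y < d)%R -> (x <= y)%R -> (y <= 1)%R -> (Cmod (CRInt f x 1 - CRInt f y 1) < eps)%R.
      move=> hx hy hxy hy1.
      have e : CRInt f x 1 = CRInt f x y + CRInt f y 1.
        apply: CRInt_eq. apply: (is_RInt_Chasles (V := C_R_NormedModule)); apply: CRInt_correct => //; lra.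
      have -> : CRInt f x 1 - CRInt f y 1 = CRInt f x y by rewrite e; ring.
      have := CRInt_dominated x y ltac:(lra) hy1. have := P0 x ltac:(lra). have := Hd y hy hy1. lra.
    move=> ha hb ha1 hb1. case: (Rle_lt_dec a b) => h; first exact: C1.
    rewrite Cmod_minus_sym. apply: C1 => //. lra.
  have [v Hv] : exists v, Cseq_lim (fun n => CRInt f (/ INR (S n)) 1) v.
    apply: Cseq_cauchy => eps he. case: (key eps he) => d [hd Hd].
    have [N hN] : exists N, forall n, (N <= n)%nat -> (/ INR (S n) < d)%R.
      have := is_lim_seq_INR. move/(is_lim_seq_incr_1 INR) => h.
      have /is_lim_seq_spec /(_ (mkposreal _ hd)) [N hN] := is_lim_seq_inv _ _ h ltac:(done).
      exists N => n /hN /=. rewrite Rminus_0_r => /Rabs_def2. lra.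
    have bd n : (0 < / INR (S n) <= 1)%R.
      have h : (1 <= INR (S n))%R by rewrite S_INR; have := pos_INR n; lra.
      split; first by apply: Rinv_0_lt_compat; lra. rewrite -Rinv_1. apply: Rinv_le_contravar; lra.
    exists N => n m /hN hn /hN hm. have := bd n. have := bd m. move=> b1 b2.
    apply: Hd; lra.
  exists v. split => // eps he. have he2 : (0 < eps / 2)%R by lra.
  case: (key _ he2) => d [hd Hd]. exists d. split => // a ha ha1.
  move/Cseq_limE/(_ _ he2): Hv => [N1 h1].
  have := is_lim_seq_INR. move/(is_lim_seq_incr_1 INR) => h.
  have /is_lim_seq_spec /(_ (mkposreal _ hd)) [N hN] := is_lim_seq_inv _ _ h ltac:(done).
  set n := (N1 + N)%nat.
  have hn1 := h1 n ltac:(rewrite /n; lia).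
  have := hN n ltac:(rewrite /n; lia). rewrite /= Rminus_0_r => /Rabs_def2 hn2.
  change (match n with O => 1 | S _ => INR n + 1 end)%R with (INR (S n)) in hn2.
  have hx : (1 <= INR (S n))%R by rewrite S_INR; have := pos_INR n; lra.
  have b1 : (0 < / INR (S n) <= 1)%R.
    split; first by apply: Rinv_0_lt_compat; lra. rewrite -Rinv_1. apply: Rinv_le_contravar; lra.
  have := Hd a (/ INR (S n))%R ha ltac:(lra) ha1 ltac:(lra).
  have := Cmod_minus_triangle (CRInt f a 1) (CRInt f (/ INR (S n)) 1) v. lra.
Qed.
End Dominated.

Lemma Rpower_pos (x y : R) : (0 < Rpower x y)%R.
Proof. exact: exp_pos. Qed.

Lemma Rpower_le1 (u t : R) : (0 < u <= 1)%R -> (0 <= t)%R -> (Rpower u t <= 1)%R.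
Proof.
  move=> hu ht. rewrite /Rpower -exp_0. apply: exp_le.
  have : (ln u <= 0)%R by rewrite -ln_1; apply: ln_le; lra. nra.
Qed.

Lemma is_derive_extR (f g : R -> R) (x l : R) :
  (forall t, f t = g t :> R) -> is_derive f x l -> is_derive g x l.
Proof. exact: is_derive_ext. Qed.

Lemma is_derive_Rpower (u t : R) : (0 < u)%R -> is_derive (fun u => Rpower u t) u (t * Rpower u (t - 1))%R.
Proof.
  move=> hu. have /is_derive_Reals := derivable_pt_lim_power u t hu. exact.
Qed.

Lemma continuous_Rpower (u t : R) : (0 < u)%R -> continuous (fun u => Rpower u t) u.
Proof. move=> /is_derive_Rpower. move/(_ t). exact: continuous_of_derive. Qed.

Lemma Rpower_small (t eps : R) : (0 < t)%R -> (0 < eps)%R ->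
  exists d, (0 < d)%R /\ forall a, (0 < a < d)%R -> (Rpower a t < eps)%R.
Proof.
  move=> ht he. exists (Rpower eps (/ t)). split; first exact: Rpower_pos.
  move=> a ha. have -> : eps = Rpower (Rpower eps (/ t)) t.
    rewrite Rpower_mult Rinv_l; last lra. by rewrite Rpower_1.
  apply: Rlt_Rpower_l; lra.
Qed.

Lemma is_int01_power (f : R -> C) (A t : R) : (0 < t)%R -> (0 <= A)%R -> cont01 f ->
  (forall u, (0 < u <= 1)%R -> (Cmod (f u) <= A * Rpower u (t - 1))%R) ->
  (exists v, is_int01 f v) /\ (forall v, is_int01 f v -> (Cmod v <= A / t)%R).
Proof.
  move=> ht hA fc fb.
  have gc u : (0 < u <= 1)%R -> continuous (fun u => A * Rpower u (t - 1))%R u.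
    move=> hu. apply: (@continuous_mult _ R_AbsRing); first exact: continuous_const.
    apply: continuous_Rpower; lra.
  have gP u : (0 < u <= 1)%R -> is_derive (fun u => A * Rpower u t / t)%R u (A * Rpower u (t - 1))%R.
    move=> hu. have := is_derive_scal _ _ (A / t)%R _ (is_derive_Rpower u t ltac:(lra)).
    rewrite /scal /= /mult /=.
    have -> : (A / t * (t * Rpower u (t - 1)) = A * Rpower u (t - 1))%R by field; lra.
    apply: is_derive_extR => y. field. lra.
  have P0 u : (0 < u <= 1)%R -> (0 <= A * Rpower u t / t)%R.
    move=> _. apply: Rdiv_le_0_compat => //. apply: Rmult_le_pos => //. exact: Rlt_le (Rpower_pos _ _).
  split.
  - apply: (is_int01_ex f _ _ fc gc gP fb P0) => eps he.
    have he2 : (0 < eps * t / (A + 1))%R by apply: Rdiv_lt_0_compat; nra.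
    case: (Rpower_small t _ ht he2) => d [hd Hd]. exists d; split => // a ha _.
    have := Hd a ha. move/(Rlt_div_r _ _ _) => h. have {}h := h ltac:(lra).
    apply/Rlt_div_l => //. have := Rpower_pos a t. nra.
  - move=> v hv. have := is_int01_bound f _ _ fc gc gP fb P0 v hv.
    have -> : Rpower 1 t = 1%R by rewrite /Rpower ln_1 Rmult_0_r exp_0. by rewrite Rmult_1_r.
Qed.

(** The majorant integrates to [A (1/t - 1/(t + 1))]: the factor [1 - u] gains a second power of
    decay in [t], which the asymptotics of [mG] and the summability of [ka] rely on. *)
Lemma is_int01_power2 (f : R -> C) (A t : R) (v : C) : (0 < t)%R -> (0 <= A)%R -> cont01 f ->
  (forall u, (0 < u <= 1)%R -> (Cmod (f u) <= A * ((1 - u) * Rpower u (t - 1)))%R) ->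
  is_int01 f v -> (Cmod v <= A / (t * (t + 1)))%R.
Proof.
  move=> ht hA fc fb hv.
  have Rp1 u : (0 < u <= 1)%R -> (u * Rpower u (t - 1) = Rpower u t)%R.
    move=> hu. rewrite -{1}(Rpower_1 u) -?Rpower_plus; try lra. f_equal. ring.
  have gc u : (0 < u <= 1)%R -> continuous (fun u => A * ((1 - u) * Rpower u (t - 1)))%R u.
    move=> hu. apply: (@continuous_mult _ R_AbsRing); first exact: continuous_const.
    apply: (@continuous_mult _ R_AbsRing); last by apply: continuous_Rpower; lra.
    apply: (@ex_derive_continuous R_AbsRing R_NormedModule). by auto_derive.
  have gP u : (0 < u <= 1)%R -> is_derive (fun u => A * (Rpower u t / t - Rpower u (t + 1) / (t + 1)))%R u (A * ((1 - u) * Rpower u (t - 1)))%R.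
    move=> hu.
    have D1 := is_derive_scal _ _ (/ t)%R _ (is_derive_Rpower u t ltac:(lra)).
    have D2 := is_derive_scal _ _ (/ (t + 1))%R _ (is_derive_Rpower u (t + 1) ltac:(lra)).
    have := is_derive_scal _ _ A _ (is_derive_minus _ _ _ _ _ D1 D2).
    rewrite /minus /plus /opp /scal /= /mult /=.
    have -> : (t + 1 - 1 = t)%R by ring. rewrite -Rp1 //.
    have -> : (A * (/ t * (t * Rpower u (t - 1)) + - (/ (t + 1) * ((t + 1) * (u * Rpower u (t - 1)))))
      = A * ((1 - u) * Rpower u (t - 1)))%R by field; lra.
    apply: is_derive_extR => y. field. lra.
  have P0 u : (0 < u <= 1)%R -> (0 <= A * (Rpower u t / t - Rpower u (t + 1) / (t + 1)))%R.
    move=> hu. apply: Rmult_le_pos => //.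
    have -> : (Rpower u (t + 1) = u * Rpower u t)%R.
      rewrite -{2}(Rpower_1 u) -?Rpower_plus; try lra. f_equal. ring.
    have hp := Rpower_pos u t.
    have -> : (Rpower u t / t - u * Rpower u t / (t + 1) = Rpower u t * ((t + 1 - u * t) / (t * (t + 1))))%R by field; lra.
    apply: Rmult_le_pos; first lra. apply: Rdiv_le_0_compat; nra.
  have := is_int01_bound f _ _ fc gc gP fb P0 v hv.
  rewrite /Rpower ln_1 !Rmult_0_r exp_0.
  by have -> : (A * (1 / t - 1 / (t + 1)) = A / (t * (t + 1)))%R by field; lra.
Qed.

(** Growth below every negative power at [0]: closed under products, satisfied by [ln] and [ellw],
    and sufficient for the Mellin transform to exist on the whole half-plane [Re z > 0]. *)
Definition slow (phi : R -> R) : Prop :=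
  (forall u, (0 < u <= 1)%R -> continuous phi u) /\
  forall e, (0 < e)%R -> exists A, (0 <= A)%R /\
    forall u, (0 < u <= 1)%R -> (Rabs (phi u) <= A * Rpower u (- e))%R.

Lemma slow_mult (f g : R -> R) : slow f -> slow g -> slow (fun u => f u * g u)%R.
Proof.
  move=> [c H] [c' H']. split.
  - move=> u hu. apply: (@continuous_mult _ R_AbsRing); [exact: c | exact: c'].
  - move=> e he. have he2 : (0 < e / 2)%R by lra.
    case: (H _ he2) => A [hA HA]. case: (H' _ he2) => A' [hA' HA'].
    exists (A * A')%R. split; first exact: Rmult_le_pos. move=> u hu.
    have -> : (- e = - (e / 2) + - (e / 2))%R by field. rewrite Rpower_plus Rabs_mult.
    have := Rmult_le_compat _ _ _ _ (Rabs_pos _) (Rabs_pos _) (HA u hu) (HA' u hu). lra.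
Qed.

Lemma slow_const (c : R) : slow (fun _ => c).
Proof.
  split; first by move=> u _; exact: continuous_const.
  move=> e he. exists (Rabs c). split; first exact: Rabs_pos. move=> u hu.
  have : (1 <= Rpower u (- e))%R.
    rewrite Rpower_Ropp -Rinv_1. apply: Rinv_le_contravar; first exact: Rpower_pos. apply: Rpower_le1; lra.
  have := Rabs_pos c. nra.
Qed.

Lemma slow_plus (f g : R -> R) : slow f -> slow g -> slow (fun u => f u + g u)%R.
Proof.
  move=> [c H] [c' H']. split.
  - move=> u hu. apply: (@continuous_plus _ _ R_NormedModule); [exact: c | exact: c'].
  - move=> e he.
    case: (H _ he) => A [hA HA]. case: (H' _ he) => A' [hA' HA'].
    exists (A + A')%R. split; first lra. move=> u hu.
    have := Rabs_triang (f u) (g u). have := HA u hu. have := HA' u hu. lra.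
Qed.

Lemma slow_le (f g : R -> R) : (forall u, (0 < u <= 1)%R -> continuous f u) ->
  (forall u, (0 < u <= 1)%R -> (Rabs (f u) <= Rabs (g u))%R) -> slow g -> slow f.
Proof.
  move=> hc hfg [_ H]. split => // e he. case: (H _ he) => A [hA HA]. exists A. split => // u hu.
  exact: Rle_trans (hfg u hu) (HA u hu).
Qed.

Lemma ln_01 (u : R) : (0 < u <= 1)%R -> (ln u <= 0)%R.
Proof. move=> h. rewrite -ln_1. apply: ln_le; lra. Qed.

Lemma slow_ln : slow ln.
Proof.
  split.
  - move=> u hu. apply: (@ex_derive_continuous R_AbsRing R_NormedModule). auto_derive. lra.
  - move=> e he. exists (/ e)%R. split; first by apply: Rlt_le; exact: Rinv_0_lt_compat.
    move=> u hu. rewrite Rabs_left1; last exact: ln_01.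
    have h := exp_ineq1_le (- e * ln u). rewrite /Rpower.
    apply: (Rmult_le_reg_l e) => //.
    have -> : (e * (/ e * exp (- e * ln u)) = exp (- e * ln u))%R by field; lra. lra.
Qed.

Lemma slow_ellw : slow ellw.
Proof.
  case: ellw_log => A [hA H].
  apply: (slow_le _ (fun u => A + (- / 2) * ln u)%R).
  - move=> u hu. apply: continuous_ellw. lra.
  - move=> u hu. have := H u hu. have := ln_01 u hu. have := ellw_ge u ltac:(lra) ltac:(lra). have := PI_RGT_0.
    move=> h1 h2 h3 /Rabs_le_between h4. rewrite !Rabs_pos_eq; lra.
  - apply: slow_plus; first exact: slow_const. apply: slow_mult; [exact: slow_const | exact: slow_ln].
Qed.

Definition mellin_fun (phi : R -> R) (z : C) (u : R) : C := Rcpow u (z - 1) * RtoC (phi u).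

Definition mellin (phi : R -> R) (z : C) : C := Ciota (is_int01 (mellin_fun phi z)).

Lemma cdiff_Rcpow (u : R) (z : C) : (0 < u)%R ->
  cdiff RtoC (fun u => Rcpow u z) u (z * Rcpow u (z - 1)).
Proof.
  move=> hu.
  have -> : z * Rcpow u (z - 1) = Cexp (z * RtoC (ln u)) * (0 * RtoC (ln u) + z * RtoC (/ u)).
    have -> : z - 1 = z + - (1) by ring. rewrite Rcpow_plus Rcpow_opp Rcpow_1 // RtoC_inv; last lra.
    rewrite /Rcpow. ring.
  apply: (cdiff_comp RtoC (fun u => z * RtoC (ln u)) Cexp); last exact: cdiff_Cexp.
  apply: cdiff_mult; first exact: cdiff_const.
  apply: cdiff_RtoC. auto_derive => //. ring.
Qed.

Lemma continuous_Rcpow (u : R) (z : C) : (0 < u)%R ->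
  continuous (U := C_R_NormedModule) (fun u => Rcpow u z) u.
Proof. move=> hu. exact: cdiff_continuous (cdiff_Rcpow u z hu). Qed.

Lemma Re_minus_1 (z : C) : Re (z - 1) = (Re z - 1)%R.
Proof. by case: z. Qed.

Lemma cont01_mellin (phi : R -> R) (z : C) :
  (forall u, (0 < u <= 1)%R -> continuous phi u) -> cont01 (mellin_fun phi z).
Proof.
  move=> h u hu. apply: continuous_Cmult; first by apply: continuous_Rcpow; lra.
  apply: continuous_RtoC. exact: h.
Qed.

Lemma mellin_correct (phi : R -> R) (z : C) : slow phi -> (0 < Re z)%R ->
  is_int01 (mellin_fun phi z) (mellin phi z).
Proof.
  move=> [hc H] hz. have he : (0 < Re z / 2)%R by lra.
  case: (H _ he) => A [hA HA].
  have hb u : (0 < u <= 1)%R -> (Cmod (mellin_fun phi z u) <= A * Rpower u (Re z / 2 - 1))%R.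
    move=> hu. rewrite /mellin_fun Cmod_mult Cmod_Rcpow Cmod_R Re_minus_1.
    have -> : (Re z / 2 - 1 = (Re z - 1) + - (Re z / 2))%R by field.
    rewrite Rpower_plus. have h1 := HA u hu. have h2 := Rpower_pos u (Re z - 1). nra.
  have [[v hv] _] := is_int01_power (mellin_fun phi z) A (Re z / 2) he hA (cont01_mellin _ _ hc) hb.
  have -> : mellin phi z = v => //.
  apply: Ciota_eq => //. exact: is_int01_unique.
Qed.

Lemma mellin_eq (phi : R -> R) (z v : C) : is_int01 (mellin_fun phi z) v -> mellin phi z = v.
Proof. apply: Ciota_eq. exact: is_int01_unique. Qed.

(** * The Mellin transform of w: recurrence, Gamma product, derivative *)

Definition mG (z : C) : C := mellin ellw z.
Definition mG1 (z : C) : C := mellin (fun u => ln u * ellw u)%R z.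

Lemma slow_lnw : slow (fun u => ln u * ellw u)%R.
Proof. exact: slow_mult slow_ln slow_ellw. Qed.

(** Integrate the derivative of [u^z (q - z (1 - u) w)]; both boundary terms vanish. *)
Lemma mG_S (z : C) : (0 < Re z)%R -> z * z * mG z = (z + 1 / 2) * (z + 1 / 2) * mG (z + 1).
Proof.
  move=> hz. have hz1 : (0 < Re (z + 1))%R by rewrite Re_plus /=; lra.
  have I := is_int01_minus _ _ _ _ (is_int01_scal ((z + 1 / 2) * (z + 1 / 2)) _ _ (mellin_correct _ _ slow_ellw hz1))
    (is_int01_scal (z * z) _ _ (mellin_correct _ _ slow_ellw hz)).
  pose F u := Rcpow u z * (RtoC (ellq u) - z * RtoC ((1 - u) * ellw u)).
  pose f u := Rcpow u (z - 1) * RtoC (ellw u) * ((z + 1 / 2) * (z + 1 / 2) * RtoC u - z * z).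
  have I' : is_int01 f ((z + 1 / 2) * (z + 1 / 2) * mG (z + 1) - z * z * mG z).
    apply: is_int01_ext I => u hu. rewrite /mellin_fun /f.
    have -> : z + 1 - 1 = (z - 1) + 1 by ring. rewrite Rcpow_plus Rcpow_1 //. ring.
  have D u : (0 < u)%R -> cdiff RtoC F u (f u).
    move=> hu.
    have h2 : is_derive (fun u => (1 - u) * ellw u)%R u (- ellw u + (1 - u) * ellw1 u)%R.
      have h := is_derive_ellw _ hu. auto_derive; first by exists (ellw1 u).
      rewrite (is_derive_unique _ _ _ h). ring.
    have := cdiff_mult _ _ _ _ _ _ (cdiff_Rcpow u z hu)
      (cdiff_minus _ _ _ _ _ _ (cdiff_RtoC _ _ _ (is_derive_ellq u hu)) (cdiff_scal _ z _ _ _ (cdiff_RtoC _ _ _ h2))).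
    suff -> : f u = z * Rcpow u (z - 1) * (RtoC (ellq u) - z * RtoC ((1 - u) * ellw u)) +
      Rcpow u z * (RtoC (ellw u / 4) - z * RtoC (- ellw u + (1 - u) * ellw1 u)) by [].
    have -> : Rcpow u z = Rcpow u (z - 1) * RtoC u.
      have {1}-> : z = (z - 1) + 1 by ring. by rewrite Rcpow_plus Rcpow_1.
    have -> : RtoC (ellw u / 4) = RtoC (ellw u) * / RtoC 4 by rewrite RtoC_div //; lra.
    have n2 : RtoC 2 <> 0 by move/RtoC_inj; lra.
    have n4 : RtoC 4 <> 0 by move/RtoC_inj; lra.
    have sq : (z + 1 / 2) * (z + 1 / 2) = z * z + z + / RtoC 4.
      have -> : RtoC 4 = RtoC 2 * RtoC 2 by rewrite -RtoC_mult; f_equal; ring. by field.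
    rewrite /f /ellq sq. move: (/ RtoC 4) => k.
    rewrite !RtoC_plus !RtoC_opp !RtoC_mult !RtoC_minus.
    move: (RtoC (ellw1 u)) (RtoC (ellw u)) (RtoC u) (Rcpow u (z - 1)) => W1 W U r. ring.
  (* At [1] both [ellq] and [1 - u] vanish; at [0] the bracket grows at most like [u^(- Re z / 2)],
     which the factor [u^z] outweighs. *)
  have I0 : is_int01 f 0.
    split; first exact: (proj1 I').
    move=> eps he. have [_ Hs] := slow_ellw. have he2 : (0 < Re z / 2)%R by lra.
    case: (Hs _ he2) => A [hA HA]. have z0 := Cmod_ge_0 z. have pi0 := PI_RGT_0.
    have hB : (0 < PI + Cmod z * A)%R by have := Rmult_le_pos _ _ z0 hA; lra.
    case: (Rpower_small _ _ he2 (Rdiv_lt_0_compat _ _ he hB)) => d [hd Hd].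
    exists d. split => // a ha ha1.
    have -> : CRInt f a 1 = F 1%R - F a.
      apply: CRInt_eq. apply: is_RInt_FTC_C => x; rewrite Rmin_left // Rmax_right // => hx.
        apply: D. lra.
      apply: (proj1 I'). lra.
    have -> : F 1%R = 0 by rewrite /F ellq_1 Rminus_diag Rmult_0_l; ring.
    have -> : 0 - F a - 0 = - F a by ring. rewrite Cmod_opp /F Cmod_mult Cmod_Rcpow.
    have ha2 : (0 < a <= 1)%R by lra.
    have b1 : (Cmod (RtoC (ellq a) - z * RtoC ((1 - a) * ellw a)) <= (PI + Cmod z * A) * Rpower a (- (Re z / 2)))%R.
      apply: Rle_trans (Cmod_minus_le _ _) _. rewrite Cmod_mult !Cmod_R.
      have c1 := ellq_bound a ha2. have c2 := HA a ha2.
      have c3 : (Rabs ((1 - a) * ellw a) <= A * Rpower a (- (Re z / 2)))%R.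
        rewrite Rabs_mult (Rabs_pos_eq (1 - a)); last lra. have := Rabs_pos (ellw a). nra.
      have c4 : (1 <= Rpower a (- (Re z / 2)))%R.
        rewrite Rpower_Ropp -Rinv_1. apply: Rinv_le_contravar; first exact: Rpower_pos. apply: Rpower_le1; lra.
      have := Rmult_le_compat_l _ _ _ z0 c3. nra.
    have hp := Rpower_pos a (Re z).
    apply: Rle_lt_trans (Rmult_le_compat_l _ _ _ (Rlt_le _ _ hp) b1) _.
    have -> : (Rpower a (Re z) * ((PI + Cmod z * A) * Rpower a (- (Re z / 2))) =
      Rpower a (Re z / 2) * (PI + Cmod z * A))%R.
      have -> : (Re z / 2 = Re z + - (Re z / 2))%R by field. 
      have -> : (- (Re z + - (Re z / 2)) = - (Re z / 2))%R by field.
      rewrite Rpower_plus. ring.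
    apply/Rlt_div_r => //. exact: Hd.
  have := is_int01_unique _ _ _ I' I0 => e.
  have -> : (z + 1 / 2) * (z + 1 / 2) * mG (z + 1) = ((z + 1 / 2) * (z + 1 / 2) * mG (z + 1) - z * z * mG z) + z * z * mG z by ring.
  rewrite e. ring.
Qed.

(** [4 * ellq] is a primitive of [ellw], with value [0] at [1] and limit [- 2] at [0]. This is the
    only Mellin value computed directly; it yields Gamma(1/2). *)
Lemma mG_1 : mG 1 = 2.
Proof.
  apply: mellin_eq. split; first exact: cont01_mellin (proj1 slow_ellw).
  move=> eps he. have pi0 := PI_RGT_0.
  have he1 : (0 < eps / (4 * PI))%R by apply: Rdiv_lt_0_compat; lra.
  have h2 : (0 < 1 / 2)%R by lra.
  case: (Rpower_small _ _ h2 he1) => d [hd Hd]. exists d. split => // a ha ha1.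
  have -> : CRInt (mellin_fun ellw 1) a 1 = RtoC (4 * ellq 1) - RtoC (4 * ellq a).
    apply: CRInt_eq.
    apply: is_RInt_ext (_ : is_RInt (V := C_R_NormedModule) (fun u => RtoC (ellw u)) _ _ _).
      move=> x _. rewrite /mellin_fun. have -> : 1 - 1 = 0 by ring. by rewrite Rcpow_0 Cmult_1_l.
    apply: (is_RInt_FTC_C (fun u => RtoC (4 * ellq u))) => x; rewrite Rmin_left // Rmax_right // => hx.
    - apply: cdiff_RtoC. have -> : ellw x = (4 * (ellw x / 4))%R by field.
      apply: is_derive_scal. apply: is_derive_ellq. lra.
    - apply: continuous_RtoC. apply: continuous_ellw. lra.
  rewrite ellq_1 Rmult_0_r -!RtoC_minus Cmod_R.
  have ha2 : (0 < a <= 1)%R by lra.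
  have := ellq_near_0 a ha2. have := Hd a ha. have -> : (1 / 2 = / 2)%R by field. rewrite Rpower_sqrt; last lra.
  move/(Rlt_div_r _ _ _) => h. have {}h := h ltac:(lra).
  have -> : (0 - 4 * ellq a - 2 = - (4 * (ellq a + / 2)))%R by field.
  rewrite Rabs_Ropp Rabs_mult (Rabs_pos_eq 4); lra.
Qed.

Lemma mellin_1 (z : C) : (0 < Re z)%R -> is_int01 (fun u => Rcpow u (z - 1)) (/ z).
Proof.
  move=> hz. have z0 : z <> 0 by move=> e; rewrite e /= in hz; lra.
  split; first by move=> u hu; apply: continuous_Rcpow; lra.
  move=> eps he.
  have cz : (0 < Cmod z)%R by apply/Cmod_gt_0.
  case: (Rpower_small _ _ hz (Rmult_lt_0_compat _ _ he cz)) => d [hd Hd]. exists d. split => // a ha ha1.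
  have -> : CRInt (fun u => Rcpow u (z - 1)) a 1 = / z * Rcpow 1 z - / z * Rcpow a z.
    apply: CRInt_eq. apply: (is_RInt_FTC_C (fun u => / z * Rcpow u z)) => x; rewrite Rmin_left // Rmax_right // => hx.
    - have -> : Rcpow x (z - 1) = / z * (z * Rcpow x (z - 1)) by field.
      apply: cdiff_scal. apply: cdiff_Rcpow. lra.
    - apply: continuous_Rcpow. lra.
  rewrite Rcpow_1_l. have -> : / z * 1 - / z * Rcpow a z - / z = - (Rcpow a z / z) by field.
  rewrite Cmod_opp Cmod_div // Cmod_Rcpow. apply/Rlt_div_l => //. exact: Hd.
Qed.

(** For large [Re z] the weight concentrates at [u = 1], where [ellw] is [PI / 2]; the difference is
    of order [(1 - u) / sqrt u], and the square root shifts the exponent by [1 / 2]. *)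
Lemma mG_asymp (z : C) : (1 / 2 < Re z)%R ->
  (Cmod (mG z - RtoC (PI / 2) / z) <= PI / 2 / ((Re z - 1 / 2) * (Re z + 1 / 2)))%R.
Proof.
  move=> hz. have hz0 : (0 < Re z)%R by lra. have pi0 := PI_RGT_0.
  have I := is_int01_minus _ _ _ _ (mellin_correct _ _ slow_ellw hz0) (is_int01_scal (RtoC (PI / 2)) _ _ (mellin_1 z hz0)).
  have -> : (Re z + 1 / 2 = Re z - 1 / 2 + 1)%R by field.
  apply: (is_int01_power2 _ _ _ _ _ _ (proj1 I) _ I); try lra.
  move=> u hu. rewrite /mellin_fun.
  have -> : Rcpow u (z - 1) * RtoC (ellw u) - RtoC (PI / 2) * Rcpow u (z - 1) =
    Rcpow u (z - 1) * RtoC (ellw u - PI / 2) by rewrite RtoC_minus; ring.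
  rewrite Cmod_mult Cmod_Rcpow Cmod_R Re_minus_1.
  have h1 := ellw_near_1 u ltac:(lra) ltac:(lra). have h2 := ellw_ge u ltac:(lra) ltac:(lra).
  rewrite Rabs_pos_eq; last lra.
  have hp := Rpower_pos u (Re z - 1).
  have -> : (Re z - 1 / 2 - 1 = (Re z - 1) + - / 2)%R by field.
  rewrite Rpower_plus Rpower_Ropp Rpower_sqrt; last lra.
  have := Rmult_le_compat_l _ _ _ (Rlt_le _ _ hp) h1. lra.
Qed.

Lemma mG_pochhammer (z : C) (n : nat) : (0 < Re z)%R ->
  pochhammer z n * pochhammer z n * mG z =
  pochhammer (z + 1 / 2) n * pochhammer (z + 1 / 2) n * mG (z + RtoC (INR n)).
Proof.
  move=> hz. elim: n => [|n IH].
    rewrite /=. have -> : z + 0 = z by ring. ring.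
  simpl pochhammer. rewrite S_INR RtoC_plus.
  have h : (0 < Re (z + RtoC (INR n)))%R by rewrite Re_plus_INR; have := pos_INR n; lra.
  have e := mG_S _ h.
  have -> : z + (RtoC (INR n) + 1) = z + RtoC (INR n) + 1 by ring.
  have -> : pochhammer z n * (z + RtoC (INR n)) * (pochhammer z n * (z + RtoC (INR n))) * mG z =
    (z + RtoC (INR n)) * (z + RtoC (INR n)) * (pochhammer z n * pochhammer z n * mG z) by ring.
  rewrite IH.
  have -> : (z + RtoC (INR n)) * (z + RtoC (INR n)) * (pochhammer (z + 1 / 2) n * pochhammer (z + 1 / 2) n * mG (z + RtoC (INR n))) =
    pochhammer (z + 1 / 2) n * pochhammer (z + 1 / 2) n * ((z + RtoC (INR n)) * (z + RtoC (INR n)) * mG (z + RtoC (INR n))) by ring.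
  rewrite e. ring.
Qed.

Lemma half_RtoC : (1 / 2 : C) = RtoC (/ 2).
Proof. rewrite RtoC_inv; last lra. by rewrite /Cdiv Cmult_1_l. Qed.

Lemma Re_plus_half (z : C) : Re (z + 1 / 2) = (Re z + 1 / 2)%R.
Proof. rewrite Re_plus half_RtoC Re_RtoC. field. Qed.

(** Iterating the recurrence expresses [mG z] by [mG (z + n)], which is [PI / (2 n)] to first order,
    and by Pochhammer symbols that Gauss's product turns into Gamma functions. The asymptotics
    select this solution of the recurrence among all others. *)
Lemma mG_Gamma (z : C) : (0 < Re z)%R ->
  mG z = RtoC (PI / 2) * (CGamma z / CGamma (z + 1 / 2)) * (CGamma z / CGamma (z + 1 / 2)).
Proof.
  move=> hz. have pi0 := PI_RGT_0.
  have hz2 : (0 < Re (z + 1 / 2))%R by rewrite Re_plus_half; lra.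
  (* [gauss (S n)] contains a Pochhammer symbol with [S (S n)] factors, hence the mismatch between
     the multiplier and the shift. *)
  have L1 : Cseq_lim (fun n => RtoC (INR (S n)) * mG (z + RtoC (INR (S (S n))))) (RtoC (PI / 2)).
    apply: (Cseq_lim_bound _ _ (fun n => (PI / 2 + PI / 2 * Cmod (z + 1)) * / INR (S n))%R); last first.
      have -> : Finite 0 = Rbar_mult (PI / 2 + PI / 2 * Cmod (z + 1))%R 0 by rewrite /= Rmult_0_r.
      apply: is_lim_seq_scal_l. have := is_lim_seq_INR.
      move/(is_lim_seq_incr_1 INR) => h. exact: (is_lim_seq_inv _ _ h).
    move=> n. set m := INR (S n).
    have hm : (1 <= m)%R by rewrite /m S_INR; have := pos_INR n; lra.
    have em : INR (S (S n)) = (m + 1)%R by rewrite (S_INR (S n)).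
    set y := z + RtoC (INR (S (S n))).
    have hy : (Re y = Re z + m + 1)%R by rewrite /y Re_plus_INR em; ring.
    have cy : (m <= Cmod y)%R by have := Re_le_Cmod y; lra.
    have ny : y <> 0 by apply/Cmod_gt_0; lra.
    have -> : RtoC m * mG y - RtoC (PI / 2) =
      RtoC m * (mG y - RtoC (PI / 2) / y) + RtoC (- (PI / 2)) * ((z + 1) / y).
      have -> : RtoC m = y - (z + 1) by rewrite /y em RtoC_plus; ring.
      rewrite RtoC_opp. field. done.
    have a := mG_asymp y ltac:(lra).
    apply: Rle_trans (Cmod_triangle _ _) _.
    rewrite !Cmod_mult Cmod_inv // !Cmod_R (Rabs_pos_eq m); last lra.
    rewrite Rabs_left; last lra.
    have b1 : (m * Cmod (mG y - RtoC (PI / 2) / y) <= PI / 2 * / m)%R.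
      apply: Rle_trans (Rmult_le_compat_l _ _ _ _ a) _; first lra.
      have -> : (m * (PI / 2 / ((Re y - 1 / 2) * (Re y + 1 / 2))) = PI / 2 * (m / ((Re y - 1 / 2) * (Re y + 1 / 2))))%R.
        field. split; lra.
      apply: Rmult_le_compat_l; first lra. apply/Rle_div_l; first nra.
      have -> : (/ m * ((Re y - 1 / 2) * (Re y + 1 / 2)) = ((Re y - 1 / 2) * (Re y + 1 / 2)) / m)%R by field; lra.
      apply/Rle_div_r; first lra. nra.
    have b2 : (- - (PI / 2) * (Cmod (z + 1) * / Cmod y) <= PI / 2 * Cmod (z + 1) * / m)%R.
      rewrite Ropp_involutive -Rmult_assoc. apply: Rmult_le_compat_l.
        have := Cmod_ge_0 (z + 1). nra.
      apply: Rinv_le_contravar; lra.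
    lra.
  have L2 : Cseq_lim (fun n => gauss (S n) z * / gauss (S n) (z + 1 / 2)) (CGamma z / CGamma (z + 1 / 2)).
    apply: Cseq_lim_mult.
    - exact: (proj2 (Cseq_lim_S _ _) (CGamma_lim z hz)).
    - exact: (proj2 (Cseq_lim_S (fun n => / gauss n (z + 1 / 2)) _) (CGamma_inv_lim _ hz2)).
  have L := Cseq_lim_mult _ _ _ _ (Cseq_lim_mult _ _ _ _ L1 L2) L2.
  apply: Cseq_lim_unique (Cseq_lim_const (mG z)) _. move: L. apply: Cseq_lim_ext => n.
  have P := mG_pochhammer z (S (S n)) hz.
  have p1 := pochhammer_neq_0 z (S (S n)) hz. have p2 := pochhammer_neq_0 _ (S (S n)) hz2.
  have hx : (0 < INR (S n))%R by apply: lt_0_INR; lia.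
  have nx : RtoC (INR (S n)) <> 0 by move/RtoC_inj; lra.
  rewrite /gauss.
  (* The two half powers supply the factor [n] that balances the decay of [mG (z + n)]. *)
  have E : Rcpow (INR (S n)) (z + 1 / 2) * Rcpow (INR (S n)) (z + 1 / 2) = Rcpow (INR (S n)) z * Rcpow (INR (S n)) z * RtoC (INR (S n)).
    have n2 : RtoC 2 <> 0 by move/RtoC_inj; lra.
    have e : z + 1 / 2 + (z + 1 / 2) = z + z + 1 by field.
    by rewrite -(Rcpow_plus _ (z + 1 / 2)) e !Rcpow_plus Rcpow_1.
  have r0 := Rcpow_neq_0 (INR (S n)) (z + 1 / 2). have rz0 := Rcpow_neq_0 (INR (S n)) z.
  have f0 : RtoC (INR (fact (S n))) <> 0 by move/RtoC_inj; exact: INR_fact_neq_0.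
  move: P p1 p2 E r0 rz0 f0.
  move: (pochhammer z _) (pochhammer (z + 1 / 2) _) (mG z) (mG (z + RtoC (INR (S (S n))))) (Rcpow _ z) (Rcpow _ (z + 1 / 2)) (RtoC (INR (fact _))).
  move=> p p' g g' r r' F P p1 p2 E r0 rz0 f0.
  have -> : RtoC (INR (S n)) * g' * (F * r / p * / (F * r' / p')) * (F * r / p * / (F * r' / p')) =
    (p' * p' * g') * (r * r * RtoC (INR (S n))) / (p * p * (r' * r')).
    field. by repeat split.
  rewrite -P E. field. by repeat split.
Qed.

(** The product formula at [z = 1] reads [2 = (PI / 2) * (2 / Gamma(1/2))^2]. *)
Lemma CGamma_half_sq : CGamma (1 / 2) * CGamma (1 / 2) = RtoC PI.
Proof.
  have h1 : (0 < Re 1)%R by rewrite /=; lra.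
  have hh : (0 < Re (1 / 2))%R by rewrite half_RtoC Re_RtoC; lra.
  have := mG_Gamma 1 h1. rewrite mG_1 CGamma_1.
  have -> : 1 + 1 / 2 = 1 / 2 + 1 by ring. rewrite CGamma_S //.
  have g0 := CGamma_neq_0 _ hh. move: (CGamma _) g0 => g g0.
  have n2 : RtoC 2 <> 0 by move/RtoC_inj; lra.
  rewrite RtoC_div; last lra. move=> e.
  have -> : g * g = RtoC 2 * (g * g) / RtoC 2 by field.
  rewrite {1}e. field. by repeat split.
Qed.

Lemma cdiff_mG (z : C) : (0 < Re z)%R -> cdiff idC mG z (mG1 z).
Proof.
  move=> hz.
  have [_ Hs] := slow_mult _ _ (slow_mult _ _ slow_ln slow_ln) slow_ellw.
  set s := Re z in hz *. have he : (0 < s / 4)%R by lra.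
  case: (Hs _ he) => A [hA HA].
  (* Half of the exponent [s] is spent, a quarter on [ln^2 * ellw] and a quarter on
     [exp (|h| |ln u|)] from the Taylor bound; [u^(s/2 - 1)] remains, with integral
     [1 / (s / 2)]. *)
  apply: (cdiff_quad _ _ _ _ (A / (s / 2)) (s / 4)) => //.
  rewrite /idC => y hy. set h := y - z in hy *.
  have hy0 : (0 < Re y)%R.
    have := re_le_Cmod h. have -> : (Re h = Re y - Re z)%R by rewrite /h; case: (y) (z) => [? ?] [? ?].
    move=> /Rabs_le_between. rewrite -/s. lra.
  have I := is_int01_minus _ _ _ _ (is_int01_minus _ _ _ _ (mellin_correct _ _ slow_ellw hy0)
    (mellin_correct _ _ slow_ellw hz)) (is_int01_scal h _ _ (mellin_correct _ _ slow_lnw hz)).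
  rewrite -/(mG y) -/(mG z) -/(mG1 z) in I.
  have -> : mG y - mG z - mG1 z * h = mG y - mG z - h * mG1 z by ring.
  have -> : (A / (s / 2) * Cmod h ^ 2 = A * Cmod h ^ 2 / (s / 2))%R by field; lra.
  have h0 := Cmod_ge_0 h. have h2 := pow2_ge_0 (Cmod h).
  apply: (proj2 (is_int01_power _ (A * Cmod h ^ 2) (s / 2) _ _ (proj1 I) _)) => //; first lra.
    exact: Rmult_le_pos.
  move=> u hu. rewrite /mellin_fun.
  have -> : Rcpow u (y - 1) = Rcpow u (z - 1) * Rcpow u h.
    rewrite -Rcpow_plus. f_equal. rewrite /h. ring.
  rewrite RtoC_mult.
  have -> : Rcpow u (z - 1) * Rcpow u h * RtoC (ellw u) - Rcpow u (z - 1) * RtoC (ellw u) -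
    h * (Rcpow u (z - 1) * (RtoC (ln u) * RtoC (ellw u))) =
    Rcpow u (z - 1) * RtoC (ellw u) * (Rcpow u h - 1 - h * RtoC (ln u)) by ring.
  rewrite Cmod_mult (Cmod_mult (Rcpow _ _)) Cmod_Rcpow Cmod_R Re_minus_1 -/s.
  have T := Cexp_taylor (h * RtoC (ln u)). rewrite -/(Rcpow u h) in T.
  have l0 := ln_01 u hu.
  have ea : Cmod (h * RtoC (ln u)) = (Cmod h * - ln u)%R by rewrite Cmod_mult Cmod_R Rabs_left1.
  rewrite ea in T.
  have e1 : (exp (Cmod h * - ln u) <= Rpower u (- (s / 4)))%R.
    rewrite /Rpower. apply: exp_le. nra.
  have T2 : (Cmod (Rcpow u h - 1 - h * RtoC (ln u)) <= Cmod h ^ 2 * (ln u * ln u) * Rpower u (- (s / 4)))%R.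
    apply: Rle_trans T _. have -> : ((Cmod h * - ln u) ^ 2 = Cmod h ^ 2 * (ln u * ln u))%R by ring.
    apply: Rmult_le_compat_l => //. apply: Rmult_le_pos => //. nra.
  have HAu := HA u hu.
  have p1 := Rpower_pos u (s - 1). have p2 := Rpower_pos u (- (s / 4)).
  have w0 := Rabs_pos (ellw u).
  apply: Rle_trans (Rmult_le_compat_l _ _ _ _ T2) _; first nra.
  have -> : (Rpower u (s / 2 - 1) = Rpower u (s - 1) * Rpower u (- (s / 4)) * Rpower u (- (s / 4)))%R.
    rewrite -!Rpower_plus. f_equal. field.
  have E : (Rabs (ln u * ln u * ellw u) = (ln u * ln u) * Rabs (ellw u))%R.
    rewrite Rabs_mult Rabs_pos_eq //. nra.
  rewrite E in HAu.
  have -> : (Rpower u (s - 1) * Rabs (ellw u) * (Cmod h ^ 2 * (ln u * ln u) * Rpower u (- (s / 4))) =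
    (Cmod h ^ 2 * Rpower u (s - 1) * Rpower u (- (s / 4))) * (ln u * ln u * Rabs (ellw u)))%R by ring.
  have -> : (A * Cmod h ^ 2 * (Rpower u (s - 1) * Rpower u (- (s / 4)) * Rpower u (- (s / 4))) =
    (Cmod h ^ 2 * Rpower u (s - 1) * Rpower u (- (s / 4))) * (A * Rpower u (- (s / 4))))%R by ring.
  apply: Rmult_le_compat_l => //. apply: Rmult_le_pos; last lra. apply: Rmult_le_pos; lra.
Qed.

Lemma is_int01_real (g : R -> R) (v : C) : is_int01 (fun u => RtoC (g u)) v -> Im v = 0%R.
Proof.
  move=> [hc H]. have : Rabs (Im v) = 0%R; last by move=> e; apply: NNPP => /Rabs_no_R0.
  apply: Rle_antisym; last exact: Rabs_pos. apply: le_epsilon => eps he.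
  case: (H eps he) => d [hd Hd].
  set a := (Rmin d 1 / 2)%R. have h1 := Rmin_l d 1. have h2 := Rmin_r d 1.
  have h3 : (0 < Rmin d 1)%R by apply: Rmin_pos; lra.
  have a1 : (0 < a < d)%R by rewrite /a; lra. have a2 : (a <= 1)%R by rewrite /a; lra.
  have := Hd a a1 a2.
  have I := CRInt_correct _ a 1 hc (conj (proj1 a1) a2) (Rle_refl _).
  have := is_RInt_fct_extend_snd _ _ _ _ I => /= J.
  have := is_RInt_const (V := R_NormedModule) a 1 0. rewrite scal_zero_r => Z.
  have e : Im (CRInt (fun u => RtoC (g u)) a 1) = 0%R.
    rewrite -[LHS](is_RInt_unique _ _ _ _ J). exact: is_RInt_unique Z.
  have := im_le_Cmod (CRInt (fun u => RtoC (g u)) a 1 - v).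
  have -> : Im (CRInt (fun u => RtoC (g u)) a 1 - v) = (Im (CRInt (fun u => RtoC (g u)) a 1) - Im v)%R by [].
  rewrite e Rminus_0_l Rabs_Ropp. lra.
Qed.

(** Lets the expansion of [ellw] be handled as real power series: [ka] and [kb], defined as real
    parts, recover the complex values. *)
Lemma mellin_real (phi : R -> R) (x : R) : slow phi -> (0 < x)%R -> Im (mellin phi (RtoC x)) = 0%R.
Proof.
  move=> hs hx. apply: (is_int01_real (fun u => Rpower u (x - 1) * phi u)%R).
  apply: is_int01_ext (mellin_correct phi (RtoC x) hs hx) => u hu.
  by rewrite /mellin_fun -RtoC_minus Rcpow_RtoC RtoC_mult.
Qed.

(** [- ln u <= (1 - u) / u] and [ellw u <= PI / (2 sqrt u)] cost [3 / 2] in the exponent, but the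
    factor [1 - u] leaves quadratic decay in [x]. *)
Lemma mG1_bound (x : R) : (3 / 2 < x)%R ->
  (Cmod (mG1 (RtoC x)) <= PI / 2 / ((x - 3 / 2) * (x - 1 / 2)))%R.
Proof.
  move=> hx. have pi0 := PI_RGT_0.
  have I := mellin_correct _ (RtoC x) slow_lnw ltac:(rewrite /=; lra).
  have -> : (x - 1 / 2 = x - 3 / 2 + 1)%R by field.
  apply: (is_int01_power2 _ _ _ _ _ _ (proj1 I) _ I); try lra.
  move=> u hu. rewrite /mellin_fun Cmod_mult Cmod_Rcpow Cmod_R Re_minus_1 Re_RtoC Rabs_mult.
  have hw := ellw_le u ltac:(lra) ltac:(lra). have hw2 := ellw_ge u ltac:(lra) ltac:(lra).
  have l0 := ln_01 u hu. rewrite (Rabs_left1 (ln u)) // (Rabs_pos_eq (ellw u)); last lra.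
  have hl : (- ln u <= (1 - u) * / u)%R.
    have := exp_ineq1_le (ln (/ u)). have iu : (0 < / u)%R by apply: Rinv_0_lt_compat; lra.
    rewrite exp_ln // ln_Rinv; last lra. have -> : ((1 - u) * / u = / u - 1)%R by field; lra. lra.
  have hp := Rpower_pos u (x - 1).
  have -> : (Rpower u (x - 3 / 2 - 1) = Rpower u (x - 1) * / sqrt u * / u)%R.
    have -> : (x - 3 / 2 - 1 = (x - 1) + - / 2 + - (1))%R by field.
    rewrite (Rpower_plus _ (- (1))) (Rpower_plus _ (- / 2)) !Rpower_Ropp Rpower_sqrt ?Rpower_1; lra.
  have su : (0 < / sqrt u)%R by apply: Rinv_0_lt_compat; apply: sqrt_lt_R0; lra.
  have b : (- ln u * ellw u <= (1 - u) * / u * (/ sqrt u * (PI / 2)))%R.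
    apply: Rmult_le_compat => //; lra.
  have := Rmult_le_compat_l _ _ _ (Rlt_le _ _ hp) b. lra.
Qed.

Open Scope R_scope.

(** * The logarithmic expansion of K' at the origin *)

Lemma CV_radius_ge1 (a : nat -> R) (M x : R) : (forall n, Rabs (a n) <= M) -> Rabs x < 1 ->
  Rbar_lt (Rabs x) (CV_radius a).
Proof.
  move=> h hx. apply: Rbar_lt_le_trans (_ : Rbar_le (Finite 1) _) => //.
  apply: (proj1 (CV_radius_bounded a)). exists M => n. by rewrite pow1 Rmult_1_r.
Qed.

(** The coefficient of [u^n] in [(u (1 - u) f')' - f / 4] is [(n + 1)^2 a (n+1) - (n (n + 1) + 1/4)
    a n], and [n (n + 1) + 1/4] is the square of [n + 1/2]. *)
Lemma PSeries_hypergeom (a : nat -> R) (u : R) : Rbar_lt (Rabs u) (CV_radius a) ->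
  is_derive (fun u => u * (1 - u) * PSeries (PS_derive a) u) u
    (PSeries a u / 4 + PSeries (fun n => (INR n + 1) ^ 2 * a (S n) - (INR n + 1 / 2) ^ 2 * a n) u).
Proof.
  move=> h0. set d1 := PS_derive a. set d2 := PS_derive d1.
  have h1 : Rbar_lt (Rabs u) (CV_radius d1) by rewrite CV_radius_derive.
  have h2 : Rbar_lt (Rabs u) (CV_radius d2) by rewrite CV_radius_derive.
  have D := is_derive_PSeries d1 u h1.
  have e0 := CV_radius_inside _ _ h0. have e1 := CV_radius_inside _ _ h1. have e2 := CV_radius_inside _ _ h2.
  have X : PSeries (fun n => (INR n + 1) ^ 2 * a (S n) - (INR n + 1 / 2) ^ 2 * a n) u =
    (u * PSeries d2 u - u * (u * PSeries d2 u)) + (PSeries d1 u - 2 * (u * PSeries d1 u) - / 4 * PSeries a u).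
    rewrite -!PSeries_incr_1 -!PSeries_scal.
    have i2 := ex_pseries_incr_1 d2 u e2. have i22 := ex_pseries_incr_1 _ u i2.
    have i1 := ex_pseries_incr_1 d1 u e1.
    have s1 := ex_pseries_scal 2 (PS_incr_1 d1) u (Rmult_comm _ _) i1.
    have s0 := ex_pseries_scal (/ 4) a u (Rmult_comm _ _) e0.
    rewrite -!PSeries_minus //; last exact: ex_pseries_minus.
    rewrite -PSeries_plus; [| exact: ex_pseries_minus | by apply: ex_pseries_minus => //; exact: ex_pseries_minus].
    apply: PSeries_ext => n.
    rewrite /PS_plus /PS_minus /PS_scal /PS_opp /PS_incr_1 /d2 /d1 /PS_derive /plus /opp /scal /zero /= /mult /=.
    case: n => [|[|n]].
    - rewrite /=. field.
    - rewrite /=. field.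
    - change (match n with O => 1 | S _ => INR n + 1 end) with (INR (S n)). rewrite !S_INR. field.
  rewrite X. auto_derive; first by exists (PSeries d2 u).
  rewrite (is_derive_unique _ _ _ D) -/d2. field.
Qed.

(** Frobenius's method in disguise. By [mG_Gamma], [kb n] is half the square of [(1/2)_n / n!], the
    coefficient of the solution regular at [0]. It extends to complex indices with the same
    recurrence, and minus its derivative in the index, which is [ka n], gives the companion
    coefficient of the logarithmic solution. *)
Definition kb (n : nat) : R := Re (mG (RtoC (INR n + / 2))) / PI ^ 2.
Definition ka (n : nat) : R := - Re (mG1 (RtoC (INR n + / 2))) / PI ^ 2.

Lemma C_real (z : C) : Im z = 0 -> z = RtoC (Re z).
Proof. case: z => x y /= ->. done. Qed.

Lemma half_pos (n : nat) : 0 < INR n + / 2.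
Proof. have := pos_INR n. lra. Qed.

Lemma PI2_neq_0 : PI ^ 2 <> 0.
Proof. have := PI_RGT_0. nra. Qed.

Lemma kb_E (n : nat) : mG (RtoC (INR n + / 2)) = RtoC (PI ^ 2 * kb n).
Proof.
  rewrite [LHS]C_real; last by apply: mellin_real; [exact: slow_ellw | exact: half_pos].
  f_equal. rewrite /kb. field. have := PI_RGT_0. lra.
Qed.

Lemma ka_E (n : nat) : mG1 (RtoC (INR n + / 2)) = RtoC (- (PI ^ 2 * ka n)).
Proof.
  rewrite [LHS]C_real; last by apply: mellin_real; [exact: slow_lnw | exact: half_pos].
  f_equal. rewrite /ka. field. have := PI_RGT_0. lra.
Qed.

Lemma RtoC_half_S (n : nat) : (RtoC (INR n + / 2) + 1 = RtoC (INR (S n) + / 2))%C.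
Proof. rewrite -RtoC_plus. f_equal. rewrite S_INR. ring. Qed.

Lemma RtoC_half_half (n : nat) : (RtoC (INR n + / 2) + 1 / 2 = RtoC (INR n + 1))%C.
Proof. rewrite half_RtoC -RtoC_plus. f_equal. field. Qed.

#[local] Opaque mG mG1 ka kb.

Lemma kb_S (n : nat) : (INR n + 1) ^ 2 * kb (S n) = (INR n + 1 / 2) ^ 2 * kb n.
Proof.
  have h : 0 < Re (RtoC (INR n + / 2)) by exact: half_pos.
  have := mG_S _ h. rewrite RtoC_half_half RtoC_half_S !kb_E -!RtoC_mult => /RtoC_inj e.
  have p := PI2_neq_0. have e2 : PI ^ 2 * ((INR n + 1) ^ 2 * kb (S n)) = PI ^ 2 * ((INR n + 1 / 2) ^ 2 * kb n) by lra.
  exact: Rmult_eq_reg_l e2 p.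
Qed.

Lemma cdiff_idC_loc (f g : C -> C) (z l : C) : 0 < Re z ->
  (forall y, 0 < Re y -> f y = g y) -> cdiff idC f z l -> cdiff idC g z l.
Proof.
  move=> hz e. apply: (cdiff_ext_loc _ _ _ _ _ (Re z)) => // y. rewrite /idC => hy. apply: e.
  have := re_le_Cmod (y - z). have -> : Re (y - z)%C = Re y - Re z by case: (y) (z) => [? ?] [? ?].
  move=> /Rabs_le_between. lra.
Qed.

(** Differentiates the recurrence of [mG_S]: its two sides agree on an open half-plane, so their
    complex derivatives agree. *)
Lemma mG1_S (z : C) : 0 < Re z ->
  ((z + z) * mG z + z * z * mG1 z =
   ((z + 1 / 2) + (z + 1 / 2)) * mG (z + 1) + (z + 1 / 2) * (z + 1 / 2) * mG1 (z + 1))%C.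
Proof.
  move=> hz. have hz1 : 0 < Re (z + 1)%C by rewrite Re_plus /=; lra.
  have I y : cdiff idC idC y 1 by exact: cdiff_id.
  have Ip (c y : C) : cdiff idC (fun y => y + c)%C y 1.
    have -> : (RtoC 1 = 1 + 0)%C by ring. apply: cdiff_plus; [exact: I | exact: cdiff_const].
  have L := cdiff_mult _ _ _ _ _ _ (cdiff_mult _ _ _ _ _ _ (I z) (I z)) (cdiff_mG z hz).
  have G1 := cdiff_comp _ (fun y => y + 1)%C mG z _ _ (Ip 1 z) (cdiff_mG _ hz1).
  have R := cdiff_mult _ _ _ _ _ _ (cdiff_mult _ _ _ _ _ _ (Ip (1 / 2)%C z) (Ip (1 / 2)%C z)) G1.
  have L' := cdiff_idC_loc _ _ z _ hz (fun y hy => mG_S y hy) L.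
  have := cdiff_unique _ _ _ _ L' R. rewrite /idC.
  move: (mG z) (mG1 z) (mG (z + 1)%C) (mG1 (z + 1)%C) => a b c d e.
  apply: (eq_trans (y := ((1 * z + z * 1) * a + z * z * b)%C)); first by ring.
  apply: (eq_trans e). ring.
Qed.

Lemma RtoC_relation (x y a b c d : R) :
  ((RtoC x + RtoC x) * RtoC a + RtoC x * RtoC x * RtoC b =
   (RtoC y + RtoC y) * RtoC c + RtoC y * RtoC y * RtoC d)%C ->
  (x + x) * a + x * x * b = (y + y) * c + y * y * d.
Proof. by rewrite -!RtoC_plus -!RtoC_mult -!RtoC_plus => /RtoC_inj. Qed.

Lemma ka_S (n : nat) :
  (INR n + 1) ^ 2 * ka (S n) - (INR n + 1 / 2) ^ 2 * ka n =
  2 * (INR n + 1) * kb (S n) - (2 * INR n + 1) * kb n.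
Proof.
  have h : 0 < Re (RtoC (INR n + / 2)) by exact: half_pos.
  have e0 := mG1_S _ h. rewrite (RtoC_half_half n) (RtoC_half_S n) in e0.
  rewrite (kb_E n) (kb_E (S n)) (ka_E n) (ka_E (S n)) in e0.
  have e := RtoC_relation _ _ _ _ _ _ e0.
  have p := PI2_neq_0.
  have e2 : PI ^ 2 * ((INR n + 1) ^ 2 * ka (S n) - (INR n + 1 / 2) ^ 2 * ka n) =
    PI ^ 2 * (2 * (INR n + 1) * kb (S n) - (2 * INR n + 1) * kb n) by lra.
  exact: Rmult_eq_reg_l e2 p.
Qed.

Lemma kb_0 : kb 0 = / 2.
Proof.
  have pi0 := PI_RGT_0.
  have hh : 0 < Re (1 / 2)%C by rewrite half_RtoC Re_RtoC; lra.
  have := mG_Gamma _ hh. have -> : (1 / 2 + 1 / 2 = 1)%C.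
    by rewrite half_RtoC -RtoC_plus; f_equal; field.
  rewrite CGamma_1.
  have -> : (RtoC (PI / 2) * (CGamma (1 / 2) / 1) * (CGamma (1 / 2) / 1) =
     RtoC (PI / 2) * (CGamma (1 / 2) * CGamma (1 / 2)))%C.
    have n1 : (RtoC 1 <> RtoC 0) by move/RtoC_inj; lra. by field.
  rewrite CGamma_half_sq -RtoC_mult.
  have -> : (1 / 2 : C)%C = RtoC (INR 0 + / 2) by rewrite half_RtoC /= Rplus_0_l.
  rewrite kb_E => /RtoC_inj e.
  have p := PI2_neq_0. have e2 : PI ^ 2 * kb 0 = PI ^ 2 * / 2 by rewrite e; field.
  exact: Rmult_eq_reg_l e2 p.
Qed.

Lemma kb_bounds (n : nat) : 0 < kb n <= / (2 * (2 * INR n + 1)).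
Proof.
  elim: n => [|n [IH1 IH2]].
    rewrite kb_0 /=. have -> : 2 * (2 * 0 + 1) = 2 by ring. lra.
  have e := kb_S n. have hn := pos_INR n. rewrite S_INR.
  have e' : kb (S n) = kb n * ((INR n + 1 / 2) ^ 2 / (INR n + 1) ^ 2).
    have : kb (S n) * (INR n + 1) ^ 2 = (INR n + 1 / 2) ^ 2 * kb n by rewrite -e; ring.
    move=> e2. field_simplify_eq; [nra | lra].
  have q : 0 < (INR n + 1 / 2) ^ 2 / (INR n + 1) ^ 2 by apply: Rdiv_lt_0_compat; apply: pow_lt; lra.
  split; first by rewrite e'; apply: Rmult_lt_0_compat.
  rewrite e'. apply: Rle_trans (Rmult_le_compat_r _ _ _ (Rlt_le _ _ q) IH2) _.
  have -> : / (2 * (2 * INR n + 1)) * ((INR n + 1 / 2) ^ 2 / (INR n + 1) ^ 2) = (2 * INR n + 1) / (8 * (INR n + 1) ^ 2).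
    field. split; lra.
  apply/Rle_div_l; first nra.
  have -> : / (2 * (2 * (INR n + 1) + 1)) * (8 * (INR n + 1) ^ 2) = (4 * (INR n + 1) ^ 2) / (2 * INR n + 3) by field; lra.
  apply/Rle_div_r; nra.
Qed.

(** The estimate of [mG1] needs an argument above [3 / 2], so indices start at [2]; subtracting
    [3 / 2] from the argument leaves [n + 1]. The factor [PI / 2] is absorbed by [PI^2]. *)
Lemma ka_bound (n : nat) : Rabs (ka (S (S n))) <= / INR (S n) ^ 2.
Proof.
  have pi0 := PI_RGT_0. have pi2 := PI2_1. have hn := pos_INR n.
  have hx : 3 / 2 < INR (S (S n)) + / 2 by rewrite !S_INR; lra.
  have := mG1_bound _ hx. rewrite ka_E Cmod_R Rabs_Ropp Rabs_mult (Rabs_pos_eq (PI ^ 2)); last exact: pow2_ge_0.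
  rewrite !S_INR. move: (Rabs _) (INR n) hn => a x hn.
  have -> : (x + 1 + 1 + / 2 - 3 / 2) * (x + 1 + 1 + / 2 - 1 / 2) = (x + 1) * (x + 2) by field.
  move=> h.
  have h2 : PI ^ 2 * a <= PI ^ 2 * / (x + 1) ^ 2.
    apply: Rle_trans h _. apply/Rle_div_l; first nra.
    have -> : PI ^ 2 * / (x + 1) ^ 2 * ((x + 1) * (x + 2)) = PI ^ 2 * ((x + 2) / (x + 1)) by field; lra.
    have : 1 <= (x + 2) / (x + 1) by apply/Rle_div_r; lra. nra.
  apply: (Rmult_le_reg_l (PI ^ 2)) => //. nra.
Qed.

Lemma ex_series_ka : ex_series (fun n => Rabs (ka n)).
Proof.
  apply/(ex_series_incr_n _ 2).
  apply: (ex_series_le (V := R_CompleteNormedModule) _ (fun n => / INR (S n) ^ 2)); last exact: ex_series_inv_sq.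
  move=> n. rewrite /norm /= /abs /= Rabs_Rabsolu. exact: ka_bound.
Qed.

Definition kterm (u : R) (n : nat) : R := (ka n - kb n * ln u) * u ^ n.

Lemma kb_le (n : nat) : Rabs (kb n) <= / 2.
Proof.
  have [h1 h2] := kb_bounds n. rewrite Rabs_pos_eq; last lra.
  apply: Rle_trans h2 _. apply: Rinv_le_contravar; first lra. have := pos_INR n. lra.
Qed.

Lemma ka_le : exists M, forall n, Rabs (ka n) <= M.
Proof.
  exists (Rabs (ka 0) + Rabs (ka 1) + 1) => -[|[|n]].
  - have := Rabs_pos (ka 1). lra.
  - have := Rabs_pos (ka 0). lra.
  - have := ka_bound n. have := Rabs_pos (ka 1). have := Rabs_pos (ka 0).
    have h : 1 <= INR (S n) by rewrite S_INR; have := pos_INR n; lra.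
    have : / INR (S n) ^ 2 <= 1.
      rewrite -Rinv_1. apply: Rinv_le_contravar; first lra. nra.
    lra.
Qed.

(** From [1 + ln y <= y] at [y = u^(-m)], [m = n + 1], one gets [m (- ln u) u^m <= 1], so the
    logarithmic part is at most [kb m / m], uniformly in [u]. The term of index [0] is unbounded and
    stays outside. *)
Lemma kterm_bound (u : R) (n : nat) : 0 < u < 1 ->
  Rabs (kterm u (S n)) <= Rabs (ka (S n)) + / INR (S n) ^ 2.
Proof.
  move=> hu. have hx : 1 <= INR (S n) by rewrite S_INR; have := pos_INR n; lra.
  have l0 : ln u <= 0 by apply: ln_01; lra.
  have un : 0 < u ^ S n <= 1.
    split; first by apply: pow_lt; lra. rewrite -(pow1 (S n)). apply: pow_incr. lra.
  have [b1 b2] := kb_bounds (S n).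
  have b3 : kb (S n) <= / INR (S n).
    apply: Rle_trans b2 _. apply: Rinv_le_contravar; lra.
  have key : INR (S n) * (- ln u) * u ^ S n <= 1.
    have := exp_ineq1_le (ln (/ u ^ S n)). rewrite exp_ln; last by apply: Rinv_0_lt_compat; lra.
    rewrite ln_Rinv; last lra. rewrite ln_pow; last lra.
    move=> h. have h2 : INR (S n) * (- ln u) <= / u ^ S n by lra.
    have := Rmult_le_compat_r _ _ _ (Rlt_le _ _ (proj1 un)) h2. rewrite Rinv_l; lra.
  have -> : kterm u (S n) = ka (S n) * u ^ S n + kb (S n) * (- ln u) * u ^ S n by rewrite /kterm; ring.
  apply: Rle_trans (Rabs_triang _ _) _. apply: Rplus_le_compat.
  - rewrite Rabs_mult (Rabs_pos_eq (u ^ S n)); last lra. have := Rabs_pos (ka (S n)). nra.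
  - have p : 0 <= (- ln u) * u ^ S n by apply: Rmult_le_pos; lra.
    rewrite Rmult_assoc Rabs_pos_eq; last by apply: Rmult_le_pos; lra.
    have ix : 0 < / INR (S n) by apply: Rinv_0_lt_compat; lra.
    apply: Rle_trans (Rmult_le_compat_r _ _ _ p b3) _.
    have -> : / INR (S n) ^ 2 = / INR (S n) * / INR (S n) by field; lra.
    apply: Rmult_le_compat_l; first lra.
    apply: (Rmult_le_reg_l (INR (S n))); first lra. rewrite Rinv_r; lra.
Qed.

Definition kS (u : R) : R := PSeries ka u - ln u * PSeries kb u.

Lemma ka_radius (u : R) : Rabs u < 1 -> Rbar_lt (Rabs u) (CV_radius ka).
Proof. case: ka_le => M h. exact: CV_radius_ge1. Qed.

Lemma kb_radius (u : R) : Rabs u < 1 -> Rbar_lt (Rabs u) (CV_radius kb).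
Proof. exact: CV_radius_ge1 kb_le. Qed.

Lemma is_series_kS (u : R) : 0 < u < 1 -> is_series (kterm u) (kS u).
Proof.
  move=> hu. have au : Rabs u < 1 by rewrite Rabs_pos_eq; lra.
  have P1 := PSeries_correct _ _ (CV_radius_inside _ _ (ka_radius _ au)).
  have P2 := PSeries_correct _ _ (CV_radius_inside _ _ (kb_radius _ au)).
  have := is_series_minus _ _ _ _ P1 (is_series_scal_l (V := R_NormedModule) (ln u) _ _ P2).
  apply: is_series_ext => n.
  rewrite /kterm /scal /= /mult /= /minus /plus /opp /= pow_n_pow. 
  change (u ^ n * ka n + - (ln u * (u ^ n * kb n)) = (ka n - kb n * ln u) * u ^ n). ring.
Qed.

Definition kS1 (u : R) : R :=
  PSeries (PS_derive ka) u - / u * PSeries kb u - ln u * PSeries (PS_derive kb) u.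

Lemma is_derive_kS (u : R) : 0 < u < 1 -> is_derive kS u (kS1 u).
Proof.
  move=> hu. have au : Rabs u < 1 by rewrite Rabs_pos_eq; lra.
  have D1 := is_derive_PSeries _ _ (ka_radius _ au). have D2 := is_derive_PSeries _ _ (kb_radius _ au).
  rewrite /kS. auto_derive.
    split; first by eexists; exact: D1. split; first lra. split => //. by eexists; exact: D2.
  rewrite (is_derive_unique _ _ _ D1) (is_derive_unique _ _ _ D2) /kS1. ring.
Qed.

(** The series parts are handled by [PSeries_hypergeom]; the terms in which the logarithm itself has
    been differentiated cancel against the right side of [ka_S]. *)
Lemma is_derive_qS (u : R) : 0 < u < 1 -> is_derive (fun u => u * (1 - u) * kS1 u) u (kS u / 4).
Proof.
  move=> hu. have au : Rabs u < 1 by rewrite Rabs_pos_eq; lra.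
  have D1 := PSeries_hypergeom _ _ (ka_radius _ au). have D2 := PSeries_hypergeom _ _ (kb_radius _ au).
  have D3 := is_derive_PSeries _ _ (kb_radius _ au).
  have zb : PSeries (fun n => (INR n + 1) ^ 2 * kb (S n) - (INR n + 1 / 2) ^ 2 * kb n) u = 0.
    rewrite -[RHS](Rmult_0_l (PSeries kb u)) -PSeries_scal. apply: PSeries_ext => n.
    rewrite kb_S /PS_scal /scal /= /mult /=. ring.
  have za : PSeries (fun n => (INR n + 1) ^ 2 * ka (S n) - (INR n + 1 / 2) ^ 2 * ka n) u =
     2 * PSeries (PS_derive kb) u - 2 * (u * PSeries (PS_derive kb) u) - PSeries kb u.
    have rd : Rbar_lt (Rabs u) (CV_radius (PS_derive kb)) by rewrite CV_radius_derive; exact: kb_radius.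
    have e0 := CV_radius_inside _ _ (kb_radius _ au). have e1 := CV_radius_inside _ _ rd.
    have i1 := ex_pseries_incr_1 _ u e1.
    have s1 := ex_pseries_scal 2 _ u (Rmult_comm _ _) e1.
    have s2 := ex_pseries_scal 2 _ u (Rmult_comm _ _) i1.
    rewrite -PSeries_incr_1 -!PSeries_scal -!PSeries_minus //; last exact: ex_pseries_minus.
    apply: PSeries_ext => n. rewrite ka_S.
    rewrite /PS_plus /PS_minus /PS_scal /PS_opp /PS_incr_1 /PS_derive /plus /opp /scal /zero /= /mult /=.
    case: n => [|n]; first by rewrite /=; ring.
    change (match n with O => 1 | S _ => INR n + 1 end) with (INR (S n)). rewrite !S_INR. ring.
  rewrite za in D1. rewrite zb Rplus_0_r in D2.
  have hl : is_derive (fun u => ln u) u (/ u) by auto_derive; lra.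
  have := is_derive_minus _ _ _ _ _ (is_derive_minus _ _ _ _ _ D1
     (is_derive_mult (fun u => 1 - u) (PSeries kb) u _ _ (_ : is_derive (fun u => 1 - u) u (-1)) D3 Rmult_comm))
     (is_derive_mult ln _ u _ _ hl D2 Rmult_comm).
  have hm : is_derive (fun u => 1 - u) u (-1) by auto_derive => //; ring.
  move=> /(_ hm).
  rewrite /minus /plus /opp /scal /= /mult /=.
  have -> : PSeries ka u / 4 + (2 * PSeries (PS_derive kb) u - 2 * (u * PSeries (PS_derive kb) u) - PSeries kb u) +
    - (-1 * PSeries kb u + (1 - u) * PSeries (PS_derive kb) u) +
    - (/ u * (u * (1 - u) * PSeries (PS_derive kb) u) + ln u * (PSeries kb u / 4)) = kS u / 4.
    rewrite /kS. field. lra.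
  apply: is_derive_ext_loc.
  have hu0 : 0 < u by lra.
  exists (mkposreal _ hu0) => z. rewrite /ball /= /AbsRing_ball /abs /minus /plus /opp /=.
  move=> /Rabs_def2 hz. rewrite /kS1. field. lra.
Qed.

(** Lagrange's identity: [ellw] and [kS] solve the same self-adjoint equation, so the terms of the
    derivative cancel in pairs. *)
Lemma wronskian : exists k, forall u, 0 < u < 1 ->
  ellw u * (u * (1 - u) * kS1 u) - ellq u * kS u = k.
Proof.
  pose V u := ellw u * (u * (1 - u) * kS1 u) - ellq u * kS u.
  have D u : 0 < u < 1 -> is_derive V u 0.
    move=> hu. have hu0 : 0 < u by lra.
    have := is_derive_minus _ _ _ _ _
      (is_derive_mult _ _ _ _ _ (is_derive_ellw _ hu0) (is_derive_qS _ hu) Rmult_comm)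
      (is_derive_mult _ _ _ _ _ (is_derive_ellq _ hu0) (is_derive_kS _ hu) Rmult_comm).
    rewrite /minus /plus /opp /scal /= /mult /=.
    suff -> : ellw1 u * (u * (1 - u) * kS1 u) + ellw u * (kS u / 4) + - (ellw u / 4 * kS u + ellq u * kS1 u) = 0 by [].
    rewrite /ellq. field.
  exists (V (/ 2)) => u hu. rewrite -/(V u).
  case: (Rtotal_order u (/ 2)) => [h|[->|h]] //.
  - apply: (@eq_is_derive R_NormedModule) => // t ht. apply: D. lra.
  - symmetry. apply: (@eq_is_derive R_NormedModule) => // t ht. apply: D. lra.
Qed.

Lemma PSeries_ka_bound : exists M, forall u, 0 < u < 1 -> Rabs (PSeries ka u) <= M.
Proof.
  exists (Series (fun n => Rabs (ka n))) => u hu.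
  have au : Rabs u < 1 by rewrite Rabs_pos_eq; lra.
  have d := CV_disk_inside _ _ (ka_radius _ au).
  apply: Rle_trans (Series_Rabs _ d) _. apply: Series_le; last exact: ex_series_ka.
  move=> n. split; first exact: Rabs_pos. rewrite Rabs_mult.
  have : 0 <= Rabs (u ^ n) <= 1.
    split; first exact: Rabs_pos. rewrite -RPow_abs -(pow1 n). apply: pow_incr. have := Rabs_pos u. lra.
  have := Rabs_pos (ka n). nra.
Qed.

Lemma PSeries_geom_bound (a : nat -> R) (M u : R) : 0 < u < 1 -> (forall n, Rabs (a n) <= M) ->
  Rabs (PSeries a u) <= M / (1 - u).
Proof.
  move=> hu h. have au : Rabs u < 1 by rewrite Rabs_pos_eq; lra.
  have d := CV_disk_inside _ _ (CV_radius_ge1 _ _ _ h au).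
  apply: Rle_trans (Series_Rabs _ d) _.
  have g := is_series_geom u au.
  have g' := is_series_scal_l (V := R_NormedModule) M _ _ g.
  have -> : M / (1 - u) = Series (fun n => M * u ^ n) by symmetry; apply: is_series_unique.
  apply: Series_le; last by eexists; exact: g'.
  move=> n. split; first exact: Rabs_pos. rewrite Rabs_mult (Rabs_pos_eq (u ^ n)); last by apply: pow_le; lra.
  apply: Rmult_le_compat_r (h n). apply: pow_le; lra.
Qed.

Lemma neg_ln_le (u : R) : 0 < u < 1 -> 0 <= - ln u <= (1 - u) / u.
Proof.
  move=> hu. have iu : 0 < / u by apply: Rinv_0_lt_compat; lra.
  split; first by have := ln_01 u ltac:(lra); lra.
  have := exp_ineq1_le (ln (/ u)). rewrite exp_ln // ln_Rinv; last lra.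
  have -> : (1 - u) / u = / u - 1 by field; lra. lra.
Qed.

(** The crude geometric bound lets [PSeries kb] grow like [1 / (1 - u)], and [- ln u <= (1 - u) / u]
    compensates exactly this growth. *)
Lemma kS_bound : exists M, 0 < M /\ forall u, / 2 <= u < 1 -> Rabs (kS u) <= M.
Proof.
  case: PSeries_ka_bound => M h. exists (Rabs M + 2). split; first by have := Rabs_pos M; lra.
  move=> u hu. have hu' : 0 < u < 1 by lra.
  have h1 := h u hu'. have h2 := PSeries_geom_bound kb _ u hu' kb_le. have [h3 h4] := neg_ln_le u hu'.
  rewrite /kS. apply: Rle_trans (Rabs_triang _ _) _. rewrite Rabs_Ropp Rabs_mult (Rabs_left1 (ln u)); last lra.
  have := Rle_abs M.
  have : - ln u * Rabs (PSeries kb u) <= (1 - u) / u * (/ 2 / (1 - u)).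
    apply: Rmult_le_compat => //. exact: Rabs_pos.
  have -> : (1 - u) / u * (/ 2 / (1 - u)) = / 2 * / u by field; lra.
  have : / u <= 2 by rewrite -(Rinv_inv 2); apply: Rinv_le_contravar; lra.
  lra.
Qed.

Lemma is_derive_ratio (k u : R) : 0 < u < 1 ->
  ellw u * (u * (1 - u) * kS1 u) - ellq u * kS u = k ->
  is_derive (fun u => kS u / ellw u) u (k / (u * (1 - u) * ellw u ^ 2)).
Proof.
  move=> hu hk. have hu0 : 0 < u by lra. have pi0 := PI_RGT_0.
  have w0 := ellw_ge u hu0 ltac:(lra).
  have := is_derive_div _ _ _ _ _ (is_derive_kS u hu) (is_derive_ellw u hu0) ltac:(lra).
  have -> : k / (u * (1 - u) * ellw u ^ 2) = (kS1 u * ellw u - kS u * ellw1 u) / ellw u ^ 2.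
    rewrite -hk /ellq. field. repeat split; lra.
  done.
Qed.

(** The ratio [kS / ellw] has derivative [k / (u (1 - u) ellw^2)]. Unless [k = 0], this behaves like
    [1 / (1 - u)] and the ratio diverges at [1], although [kS] is bounded there and
    [ellw >= PI / 2]. *)
Lemma wronskian_0 (u : R) : 0 < u < 1 ->
  ellw u * (u * (1 - u) * kS1 u) - ellq u * kS u = 0.
Proof.
  case: wronskian => k hk hu. rewrite hk // {u hu}. apply: NNPP => k0.
  case: kS_bound => M [hM0 hM]. have pi0 := PI_RGT_0. have pi4 := PI_4.
  have [s [hs hs1]] : exists s, s * k = Rabs k /\ Rabs s = 1.
    case: (Rle_dec 0 k) => h.
    - exists 1. rewrite Rabs_R1 Rabs_pos_eq; lra.
    - exists (-1). rewrite Rabs_Ropp Rabs_R1 Rabs_left; lra.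
  have ak : 0 < Rabs k by exact: Rabs_pos_lt.
  (* On [[1/2, 1)] one has [ellw <= 8], hence [u ellw^2 <= 64]; the sign [s] makes the first term
     increase fast enough for [H] to be nondecreasing despite the logarithm. *)
  pose H u := s * (kS u / ellw u) + Rabs k / 64 * ln (1 - u).
  have D u : / 2 <= u < 1 -> is_derive H u (s * (k / (u * (1 - u) * ellw u ^ 2)) - Rabs k / 64 * / (1 - u)).
    move=> hu. have hu' : 0 < u < 1 by lra.
    have d := is_derive_ratio k u hu' (hk u hu').
    have := is_derive_plus _ _ _ _ _ (is_derive_scal _ _ s _ d) (_ : is_derive (fun u => Rabs k / 64 * ln (1 - u)) u (- (Rabs k / 64 * / (1 - u)))).
    apply. auto_derive; first lra. field. lra.
  have inc u : / 2 < u < 1 -> H (/ 2) <= H u.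
    move=> hu.
    case: (MVT_gen H (/ 2) u (fun u => s * (k / (u * (1 - u) * ellw u ^ 2)) - Rabs k / 64 * / (1 - u))).
    - rewrite Rmin_left ?Rmax_right; try lra. move=> x hx. apply: D. lra.
    - rewrite Rmin_left ?Rmax_right; try lra. move=> x hx. apply/continuity_pt_filterlim.
      apply: continuous_of_derive (D x _). lra.
    - rewrite Rmin_left ?Rmax_right; try lra. move=> x [hx e].
      suff : 0 <= s * (k / (x * (1 - x) * ellw x ^ 2)) - Rabs k / 64 * / (1 - x) by nra.
      have w1 := ellw_ge x ltac:(lra) ltac:(lra). have w2 := ellw_le x ltac:(lra) ltac:(lra).
      have w3 : ellw x <= 8.
        have : / sqrt x <= 2.
          rewrite -(Rinv_inv 2). apply: Rinv_le_contravar; first lra.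
          have e2 : sqrt x * sqrt x = x by apply: sqrt_sqrt; lra.
          have := sqrt_pos x. have : sqrt x <= 1 by rewrite -sqrt_1; apply: sqrt_le_1_alt; lra. nra.
        have : 0 < / sqrt x by apply: Rinv_0_lt_compat; apply: sqrt_lt_R0; lra. nra.
      have -> : s * (k / (x * (1 - x) * ellw x ^ 2)) - Rabs k / 64 * / (1 - x) =
        Rabs k / (1 - x) * (/ (x * ellw x ^ 2) - / 64) by rewrite -hs; field; lra.
      apply: Rmult_le_pos; first by apply: Rdiv_le_0_compat; lra.
      have : / 64 <= / (x * ellw x ^ 2) by apply: Rinv_le_contravar; nra. lra.
  have bd u : / 2 <= u < 1 -> s * (kS u / ellw u) <= M.
    move=> hu. have w1 := ellw_ge u ltac:(lra) ltac:(lra). have b := hM u hu. have pi3 := PI2_1.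
    apply: Rle_trans (Rle_abs _) _. rewrite Rabs_mult hs1 Rmult_1_l Rabs_div; last lra.
    rewrite (Rabs_pos_eq (ellw u)); last lra. apply/Rle_div_l; first lra.
    have := Rabs_pos (kS u). nra.
  (* So close to [1] that the logarithm pushes [H (1 - y)] at least [1] below [H (/ 2)]. *)
  set y := Rmin (/ 4) (exp (64 / Rabs k * (H (/ 2) - M - 1))).
  have hy : 0 < y <= / 4.
    split; last exact: Rmin_l. apply: Rmin_pos; [lra | exact: exp_pos].
  have hy2 : ln y <= 64 / Rabs k * (H (/ 2) - M - 1).
    rewrite -(ln_exp (64 / Rabs k * (H (/ 2) - M - 1))). apply: ln_le; [lra | exact: Rmin_r].
  have hu : / 2 < 1 - y < 1 by lra.
  have := inc _ hu. have := bd (1 - y) ltac:(lra). rewrite {2}/H.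
  have -> : 1 - (1 - y) = y by ring.
  have : Rabs k / 64 * ln y <= H (/ 2) - M - 1.
    have := Rmult_le_compat_l (Rabs k / 64) _ _ ltac:(lra) hy2.
    have -> : Rabs k / 64 * (64 / Rabs k * (H (/ 2) - M - 1)) = H (/ 2) - M - 1 by field; lra. done.
  lra.
Qed.

Lemma kS_log : exists K, forall u, 0 < u <= / 2 -> Rabs (kS u + ln u / 2) <= K.
Proof.
  case: PSeries_ka_bound => M h. exists (M + 1) => u hu. have hu' : 0 < u < 1 by lra.
  have au : Rabs u < 1 by rewrite Rabs_pos_eq; lra.
  have [h3 h4] := neg_ln_le u hu'.
  have e := PSeries_decr_1 _ _ (CV_radius_inside _ _ (kb_radius _ au)). rewrite kb_0 in e.
  have b := PSeries_geom_bound (PS_decr_1 kb) (/ 2) u hu' (fun n => kb_le (S n)).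
  have {}e : kS u = PSeries ka u - ln u * (/ 2 + u * PSeries (PS_decr_1 kb) u) :=
    f_equal (fun t => PSeries ka u - ln u * t) e.
  have -> : kS u + ln u / 2 = PSeries ka u + (- ln u * u) * PSeries (PS_decr_1 kb) u.
    rewrite e. move: (PSeries ka u) (PSeries (PS_decr_1 kb) u) => a1 a2. field.
  apply: Rle_trans (Rabs_triang _ _) _. apply: Rplus_le_compat (h u hu') _.
  have p : 0 <= - ln u * u <= 1 - u.
    split; first by apply: Rmult_le_pos; lra.
    have := Rmult_le_compat_r u _ _ ltac:(lra) h4. have -> : (1 - u) / u * u = 1 - u by field; lra. done.
  rewrite Rabs_mult (Rabs_pos_eq (- ln u * u)); last lra.
  apply: Rle_trans (Rmult_le_compat _ _ _ _ (proj1 p) (Rabs_pos _) (proj2 p) b) _.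
  have -> : (1 - u) * (/ 2 / (1 - u)) = / 2 by field; lra. lra.
Qed.

(** A zero Wronskian makes [kS / ellw] a constant [c]. Both functions are [- ln u / 2] up to bounded
    terms at [0], so [(c - 1) ln u] is bounded, which forces [c = 1]. *)
Lemma ellw_kS (u : R) : 0 < u < 1 -> ellw u = kS u.
Proof.
  have pi0 := PI_RGT_0.
  set c := kS (/ 2) / ellw (/ 2).
  have E v : 0 < v < 1 -> kS v = c * ellw v.
    move=> hv. have w0 := ellw_ge v ltac:(lra) ltac:(lra).
    have D x : 0 < x < 1 -> is_derive (fun u => kS u / ellw u) x 0.
      move=> hx. have := is_derive_ratio 0 x hx (wronskian_0 x hx). by rewrite /Rdiv Rmult_0_l.
    have -> : c = kS v / ellw v; last by field; lra.
    rewrite /c. case: (Rtotal_order v (/ 2)) => [h|[->|h]] //.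
    - symmetry. apply: (@eq_is_derive R_NormedModule (fun u => kS u / ellw u)) => // t ht. apply: D. lra.
    - apply: (@eq_is_derive R_NormedModule (fun u => kS u / ellw u)) => // t ht. apply: D. lra.
  case: ellw_log => A [hA HA]. case: kS_log => K HK.
  suff hc1 : c = 1 by move=> hu; rewrite (E u hu) hc1 Rmult_1_l.
    apply: NNPP => hc. have hc' : c - 1 <> 0 by lra. have ac := Rabs_pos_lt _ hc'.
    (* Makes [Rabs (c - 1) * (L / 2)] exceed the bound [Rabs c * A + Rabs K] by [1]. *)
    set L := 2 * (Rabs c * A + Rabs K + 1) / Rabs (c - 1).
    have hL : 0 < L.
      apply: Rdiv_lt_0_compat => //. have := Rabs_pos c. have := Rabs_pos K. nra.
    set v := Rmin (/ 2) (exp (- L)).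
    have hv : 0 < v <= / 2 by split; [apply: Rmin_pos; [lra | exact: exp_pos] | exact: Rmin_l].
    have lv : ln v <= - L by rewrite -(ln_exp (- L)); apply: ln_le; [lra | exact: Rmin_r].
    have a := HA v ltac:(lra). have b := HK v hv. rewrite (E v) in b; last lra.
    have : Rabs ((c - 1) * (ln v / 2)) <= Rabs c * A + Rabs K.
      have -> : (c - 1) * (ln v / 2) = c * (ellw v + ln v / 2) - (c * ellw v + ln v / 2) by ring.
      apply: Rle_trans (Rabs_triang _ _) _. rewrite Rabs_Ropp Rabs_mult.
      have := Rmult_le_compat_l _ _ _ (Rabs_pos c) a. have := Rle_abs K. lra.
    rewrite Rabs_mult (Rabs_left1 (ln v / 2)); last lra.
    have : Rabs (c - 1) * (L / 2) <= Rabs (c - 1) * - (ln v / 2) by apply: Rmult_le_compat_l; lra.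
    have -> : Rabs (c - 1) * (L / 2) = Rabs c * A + Rabs K + 1 by rewrite /L; field; lra. lra.
Qed.

Lemma sum_n_R_C (u : nat -> R) (n : nat) : RtoC (sum_n u n) = Csum (fun k => RtoC (u k)) (S n).
Proof.
  elim: n => [|n IH]; first by rewrite sum_O /=; ring.
  rewrite sum_Sn. rewrite RtoC_plus IH. done.
Qed.

(** The majorant of [kterm_bound] is summable and free of [u]; differences of partial sums never
    contain the unbounded term of index [0], so uniformity holds down to [u = 0]. *)
Lemma kterm_uniform (eps : R) : 0 < eps -> exists N0 : nat,
  forall N u, (N0 <= N)%nat -> 0 < u < 1 -> Rabs (ellw u - sum_n (kterm u) N) <= eps.
Proof.
  move=> he.
  have hb : ex_series (fun n => Rabs (ka (S n)) + / INR (S n) ^ 2).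
    apply: (ex_series_plus (V := R_NormedModule)); last exact: ex_series_inv_sq.
    have := proj1 (ex_series_incr_1 (V := R_NormedModule) _) ex_series_ka. done.
  have [N1 hN] := Cauchy_ex_series _ hb (mkposreal _ he).
  exists (S N1) => N u hN0 hu.
  have S0 := is_series_kS u hu. rewrite -(ellw_kS u hu) in S0.
  have key M : (N <= M)%nat -> Rabs (sum_n (kterm u) M - sum_n (kterm u) N) <= eps.
    move=> hM. case: (Nat.eq_dec N M) => [->|hne]; first by rewrite Rminus_diag Rabs_R0; lra.
    have -> : sum_n (kterm u) M - sum_n (kterm u) N = sum_n_m (kterm u) (S N) M.
      have := sum_n_m_sum_n (kterm u) N M hM. by move=> ->.
    have h := hN N (Nat.pred M) ltac:(lia) ltac:(lia).
    apply: Rle_trans (_ : norm (sum_n_m (fun n => Rabs (ka (S n)) + / INR (S n) ^ 2) N (Nat.pred M)) <= _); last exact: Rlt_le.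
    apply: Rle_trans _ (Rle_abs _).
    have -> : sum_n_m (kterm u) (S N) M = sum_n_m (fun n => kterm u (S n)) N (Nat.pred M).
      rewrite sum_n_m_S. f_equal. lia.
    apply: Rle_trans (norm_sum_n_m (V := R_NormedModule) _ _ _) _.
    apply: sum_n_m_le => n. exact: kterm_bound.
  have L : is_lim_seq (fun M => Rabs (sum_n (kterm u) M - sum_n (kterm u) N)) (Rabs (ellw u - sum_n (kterm u) N)).
    apply: (is_lim_seq_abs _ (Finite (ellw u - sum_n (kterm u) N))).
    apply: is_lim_seq_minus'; last exact: is_lim_seq_const. exact: S0.
  have := is_lim_seq_le_loc _ (fun _ => eps) _ (Finite eps) _ L (is_lim_seq_const eps).
  apply. exists N. exact: key.
Qed.

Lemma continuous_kterm (u : R) (n : nat) : 0 < u -> continuous (fun u => kterm u n) u.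
Proof.
  move=> hu. apply: (@ex_derive_continuous R_AbsRing R_NormedModule). rewrite /kterm. by auto_derive.
Qed.

Lemma continuous_kterm_sum (u : R) (N : nat) : 0 < u -> continuous (fun u => sum_n (kterm u) N) u.
Proof.
  move=> hu. elim: N => [|N IH].
    apply: continuous_ext (continuous_kterm u 0 hu) => x. by rewrite sum_O.
  apply: continuous_ext (@continuous_plus _ _ R_NormedModule _ _ _ IH (continuous_kterm u (S N) hu)) => x.
  by rewrite sum_Sn.
Qed.

(** The endpoint, required by [is_int01], inherits the inequality for each [N] separately from the
    continuity of [ellw] and of a finite sum. *)
Lemma kterm_uniform_1 (eps : R) : 0 < eps -> exists N0 : nat,
  forall N u, (N0 <= N)%nat -> 0 < u <= 1 -> Rabs (ellw u - sum_n (kterm u) N) <= eps.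
Proof.
  move=> he. case: (kterm_uniform _ he) => N0 H. exists N0 => N u hN [h0 h1].
  case: h1 => [h1|e]; first exact: H. subst u.
  apply: Rnot_lt_le => hlt.
  have C : continuous (fun u => Rabs (ellw u - sum_n (kterm u) N)) 1.
    apply: (continuous_comp (fun u => ellw u - sum_n (kterm u) N) Rabs); last exact: continuous_Rabs.
    apply: (@continuous_minus _ _ R_NormedModule); first by apply: continuous_ellw; lra.
    apply: continuous_kterm_sum. lra.
  have hd : 0 < Rabs (ellw 1 - sum_n (kterm 1) N) - eps by lra.
  case: (C _ (locally_ball _ (mkposreal _ hd))) => d hd'.
  set u := 1 - Rmin (/ 2) (d / 2).
  have m1 := Rmin_l (/ 2) (d / 2). have m2 := Rmin_r (/ 2) (d / 2).
  have m3 : 0 < Rmin (/ 2) (d / 2) by apply: Rmin_pos; have := cond_pos d; lra.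
  have hu : 0 < u < 1 by rewrite /u; lra.
  have b : ball 1 d u.
    rewrite /ball /= /AbsRing_ball /abs /minus /plus /opp /= /u. apply: Rabs_def1; have := cond_pos d; lra.
  have := hd' u b. rewrite /ball /= /AbsRing_ball /abs /minus /plus /opp /=.
  have := H N u hN hu => k /Rabs_def2. lra.
Qed.

(** Termwise integration against [u^(s-1) w]. *)
Lemma mellin_sq_series (s : C) : 0 < Re s ->
  Cseq_lim (fun N => Csum (fun n => RtoC (ka n) * mG (s + RtoC (INR n)) - RtoC (kb n) * mG1 (s + RtoC (INR n))) N)%C
    (mellin (fun u => ellw u * ellw u) s).
Proof.
  move=> hs.
  have hn n : 0 < Re (s + RtoC (INR n))%C by rewrite Re_plus_INR; have := pos_INR n; lra.
  have I1 n : is_int01 (fun u => mellin_fun ellw s u * RtoC (kterm u n))%C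
    (RtoC (ka n) * mG (s + RtoC (INR n)) - RtoC (kb n) * mG1 (s + RtoC (INR n)))%C.
    have := is_int01_minus _ _ _ _ (is_int01_scal (RtoC (ka n)) _ _ (mellin_correct _ _ slow_ellw (hn n)))
      (is_int01_scal (RtoC (kb n)) _ _ (mellin_correct _ _ slow_lnw (hn n))).
    apply: is_int01_ext => u hu. rewrite /mellin_fun /kterm.
    have -> : (s + RtoC (INR n) - 1 = (s - 1) + RtoC (INR n))%C by ring.
    rewrite Rcpow_plus Rcpow_INR //.
    move: (ka n) (kb n) (ln u) (ellw u) (u ^ n) => a b l w p. rewrite !RtoC_mult RtoC_minus RtoC_mult. ring.
  have I2 N := is_int01_Csum _ _ N I1.
  have I3 := mellin_correct _ _ (slow_mult _ _ slow_ellw slow_ellw) hs.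
  apply/Cseq_lim_S.
  case: (slow_ellw) => _ Hs. have he2 : 0 < Re s / 2 by lra.
  case: (Hs _ he2) => A [hA HA].
  apply/Cseq_limE => eps he.
  have he3 : 0 < eps * (Re s / 2) / (A + 1) by apply: Rdiv_lt_0_compat; [nra | lra].
  case: (kterm_uniform_1 _ he3) => N0 hN0. exists N0 => N hN.
  have I := is_int01_minus _ _ _ _ (I2 (S N)) I3.
  (* A uniform error [e] in the expansion costs at most [e A / (Re s / 2)] after integration against
     [u^(s-1) ellw]. *)
  set e := eps * (Re s / 2) / (A + 1) in he3 hN0.
  have E : e * A / (Re s / 2) < eps.
    apply/Rlt_div_l => //. have -> : eps * (Re s / 2) = e * (A + 1) by rewrite /e; field; lra. nra.
  apply: Rle_lt_trans E.
  apply: (proj2 (is_int01_power _ (e * A) (Re s / 2) he2 _ (proj1 I) _) _ I); first nra.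
  move=> u hu.
  have -> : (Csum (fun k => mellin_fun ellw s u * RtoC (kterm u k)) (S N) - mellin_fun (fun u => (ellw u * ellw u)%R) s u =
    - (Rcpow u (s - 1) * RtoC (ellw u) * RtoC (ellw u - sum_n (kterm u) N)))%C.
    have -> : Csum (fun k => mellin_fun ellw s u * RtoC (kterm u k))%C (S N) = (mellin_fun ellw s u * RtoC (sum_n (kterm u) N))%C.
      rewrite sum_n_R_C. elim: (S N) => [|m IH] /=; first by ring. rewrite IH. ring.
    rewrite /mellin_fun. move: (ellw u) (sum_n _ _) => w p. rewrite RtoC_minus RtoC_mult. ring.
  rewrite Cmod_opp Cmod_mult (Cmod_mult (Rcpow _ _)) Cmod_Rcpow !Cmod_R Re_minus_1.
  have h1 := HA u hu. have h2 := hN0 N u hN hu. have p := Rpower_pos u (Re s - 1).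
  have -> : Re s / 2 - 1 = (Re s - 1) + - (Re s / 2) by field. rewrite Rpower_plus.
  have a1 : Rpower u (Re s - 1) * Rabs (ellw u) <= Rpower u (Re s - 1) * (A * Rpower u (- (Re s / 2))) by apply: Rmult_le_compat_l; lra.
  have a0 : 0 <= Rpower u (Re s - 1) * Rabs (ellw u) by apply: Rmult_le_pos; [lra | exact: Rabs_pos].
  have := Rmult_le_compat _ _ _ _ a0 (Rabs_pos _) a1 h2. lra.
Qed.

#[local] Transparent mG mG1 ka kb.

Open Scope C_scope.

(** * Saalschützian hypergeometric series *)

Definition hterm (a1 a2 a3 a4 b1 b2 b3 : C) (n : nat) : C :=
  pochhammer a1 n * pochhammer a2 n * pochhammer a3 n * pochhammer a4 n
    / (pochhammer b1 n * pochhammer b2 n * pochhammer b3 n * RtoC (INR (fact n))).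

Lemma RtoC_neq_0 (x : R) : x <> 0%R -> RtoC x <> 0.
Proof. by move=> h /RtoC_inj. Qed.

Lemma Cmod_RtoC_pos (x : R) : (0 <= x)%R -> Cmod (RtoC x) = x.
Proof. move=> h. by rewrite Cmod_R Rabs_pos_eq. Qed.

Definition in_region (eps Z : R) (z : C) : Prop := (eps <= Re z)%R /\ (Cmod z <= Z)%R.

Lemma pochhammer_gauss (m : nat) (z : C) : (0 < Re z)%R ->
  pochhammer z (S m) = RtoC (INR (fact m)) * Rcpow (INR m) z * / gauss m z.
Proof.
  move=> hz. have h1 := pochhammer_neq_0 z (S m) hz. have h2 := Rcpow_neq_0 (INR m) z.
  have h3 : RtoC (INR (fact m)) <> 0 by apply: RtoC_neq_0; exact: INR_fact_neq_0.
  rewrite /gauss. move: (pochhammer _ _) (Rcpow _ _) (RtoC (INR (fact m))) h1 h2 h3 => p r k h1 h2 h3.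
  field. by repeat split.
Qed.

(** With every Pochhammer symbol written as a Gauss product, the powers of [k + 1] combine to the
    exponent [sum a - sum b], which is [- 1] on the hyperplane, and the factorials leave
    [1 / (k + 2)]. The quadratic decay is thus uniform in the parameters. *)
Lemma hterm_gauss (a1 a2 a3 a4 b1 b2 b3 : C) (k : nat) :
  (0 < Re a1)%R -> (0 < Re a2)%R -> (0 < Re a3)%R -> (0 < Re a4)%R ->
  (0 < Re b1)%R -> (0 < Re b2)%R -> (0 < Re b3)%R ->
  b1 + b2 + b3 - a1 - a2 - a3 - a4 = 1 ->
  hterm a1 a2 a3 a4 b1 b2 b3 (S (S k)) =
    (/ gauss (S k) a1 * / gauss (S k) a2 * / gauss (S k) a3 * / gauss (S k) a4)
    * (gauss (S k) b1 * gauss (S k) b2 * gauss (S k) b3)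
    * RtoC (/ (INR (S k) * INR (S (S k)))).
Proof.
  move=> ha1 ha2 ha3 ha4 hb1 hb2 hb3 hs. rewrite /hterm !pochhammer_gauss //.
  have hx : (0 < INR (S k))%R by apply: lt_0_INR; lia.
  have hy : (0 < INR (S (S k)))%R by apply: lt_0_INR; lia.
  have -> : fact (S (S k)) = (S (S k) * fact (S k))%nat by [].
  rewrite mult_INR !RtoC_inv ?RtoC_mult; try nra.
  have E : Rcpow (INR (S k)) b1 * Rcpow (INR (S k)) b2 * Rcpow (INR (S k)) b3 =
    Rcpow (INR (S k)) a1 * Rcpow (INR (S k)) a2 * Rcpow (INR (S k)) a3 * Rcpow (INR (S k)) a4 * RtoC (INR (S k)).
    have -> : RtoC (INR (S k)) = Rcpow (INR (S k)) 1 by rewrite Rcpow_1.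
    rewrite -hs -!Rcpow_plus. f_equal. ring.
  have := Rcpow_neq_0 (INR (S k)) a1. have := Rcpow_neq_0 (INR (S k)) a2.
  have := Rcpow_neq_0 (INR (S k)) a3. have := Rcpow_neq_0 (INR (S k)) a4.
  have := gauss_neq_0 (S k) b1 hb1. have := gauss_neq_0 (S k) b2 hb2. have := gauss_neq_0 (S k) b3 hb3.
  have := gauss_neq_0 (S k) a1 ha1. have := gauss_neq_0 (S k) a2 ha2.
  have := gauss_neq_0 (S k) a3 ha3. have := gauss_neq_0 (S k) a4 ha4.
  have hf : RtoC (INR (fact (S k))) <> 0 by apply: RtoC_neq_0; exact: INR_fact_neq_0.
  have hxn : RtoC (INR (S k)) <> 0 by apply: RtoC_neq_0; lra.
  have hyn : RtoC (INR (S (S k))) <> 0 by apply: RtoC_neq_0; lra.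
  move: E hf hxn hyn.
  move: (Rcpow _ a1) (Rcpow _ a2) (Rcpow _ a3) (Rcpow _ a4) (Rcpow _ b1) (Rcpow _ b2) (Rcpow _ b3) => r1 r2 r3 r4 t1 t2 t3.
  move: (gauss _ a1) (gauss _ a2) (gauss _ a3) (gauss _ a4) (gauss _ b1) (gauss _ b2) (gauss _ b3) => g1 g2 g3 g4 k1 k2 k3.
  move: (RtoC (INR (fact _))) (RtoC (INR (S k))) (RtoC (INR (S (S k)))) => F x y.
  move=> E hF hx' hy' h1 h2 h3 h4 h5 h6 h7 h8 h9 h10 h11.
  have -> : F * r1 * / g1 * (F * r2 * / g2) * (F * r3 * / g3) * (F * r4 * / g4) /
    (F * t1 * / k1 * (F * t2 * / k2) * (F * t3 * / k3) * (y * F)) =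
    (r1 * r2 * r3 * r4) * / (t1 * t2 * t3) * (/ g1 * / g2 * / g3 * / g4) * (k1 * k2 * k3) * / y.
    have : t1 * t2 * t3 <> 0 by rewrite E; repeat apply: Cmult_neq_0.
    move=> ht. have t1n : t1 <> 0 by move=> e; apply: ht; rewrite e; ring.
    have t2n : t2 <> 0 by move=> e; apply: ht; rewrite e; ring.
    have t3n : t3 <> 0 by move=> e; apply: ht; rewrite e; ring.
    field. by repeat split.
  rewrite E. field. by repeat split.
Qed.

Lemma Csum_inv_sq_bound (u : nat -> C) (A : R) (n : nat) : (0 <= A)%R ->
  (forall k, Cmod (u (S (S k))) <= A * / INR (S k) ^ 2)%R ->
  (Cmod (Csum u n) <= Cmod (u 0%nat) + Cmod (u 1%nat) + 2 * A)%R.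
Proof.
  move=> hA h. have c0 := Cmod_ge_0 (u 0%nat). have c1 := Cmod_ge_0 (u 1%nat).
  case: n => [|[|n]].
  - rewrite /= Cmod_0. lra.
  - rewrite /=. have -> : 0 + u 0%nat = u 0%nat by ring. lra.
  - suff : (Cmod (Csum u (S (S n))) <= Cmod (u 0%nat) + Cmod (u 1%nat) + 2 * A * (1 - / INR (S n)))%R.
      have : (0 < / INR (S n))%R by apply: Rinv_0_lt_compat; apply: lt_0_INR; lia.
      move=> i. have := Rmult_le_pos _ _ hA (Rlt_le _ _ i). lra.
    elim: n => [|n IH].
      rewrite /= Rinv_1 Rminus_diag Rmult_0_r Rplus_0_r.
      have -> : 0 + u 0%nat + u 1%nat = u 0%nat + u 1%nat by ring. exact: Cmod_triangle.
    have -> : Csum u (S (S (S n))) = Csum u (S (S n)) + u (S (S n)) by [].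
    apply: Rle_trans (Cmod_plus_le _ _ _ _ IH (h n)) _.
    rewrite (S_INR (S n)). have : (1 <= INR (S n))%R by rewrite S_INR; have := pos_INR n; lra.
    move: (INR (S n)) => x hx.
    have : (/ x ^ 2 <= 2 * (/ x - / (x + 1)))%R.
      have -> : (2 * (/ x - / (x + 1)) = / (x * (x + 1) / 2))%R by field; lra.
      apply: Rinv_le_contravar; nra.
    move=> k. have := Rmult_le_compat_l _ _ _ hA k. lra.
Qed.

Lemma Cmod_inv_le (z : C) (e : R) : (0 < e)%R -> (e <= Re z)%R -> (Cmod (/ z) <= / e)%R.
Proof.
  move=> he hz. have h : (e <= Cmod z)%R by have := Re_le_Cmod z; lra.
  have hn : z <> 0 by apply/Cmod_gt_0; lra.
  rewrite Cmod_inv //. exact: Rinv_le_contravar.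
Qed.

(** The bound depends on the region only, as the limit theorem for holomorphic functions demands.
    The terms of index [0] and [1], outside the Gauss-product form, are bounded by hand. *)
Lemma hyp_bound (eps Z : R) : (0 < eps)%R -> exists M, forall a1 a2 a3 a4 b1 b2 b3,
  in_region eps Z a1 -> in_region eps Z a2 -> in_region eps Z a3 -> in_region eps Z a4 ->
  in_region eps Z b1 -> in_region eps Z b2 -> in_region eps Z b3 ->
  b1 + b2 + b3 - a1 - a2 - a3 - a4 = 1 ->
  (forall n, (Cmod (Csum (hterm a1 a2 a3 a4 b1 b2 b3) n) <= M)%R) /\
  Cseq_lim (Csum (hterm a1 a2 a3 a4 b1 b2 b3)) (hyp4F3 a1 a2 a3 a4 b1 b2 b3).
Proof.
  move=> he. case: (gauss_bounds eps Z he) => B [hB HB].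
  set A := ((B * B * B * B) * (B * B * B))%R.
  have hA : (0 < A)%R by repeat apply: Rmult_lt_0_compat.
  set C1 := (Z * Z * Z * Z * (/ eps * / eps * / eps * 1))%R.
  exists (1 + C1 + 2 * A)%R => a1 a2 a3 a4 b1 b2 b3 [p1 q1] [p2 q2] [p3 q3] [p4 q4] [p5 q5] [p6 q6] [p7 q7] hs.
  have hk k : (Cmod (hterm a1 a2 a3 a4 b1 b2 b3 (S (S k))) <= A * / INR (S k) ^ 2)%R.
    rewrite hterm_gauss //; try lra.
    apply: Cmod_mult_le.
      repeat apply: Cmod_mult_le; by apply HB.
    have hx : (0 < INR (S k))%R by apply: lt_0_INR; lia.
    rewrite (S_INR (S k)). move: (INR (S k)) hx => x hx.
    rewrite Cmod_RtoC_pos; last by apply: Rlt_le; apply: Rinv_0_lt_compat; nra.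
    apply: Rinv_le_contravar; nra.
  have h0 : Cmod (hterm a1 a2 a3 a4 b1 b2 b3 0) = 1%R.
    rewrite /hterm /=. have -> : 1 * 1 * 1 * 1 / (1 * 1 * 1 * 1) = 1.
      have n1 : RtoC 1 <> 0 by apply: RtoC_neq_0; lra. by field.
    exact: Cmod_1.
  have h1 : (Cmod (hterm a1 a2 a3 a4 b1 b2 b3 1) <= C1)%R.
    have nz b : (eps <= Re b)%R -> b <> 0 by move=> h e; rewrite e /= in h; lra.
    have -> : hterm a1 a2 a3 a4 b1 b2 b3 1 = a1 * a2 * a3 * a4 * (/ b1 * / b2 * / b3 * 1).
      rewrite /hterm /=.
      have n1 : RtoC 1 <> 0 by apply: RtoC_neq_0; lra.
      have e x : 1 * (x + 0) = x by ring. rewrite !e.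
      have := nz _ p5. have := nz _ p6. have := nz _ p7 => ? ? ?. field. by repeat split.
    apply: Cmod_mult_le; first by repeat apply: Cmod_mult_le.
    apply: Cmod_mult_le; last by rewrite Cmod_1; lra.
    repeat apply: Cmod_mult_le; exact: Cmod_inv_le.
  split.
    move=> n. have := Csum_inv_sq_bound _ _ n (Rlt_le _ _ hA) hk. lra.
  have [l hl] : exists l, Cseq_lim (fun n => Csum (hterm a1 a2 a3 a4 b1 b2 b3) (S (S n))) l.
    apply: (Cseq_summable _ (fun n => A * / INR (S n) ^ 2)%R).
    - move=> n.
      have -> : Csum (hterm a1 a2 a3 a4 b1 b2 b3) (S (S (S n))) - Csum (hterm a1 a2 a3 a4 b1 b2 b3) (S (S n)) =
        hterm a1 a2 a3 a4 b1 b2 b3 (S (S n)) by simpl Csum; ring.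
      exact: hk.
    - apply: (ex_series_scal_l (V := R_NormedModule)). exact: ex_series_inv_sq.
  have hl1 := proj1 (Cseq_lim_S (fun n => Csum (hterm a1 a2 a3 a4 b1 b2 b3) (S n)) l) hl.
  have hl0 := proj1 (Cseq_lim_S (Csum (hterm a1 a2 a3 a4 b1 b2 b3)) l) hl1.
  have -> : hyp4F3 a1 a2 a3 a4 b1 b2 b3 = l => //.
  apply: Ciota_eq.
    move=> x y hx hy. exact: (@filterlim_locally_unique _ C_AbsRing C_NormedModule eventually _ _ _ _ hx hy).
  apply: filterlim_ext hl1 => n. by rewrite -sum_n_Csum.
Qed.

Section HolTerms.
Context {E : NormedModule C_AbsRing}.
Variables (x0 : E) (r eps : R) (hr : (0 < r)%R) (heps : (0 < eps)%R).

Definition good (f : E -> C) : Prop :=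
  Hol x0 r f /\ forall x, inB x0 r x -> (eps <= Re (f x))%R.

Lemma Hol_hterm (a1 a2 a3 a4 b1 b2 b3 : E -> C) (n : nat) :
  good a1 -> good a2 -> good a3 -> good a4 -> good b1 -> good b2 -> good b3 ->
  Hol x0 r (fun x => hterm (a1 x) (a2 x) (a3 x) (a4 x) (b1 x) (b2 x) (b3 x) n).
Proof.
  move=> [h1 _] [h2 _] [h3 _] [h4 _] [h5 r5] [h6 r6] [h7 r7].
  apply: (Hol_ext _ _ (fun x => pochhammer (a1 x) n * pochhammer (a2 x) n * pochhammer (a3 x) n * pochhammer (a4 x) n
     * (/ pochhammer (b1 x) n * / pochhammer (b2 x) n * / pochhammer (b3 x) n * RtoC (/ INR (fact n))))).
    move=> x hx. rewrite /hterm RtoC_inv; last exact: INR_fact_neq_0.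
    have p5 := pochhammer_neq_0 (b1 x) n (Rlt_le_trans _ _ _ heps (r5 x hx)).
    have p6 := pochhammer_neq_0 (b2 x) n (Rlt_le_trans _ _ _ heps (r6 x hx)).
    have p7 := pochhammer_neq_0 (b3 x) n (Rlt_le_trans _ _ _ heps (r7 x hx)).
    have hf : RtoC (INR (fact n)) <> 0 by apply: RtoC_neq_0; exact: INR_fact_neq_0.
    move: (pochhammer (a1 x) n) (pochhammer (a2 x) n) (pochhammer (a3 x) n) (pochhammer (a4 x) n) => w1 w2 w3 w4.
    move: (pochhammer (b1 x) n) (pochhammer (b2 x) n) (pochhammer (b3 x) n) (RtoC (INR (fact n))) p5 p6 p7 hf => w5 w6 w7 w8 p5 p6 p7 hf.
    field. by repeat split.
  apply: Hol_mult.
  - by repeat apply: Hol_mult; apply: Hol_pochhammer.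
  - apply: Hol_mult; last exact: Hol_const.
    by repeat apply: Hol_mult; apply: (Hol_pochhammer_inv _ _ eps).
Qed.

Lemma good_Gamma_inv (f : E -> C) : good f -> Hol x0 (r / 8) (fun x => / CGamma (f x)).
Proof. move=> [h hre]. exact: (proj1 (Hol_CGamma _ _ _ _ hr heps hre h)). Qed.

Lemma good_in_region (f : E -> C) : good f -> exists Z, forall x, inB x0 r x -> in_region eps Z (f x).
Proof.
  move=> [[D [M H]] hre]. exists M => x hx. split; first exact: hre. exact: (holD_le _ _ _ _ _ H).
Qed.

End HolTerms.

(** * Local analysis at a point with e = 1 *)

Definition ca (q : C6) : C := fst (fst (fst (fst (fst q)))).
Definition cb (q : C6) : C := snd (fst (fst (fst (fst q)))).
Definition cc (q : C6) : C := snd (fst (fst (fst q))).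
Definition cd (q : C6) : C := snd (fst (fst q)).
Definition ce (q : C6) : C := snd (fst q).
Definition cf (q : C6) : C := snd q.

(** What is used of a projection from the nested product: linearity, for evaluation along lines, and
    norm at most [1], for holomorphy and for nearness. *)
Definition coord {U : NormedModule C_AbsRing} (p : U -> C) : Prop :=
  (forall u v : U, p (plus u v) = p u + p v) /\
  (forall (a : C) (v : U), p (scal (a : C_AbsRing) v) = a * p v) /\
  (forall v : U, Cmod (p v) <= norm v)%R.

Lemma coord_id : coord (U := C_NormedModule) (fun z => z).
Proof. split; first by []. split; first by []. move=> v. exact: Rle_refl. Qed.

Lemma coord_fst {U V : NormedModule C_AbsRing} (p : U -> C) :
  coord p -> coord (U := prod_NormedModule C_AbsRing U V) (fun x => p (fst x)).
Proof.
  move=> [h1 [h2 h3]]. split; first by move=> u v; exact: h1. split; first by move=> a v; exact: h2.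
  move=> v. apply: Rle_trans (h3 _) _. exact: norm_le_prod_norm_1.
Qed.

Lemma coord_snd {U V : NormedModule C_AbsRing} (p : V -> C) :
  coord p -> coord (U := prod_NormedModule C_AbsRing U V) (fun x => p (snd x)).
Proof.
  move=> [h1 [h2 h3]]. split; first by move=> u v; exact: h1. split; first by move=> a v; exact: h2.
  move=> v. apply: Rle_trans (h3 _) _. exact: norm_le_prod_norm_2.
Qed.

Lemma ca_coord : coord ca. Proof. exact (coord_fst _ (coord_fst _ (coord_fst _ (coord_fst _ (coord_fst _ coord_id))))). Qed.
Lemma cb_coord : coord cb. Proof. exact (coord_fst _ (coord_fst _ (coord_fst _ (coord_fst _ (coord_snd _ coord_id))))). Qed.
Lemma cc_coord : coord cc. Proof. exact (coord_fst _ (coord_fst _ (coord_fst _ (coord_snd _ coord_id)))). Qed.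
Lemma cd_coord : coord cd. Proof. exact (coord_fst _ (coord_fst _ (coord_snd _ coord_id))). Qed.
Lemma ce_coord : coord ce. Proof. exact (coord_fst _ (coord_snd _ coord_id)). Qed.
Lemma cf_coord : coord cf. Proof. exact (coord_snd _ coord_id). Qed.

Lemma coord_Hol (p : C6 -> C) (q0 : C6) (r : R) : coord p -> Hol q0 r p.
Proof. move=> [h1 [h2 h3]]. apply: (Hol_linear _ _ _ 1) => // v. rewrite Rmult_1_l. exact: h3. Qed.

Lemma coord_minus (p : C6 -> C) (q q0 : C6) : coord p -> p (minus q q0) = p q - p q0.
Proof.
  move=> [h1 [h2 _]]. rewrite /minus h1.
  have -> : opp q0 = scal (-(1) : C_AbsRing) q0 by rewrite -(scal_opp_one q0).
  rewrite h2. ring.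
Qed.

Lemma coord_near (p : C6 -> C) (q q0 : C6) (r : R) : coord p -> inB q0 r q ->
  (Rabs (Re (p q) - Re (p q0)) < r)%R.
Proof.
  move=> hp hq. have h := coord_minus p q q0 hp. case: (hp) => _ [_ h3].
  have := h3 (minus q q0). rewrite h. have := re_le_Cmod (p q - p q0).
  have -> : Re (p q - p q0) = (Re (p q) - Re (p q0))%R by [].
  rewrite /inB in hq. lra.
Qed.

Definition cg (q : C6) : C := 1 + ca q + cb q + cc q + cd q - ce q - cf q.

(** The fourteen arguments of the Gamma function in the numerator. Keeping them in the right
    half-plane makes all Gamma values nonzero and, when [e] is not an integer, the point generic. *)
Definition all_pos (q : C6) : Prop :=
  (0 < Re (ca q) /\ 0 < Re (cb q) /\ 0 < Re (cc q) /\ 0 < Re (cd q) /\ 0 < Re (ce q) /\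
    0 < Re (cf q) /\ 0 < Re (cg q) /\ 0 < Re (1 + ca q - ce q) /\ 0 < Re (1 + cb q - ce q) /\ 0 < Re (1 + cc q - ce q) /\
    0 < Re (1 + cd q - ce q) /\ 0 < Re (1 + cf q - ce q) /\ 0 < Re (1 + cg q - ce q) /\ 0 < Re (2 - ce q))%R.

(** [mishev_expr] times [sin (PI e)], truncated to [n] terms of each series. *)
Definition mnum (n : nat) (q : C6) : C :=
  / CGamma (ce q) * / CGamma (cf q) * / CGamma (cg q)
  * (/ CGamma (1 + ca q - ce q) * / CGamma (1 + cb q - ce q) * / CGamma (1 + cc q - ce q) * / CGamma (1 + cd q - ce q))
  * Csum (hterm (ca q) (cb q) (cc q) (cd q) (ce q) (cf q) (cg q)) n
  - / CGamma (ca q) * / CGamma (cb q) * / CGamma (cc q) * / CGamma (cd q)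
  * (/ CGamma (1 + cf q - ce q) * / CGamma (1 + cg q - ce q) * / CGamma (2 - ce q))
  * Csum (hterm (1 + ca q - ce q) (1 + cb q - ce q) (1 + cc q - ce q) (1 + cd q - ce q)
            (1 + cf q - ce q) (1 + cg q - ce q) (2 - ce q)) n.

Definition mnum_lim (q : C6) : C :=
  / CGamma (ce q) * / CGamma (cf q) * / CGamma (cg q)
  * (/ CGamma (1 + ca q - ce q) * / CGamma (1 + cb q - ce q) * / CGamma (1 + cc q - ce q) * / CGamma (1 + cd q - ce q))
  * hyp4F3 (ca q) (cb q) (cc q) (cd q) (ce q) (cf q) (cg q)
  - / CGamma (ca q) * / CGamma (cb q) * / CGamma (cc q) * / CGamma (cd q)
  * (/ CGamma (1 + cf q - ce q) * / CGamma (1 + cg q - ce q) * / CGamma (2 - ce q))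
  * hyp4F3 (1 + ca q - ce q) (1 + cb q - ce q) (1 + cc q - ce q) (1 + cd q - ce q)
            (1 + cf q - ce q) (1 + cg q - ce q) (2 - ce q).

(** [e = 1] exchanges the two terms. *)
Lemma mnum_e1 (n : nat) (q : C6) : ce q = 1 -> mnum n q = 0.
Proof.
  move=> e. rewrite /mnum e.
  have h z : 1 + z - 1 = z by ring. have h2 : 2 - 1 = 1.
    by rewrite -RtoC_minus; f_equal; ring.
  rewrite !h h2.
  have -> : Csum (hterm (ca q) (cb q) (cc q) (cd q) (cf q) (cg q) 1) n = Csum (hterm (ca q) (cb q) (cc q) (cd q) 1 (cf q) (cg q)) n.
    elim: n => [|n IH] //=. rewrite IH. congr Cplus. rewrite /hterm. congr Cdiv. ring.
  ring.
Qed.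

Section AtE1.
Variables (q0 : C6) (mu : R).
Hypothesis hmu : (0 < mu <= 1)%R.
Hypothesis ha : (mu <= Re (ca q0))%R.
Hypothesis hb : (mu <= Re (cb q0))%R.
Hypothesis hc : (mu <= Re (cc q0))%R.
Hypothesis hd : (mu <= Re (cd q0))%R.
Hypothesis he : ce q0 = 1.
Hypothesis hf : (mu <= Re (cf q0))%R.
Hypothesis hg : (mu <= Re (cg q0))%R.

(** In the ball [cg] moves by at most [6 mu / 16], one part for each coordinate, and adding [1 - e]
    costs another [mu / 16]; the [9 mu / 16] that remain exceed [eps = mu / 2]. *)
Let r : R := (mu / 16)%R.
Let eps : R := (mu / 2)%R.
Let hr : (0 < r)%R. Proof. rewrite /r. lra. Qed.
Let heps : (0 < eps)%R. Proof. rewrite /eps. lra. Qed.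

Lemma Re_cg (q : C6) : Re (cg q) = (1 + Re (ca q) + Re (cb q) + Re (cc q) + Re (cd q) - Re (ce q) - Re (cf q))%R.
Proof. by []. Qed.

Lemma Re_shift (z w : C) : Re (1 + z - w) = (1 + Re z - Re w)%R.
Proof. by []. Qed.

Lemma Re_2_minus (w : C) : Re (2 - w) = (2 - Re w)%R.
Proof. by []. Qed.

Lemma Hol_cg : Hol q0 r cg.
Proof.
  rewrite /cg. repeat first [apply: Hol_minus | apply: Hol_plus | exact: Hol_const].
  - exact: coord_Hol ca_coord.
  - exact: coord_Hol cb_coord.
  - exact: coord_Hol cc_coord.
  - exact: coord_Hol cd_coord.
  - exact: coord_Hol ce_coord.
  - exact: coord_Hol cf_coord.
Qed.

Lemma Hol_shift (p : C6 -> C) : Hol q0 r p -> Hol q0 r (fun q => 1 + p q - ce q).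
Proof.
  move=> h. apply: Hol_minus; last exact: coord_Hol ce_coord. apply: Hol_plus => //. exact: Hol_const.
Qed.

Let nearq (q : C6) : inB q0 r q ->
  (mu - mu / 16 <= Re (ca q) /\ mu - mu / 16 <= Re (cb q) /\ mu - mu / 16 <= Re (cc q) /\ mu - mu / 16 <= Re (cd q) /\
  1 - mu / 16 <= Re (ce q) <= 1 + mu / 16 /\ mu - mu / 16 <= Re (cf q) /\ mu - 6 * mu / 16 <= Re (cg q))%R.
Proof.
  move=> hq.
  move: (coord_near _ _ _ _ ca_coord hq) (coord_near _ _ _ _ cb_coord hq) (coord_near _ _ _ _ cc_coord hq)
    (coord_near _ _ _ _ cd_coord hq) (coord_near _ _ _ _ ce_coord hq) (coord_near _ _ _ _ cf_coord hq).
  rewrite /r => /Rabs_def2 h1 /Rabs_def2 h2 /Rabs_def2 h3 /Rabs_def2 h4 /Rabs_def2 h5 /Rabs_def2 h6.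
  have e1 : Re (ce q0) = 1%R by rewrite he.
  rewrite (Re_cg q). have := Re_cg q0. move: hg. lra.
Qed.

Lemma good_ca : good q0 r eps ca.
Proof. split; first exact: coord_Hol ca_coord. move=> q /nearq. rewrite /eps. lra. Qed.
Lemma good_cb : good q0 r eps cb.
Proof. split; first exact: coord_Hol cb_coord. move=> q /nearq. rewrite /eps. lra. Qed.
Lemma good_cc : good q0 r eps cc.
Proof. split; first exact: coord_Hol cc_coord. move=> q /nearq. rewrite /eps. lra. Qed.
Lemma good_cd : good q0 r eps cd.
Proof. split; first exact: coord_Hol cd_coord. move=> q /nearq. rewrite /eps. lra. Qed.
Lemma good_ce : good q0 r eps ce.
Proof. split; first exact: coord_Hol ce_coord. move=> q /nearq. rewrite /eps. lra. Qed.
Lemma good_cf : good q0 r eps cf.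
Proof. split; first exact: coord_Hol cf_coord. move=> q /nearq. rewrite /eps. lra. Qed.
Lemma good_cg : good q0 r eps cg.
Proof. split; first exact: Hol_cg. move=> q /nearq. rewrite /eps. lra. Qed.
Lemma good_shift (p : C6 -> C) : good q0 r eps p ->
  (forall q, inB q0 r q -> (mu - 6 * mu / 16 <= Re (p q))%R) -> good q0 r eps (fun q => 1 + p q - ce q).
Proof.
  move=> [h _] hp. split; first exact: Hol_shift.
  move=> q hq. have := hp q hq. have := nearq q hq. rewrite Re_shift /eps. lra.
Qed.
Lemma good_e' : good q0 r eps (fun q => 2 - ce q).
Proof.
  split; first by apply: Hol_minus; [exact: Hol_const | exact: coord_Hol ce_coord].
  move=> q /nearq. rewrite Re_2_minus /eps. lra.
Qed.

Let ga' : good q0 r eps (fun q => 1 + ca q - ce q). Proof. apply: good_shift; first exact: good_ca. move=> q /nearq; lra. Qed.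
Let gb' : good q0 r eps (fun q => 1 + cb q - ce q). Proof. apply: good_shift; first exact: good_cb. move=> q /nearq; lra. Qed.
Let gc' : good q0 r eps (fun q => 1 + cc q - ce q). Proof. apply: good_shift; first exact: good_cc. move=> q /nearq; lra. Qed.
Let gd' : good q0 r eps (fun q => 1 + cd q - ce q). Proof. apply: good_shift; first exact: good_cd. move=> q /nearq; lra. Qed.
Let gf' : good q0 r eps (fun q => 1 + cf q - ce q). Proof. apply: good_shift; first exact: good_cf. move=> q /nearq; lra. Qed.
Let gg' : good q0 r eps (fun q => 1 + cg q - ce q). Proof. apply: good_shift; first exact: good_cg. move=> q /nearq; lra. Qed.

Lemma region_all : exists Z, forall q, inB q0 r q ->
  in_region eps Z (ca q) /\ in_region eps Z (cb q) /\ in_region eps Z (cc q) /\ in_region eps Z (cd q) /\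
  in_region eps Z (ce q) /\ in_region eps Z (cf q) /\ in_region eps Z (cg q) /\
  in_region eps Z (1 + ca q - ce q) /\ in_region eps Z (1 + cb q - ce q) /\ in_region eps Z (1 + cc q - ce q) /\
  in_region eps Z (1 + cd q - ce q) /\ in_region eps Z (1 + cf q - ce q) /\ in_region eps Z (1 + cg q - ce q) /\
  in_region eps Z (2 - ce q).
Proof.
  have [Z1 z1] := good_in_region _ _ _ _ good_ca. have [Z2 z2] := good_in_region _ _ _ _ good_cb.
  have [Z3 z3] := good_in_region _ _ _ _ good_cc. have [Z4 z4] := good_in_region _ _ _ _ good_cd.
  have [Z5 z5] := good_in_region _ _ _ _ good_ce. have [Z6 z6] := good_in_region _ _ _ _ good_cf.
  have [Z7 z7] := good_in_region _ _ _ _ good_cg. have [Z8 z8] := good_in_region _ _ _ _ ga'.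
  have [Z9 z9] := good_in_region _ _ _ _ gb'. have [Z10 z10] := good_in_region _ _ _ _ gc'.
  have [Z11 z11] := good_in_region _ _ _ _ gd'. have [Z12 z12] := good_in_region _ _ _ _ gf'.
  have [Z13 z13] := good_in_region _ _ _ _ gg'. have [Z14 z14] := good_in_region _ _ _ _ good_e'.
  exists (Rabs Z1 + Rabs Z2 + Rabs Z3 + Rabs Z4 + Rabs Z5 + Rabs Z6 + Rabs Z7 + Rabs Z8 + Rabs Z9 + Rabs Z10 + Rabs Z11 + Rabs Z12 + Rabs Z13 + Rabs Z14)%R => q hq.
  have ab x := conj (Rle_abs x) (Rabs_pos x).
  move: (ab Z1) (ab Z2) (ab Z3) (ab Z4) (ab Z5) (ab Z6) (ab Z7) (ab Z8) (ab Z9) (ab Z10) (ab Z11) (ab Z12) (ab Z13) (ab Z14).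
  move: (z1 q hq) (z2 q hq) (z3 q hq) (z4 q hq) (z5 q hq) (z6 q hq) (z7 q hq) (z8 q hq) (z9 q hq) (z10 q hq) (z11 q hq) (z12 q hq) (z13 q hq) (z14 q hq).
  rewrite /in_region => *. repeat split; lra.
Qed.

(** The differentials of the truncated numerators are kept along with the limit, since they are the
    ones that can be computed; at [q0] they converge to the differential of [mnum_lim]. The radius
    is divided by [8] once for the Gamma factors and once for the limit. *)
Lemma mnum_limit : exists D D' M', (forall n, exists M, holD q0 (r / 8) (mnum n) (D n) M) /\
  holD q0 (r / 8 / 8) mnum_lim D' M' /\
  (forall v, Cseq_lim (fun n => D n q0 v) (D' q0 v)).
Proof.
  have r8 : (r / 8 <= r)%R by lra.
  have [Z hZ] := region_all.
  have [M HM] := hyp_bound eps Z heps.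
  have i8 q : inB q0 (r / 8) q -> inB q0 r q by apply: inB_le.
  pose c1 q := / CGamma (ce q) * / CGamma (cf q) * / CGamma (cg q)
  * (/ CGamma (1 + ca q - ce q) * / CGamma (1 + cb q - ce q) * / CGamma (1 + cc q - ce q) * / CGamma (1 + cd q - ce q)).
  pose c2 q := / CGamma (ca q) * / CGamma (cb q) * / CGamma (cc q) * / CGamma (cd q)
  * (/ CGamma (1 + cf q - ce q) * / CGamma (1 + cg q - ce q) * / CGamma (2 - ce q)).
  have G (p : C6 -> C) : good q0 r eps p -> Hol q0 (r / 8) (fun q => / CGamma (p q)) by exact: (good_Gamma_inv q0 r eps).
  have H1 : Hol q0 (r / 8) c1.
    rewrite /c1. repeat apply: Hol_mult; apply: G => //; [exact: good_ce | exact: good_cf | exact: good_cg].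
  have H2 : Hol q0 (r / 8) c2.
    rewrite /c2. repeat apply: Hol_mult; apply: G => //; [exact: good_ca | exact: good_cb | exact: good_cc | exact: good_cd | exact: good_e'].
  have S1 q : inB q0 r q -> ce q + cf q + cg q - ca q - cb q - cc q - cd q = 1 by move=> _; rewrite /cg; ring.
  have S2 q : inB q0 r q -> (1 + cf q - ce q) + (1 + cg q - ce q) + (2 - ce q) - (1 + ca q - ce q) - (1 + cb q - ce q) - (1 + cc q - ce q) - (1 + cd q - ce q) = 1.
    move=> _. rewrite /cg. have -> : RtoC 2 = 1 + 1 by rewrite -RtoC_plus; f_equal; ring. ring.
  have K q (hq : inB q0 r q) :
    ((forall n, (Cmod (Csum (hterm (ca q) (cb q) (cc q) (cd q) (ce q) (cf q) (cg q)) n) <= M)%R) /\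
    Cseq_lim (Csum (hterm (ca q) (cb q) (cc q) (cd q) (ce q) (cf q) (cg q))) (hyp4F3 (ca q) (cb q) (cc q) (cd q) (ce q) (cf q) (cg q))) /\
    ((forall n, (Cmod (Csum (hterm (1 + ca q - ce q) (1 + cb q - ce q) (1 + cc q - ce q) (1 + cd q - ce q)
            (1 + cf q - ce q) (1 + cg q - ce q) (2 - ce q)) n) <= M)%R) /\
    Cseq_lim (Csum (hterm (1 + ca q - ce q) (1 + cb q - ce q) (1 + cc q - ce q) (1 + cd q - ce q)
            (1 + cf q - ce q) (1 + cg q - ce q) (2 - ce q))) (hyp4F3 (1 + ca q - ce q) (1 + cb q - ce q) (1 + cc q - ce q) (1 + cd q - ce q)
            (1 + cf q - ce q) (1 + cg q - ce q) (2 - ce q))).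
    have := hZ q hq => z. split; apply: HM; try tauto; [exact: S1 | exact: S2].
  have HN n : Hol q0 (r / 8) (mnum n).
    apply: Hol_minus; apply: Hol_mult => //.
    - apply: (Hol_Csum _ _ (fun k q => hterm (ca q) (cb q) (cc q) (cd q) (ce q) (cf q) (cg q) k)) => k.
      apply: (Hol_restr _ _ _ _ r8). apply: (Hol_hterm _ _ eps) => //;
        [exact: good_ca | exact: good_cb | exact: good_cc | exact: good_cd | exact: good_ce | exact: good_cf | exact: good_cg].
    - apply: (Hol_Csum _ _ (fun k q => hterm (1 + ca q - ce q) (1 + cb q - ce q) (1 + cc q - ce q) (1 + cd q - ce q)
            (1 + cf q - ce q) (1 + cg q - ce q) (2 - ce q) k)) => k.
      apply: (Hol_restr _ _ _ _ r8). apply: (Hol_hterm _ _ eps) => //. exact: good_e'.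
  case: (choice _ HN) => D HD.
  case: H1 => D1 [M1 /holD_le B1]. case: H2 => D2 [M2 /holD_le B2].
  have hb' n q : inB q0 (r / 8) q -> (Cmod (mnum n q) <= M1 * M + M2 * M)%R.
    move=> hq. case: (K q (i8 q hq)) => [[k1 _] [k2 _]].
    apply: Rle_trans (Cmod_minus_le _ _) _. apply: Rplus_le_compat.
    - exact: Cmod_mult_le (B1 q hq) (k1 n).
    - exact: Cmod_mult_le (B2 q hq) (k2 n).
  have hl q : inB q0 (r / 8) q -> Cseq_lim (fun n => mnum n q) (mnum_lim q).
    move=> hq. case: (K q (i8 q hq)) => [[_ k1] [_ k2]].
    apply: Cseq_lim_minus; apply: Cseq_lim_mult => //; exact: Cseq_lim_const.
  have hr8 : (0 < r / 8)%R by lra.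
  case: (Hol_limit _ _ _ _ _ _ hr8 HD hb' hl) => D' [M' [h1 h2]].
  exists D, D', M'. split => //. split => // v. apply: h2. apply: inB_center. lra.
Qed.

Lemma Csin_line : cdiff idC (fun t => Csin (RtoC PI * (1 + t * 1))) 0 (- RtoC PI).
Proof.
  have n2 : RtoC 2 <> 0 by apply: RtoC_neq_0; lra.
  have ni : Ci <> 0 by apply/Cmod_gt_0; rewrite Cmod_Ci; lra.
  have L (k : C) : cdiff idC (fun t => Cexp (k * (RtoC PI * (1 + t * 1)))) 0 (Cexp (k * RtoC PI) * (k * RtoC PI)).
    have e0 : k * (RtoC PI * (1 + 0 * 1)) = k * RtoC PI by ring.
    apply: (cdiff_comp idC (fun t => k * (RtoC PI * (1 + t * 1))) Cexp); last by rewrite e0; exact: cdiff_Cexp.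
    apply: cdiff_scal.
    have -> : RtoC PI = RtoC PI * (0 + (1 * 1 + 0 * 0)) by ring.
    apply: (cdiff_ext _ (fun t => RtoC PI * (1 + t * 1))); first by move=> t; ring.
    apply: cdiff_scal. apply: cdiff_plus; first exact: cdiff_const.
    apply: cdiff_mult; [exact: cdiff_id | exact: cdiff_const].
  have := cdiff_scal _ (/ (2 * Ci)) _ _ _ (cdiff_minus _ _ _ _ _ _ (L Ci) (L (- Ci))).
  have eP : Cexp (Ci * RtoC PI) = -(1).
    rewrite /Cexp /Ci /Cmult /RtoC /Copp /Re /Im /=.
    have -> : (0 * PI - 1 * 0 = 0)%R by ring. have -> : (0 * 0 + 1 * PI = PI)%R by ring.
    rewrite exp_0 cos_PI sin_PI. f_equal; ring.
  have eM : Cexp (- Ci * RtoC PI) = -(1).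
    have : Cexp (Ci * RtoC PI) * Cexp (- Ci * RtoC PI) = 1.
      rewrite -Cexp_plus -Cexp_0. f_equal. ring.
    rewrite eP => X.
    have -> : Cexp (- Ci * RtoC PI) = -(1) * (-(1) * Cexp (- Ci * RtoC PI)) by ring. rewrite X. ring.
  rewrite eP eM.
  have -> : / (2 * Ci) * (- (1) * (Ci * RtoC PI) - - (1) * (- Ci * RtoC PI)) = - RtoC PI by field.
  apply: cdiff_ext => t. rewrite /Csin.
  have -> : - (Ci * (RtoC PI * (1 + t * 1))) = - Ci * (RtoC PI * (1 + t * 1)) by ring.
  rewrite /Cdiv. ring.
Qed.

Lemma Csin_PI : Csin (RtoC PI * 1) = 0.
Proof.
  rewrite /Csin. have -> : - (Ci * (RtoC PI * 1)) = Ci * RtoC PI * -(1) by ring.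
  rewrite /Cexp /Ci /Cmult /RtoC /Copp /Re /Im /=.
  have -> : (0 * (PI * 1 - 0 * 0) - 1 * (PI * 0 + 0 * 1) = 0)%R by ring.
  have -> : (0 * (PI * 0 + 0 * 1) + 1 * (PI * 1 - 0 * 0) = PI)%R by ring.
  have -> : ((0 * PI - 1 * 0) * - (1) - (0 * 0 + 1 * PI) * - 0 = 0)%R by ring.
  have -> : ((0 * PI - 1 * 0) * - 0 + (0 * 0 + 1 * PI) * - (1) = - PI)%R by ring.
  rewrite exp_0 cos_neg sin_neg sin_PI cos_PI. rewrite /Cdiv /Cinv /Cminus /Cplus /Cmult /Copp /=.
  f_equal; ring.
Qed.

Lemma Hol_Csin (d : R) : Hol q0 d (fun q => Csin (RtoC PI * ce q)).
Proof.
  rewrite /Csin /Cdiv. apply: Hol_mult; last exact: Hol_const.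
  have Hl (k : C) : Hol q0 d (fun q => k * (RtoC PI * ce q)).
    apply: Hol_mult; first exact: Hol_const. apply: Hol_mult; first exact: Hol_const. exact: coord_Hol ce_coord.
  apply: Hol_minus; apply: Hol_exp_comp => //. exact: Hol_opp.
Qed.

(** [F] is the quotient of two functions already divided by [e - 1]: the numerator, with value [D']
    at [q0], and the sine, with value [- PI]. [D'] is given as a limit of truncated derivatives so
    that it can be computed in a convenient direction. *)
Lemma mishev_extension (v : C6) : ce v = 1 -> exists D D' F d,
  (forall n, exists d M, (0 < d)%R /\ holD q0 d (mnum n) (D n) M) /\
  Cseq_lim (fun n => D n q0 v) D' /\ (0 < d)%R /\ Hol q0 d F /\ F q0 = - (D' / RtoC PI) /\
  (forall q, inB q0 d q -> all_pos q) /\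
  (forall q, inB q0 d q -> ce q <> 1 ->
    F q = mishev_expr (ca q) (cb q) (cc q) (cd q) (ce q) (cf q) (cg q)).
Proof.
  move=> hv.
  have hpi := PI_RGT_0. have npi : RtoC PI <> 0 by apply: RtoC_neq_0; lra.
  case: mnum_limit => D [D' [M' [HD [HN HL]]]].
  have hr8 : (0 < r / 8)%R by lra. have hr64 : (0 < r / 8 / 8)%R by lra.
  have [ep [es el]] := ce_coord.
  have l1 v' : (Cmod (ce v') <= 1 * norm v')%R by rewrite Rmult_1_l.
  have N0 q : inB q0 (r / 8 / 8) q -> ce (minus q q0) = 0 -> mnum_lim q = 0.
    move=> hq. rewrite (coord_minus _ _ _ ce_coord) he => h.
    have e1 : ce q = 1.
      have -> : ce q = (ce q - 1) + 1 by ring. rewrite h. ring.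
    have [Z hZ] := region_all. have [M HM] := hyp_bound eps Z heps.
    have hq' : inB q0 r q by apply: inB_le hq; lra.
    have z := hZ q hq'.
    have k1 : Cseq_lim (Csum (hterm (ca q) (cb q) (cc q) (cd q) (ce q) (cf q) (cg q))) (hyp4F3 (ca q) (cb q) (cc q) (cd q) (ce q) (cf q) (cg q)).
      apply HM; try tauto. rewrite /cg. ring.
    have k2 : Cseq_lim (Csum (hterm (1 + ca q - ce q) (1 + cb q - ce q) (1 + cc q - ce q) (1 + cd q - ce q)
            (1 + cf q - ce q) (1 + cg q - ce q) (2 - ce q))) (hyp4F3 (1 + ca q - ce q) (1 + cb q - ce q) (1 + cc q - ce q) (1 + cd q - ce q)
            (1 + cf q - ce q) (1 + cg q - ce q) (2 - ce q)).
      apply HM; try tauto. rewrite /cg. have -> : RtoC 2 = 1 + 1 by rewrite -RtoC_plus; f_equal; ring. ring.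
    have L : Cseq_lim (fun n => mnum n q) (mnum_lim q).
      apply: Cseq_lim_minus; apply: Cseq_lim_mult => //; exact: Cseq_lim_const.
    apply: Cseq_lim_unique L _. apply: Cseq_lim_ext (Cseq_lim_const _) => n. by rewrite mnum_e1.
  case: (Hol_divide _ _ _ _ _ ce 1 v hr64 HN Rle_0_1 ep es l1 hv N0) => rG [G [hrG [HG [G0 Gq]]]].
  case: (Hol_Csin 1) => Ds [Ms Hs].
  have s0 q : inB q0 1 q -> ce (minus q q0) = 0 -> Csin (RtoC PI * ce q) = 0.
    move=> _. rewrite (coord_minus _ _ _ ce_coord) he => h.
    have -> : ce q = 1.
      have -> : ce q = (ce q - 1) + 1 by ring. rewrite h. ring.
    exact: Csin_PI.
  case: (Hol_divide _ _ _ _ _ ce 1 v Rlt_0_1 Hs Rle_0_1 ep es l1 hv s0) => rS [S [hrS [HS [S0 Sq]]]].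
  have S0v : S q0 = - RtoC PI.
    rewrite S0. apply: cdiff_unique _ Csin_line.
    apply: cdiff_ext (holD_line _ _ _ _ _ _ v Hs (inB_center _ _ Rlt_0_1)) => t.
    rewrite ep es hv he. done.
  have [Ls HLs] := Hol_lip _ _ _ HS.
  (* The last radius keeps [S] within [PI / 2] of its value [- PI] at the centre, by its Lipschitz
     bound, so that its inverse is holomorphic. *)
  set d := Rmin (Rmin rG rS) (Rmin (r / 8 / 8) (PI / 2 / (Rabs Ls + 1))).
  have hL := Rabs_pos Ls.
  have hd0 : (0 < d)%R by repeat apply: Rmin_pos => //; apply: Rdiv_lt_0_compat; lra.
  have d1 : (d <= rG)%R by apply: Rle_trans (Rmin_l _ _) (Rmin_l _ _).
  have d2 : (d <= rS)%R by apply: Rle_trans (Rmin_l _ _) (Rmin_r _ _).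
  have d3 : (d <= r / 8 / 8)%R by apply: Rle_trans (Rmin_r _ _) (Rmin_l _ _).
  have d4 : (d <= PI / 2 / (Rabs Ls + 1))%R by apply: Rle_trans (Rmin_r _ _) (Rmin_r _ _).
  have Sge q : inB q0 d q -> (PI / 2 <= Cmod (S q))%R.
    move=> hq. have := HLs q0 q (inB_center _ _ hrS) (inB_le _ _ _ _ d2 hq). rewrite S0v.
    have := Cmod_ge_minus (- RtoC PI) (- RtoC PI - S q).
    have -> : - RtoC PI - (- RtoC PI - S q) = S q by ring.
    rewrite Cmod_opp Cmod_RtoC_pos; last lra. rewrite (Cmod_minus_sym (- RtoC PI)).
    rewrite /inB in hq. have n0 := norm_ge_0 (minus q q0).
    have : (norm (minus q q0) * (Rabs Ls + 1) <= PI / 2)%R by apply/Rle_div_r; lra.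
    have := Rle_abs Ls. nra.
  exists D, (D' q0 v), (fun q => G q * / S q), d.
  split; first by move=> n; case: (HD n) => M hM; exists (r / 8)%R, M.
  split; first exact: HL. split => //. split.
    apply: Hol_mult; first exact: Hol_restr d1 HG.
    apply: (Hol_inv _ _ (PI / 2)) => //; first lra. exact: Hol_restr d2 HS.
  split.
    rewrite G0 S0v. by field.
  have hRe q : inB q0 d q -> all_pos q.
    move=> hq. have hq' : inB q0 r q by apply: inB_le hq; lra.
    have := nearq q hq'. rewrite /all_pos !Re_shift Re_2_minus. lra.
  split => // q hq hne.
  have hne' : ce (minus q q0) <> 0.
    rewrite (coord_minus _ _ _ ce_coord) he => h. apply: hne.
    have -> : ce q = (ce q - 1) + 1 by ring. rewrite h. ring.
  have eG := Gq q (inB_le _ _ _ _ d1 hq) hne'. have eS := Sq q (inB_le _ _ _ _ d2 hq) hne'.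
  have Sn : S q <> 0 by apply/Cmod_gt_0; have := Sge q hq; lra.
  have sn : Csin (RtoC PI * ce q) <> 0.
    move=> h. apply: Sn. rewrite eS h. rewrite /Cdiv. ring.
  rewrite eG eS.
  have -> : mnum_lim q / ce (minus q q0) * / (Csin (RtoC PI * ce q) / ce (minus q q0)) = mnum_lim q / Csin (RtoC PI * ce q).
    move: (mnum_lim q) (ce (minus q q0)) (Csin _) hne' sn => x y z h1 h2. field. by split.
  have := hRe q hq. rewrite /all_pos /mishev_expr /mnum_lim.
  move=> [/CGamma_neq_0 n1 [/CGamma_neq_0 n2 [/CGamma_neq_0 n3 [/CGamma_neq_0 n4 [/CGamma_neq_0 n5 [/CGamma_neq_0 n6
    [/CGamma_neq_0 n7 [/CGamma_neq_0 n8 [/CGamma_neq_0 n9 [/CGamma_neq_0 n10 [/CGamma_neq_0 n11 [/CGamma_neq_0 n12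
    [/CGamma_neq_0 n13 /CGamma_neq_0 n14]]]]]]]]]]]]].
  move: (hyp4F3 (ca q) _ _ _ _ _ _) (hyp4F3 (1 + ca q - ce q) _ _ _ _ _ _) => h1 h2.
  move: (Csin _) sn n1 n2 n3 n4 n5 n6 n7 n8 n9 n10 n11 n12 n13 n14 => z sn.
  move: (CGamma (ca q)) (CGamma (cb q)) (CGamma (cc q)) (CGamma (cd q)) (CGamma (ce q)) (CGamma (cf q)) (CGamma (cg q))
    (CGamma (1 + ca q - ce q)) (CGamma (1 + cb q - ce q)) (CGamma (1 + cc q - ce q)) (CGamma (1 + cd q - ce q))
    (CGamma (1 + cf q - ce q)) (CGamma (1 + cg q - ce q)) (CGamma (2 - ce q)).
  move=> w1 w2 w3 w4 w5 w6 w7 w8 w9 w10 w11 w12 w13 w14 n1 n2 n3 n4 n5 n6 n7 n8 n9 n10 n11 n12 n13 n14.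
  field. by repeat split.
Qed.

End AtE1.

(** * The value of Mishev's function *)

Lemma holD_ex_filterdiff {E : NormedModule C_AbsRing} (x0 : E) (r : R) (f : E -> C_NormedModule)
    (D : E -> E -> C) (M : R) (x : E) :
  holD x0 r f D M -> inB x0 r x -> ex_filterdiff f (locally x).
Proof.
  move=> H hx. exists (D x). split.
  - split.
    + move=> u v. exact: (holD_plus _ _ _ _ _ H).
    + move=> k v. exact: (holD_scal _ _ _ _ _ H).
    + exists (Rabs M + 1)%R. split; first by have := Rabs_pos M; lra.
      move=> v. apply: Rle_trans (holD_dle _ _ _ _ _ H x v hx) _.
      apply: Rmult_le_compat_r; first exact: norm_ge_0. have := Rle_abs M. lra.
  - move=> x' /is_filter_lim_locally_unique <- eps.
    apply: (locally_le_locally_norm x).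
    have hM := Rabs_pos M. have he := cond_pos eps.
    have hd : (0 < Rmin (r - norm (minus x x0)) (eps / (Rabs M + 1)))%R.
      rewrite /inB in hx. apply: Rmin_pos; first lra. apply: Rdiv_lt_0_compat; lra.
    exists (mkposreal _ hd) => y hy. rewrite /ball_norm /= in hy.
    have h1 := Rlt_le_trans _ _ _ hy (Rmin_l _ _). have h2 := Rlt_le_trans _ _ _ hy (Rmin_r _ _).
    have hy' : inB x0 r y by rewrite /inB; have := norm_minus_triangle y x x0; lra.
    apply: Rle_trans (holD_quad _ _ _ _ _ H x y hx hy') _.
    have n0 := norm_ge_0 (minus y x).
    have h3 : (norm (minus y x) * (Rabs M + 1) < eps)%R by apply/Rlt_div_r => //; lra.
    have h4 : (M * norm (minus y x) <= eps)%R by have := Rle_abs M; nra.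
    have -> : (M * norm (minus y x) ^ 2 = (M * norm (minus y x)) * norm (minus y x))%R by ring.
    exact: Rmult_le_compat_r.
Qed.

Lemma not_nonpos_int (z : C) : (0 < Re z)%R -> ~ nonpos_int z.
Proof. move=> h [n e]. rewrite e /= in h. have := pos_INR n. lra. Qed.

Lemma continuous_ex_filterdiff (F : C6 -> C_NormedModule) (q0 : C6) (eps : R) : (0 < eps)%R ->
  ex_filterdiff F (locally q0) -> locally q0 (fun q => (Cmod (F q - F q0) < eps)%R).
Proof.
  move=> he H. have := filterdiff_continuous F q0 H.
  move/(filterlim_C _ _ _) => X. exact: X.
Qed.

(** The agreement condition of [is_mishevL] through projections in place of a pattern, hence usable
    at a point that is not a literal tuple. *)
Definition mishev_at (F : C6 -> C) (q : C6) : Prop :=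
  mishev_generic (ca q) (cb q) (cc q) (cd q) (ce q) (cf q) (cg q) ->
  F q = mishev_expr (ca q) (cb q) (cc q) (cd q) (ce q) (cf q) (cg q).

Lemma mishev_atE (F : C6 -> C) (q : C6) : mishev_at F q <->
  let '(a', b', c', d', e', f') := q in
  let g' := 1 + a' + b' + c' + d' - e' - f' in
  mishev_generic a' b' c' d' e' f' g' -> F q = mishev_expr a' b' c' d' e' f' g'.
Proof. by case: q => [[[[[a b] c] d] e] f]. Qed.

Definition e6 : C6 := (RtoC 0, RtoC 0, RtoC 0, RtoC 0, RtoC 1, RtoC 0).

Lemma mishev_generic_near (q0 : C6) (t : R) : ce q0 = 1 -> (0 < t < 1)%R ->
  let q := plus q0 (scal (RtoC t : C_AbsRing) e6) in
  all_pos q ->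
  mishev_generic (ca q) (cb q) (cc q) (cd q) (ce q) (cf q) (cg q).
Proof.
  move=> he ht q. rewrite /all_pos => H. split.
  - have -> : ce q = RtoC (1 + t).
      have [ep [es _]] := ce_coord. rewrite /q ep es he RtoC_plus. change (ce e6) with (RtoC 1). ring.
    move=> n /RtoC_inj e.
    have h1 : (1 < n)%Z by apply: lt_IZR; lra. have h2 : (n < 2)%Z by apply: lt_IZR; lra. lia.
  - repeat (apply: Forall_cons; first by apply: not_nonpos_int; tauto). exact: Forall_nil.
Qed.

(** Both germs equal [mishev_expr] at [q0 + t e6], generic for small real [t > 0] because
    [e = 1 + t] is then no integer; continuity at [q0] forces the two values to coincide. *)
Lemma mishevL_unique (a b c d e f g x y : C) (q0 : C6) (d0 : R) : (0 < d0)%R ->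
  q0 = (a, b, c, d, e, f) -> e = 1 ->
  (forall q, inB q0 d0 q -> all_pos q) ->
  is_mishevL a b c d e f g x -> is_mishevL a b c d e f g y -> x = y.
Proof.
  move=> hd0 eq0 he hRe [_ [F1 [A1 [B1 <-]]]] [_ [F2 [A2 [B2 <-]]]].
  rewrite -eq0 in A1 B1 A2 B2 *.
  apply: NNPP => hne.
  set eta := (Cmod (F1 q0 - F2 q0) / 2)%R.
  have heta : (0 < eta)%R.
    have : (0 < Cmod (F1 q0 - F2 q0))%R; last by rewrite /eta; lra.
    have sub0 (u w : C) : u - w = 0 -> u = w.
      move=> e0. have -> : u = (u - w) + w by ring. rewrite e0. ring.
    apply/Cmod_gt_0 => h. apply: hne. exact: (sub0 (F1 q0) (F2 q0)).
  have C1 := continuous_ex_filterdiff F1 q0 _ heta (locally_singleton _ _ A1).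
  have C2 := continuous_ex_filterdiff F2 q0 _ heta (locally_singleton _ _ A2).
  have FF : Filter (locally q0) by exact: filter_filter.
  have hl0 := @filter_and _ _ FF _ _ (@filter_and _ _ FF _ _ C1 C2) (@filter_and _ _ FF _ _ B1 B2).
  case: (locally_norm_le_locally q0 _ hl0) => dl Hd.
  have n0 := norm_ge_0 e6. have hdl := cond_pos dl.
  set m := Rmin (Rmin (/ 2) (dl / (norm e6 + 1))) (d0 / (norm e6 + 1)).
  have hm : (0 < m)%R by repeat apply: Rmin_pos; try apply: Rdiv_lt_0_compat; lra.
  have m1 : (m <= / 2)%R by apply: Rle_trans (Rmin_l _ _) (Rmin_l _ _).
  have m2 : (m * (norm e6 + 1) <= dl)%R.
    apply/Rle_div_r; first lra. by apply: Rle_trans (Rmin_l _ _) (Rmin_r _ _).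
  have m3 : (m * (norm e6 + 1) <= d0)%R by apply/Rle_div_r; [lra | exact: Rmin_r].
  set t := (m / 2)%R. have ht : (0 < t < 1)%R by rewrite /t; lra.
  have cm : (Cmod (RtoC t) = m / 2)%R by rewrite Cmod_RtoC_pos //; rewrite /t; lra.
  have mn : (m / 2 * norm e6 < m * (norm e6 + 1))%R by nra.
  pose q := plus q0 (scal (RtoC t : C_AbsRing) e6).
  have hq1 : inB q0 dl q by apply: inB_line; rewrite minus_self norm_zero cm; lra.
  have hq2 : inB q0 d0 q by apply: inB_line; rewrite minus_self norm_zero cm; lra.
  have ce0 : ce q0 = 1 by rewrite eq0.
  have gen := mishev_generic_near q0 t ce0 ht (hRe q hq2).
  move: hq1 hq2 gen. rewrite -/q. move: q => q hq1 hq2 gen.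
  case: (Hd q hq1) => [[h1 h2] [h3 h4]].
  have g1 := proj2 (mishev_atE F1 q) h3 gen. have g2 := proj2 (mishev_atE F2 q) h4 gen.
  rewrite g1 in h1. rewrite g2 in h2.
  have := Cmod_minus_le (mishev_expr (ca q) (cb q) (cc q) (cd q) (ce q) (cf q) (cg q) - F2 q0)
    (mishev_expr (ca q) (cb q) (cc q) (cd q) (ce q) (cf q) (cg q) - F1 q0).
  have -> : mishev_expr (ca q) (cb q) (cc q) (cd q) (ce q) (cf q) (cg q) - F2 q0 -
    (mishev_expr (ca q) (cb q) (cc q) (cd q) (ce q) (cf q) (cg q) - F1 q0) = F1 q0 - F2 q0.
    move: (mishev_expr _ _ _ _ _ _ _) (F1 q0) (F2 q0) => u v w. ring.
  rewrite /eta in h1 h2. lra.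
Qed.

(** The derivatives stay unnamed: digamma values never appear in the result, being either eliminated
    in favour of [mG1] or multiplied by zero. *)
Lemma CGamma_cdiff (z : C) : (0 < Re z)%R ->
  exists l l', cdiff idC CGamma z l /\ cdiff idC (fun z => / CGamma z) z l'.
Proof.
  move=> hz.
  have hr : (0 < Re z / 2)%R by lra.
  have hH : Hol (E := C_NormedModule) z (Re z / 2) (fun y => y).
    apply: (Hol_linear _ _ (fun y : C_NormedModule => y : C) 1) => // y. rewrite Rmult_1_l. exact: Rle_refl.
  have hre (y : C_NormedModule) : inB (E := C_NormedModule) z (Re z / 2) y -> (Re z / 2 <= Re y)%R.
    rewrite /inB. change (Cmod (y - z) < Re z / 2 -> Re z / 2 <= Re y)%R.
    have := re_le_Cmod (y - z). have -> : Re (y - z) = (Re y - Re z)%R by [].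
    move=> h1 h2. have := Rle_abs (- (Re y - Re z)). rewrite Rabs_Ropp. lra.
  case: (Hol_CGamma _ _ _ _ hr hr hre hH) => [[D' [M' H']] [D [M H]]].
  have hc : inB (E := C_NormedModule) z (Re z / 2 / 8) z by apply: inB_center; lra.
  have sh (f : C -> C) (l : C) : cdiff idC (fun t => f (z + t * 1)) 0 l -> cdiff idC f z l.
    move=> h. have hz' : cdiff idC (fun y => y - z) z 1.
      have -> : RtoC 1 = 1 - 0 by ring. apply: cdiff_minus; [exact: cdiff_id | exact: cdiff_const].
    have h2 : cdiff idC (fun t => f (z + t * 1)) (z - z) l by have -> : z - z = 0 by ring.
    have := cdiff_comp _ _ _ _ _ _ hz' h2. have -> : l * 1 = l by ring.
    apply: cdiff_ext => y. f_equal. ring.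
  exists (D z (RtoC 1)), (D' z (RtoC 1)). split; apply: sh.
  - exact: (holD_line _ _ _ _ _ _ (RtoC 1 : C_NormedModule) H hc).
  - exact: (holD_line _ _ _ _ _ _ (RtoC 1 : C_NormedModule) H' hc).
Qed.

Lemma fact_CGamma (n : nat) : RtoC (INR (fact n)) = CGamma (1 + RtoC (INR n)).
Proof.
  have h1 : (0 < Re 1)%R by rewrite /=; lra.
  have := pochhammer_CGamma 1 n h1. rewrite CGamma_1.
  have -> : CGamma (1 + RtoC (INR n)) / 1 = CGamma (1 + RtoC (INR n)).
    have n1 : RtoC 1 <> 0 by apply: RtoC_neq_0; lra. by field.
  move=> <-. elim: n => [|n IH] //=.
  change (fact n + n * fact n)%nat with (fact (S n)). rewrite -IH.
  have -> : fact (S n) = (S n * fact n)%nat by []. rewrite mult_INR RtoC_mult S_INR RtoC_plus. ring.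
Qed.

(** A term of the series with its Pochhammer symbols replaced by shifted Gamma functions, in which a
    derivative with respect to the parameters can be taken factor by factor. *)
Definition gterm (a1 a2 a3 a4 b1 b2 b3 : C) (n : nat) : C :=
  CGamma (a1 + RtoC (INR n)) * CGamma (a2 + RtoC (INR n)) * CGamma (a3 + RtoC (INR n)) * CGamma (a4 + RtoC (INR n))
  * (/ CGamma (b1 + RtoC (INR n)) * / CGamma (b2 + RtoC (INR n)) * / CGamma (b3 + RtoC (INR n)) * / CGamma (1 + RtoC (INR n))).

Lemma Re_INR_pos (z : C) (n : nat) : (0 < Re z)%R -> (0 < Re (z + RtoC (INR n)))%R.
Proof. rewrite Re_plus_INR. have := pos_INR n. lra. Qed.

Lemma hterm_Gamma (a1 a2 a3 a4 b1 b2 b3 : C) (n : nat) :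
  (0 < Re a1)%R -> (0 < Re a2)%R -> (0 < Re a3)%R -> (0 < Re a4)%R ->
  (0 < Re b1)%R -> (0 < Re b2)%R -> (0 < Re b3)%R ->
  / CGamma b1 * / CGamma b2 * / CGamma b3 * hterm a1 a2 a3 a4 b1 b2 b3 n =
  / CGamma a1 * / CGamma a2 * / CGamma a3 * / CGamma a4 * gterm a1 a2 a3 a4 b1 b2 b3 n.
Proof.
  move=> h1 h2 h3 h4 h5 h6 h7. rewrite /hterm /gterm !pochhammer_CGamma // fact_CGamma.
  have p z : (0 < Re z)%R -> CGamma z <> 0 /\ CGamma (z + RtoC (INR n)) <> 0.
    move=> h. split; apply: CGamma_neq_0 => //. exact: Re_INR_pos.
  have hone : (0 < Re 1)%R by rewrite /=; lra.
  case: (p _ h1) (p _ h2) (p _ h3) (p _ h4) (p _ h5) (p _ h6) (p _ h7) (p _ hone).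
  move: (CGamma a1) (CGamma a2) (CGamma a3) (CGamma a4) (CGamma b1) (CGamma b2) (CGamma b3) => x1 x2 x3 x4 y1 y2 y3.
  move: (CGamma (a1 + _)) (CGamma (a2 + _)) (CGamma (a3 + _)) (CGamma (a4 + _)) (CGamma (b1 + _)) (CGamma (b2 + _)) (CGamma (b3 + _)) (CGamma (1 + _)) => u1 u2 u3 u4 w1 w2 w3 w4.
  move=> ? ? [? ?] [? ?] [? ?] [? ?] [? ?] [? ?] [_ ?]. field. by repeat split.
Qed.

Lemma Csum_scal (c : C) (u : nat -> C) (n : nat) : c * Csum u n = Csum (fun k => c * u k) n.
Proof. elim: n => [|n IH] /=; first by ring. rewrite -IH. ring. Qed.

Lemma Csum_ext (u v : nat -> C) (n : nat) : (forall k, u k = v k) -> Csum u n = Csum v n.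
Proof. move=> h. elim: n => [|n IH] //=. by rewrite IH h. Qed.

(** In this form the Gamma factors of the lower parameters are absorbed by the terms and those of
    the upper parameters come out, so both series acquire the same prefactor and the numerator is a
    prefactor times a difference. *)
Lemma mnum_Gamma (n : nat) (q : C6) :
  all_pos q ->
  mnum n q =
  (/ CGamma (ca q) * / CGamma (cb q) * / CGamma (cc q) * / CGamma (cd q)
   * (/ CGamma (1 + ca q - ce q) * / CGamma (1 + cb q - ce q) * / CGamma (1 + cc q - ce q) * / CGamma (1 + cd q - ce q)))
  * (Csum (gterm (ca q) (cb q) (cc q) (cd q) (ce q) (cf q) (cg q)) n
     - Csum (gterm (1 + ca q - ce q) (1 + cb q - ce q) (1 + cc q - ce q) (1 + cd q - ce q)
            (1 + cf q - ce q) (1 + cg q - ce q) (2 - ce q)) n).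
Proof.
  move=> [h1 [h2 [h3 [h4 [h5 [h6 [h7 [h8 [h9 [h10 [h11 [h12 [h13 h14]]]]]]]]]]]]].
  rewrite /mnum.
  have S1 : / CGamma (ce q) * / CGamma (cf q) * / CGamma (cg q) * Csum (hterm (ca q) (cb q) (cc q) (cd q) (ce q) (cf q) (cg q)) n
    = / CGamma (ca q) * / CGamma (cb q) * / CGamma (cc q) * / CGamma (cd q) * Csum (gterm (ca q) (cb q) (cc q) (cd q) (ce q) (cf q) (cg q)) n.
    rewrite !Csum_scal. apply: Csum_ext => k. exact: hterm_Gamma.
  have S2 : / CGamma (1 + cf q - ce q) * / CGamma (1 + cg q - ce q) * / CGamma (2 - ce q) *
    Csum (hterm (1 + ca q - ce q) (1 + cb q - ce q) (1 + cc q - ce q) (1 + cd q - ce q) (1 + cf q - ce q) (1 + cg q - ce q) (2 - ce q)) n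
    = / CGamma (1 + ca q - ce q) * / CGamma (1 + cb q - ce q) * / CGamma (1 + cc q - ce q) * / CGamma (1 + cd q - ce q) *
    Csum (gterm (1 + ca q - ce q) (1 + cb q - ce q) (1 + cc q - ce q) (1 + cd q - ce q) (1 + cf q - ce q) (1 + cg q - ce q) (2 - ce q)) n.
    rewrite !Csum_scal. apply: Csum_ext => k. exact: hterm_Gamma.
  move: S1 S2.
  move: (Csum (hterm (ca q) _ _ _ _ _ _) n) (Csum (hterm (1 + ca q - ce q) _ _ _ _ _ _) n)
    (Csum (gterm (ca q) _ _ _ _ _ _) n) (Csum (gterm (1 + ca q - ce q) _ _ _ _ _ _) n) => s1 s2 t1 t2.
  move: (/ CGamma (ca q)) (/ CGamma (cb q)) (/ CGamma (cc q)) (/ CGamma (cd q)) (/ CGamma (ce q)) (/ CGamma (cf q)) (/ CGamma (cg q))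
    (/ CGamma (1 + ca q - ce q)) (/ CGamma (1 + cb q - ce q)) (/ CGamma (1 + cc q - ce q)) (/ CGamma (1 + cd q - ce q))
    (/ CGamma (1 + cf q - ce q)) (/ CGamma (1 + cg q - ce q)) (/ CGamma (2 - ce q)).
  move=> w1 w2 w3 w4 w5 w6 w7 w8 w9 w10 w11 w12 w13 w14 S1 S2.
  have -> : w5 * w6 * w7 * (w8 * w9 * w10 * w11) * s1 - w1 * w2 * w3 * w4 * (w12 * w13 * w14) * s2 =
    (w8 * w9 * w10 * w11) * (w5 * w6 * w7 * s1) - w1 * w2 * w3 * w4 * (w12 * w13 * w14 * s2) by ring.
  rewrite S1 S2. ring.
Qed.

(** * Derivative of the numerator along the symmetric direction, and the value at e = 1 *)

Section Value.
Variables (s : C) (hs : (0 < Re s)%R).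

Let h : C := 1 / 2.
Let h2 : h + h = 1. Proof. rewrite /h half_RtoC -RtoC_plus. f_equal. field. Qed.

(** At the point [mq0 + t mv] below, the two series have the terms [lterm n t] and [lterm n (- t)], up to factors free of [n]. *)
Definition lterm (n : nat) (t : C) : C :=
  gterm (s + t * (1 / 2)) (s + t * (1 / 2)) (1 / 2 + t * (1 / 2)) (1 / 2 + t * (1 / 2))
    (1 + t) (s + 1 / 2 + t * (1 / 2)) (s + 1 / 2 + t * (1 / 2)) n.

Lemma cdiff_affine (z k : C) : cdiff idC (fun t => z + t * k) 0 k.
Proof.
  have {2}-> : k = 0 + (1 * k + 0 * 0) by ring.
  apply: cdiff_plus; first exact: cdiff_const.
  have -> : 1 * k + 0 * 0 = 1 * k + idC 0 * 0 by [].
  apply: cdiff_mult; [exact: cdiff_id | exact: cdiff_const].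
Qed.

Lemma cdiff_comp_affine (f : C -> C) (z k l : C) : cdiff idC f z l -> cdiff idC (fun t => f (z + t * k)) 0 (l * k).
Proof.
  move=> H. apply: (cdiff_comp idC (fun t => z + t * k) f); first exact: cdiff_affine.
  by have -> : z + 0 * k = z by ring.
Qed.

Lemma Re_mult_half (t : C) : Re (t * (1 / 2)) = (Re t / 2)%R.
Proof. rewrite half_RtoC. case: t => x y. rewrite /Re /Cmult /RtoC /=. field. Qed.

(** Pairing equal Gamma factors, the term is [2 / PI * mG (s + n + t/2)] times Gamma(1/2 + n +
    t/2)^2 / (Gamma(1 + n + t) Gamma(1 + n)). The value of the second factor is a multiple of
    [kb n], its derivative a multiple of [ka n]. *)
Lemma cdiff_lterm (n : nat) : cdiff idC (lterm n) 0
  (RtoC (-2) * (RtoC (ka n) * mG (s + RtoC (INR n)) - RtoC (kb n) * mG1 (s + RtoC (INR n)))).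
Proof.
  have hpi := PI_RGT_0. have hn := pos_INR n.
  have npi : RtoC PI <> 0 by apply: RtoC_neq_0; lra.
  have n2 : RtoC 2 <> 0 by apply: RtoC_neq_0; lra.
  set z0 := RtoC (INR n + / 2). set z1 := 1 + RtoC (INR n).
  have hz0 : (0 < Re z0)%R by exact: half_pos.
  have hz1 : (0 < Re z1)%R by rewrite /z1 Re_plus_INR /=; lra.
  have e01 : z0 + 1 / 2 = z1 by rewrite /z0 RtoC_half_half /z1 RtoC_plus; ring.
  have hsn : (0 < Re (s + RtoC (INR n)))%R by exact: Re_INR_pos.
  case: (CGamma_cdiff z0 hz0) => dG [_ [HG _]]. case: (CGamma_cdiff z1 hz1) => [_ [dI [_ HI]]].
  set gam := CGamma z0. set iot := / CGamma z1.
  have Gam2 (z : C) : (0 < Re z)%R -> CGamma z * CGamma z * (/ CGamma (z + 1 / 2) * / CGamma (z + 1 / 2)) = RtoC 2 / RtoC PI * mG z.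
    move=> hz. rewrite mG_Gamma // RtoC_div; last lra. have hz' : (0 < Re (z + 1 / 2))%R by rewrite Re_plus_half; lra.
    have := CGamma_neq_0 _ hz'. move: (CGamma z) (CGamma (z + 1 / 2)) => u w hw. field. by repeat split.
  (* Differentiates the square of Gamma(z0 + t) / Gamma(z1 + t), a multiple of [mG]. In [lterm] only
     one of the two reciprocals moves, at twice the speed of the numerators; to first order this is
     the same square at [t / 2]. *)
  have K : (dG * gam + gam * dG) * (iot * iot) + gam * gam * (dI * iot + iot * dI) = RtoC 2 / RtoC PI * mG1 z0.
    have A1 := cdiff_comp_affine _ _ 1 _ HG. have A2 := cdiff_comp_affine _ _ 1 _ HI.
    have A3 := cdiff_scal idC (RtoC 2 / RtoC PI) _ _ _ (cdiff_comp_affine _ _ 1 _ (cdiff_mG z0 hz0)).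
    have L := cdiff_mult _ _ _ _ _ _ (cdiff_mult _ _ _ _ _ _ A1 A1) (cdiff_mult _ _ _ _ _ _ A2 A2).
    have e0 z : z + 0 * 1 = z by ring.
    rewrite !e0 in L.
    have L' : cdiff idC (fun t => RtoC 2 / RtoC PI * mG (z0 + t * 1)) 0 ((dG * 1 * gam + gam * (dG * 1)) * (iot * iot) + gam * gam * (dI * 1 * iot + iot * (dI * 1))).
      apply: (cdiff_ext_loc _ _ _ _ _ (Re z0) hz0 _ L) => t.
      rewrite /idC. have -> : t - 0 = t by ring. move=> ht.
      have hre : (0 < Re (z0 + t * 1))%R.
        rewrite Re_plus. have -> : t * 1 = t by ring. have := re_le_Cmod t. have := Rle_abs (- Re t). rewrite Rabs_Ropp. lra.
      rewrite -(Gam2 _ hre).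
      have -> : z0 + t * 1 + 1 / 2 = z1 + t * 1 by rewrite -e01; ring. done.
    have := cdiff_unique _ _ _ _ L' A3. 
    have -> : dG * 1 = dG by ring. have -> : dI * 1 = dI by ring. move=> ->. ring.
  have B1 := cdiff_comp_affine _ _ (1 / 2) _ HG. have B2 := cdiff_comp_affine _ _ 1 _ HI.
  have B3 := cdiff_scal idC (RtoC 2 / RtoC PI) _ _ _ (cdiff_comp_affine _ _ (1 / 2) _ (cdiff_mG _ hsn)).
  have L := cdiff_mult _ _ _ _ _ _ B3 (cdiff_mult _ _ _ _ _ _ (cdiff_mult _ _ _ _ _ _ B1 B1)
     (cdiff_mult _ _ _ _ _ _ B2 (cdiff_const _ (RtoC 0) iot))).
  have e0 z k : z + 0 * k = z by ring.
  rewrite !e0 -/gam -/iot in L.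
  have G0 := Gam2 z0 hz0. rewrite e01 -/gam -/iot in G0.
  rewrite /z0 kb_E in G0. rewrite /z0 ka_E in K.
  have E : RtoC 2 / RtoC PI * (mG1 (s + RtoC (INR n)) * (1 / 2)) * (gam * gam * (iot * iot)) +
    RtoC 2 / RtoC PI * mG (s + RtoC (INR n)) *
    ((dG * (1 / 2) * gam + gam * (dG * (1 / 2))) * (iot * iot) + gam * gam * (dI * 1 * iot + iot * 0)) =
    RtoC (-2) * (RtoC (ka n) * mG (s + RtoC (INR n)) - RtoC (kb n) * mG1 (s + RtoC (INR n))).
    rewrite G0.
    have -> : (dG * (1 / 2) * gam + gam * (dG * (1 / 2))) * (iot * iot) + gam * gam * (dI * 1 * iot + iot * 0) =
      1 / 2 * ((dG * gam + gam * dG) * (iot * iot) + gam * gam * (dI * iot + iot * dI)) by field.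
    rewrite K. move: (ka n) (kb n) (mG _) (mG1 _) => a b u w.
    have -> : (PI ^ 2 * b)%R = (PI * PI * b)%R by ring. have -> : (- (PI ^ 2 * a))%R = (- (PI * PI * a))%R by ring.
    have -> : RtoC (-2) = - RtoC 2 by rewrite -RtoC_opp.
    rewrite RtoC_opp !(RtoC_mult _ a) !(RtoC_mult _ b) (RtoC_mult PI PI). field. done.
  rewrite -E.
  have hd : (0 < Rmin (Re s) (/ 2))%R by apply: Rmin_pos; lra.
  apply: (cdiff_ext_loc _ _ _ _ _ _ hd _ L) => t.
  rewrite /idC. have -> : t - 0 = t by ring. move=> ht.
  have t1 := Rlt_le_trans _ _ _ ht (Rmin_l _ _). have t2 := Rlt_le_trans _ _ _ ht (Rmin_r _ _).
  have rt := re_le_Cmod t. have ra := Rle_abs (- Re t). rewrite Rabs_Ropp in ra.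
  have hre : (0 < Re (s + RtoC (INR n) + t * (1 / 2)))%R.
    rewrite Re_plus Re_plus_INR Re_mult_half. lra.
  rewrite -(Gam2 _ hre) /lterm /gterm /iot /z1.
  have -> : s + t * (1 / 2) + RtoC (INR n) = s + RtoC (INR n) + t * (1 / 2) by ring.
  have -> : 1 / 2 + t * (1 / 2) + RtoC (INR n) = z0 + t * (1 / 2).
    rewrite /z0 RtoC_plus -half_RtoC. ring.
  have -> : s + 1 / 2 + t * (1 / 2) + RtoC (INR n) = s + RtoC (INR n) + t * (1 / 2) + 1 / 2 by ring.
  have -> : 1 + RtoC (INR n) + t * 1 = 1 + t + RtoC (INR n) by ring.
  ring.
Qed.

Definition mq0 : C6 := (s, s, (1 / 2)%C, (1 / 2)%C, RtoC 1, (s + 1 / 2)%C).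
Definition mv : C6 := ((1 / 2)%C, (1 / 2)%C, (1 / 2)%C, (1 / 2)%C, RtoC 1, (1 / 2)%C).

Lemma mline (t : C) : let q := plus mq0 (scal (t : C_AbsRing) mv) in
  ca q = s + t * (1 / 2) /\ cb q = s + t * (1 / 2) /\ cc q = 1 / 2 + t * (1 / 2) /\ cd q = 1 / 2 + t * (1 / 2) /\
  ce q = 1 + t /\ cf q = s + 1 / 2 + t * (1 / 2) /\ cg q = s + 1 / 2 + t * (1 / 2) /\
  1 + ca q - ce q = s + - t * (1 / 2) /\ 1 + cb q - ce q = s + - t * (1 / 2) /\
  1 + cc q - ce q = 1 / 2 + - t * (1 / 2) /\ 1 + cd q - ce q = 1 / 2 + - t * (1 / 2) /\
  1 + cf q - ce q = s + 1 / 2 + - t * (1 / 2) /\ 1 + cg q - ce q = s + 1 / 2 + - t * (1 / 2) /\ 2 - ce q = 1 + - t.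
Proof.
  move=> q.
  have A (p : C6 -> C) : coord p -> p q = p mq0 + t * p mv by case=> p1 [p2 _]; rewrite /q p1 p2.
  have ea := A _ ca_coord. have eb := A _ cb_coord. have ec := A _ cc_coord.
  have ed := A _ cd_coord. have ee := A _ ce_coord. have ef := A _ cf_coord.
  change (ca q = s + t * (1 / 2)) in ea. change (cb q = s + t * (1 / 2)) in eb.
  change (cc q = 1 / 2 + t * (1 / 2)) in ec. change (cd q = 1 / 2 + t * (1 / 2)) in ed.
  change (ce q = 1 + t * 1) in ee. change (cf q = s + 1 / 2 + t * (1 / 2)) in ef.
  have two : RtoC 2 = 1 + 1 by rewrite -RtoC_plus; f_equal; ring.
  have th : t = t * (1 / 2) + t * (1 / 2) by rewrite -Cmult_plus_distr_l -/h h2; ring.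
  have eg : cg q = s + 1 / 2 + t * (1 / 2).
    rewrite /cg ea eb ec ed ee ef. have -> : t * 1 = t * (1 / 2) + t * (1 / 2) by rewrite -th; ring.
    have hh : 1 / 2 + 1 / 2 = 1 := h2.
    have -> : 1 + (s + t * (1 / 2)) + (s + t * (1 / 2)) + (1 / 2 + t * (1 / 2)) + (1 / 2 + t * (1 / 2)) -
      (1 + (t * (1 / 2) + t * (1 / 2))) - (s + 1 / 2 + t * (1 / 2)) = s + (1 / 2 + 1 / 2) - 1 / 2 + t * (1 / 2) by ring.
    ring.
  have fin (z : C) : 1 + (z + t * (1 / 2)) - (1 + t) = z + - t * (1 / 2).
    have -> : z + - t * (1 / 2) = z + t * (1 / 2) - (t * (1 / 2) + t * (1 / 2)) by ring.
    rewrite -th. ring.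
  have ee2 : ce q = 1 + t by rewrite ee; ring.
  rewrite eg ea eb ec ed ee2 ef.
  repeat split; try exact: fin. rewrite two. ring.
Qed.

Lemma cdiff_Csum (u : nat -> C -> C) (l : nat -> C) (x : C) (n : nat) :
  (forall k, cdiff idC (u k) x (l k)) -> cdiff idC (fun t => Csum (fun k => u k t) n) x (Csum l n).
Proof.
  move=> H. elim: n => [|n IH] /=; first exact: cdiff_const. exact: cdiff_plus.
Qed.

Let P0 : C := / CGamma s * / CGamma s * / CGamma (1 / 2) * / CGamma (1 / 2)
   * (/ CGamma s * / CGamma s * / CGamma (1 / 2) * / CGamma (1 / 2)).

(** The difference of the two sums is zero at [t = 0], so the derivative [dP] of the prefactor is
    multiplied by [0] and only its value [P0] survives. The sums in [t] and [- t] contribute [2]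
    each in modulus, whence [- 4]. *)
Lemma mnum_line (n : nat) : cdiff idC (fun t => mnum n (plus mq0 (scal (t : C_AbsRing) mv))) 0
  (RtoC (-4) * P0 * Csum (fun k => RtoC (ka k) * mG (s + RtoC (INR k)) - RtoC (kb k) * mG1 (s + RtoC (INR k))) n).
Proof.
  have hh : (0 < Re (1 / 2))%R by rewrite half_RtoC Re_RtoC; lra.
  case: (CGamma_cdiff s hs) => _ [i1 [_ H1]]. case: (CGamma_cdiff _ hh) => _ [i2 [_ H2]].
  have C1 := cdiff_comp_affine _ _ (1 / 2) _ H1. have C2 := cdiff_comp_affine _ _ (1 / 2) _ H2.
  have C3 := cdiff_comp_affine _ _ (- (1 / 2)) _ H1. have C4 := cdiff_comp_affine _ _ (- (1 / 2)) _ H2.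
  have CP := cdiff_mult _ _ _ _ _ _
     (cdiff_mult _ _ _ _ _ _ (cdiff_mult _ _ _ _ _ _ (cdiff_mult _ _ _ _ _ _ C1 C1) C2) C2)
     (cdiff_mult _ _ _ _ _ _ (cdiff_mult _ _ _ _ _ _ (cdiff_mult _ _ _ _ _ _ C3 C3) C4) C4).
  move: CP. set dP := (X in cdiff _ _ _ X). move=> CP.
  set T := fun k => RtoC (ka k) * mG (s + RtoC (INR k)) - RtoC (kb k) * mG1 (s + RtoC (INR k)).
  have S1 := cdiff_Csum lterm (fun k => RtoC (-2) * T k) 0 n cdiff_lterm.
  have Neg k : cdiff idC (fun t => lterm k (- t)) 0 (RtoC (-2) * T k * (- (1))).
    apply: (cdiff_comp idC (fun t => - t) (lterm k)).
    - apply: cdiff_opp. exact: cdiff_id.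
    - have -> : - RtoC 0 = 0 by ring. exact: cdiff_lterm.
  have S2 := cdiff_Csum (fun k t => lterm k (- t)) (fun k => RtoC (-2) * T k * (- (1))) 0 n Neg.
  have L := cdiff_mult _ _ _ _ _ _ CP (cdiff_minus _ _ _ _ _ _ S1 S2).
  have z0 : Csum (fun k => lterm k 0) n - Csum (fun k => lterm k (- 0)) n = 0.
    have -> : - RtoC 0 = 0 by ring. ring.
  rewrite z0 in L.
  have e0 z k : z + 0 * k = z by ring. rewrite !e0 in L.
  have eS : Csum (fun k => RtoC (-2) * T k) n - Csum (fun k => RtoC (-2) * T k * - (1)) n = RtoC (-4) * Csum T n.
    have -> : Csum (fun k => RtoC (-2) * T k * - (1)) n = RtoC 2 * Csum T n.
      rewrite Csum_scal. apply: Csum_ext => k. have -> : RtoC (-2) = - RtoC 2 by rewrite -RtoC_opp. ring.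
    rewrite -Csum_scal. have -> : RtoC (-4) = RtoC (-2) - RtoC 2 by rewrite -RtoC_minus; f_equal; ring. ring.
  rewrite eS in L.
  have -> : RtoC (-4) * P0 * Csum T n = dP * 0 + P0 * (RtoC (-4) * Csum T n) by ring.
  (* Within this radius all fourteen Gamma arguments keep a positive real part. *)
  have hd : (0 < Rmin (Re s) (/ 2))%R by apply: Rmin_pos; lra.
  apply: (cdiff_ext_loc _ _ _ _ _ _ hd _ L) => t.
  rewrite /idC. have -> : t - 0 = t by ring. move=> ht.
  have t1 := Rlt_le_trans _ _ _ ht (Rmin_l _ _). have t2 := Rlt_le_trans _ _ _ ht (Rmin_r _ _).
  have rt := re_le_Cmod t. have ra := Rle_abs (- Re t). rewrite Rabs_Ropp in ra. have rb := Rle_abs (Re t).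
  have rh : Re (1 / 2) = (/ 2)%R by rewrite half_RtoC.
  have rs1 : Re (s + t * (1 / 2)) = (Re s + Re t / 2)%R by rewrite Re_plus Re_mult_half.
  have rs2 : Re (s + - t * (1 / 2)) = (Re s - Re t / 2)%R.
    rewrite Re_plus Re_mult_half. have -> : Re (- t) = (- Re t)%R by []. field.
  have rh1 : Re (1 / 2 + t * (1 / 2)) = (/ 2 + Re t / 2)%R by rewrite Re_plus Re_mult_half rh.
  have rh2 : Re (1 / 2 + - t * (1 / 2)) = (/ 2 - Re t / 2)%R.
    rewrite Re_plus Re_mult_half rh. have -> : Re (- t) = (- Re t)%R by []. field.
  have rg1 : Re (s + 1 / 2 + t * (1 / 2)) = (Re s + / 2 + Re t / 2)%R by rewrite !Re_plus Re_mult_half rh.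
  have rg2 : Re (s + 1 / 2 + - t * (1 / 2)) = (Re s + / 2 - Re t / 2)%R.
    rewrite !Re_plus Re_mult_half rh. have -> : Re (- t) = (- Re t)%R by []. field.
  have ro1 : Re (1 + t) = (1 + Re t)%R by []. have ro2 : Re (1 + - t) = (1 - Re t)%R by [].
  move: (mline t). move: (plus mq0 _) => q /=.
  move=> [q1 [q2 [q3 [q4 [q5 [q6 [q7 [q8 [q9 [q10 [q11 [q12 [q13 q14]]]]]]]]]]]]].
  rewrite mnum_Gamma; last first.
    rewrite /all_pos q8 q9 q10 q11 q12 q13 q14 q1 q2 q3 q4 q5 q6 q7 rs1 rs2 rh1 rh2 rg1 rg2 ro1 ro2. lra.
  rewrite q8 q9 q10 q11 q12 q13 q14 q1 q2 q3 q4 q5 q6 q7.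
  have -> : s + t * - (1 / 2) = s + - t * (1 / 2) by ring.
  have -> : 1 / 2 + t * - (1 / 2) = 1 / 2 + - t * (1 / 2) by ring.
  congr Cmult. congr Cminus.
  apply: Csum_ext => k. rewrite /lterm /gterm. ring.
Qed.

Lemma mishevL_value :
  mishevL s s (1 / 2) (1 / 2) 1 (s + 1 / 2) (s + 1 / 2) =
  RtoC 4 * P0 / RtoC PI * mellin (fun u => (ellw u * ellw u)%R) s.
Proof.
  have hpi := PI_RGT_0. have npi : RtoC PI <> 0 by apply: RtoC_neq_0; lra.
  have hh : Re (1 / 2) = (/ 2)%R by rewrite half_RtoC.
  set mu := Rmin (Re s) (/ 2).
  have m1 : (mu <= Re s)%R by exact: Rmin_l. have m2 : (mu <= / 2)%R by exact: Rmin_r.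
  have hmu : (0 < mu <= 1)%R by split; [apply: Rmin_pos; lra | lra].
  have ecg : cg mq0 = s + 1 / 2.
    have [_ [_ [_ [_ [_ [_ [e _]]]]]]] := mline 0. move: e.
    have -> : plus mq0 (scal (RtoC 0 : C_AbsRing) mv) = mq0.
      have -> : (RtoC 0 : C_AbsRing) = zero by []. by rewrite scal_zero_l plus_zero_r.
    move=> ->. ring.
  have rsh : Re (s + 1 / 2) = (Re s + / 2)%R by rewrite Re_plus hh.
  have Hext := mishev_extension mq0 mu hmu.
  case: (Hext m1 m1 (_ : (mu <= Re (1 / 2))%R) (_ : (mu <= Re (1 / 2))%R) eq_refl (_ : (mu <= Re (s + 1 / 2))%R) (_ : (mu <= Re (cg mq0))%R) mv eq_refl).
  1,2: by rewrite hh.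
  - by rewrite rsh; lra.
  - by rewrite ecg rsh; lra.
  move=> D [D' [F [d [HD [HL [hd [HF [F0 [hRe Fq]]]]]]]]].
  (* The differential supplied by the limit theorem is abstract; uniqueness of the derivative along
     a complex line identifies it with the computed one. *)
  have eD n : D n mq0 mv = RtoC (-4) * P0 * Csum (fun k => RtoC (ka k) * mG (s + RtoC (INR k)) - RtoC (kb k) * mG1 (s + RtoC (INR k))) n.
    case: (HD n) => dn [M [hdn HM]].
    exact: cdiff_unique (holD_line _ _ _ _ _ _ mv HM (inB_center _ _ hdn)) (mnum_line n).
  have HL2 : Cseq_lim (fun n => D n mq0 mv) (RtoC (-4) * P0 * mellin (fun u => (ellw u * ellw u)%R) s).
    apply: Cseq_lim_ext (fun n => eq_sym (eD n)) _.
    apply: Cseq_lim_mult; first exact: Cseq_lim_const. exact: mellin_sq_series.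
  have eD' := Cseq_lim_unique _ _ _ HL HL2.
  have IM : is_mishevL s s (1 / 2) (1 / 2) 1 (s + 1 / 2) (s + 1 / 2) (F mq0).
    split.
      have -> : 1 + (s + 1 / 2) + (s + 1 / 2) - s - s - 1 / 2 - 1 / 2 = 1 by ring. done.
    case: HF => DF [MF HMF].
    exists F. split; last split => //.
    - apply: (locally_le_locally_norm mq0). exists (mkposreal _ hd) => q hq.
      exact: holD_ex_filterdiff HMF hq.
    - apply: (locally_le_locally_norm mq0). exists (mkposreal _ hd) => q hq.
      apply: (proj1 (mishev_atE F q)). move=> [gen _]. exact: (Fq q hq (gen 1%Z)).
  have -> : mishevL s s (1 / 2) (1 / 2) 1 (s + 1 / 2) (s + 1 / 2) = F mq0.
    apply: Ciota_eq => // x y. exact: (mishevL_unique _ _ _ _ _ _ _ _ _ mq0 d hd eq_refl eq_refl hRe).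
  rewrite F0 eD'. have -> : RtoC (-4) = - RtoC 4 by rewrite -RtoC_opp. by field.
Qed.

(** By [CGamma_half_sq], [P0] is the inverse of [PI^2 * Gamma(s)^4], so all powers cancel; the
    [1 / 2] that remains is the Jacobian of the substitution [u = x^2]. *)
Lemma mishevL_value' :
  RtoC (PI ^ 3 / 8) * CGamma s ^ 4 * mishevL s s (1 / 2) (1 / 2) 1 (s + 1 / 2) (s + 1 / 2) =
  1 / 2 * mellin (fun u => (ellw u * ellw u)%R) s.
Proof.
  have hpi := PI_RGT_0. have npi : RtoC PI <> 0 by apply: RtoC_neq_0; lra.
  have n2 : RtoC 2 <> 0 by apply: RtoC_neq_0; lra.
  have hh : (0 < Re (1 / 2))%R by rewrite half_RtoC Re_RtoC; lra.
  rewrite mishevL_value /P0. have gs := CGamma_neq_0 s hs. have gh := CGamma_neq_0 _ hh.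
  have -> : RtoC (PI ^ 3 / 8) = RtoC PI * RtoC PI * RtoC PI / (RtoC 2 * (RtoC 2 * RtoC 2)).
    rewrite -!RtoC_mult -RtoC_div; last lra. f_equal. field.
  have -> : RtoC 4 = RtoC 2 * RtoC 2 by rewrite -RtoC_mult; f_equal; ring.
  have E := CGamma_half_sq.
  move: (mellin _ _) gs gh E. move: (CGamma s) (CGamma (1 / 2)) (RtoC PI) npi => g k p np J hg hk E.
  rewrite -E in np *. simpl Cpow. field. by repeat split.
Qed.

End Value.

(** * The substitution u = x^2 and the improper integral *)

Lemma ellw_sq_substitution (s : C) (a b : R) : (0 < a < b)%R -> (b < 1)%R ->
  is_RInt (V := C_R_NormedModule) (fun x => Rcpow x (2 * s - 1) * RtoC (ellK' x ^ 2)) a b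
    (1 / 2 * CRInt (mellin_fun (fun u => (ellw u * ellw u)%R) s) (a ^ 2) (b ^ 2)).
Proof.
  move=> hab hb. set H := mellin_fun _ s.
  have hc : cont01 H by apply: cont01_mellin; exact: (proj1 (slow_mult _ _ slow_ellw slow_ellw)).
  have I := @is_RInt_comp C_R_CompleteNormedModule H (fun x => x ^ 2)%R (fun x => 2 * x)%R a b.
  have {}I : is_RInt (V := C_R_NormedModule) (fun y => scal (2 * y)%R (H (y ^ 2)%R : C_R_NormedModule)) a b (CRInt H (a ^ 2) (b ^ 2)).
    apply: I => x; rewrite Rmin_left ?Rmax_right; try lra; move=> hx.
    - apply: hc. nra.
    - split; first by auto_derive => //; ring.
      apply: (@ex_derive_continuous R_AbsRing R_NormedModule). by auto_derive.
  have := is_RInt_Cscal _ _ _ (1 / 2) _ I.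
  apply: is_RInt_ext => x. rewrite Rmin_left ?Rmax_right; try lra. move=> hx.
  rewrite C_R_scal /H /mellin_fun ellK'_ellw; last lra.
  have x0 : (0 < x)%R by lra.
  (* The power [u^(s-1)] is [x^(2s-2)]; the Jacobian [2 x] restores one power of [x], and its [2]
     cancels the [1 / 2] in front. *)
  have -> : Rcpow (x ^ 2) (s - 1) = Rcpow x (2 * s - 1) * / Rcpow x 1.
    have -> : Rcpow (x ^ 2) (s - 1) = Rcpow x (2 * s - 1 - 1).
      rewrite /Rcpow. f_equal. rewrite ln_pow // RtoC_mult. change (INR 2) with (1 + 1)%R.
      have -> : (1 + 1 = 2)%R by ring. have -> : RtoC 2 = 1 + 1 by rewrite -RtoC_plus; f_equal; ring. ring.
    have -> : 2 * s - 1 - 1 = (2 * s - 1) + - (1) by ring. by rewrite Rcpow_plus Rcpow_opp.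
  rewrite Rcpow_1 //. have xn : RtoC x <> 0 by apply: RtoC_neq_0; lra.
  have n2 : RtoC 2 <> 0 by apply: RtoC_neq_0; lra.
  have -> : (ellw (x ^ 2) ^ 2 = ellw (x ^ 2) * ellw (x ^ 2))%R by ring.
  move: (Rcpow _ _) (ellw _ * ellw _)%R => u w. rewrite (RtoC_mult 2 x). 
  have -> : 1 / 2 * (RtoC 2 * RtoC x * (u * / RtoC x * RtoC w)) = u * RtoC w by field. done.
Qed.

Theorem mainTheorem10 : forall s : C, (0 < Re s)%R ->
  is_RInt_gen (V := C_R_NormedModule)
    (fun x : R => Rcpow x (2 * s - 1) * RtoC (ellK' x ^ 2))
    (at_right 0) (at_left 1)
    (RtoC (PI ^ 3 / 8) * CGamma s ^ 4
     * mishevL s s (1 / 2) (1 / 2) 1 (s + 1 / 2) (s + 1 / 2)).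
Proof.
  move=> s hs. rewrite mishevL_value' //.
  have sl := slow_mult _ _ slow_ellw slow_ellw.
  have [hc Hl] := mellin_correct _ s sl hs.
  set H := mellin_fun _ s in hc Hl *. set J := mellin _ s in Hl *.
  case: sl => _ Hs. case: (Hs 1%R Rlt_0_1) => A [hA HA].
  (* The statement is improper at both ends, whereas [is_int01] runs up to [1]: a bound near [1]
     makes the missing piece small. Slow growth with exponent [1] bounds [ellw^2] by [2 A], and
     [u^(Re s - 1)] is at most [2]. *)
  have Hb u : (/ 2 <= u <= 1)%R -> (Cmod (H u) <= 4 * A)%R.
    move=> hu. rewrite /H /mellin_fun Cmod_mult Cmod_Rcpow Cmod_R Re_minus_1.
    have iu : (Rpower u (- (1)) <= 2)%R.
      rewrite Rpower_Ropp Rpower_1; last lra. rewrite -(Rinv_inv 2). apply: Rinv_le_contravar; lra.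
    have h1 : (Rpower u (Re s - 1) <= 2)%R.
      have -> : (Re s - 1 = Re s + - (1))%R by ring. rewrite Rpower_plus.
      have := Rpower_le1 u (Re s) ltac:(lra) ltac:(lra). have := Rpower_pos u (Re s). have := Rpower_pos u (- (1)). nra.
    have h2 := HA u ltac:(lra). have h3 := Rpower_pos u (Re s - 1). have h4 := Rabs_pos (ellw u * ellw u).
    have h5 : (Rabs (ellw u * ellw u) <= A * 2)%R by apply: Rle_trans h2 _; apply: Rmult_le_compat_l.
    nra.
  move=> P /locally_C [eps [he hP]].
  have he1 : (0 < eps / 2)%R by lra.
  case: (Hl _ he1) => d [hd Hd].
  set d1 := Rmin d (/ 2). have d1p : (0 < d1)%R by apply: Rmin_pos; lra.
  have d1a : (d1 <= d)%R by exact: Rmin_l. have d1b : (d1 <= / 2)%R by exact: Rmin_r.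
  (* As [b ^ 2 >= 1 - 2 * d2], the missing piece is at most [8 A d2 <= eps / 2]; the [/ 8] keeps
     [b ^ 2] above [/ 2] and [b] above [a]. *)
  set d2 := Rmin (/ 8) (eps / (16 * (A + 1))).
  have d2p : (0 < d2)%R by apply: Rmin_pos; [lra | apply: Rdiv_lt_0_compat; lra].
  have d2a : (d2 <= / 8)%R by exact: Rmin_l.
  have d2b : (d2 * (16 * (A + 1)) <= eps)%R by apply/Rle_div_r; [lra | exact: Rmin_r].
  apply: (Filter_prod _ _ _ (fun a => (0 < a < d1)%R) (fun b => (1 - d2 < b < 1)%R)).
  - exists (mkposreal _ d1p) => a. rewrite /ball /= /AbsRing_ball /abs /minus /plus /opp /= => /Rabs_def2. lra.
  - exists (mkposreal _ d2p) => b. rewrite /ball /= /AbsRing_ball /abs /minus /plus /opp /= => /Rabs_def2. lra.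
  - move=> a b ha hb. 
    have hab : (0 < a < b)%R by lra.
    exists (1 / 2 * CRInt H (a ^ 2) (b ^ 2)). split; first by exact: (ellw_sq_substitution _ _ _ hab (proj2 hb)).
    apply: hP.
    have a2 : (0 < a ^ 2 < d)%R by nra. have a21 : (a ^ 2 <= 1)%R by nra.
    have b2 : (1 - 2 * d2 <= b ^ 2 <= 1)%R by nra. have ab2 : (a ^ 2 <= b ^ 2)%R by nra.
    have e : CRInt H (a ^ 2) 1 = CRInt H (a ^ 2) (b ^ 2) + CRInt H (b ^ 2) 1.
      apply: CRInt_eq. apply: (is_RInt_Chasles (V := C_R_NormedModule)); apply: CRInt_correct => //; lra.
    have t : (Cmod (CRInt H (b ^ 2) 1) <= (1 - b ^ 2) * (4 * A))%R.
      have C0 := is_RInt_const (V := R_NormedModule) (b ^ 2) 1 (4 * A)%R.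
      apply: (is_RInt_C_le _ _ _ _ _ _ _ _ (CRInt_correct _ _ _ hc (conj (_ : 0 < b ^ 2)%R (proj2 b2)) (Rle_refl _)) C0); try lra.
      move=> x hx. apply: Hb. lra.
    have t2 : ((1 - b ^ 2) * (4 * A) <= eps / 2)%R.
      apply: Rle_trans (_ : 2 * d2 * (4 * A) <= _)%R; first by apply: Rmult_le_compat_r; lra. nra.
    have -> : 1 / 2 * CRInt H (a ^ 2) (b ^ 2) - 1 / 2 * J = 1 / 2 * ((CRInt H (a ^ 2) 1 - J) - CRInt H (b ^ 2) 1).
      rewrite e. ring.
    rewrite Cmod_mult half_RtoC Cmod_RtoC_pos; last lra.
    have := Cmod_minus_le (CRInt H (a ^ 2) 1 - J) (CRInt H (b ^ 2) 1). have := Hd _ a2 a21. lra.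
Qed.
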